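(* Let $B$ be a division quaternion algebra over $F$ that splits at $\infty$, with an isomorphism of $F_\infty$-algebras $\iota\colon B\otimes_FF_\infty\to M_2(F_\infty)$, let $\mathcal{O}$ be a maximal $A$-order in $B$, and let $\Gamma$ be a finite-index subgroup of $\iota(\mathcal{O}^\times)$. Let $k\geqslant 2$, let $l$ be an integer with $2l\equiv 0\bmod \#Z(\Gamma)$, and put $m=k+l$. Then the space $M_{2k,m}(\Gamma)$ is spanned by the Poincaré series $$f(z)=\sum_{[\gamma]\in\widetilde{\Gamma}}(\det\gamma)^{-l}\prod_{i=1}^ru(z;\gamma a_i,\gamma b_i)^{k_i},$$ where $\widetilde\Gamma=\Gamma/Z(\Gamma)$, $r\geqslant 2$, $k_1,\dots,k_r\geqslant1$ with $\sum_{i=1}^rk_i=k$, and $a_1,b_1,\dots,a_r,b_r\in\mathbb{P}^1(F_\infty)$ with $a_i\neq b_i$, $\{a_i,b_i\}\neq\{a_j,b_j\}$ for $i\neq j$, and $\bigcap_{i=1}^r\{a_i,b_i\}=\emptyset$.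
   Context: $q$ is an odd prime power, $A=\mathbb{F}_q[T]$, $F=\mathbb{F}_q(T)$, $F_\infty=\mathbb{F}_q((1/T))$, $\mathbb{C}_\infty$ is the completion of an algebraic closure of $F_\infty$, $\Omega=\mathbb{C}_\infty\setminus F_\infty$ is the Drinfeld half-plane, on which $\mathrm{GL}_2(F_\infty)$ acts by linear fractional transformations. $\mathcal{O}^\times=\{x\in\mathcal{O}:\mathrm{Nr}(x)\in\mathbb{F}_q^\times\}$, with $\mathrm{Nr}$ the reduced norm, which corresponds to the determinant under $\iota$. The group $\iota(\mathcal{O}^\times)$ is discrete and cocompact in $\mathrm{GL}_2(F_\infty)$; $Z(\Gamma)$ is the center of $\Gamma$, which consists of the scalar matrices in $\Gamma$ and is contained in $\mathbb{F}_q^\times\cdot I$. $u(z;a,b)=\frac1{z-b}-\frac1{z-a}$ with $\frac1{z-\infty}=0$. The condition on $l$ means $\det(h)^l=1$ for $h\in Z(\Gamma)$, so the summand depends only on the class of $\gamma$; the series converge locally uniformly on $\Omega$ (uniformly on affinoids). With $d(\Gamma)=\#\det(\Gamma)$, weight $w\geqslant 0$ and type $m\in\mathbb{Z}/d(\Gamma)\mathbb{Z}$, $M_{w,m}(\Gamma)$ is the $\mathbb{C}_\infty$-vector space of rigid holomorphic functions $f\colon\Omega\to\mathbb{C}_\infty$ such that $\frac{(\det\gamma)^m}{(cz+d)^w}f(\gamma z)=f(z)$ for all $\gamma=\begin{pmatrix}a&b\\c&d\end{pmatrix}\in\Gamma$ (no condition at cusps as $\Gamma$ is cocompact). In $M_{2k,m}$,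 $m=k+l$ is taken modulo $d(\Gamma)$. *)

(* Defs.v *)
From HB Require Import structures.
From mathcomp Require Import all_boot all_order all_algebra all_field.
From mathcomp Require Import finmap.
From mathcomp Require Import boolp classical_sets cardinality reals.

Set Implicit Arguments.
Unset Strict Implicit.
Unset Printing Implicit Defensive.

Import Order.TTheory GRing.Theory Num.Theory.
Local Open Scope classical_set_scope.
Local Open Scope ring_scope.

(** * Valued fields and completions *)

Section AbsoluteValues.
Variable R : realType.

Definition nonarch_abs (k : fieldType) (v : k -> R) : Prop :=
  [/\ forall x, 0 <= v x,
      forall x, v x = 0 <-> x = 0,
      forall x y, v (x * y) = v x * v y
    & forall x y, v (x + y) <= Num.max (v x) (v y)].

Definition abs_complete (k : fieldType) (v : k -> R) : Prop :=
  forall u : nat -> k,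
    (forall eps, 0 < eps -> exists N, forall m n,
       (N <= m)%N -> (N <= n)%N -> v (u m - u n) < eps) ->
    exists x, forall eps, 0 < eps -> exists N, forall n,
      (N <= n)%N -> v (u n - x) < eps.

Definition is_completion (k : fieldType) (v : k -> R)
    (K : fieldType) (w : K -> R) (j : {rmorphism k -> K}) : Prop :=
  [/\ nonarch_abs w,
      forall x, w (j x) = v x,
      abs_complete w
    & forall y eps, 0 < eps -> exists x, w (y - j x) < eps].

Definition is_alg_closure (k K : fieldType) (j : {rmorphism k -> K}) : Prop :=
  GRing.closed_field_axiom K /\ forall x, algebraicOver j x.

(* |f / g| = q ^ (deg f - deg g); the off-by-ones in [size] cancel. *)
Definition abs_at_infty (Fq : finFieldType) (x : {fraction {poly Fq}}) : R :=
  if x == 0 then 0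
  else (#|Fq|%:R : R) ^+ size (\n_(repr x)) / #|Fq|%:R ^+ size (\d_(repr x)).

End AbsoluteValues.

(** * Extension of scalars of a finite-dimensional algebra *)

(* A model of the K-algebra B (x)_F K: coordinate vectors on the basis
   e_i (x) 1, where (e_i) is the basis [vbasis {:B}] of B, with the structure
   constants of B. *)
Definition scalar_ext (F K : fieldType) (j : {rmorphism F -> K})
  (B : falgType F) : Type := 'rV[K]_(\dim {:B}).

Section ScalarExt.
Variables (F K : fieldType) (j : {rmorphism F -> K}) (B : falgType F).

HB.instance Definition _ :=
  GRing.Lmodule.copy (scalar_ext j B) 'rV[K]_(\dim {:B}).

Local Notation BK := (scalar_ext j B).
Local Notation n := (\dim {:B}).
Local Notation e := (vbasis {:B}).

(* b |-> b (x) 1 *)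
Definition ext1 (b : B) : BK := \row_k j (coord e k b).

Definition ext_mul (x y : BK) : BK :=
  \sum_(s < n) \sum_(t < n)
    ((x : 'rV_n) 0 s * (y : 'rV_n) 0 t) *: ext1 (e`_s * e`_t).

Lemma ext1_lin (a : F) (b c : B) : ext1 (a *: b + c) = j a *: ext1 b + ext1 c.
Proof. by apply/rowP => k; rewrite !mxE linearP rmorphD rmorphM. Qed.

Lemma ext1_is_zmod_morphism : zmod_morphism ext1.
Proof. by move=> b c; apply/rowP => k; rewrite !mxE linearB rmorphB. Qed.

HB.instance Definition _ :=
  GRing.isZmodMorphism.Build B BK ext1 ext1_is_zmod_morphism.

Lemma ext1Z a b : ext1 (a *: b) = j a *: ext1 b.
Proof. by rewrite -[a *: b]addr0 ext1_lin raddf0 addr0. Qed.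

Lemma ext_mul_linl a (x x' y : BK) :
  ext_mul (a *: x + x') y = a *: ext_mul x y + ext_mul x' y.
Proof.
rewrite /ext_mul scaler_sumr -big_split /=; apply: eq_bigr => s _.
rewrite scaler_sumr -big_split /=; apply: eq_bigr => t _.
by rewrite !mxE mulrDl scalerDl scalerA mulrA.
Qed.

Lemma ext_mul_linr a (x y y' : BK) :
  ext_mul x (a *: y + y') = a *: ext_mul x y + ext_mul x y'.
Proof.
rewrite /ext_mul scaler_sumr -big_split /=; apply: eq_bigr => s _.
rewrite scaler_sumr -big_split /=; apply: eq_bigr => t _.
by rewrite !mxE mulrDr scalerDl scalerA mulrCA.
Qed.

Lemma ext_mulDl : left_distributive ext_mul +%R.
Proof. by move=> x y z; rewrite -[x]scale1r ext_mul_linl !scale1r. Qed.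

Lemma ext_mulDr : right_distributive ext_mul +%R.
Proof. by move=> x y z; rewrite -[y]scale1r ext_mul_linr !scale1r. Qed.

Lemma ext_mul0l y : ext_mul 0 y = 0.
Proof. by apply: (addrI (ext_mul 0 y)); rewrite -ext_mulDl !addr0. Qed.

Lemma ext_mul0r x : ext_mul x 0 = 0.
Proof. by apply: (addrI (ext_mul x 0)); rewrite -ext_mulDr !addr0. Qed.

Lemma ext_mulZl a x y : ext_mul (a *: x) y = a *: ext_mul x y.
Proof. by rewrite -[a *: x]addr0 ext_mul_linl ext_mul0l addr0. Qed.

Lemma ext_mulZr a x y : ext_mul x (a *: y) = a *: ext_mul x y.
Proof. by rewrite -[a *: y]addr0 ext_mul_linr ext_mul0r addr0. Qed.

Lemma coord_vbasis_full (b : B) : b = \sum_(s < n) coord e s b *: e`_s.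
Proof. exact/coord_vbasis/memvf. Qed.

Lemma ext1_vbasis (s : 'I_n) : ext1 e`_s = delta_mx 0 s.
Proof.
apply/rowP => k; rewrite !mxE eqxx /=.
by rewrite coord_free ?(basis_free (vbasisP _)) // eq_sym rmorph_nat.
Qed.

Lemma ext_decomp (x : BK) : x = \sum_(s < n) (x : 'rV_n) 0 s *: ext1 e`_s.
Proof.
rewrite [LHS](row_sum_delta (x : 'rV_n)).
by apply: eq_bigr => s _; rewrite ext1_vbasis.
Qed.

Lemma ext1M b c : ext1 (b * c) = ext_mul (ext1 b) (ext1 c).
Proof.
rewrite {1}[b]coord_vbasis_full {1}[c]coord_vbasis_full /ext_mul mulr_suml raddf_sum.
apply: eq_bigr => s _; rewrite mulr_sumr raddf_sum; apply: eq_bigr => t _ /=.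
by rewrite -scalerAl -scalerAr scalerA ext1Z rmorphM !mxE.
Qed.

Lemma ext_eq (f g : BK -> BK) :
  linear f -> linear g -> (forall b, f (ext1 b) = g (ext1 b)) -> f =1 g.
Proof.
move=> lf lg fg x; rewrite [x]ext_decomp.
have sumZ (h : BK -> BK) : linear h -> forall c : 'I_n -> K,
    h (\sum_s c s *: ext1 e`_s) = \sum_s c s *: h (ext1 e`_s).
  move=> lh c; have h0 : h 0 = 0.
    by apply: (addrI (h 0)); rewrite -{1}[h 0]scale1r -lh scale1r !addr0.
  elim/big_rec2: _ => // s y1 y2 _ <-; exact: lh.
by rewrite !sumZ //; apply: eq_bigr => s _; rewrite fg.
Qed.

Lemma ext_mulA : associative ext_mul.
Proof.
move=> x y z; move: x; apply: ext_eq => [a x x'|a x x'|b].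
- exact: ext_mul_linl.
- by rewrite !ext_mul_linl.
move: y; apply: ext_eq => [a y y'|a y y'|c].
- by rewrite ext_mul_linl ext_mul_linr.
- by rewrite ext_mul_linr ext_mul_linl.
move: z; apply: ext_eq => [a z z'|a z z'|d].
- by rewrite !ext_mul_linr.
- by rewrite !ext_mul_linr.
by rewrite -!ext1M mulrA.
Qed.

Lemma ext_mul1l : left_id (ext1 1) ext_mul.
Proof.
apply: ext_eq => [a x x'|//|b]; first exact: ext_mul_linr.
by rewrite -ext1M mul1r.
Qed.

Lemma ext_mul1r : right_id (ext1 1) ext_mul.
Proof.
apply: (ext_eq (f := ext_mul^~ (ext1 1))) => [a x x'|//|b].
  exact: ext_mul_linl.
by rewrite -ext1M mulr1.
Qed.

Lemma ext1_inj : injective ext1.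
Proof.
move=> b c /rowP h; rewrite [b]coord_vbasis_full [c]coord_vbasis_full.
by apply: eq_bigr => s _; move: (h s); rewrite !mxE => /fmorph_inj ->.
Qed.

Lemma ext1_neq0 : ext1 1 != 0.
Proof. by apply/eqP; rewrite -(raddf0 ext1) => /ext1_inj/eqP; rewrite oner_eq0. Qed.

HB.instance Definition _ := GRing.Zmodule_isNzRing.Build BK
  ext_mulA ext_mul1l ext_mul1r ext_mulDl ext_mulDr ext1_neq0.

HB.instance Definition _ := GRing.Lmodule_isLalgebra.Build K BK
  (fun a x y => esym (ext_mulZl a x y)).

HB.instance Definition _ := GRing.Lalgebra_isAlgebra.Build K BK
  (fun a x y => esym (ext_mulZr a x y)).

End ScalarExt.

(** * Quaternion algebras and orders *)

Section Quaternions.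
Variables (F : fieldType) (B : falgType F).

Definition is_central_algebra : Prop :=
  forall x : B, (forall y, x * y = y * x) -> exists a : F, x = a%:A.

Definition is_simple_algebra : Prop :=
  forall I : {vspace B},
    (forall a x, x \in I -> a * x \in I /\ x * a \in I) ->
    I = 0%VS \/ I = fullv.

Definition is_quaternion_algebra : Prop :=
  [/\ \dim {:B} = 4, is_central_algebra & is_simple_algebra].

Definition is_division_algebra : Prop :=
  forall x : B, x != 0 -> x \is a GRing.unit.

End Quaternions.

Section Orders.
Variables (Fq : finFieldType).
Local Notation A := {poly Fq}.
Local Notation F := {fraction A}.
Local Notation "x %:F" := (tofrac x).
Variable B : falgType F.

Definition is_order (O : set B) : Prop :=
  [/\ O 1,
      forall x y, O x -> O y -> O (x * y)
    & exists s : seq B,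
        <<s>>%VS = fullv /\
        forall x, O x <->
          exists c : 'I_(size s) -> A, x = \sum_(i < size s) (c i)%:F *: s`_i].

Definition is_maximal_order (O : set B) : Prop :=
  is_order O /\ forall O', is_order O' -> O `<=` O' -> O' = O.

Variables (K : fieldType) (j : {rmorphism F -> K}).
Variable iota : scalar_ext j B -> 'M[K]_2.

(* The reduced norm computed in the splitting field K; its values lie in j(F). *)
Definition reduced_norm (x : B) : K := \det (iota (ext1 j x)).

(* The image under iota of O^x = {x in O | Nr(x) is a nonzero constant of Fq}. *)
Definition order_units (O : set B) : set 'M[K]_2 :=
  [set iota (ext1 j x) | x in
    [set x | O x /\ exists2 c : Fq, c != 0 & reduced_norm x = j (c%:P)%:F]].

End Orders.

(** * Groups of matrices *)

Section MatrixGroups.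
Variables (K : fieldType).
Implicit Types G H : set 'M[K]_2.

Definition lcoset (g : 'M[K]_2) H : set 'M[K]_2 := [set g * h | h in H].

Definition lcosets G H : set (set 'M[K]_2) := [set lcoset g H | g in G].

Definition finite_index_subgroup H G : Prop :=
  [/\ H `<=` G, H 1,
      forall g h, H g -> H h -> H (g * h),
      forall g, H g -> H g^-1
    & finite_set (lcosets G H)].

Definition center G : set 'M[K]_2 :=
  [set h | G h /\ forall g, G g -> h * g = g * h].

(* The projective line over K, [None] being the point at infinity *)
Definition P1 : Type := option K.

Definition moebiusP1 (g : 'M[K]_2) (x : P1) : P1 :=
  let num := if x is Some y then g 0 0 * y + g 0 1 else g 0 0 in
  let den := if x is Some y then g 1 0 * y + g 1 1 else g 1 0 in
  if den == 0 then None else Some (num / den).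

End MatrixGroups.

(** * The half-plane, rigid functions, modular forms, Poincare series *)

Record poincare_data (K : fieldType) := PoincareData {
  pd_r : nat;
  pd_k : 'I_pd_r -> nat;
  pd_a : 'I_pd_r -> P1 K;
  pd_b : 'I_pd_r -> P1 K
}.
Arguments pd_k {K} D s : rename.
Arguments pd_a {K} D s : rename.
Arguments pd_b {K} D s : rename.

(* Functions on the half-plane are represented by total functions C -> C, whose
   values outside [halfplane] are irrelevant. *)
Section HalfPlane.
Variables (R : realType) (K C : fieldType) (i : K -> C) (v : C -> R).

Definition halfplane : set C := ~` range i.

Definition cocycle (g : 'M[K]_2) (z : C) : C := i (g 1 0) * z + i (g 1 1).

Definition moebius (g : 'M[K]_2) (z : C) : C :=
  (i (g 0 0) * z + i (g 0 1)) / cocycle g z.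

(* The closed disc D(c, |p|) minus the open discs D(x.1, |x.2|) for x in s; any
   connected affinoid subset of P^1(C) missing infinity has this form. *)
Definition affinoid (c p : C) (s : seq (C * C)) : set C :=
  [set z | v (z - c) <= v p /\
           forall x, x \in s -> v x.2 <= v (z - x.1)].

Definition rational_approx (X : set C) (f : C -> C) : Prop :=
  forall eps, 0 < eps -> exists P Q : {poly C},
    forall z, X z -> Q.[z] != 0 /\ v (f z - P.[z] / Q.[z]) < eps.

Definition rigid_holomorphic (f : C -> C) : Prop :=
  forall (c p : C) (s : seq (C * C)),
    p != 0 -> (forall x, x \in s -> x.2 != 0) ->
    affinoid c p s `<=` halfplane -> rational_approx (affinoid c p s) f.

(* M_{w,m}(Gamma); the type m matters only modulo the order of det(Gamma). *)
Definition modular_forms (Gamma : set 'M[K]_2) (w : nat) (m : int) :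
    set (C -> C) :=
  [set f | rigid_holomorphic f /\
    forall g z, Gamma g -> halfplane z ->
      i (\det g) ^ m / cocycle g z ^+ w * f (moebius g z) = f z].

Definition has_sum (I : choiceType) (D : set I) (F : I -> C) (S : C) : Prop :=
  forall eps, 0 < eps -> exists J0 : {fset I}, [set` J0] `<=` D /\
    forall J : {fset I}, [set` J] `<=` D -> (J0 `<=` J)%fset ->
      v (\sum_(x <- J) F x - S) < eps.

Definition summable (I : choiceType) (D : set I) (F : I -> C) : Prop :=
  exists S, has_sum D F S.

(* The unconditional sum of F over D, and 0 if F is not summable *)
Definition total_sum (I : choiceType) (D : set I) (F : I -> C) : C :=
  xget 0 [set S | has_sum D F S].

Definition inv_pt (z : C) (a : P1 K) : C :=
  if a is Some x then (z - i x)^-1 else 0.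

Definition u_fun (z : C) (a b : P1 K) : C := inv_pt z b - inv_pt z a.

Definition poincare_admissible (k : nat) (D : poincare_data K) : Prop :=
  let ab s := [set pd_a D s; pd_b D s] in
  [/\ (2 <= pd_r D)%N,
      (forall s, 1 <= pd_k D s)%N /\ (\sum_s pd_k D s)%N = k,
      forall s, pd_a D s <> pd_b D s,
      forall s t, s <> t -> ab s <> ab t
    & \bigcap_s ab s = set0].

Definition poincare_summand (l : int) (D : poincare_data K) (z : C)
    (g : 'M[K]_2) : C :=
  i (\det g) ^ (- l) *
  \prod_(s < pd_r D)
    u_fun z (moebiusP1 g (pd_a D s)) (moebiusP1 g (pd_b D s)) ^+ pd_k D s.

(* The summand at a class c in Gamma / Z(Gamma), through a chosen element of c;
   it does not depend on this choice when #Z(Gamma) divides 2l. *)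
Definition poincare_term (l : int) (D : poincare_data K) (z : C)
    (c : set 'M[K]_2) : C :=
  poincare_summand l D z (xget 1 c).

Definition poincare_summable (Gamma : set 'M[K]_2) (l : int)
    (D : poincare_data K) (z : C) : Prop :=
  summable (lcosets Gamma (center Gamma)) (poincare_term l D z).

Definition poincare_series (Gamma : set 'M[K]_2) (l : int)
    (D : poincare_data K) (z : C) : C :=
  total_sum (lcosets Gamma (center Gamma)) (poincare_term l D z).

Definition poincare_family (Gamma : set 'M[K]_2) (k : nat) (l : int) :
    set (C -> C) :=
  [set poincare_series Gamma l D | D in poincare_admissible k].

(* C-linear span of P, as functions on the half-plane *)
Definition span_halfplane (P : set (C -> C)) : set (C -> C) :=
  [set f | exists (n : nat) (c : 'I_n -> C) (g : 'I_n -> C -> C),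
    (forall s, P (g s)) /\
    forall z, halfplane z -> f z = \sum_(s < n) c s * g s z].

End HalfPlane.

(* Main.v *)
(* For a form f of weight 2k put nu f z = |f z| d(z)^k, where d(z) is the distance from z to F_oo; nu f is invariant under
   Gamma, hence bounded since Gamma is cocompact. It suffices to find finitely many Poincare series and a constant s < 1
   such that every f with nu f <= N differs by some g with nu g <= s N from a combination of these series with
   coefficients bounded by N: iterating and summing the coefficients then writes f exactly as a combination.

   Locally on Omega this is an approximation by products of k functions u(z; a, b). On the annulus above an edge of the
   tree, f is close to a multiple of z^(-k), which is close to such a product. After this correction f is small on all
   edges. On the affinoid above a vertex, expand an approximation of f in powers of H = z^q - z; as f is small on the
   adjacent edges, f is close to P / H^(k-1) with deg P < q (k-1) - k, and such fractions are combinations of products of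
   k functions u(z; a, b) with a, b in P^1(F_q), no point being a pole of order k. These products are small off the chosen
   edge or vertex, so averaging over stabilizers, whose orders are prime to p, turns them into Poincare series.

   Cocompactness is proved by Fujisaki's argument from Minkowski's theorem for the order O. *)
From mathcomp Require Import fingroup perm pgroup.
Require Import Defs.
From HB Require Import structures.
From mathcomp Require Import all_boot all_order all_algebra all_field.
From mathcomp Require Import finmap.
From mathcomp Require Import boolp classical_sets cardinality reals.
From mathcomp Require Import ring lra zify.
Import Order.TTheory GRing.Theory Num.Theory.
Local Open Scope classical_set_scope.
Local Open Scope ring_scope.

Set Implicit Arguments.
Unset Strict Implicit.
Unset Printing Implicit Defensive.

(** The claim concerns finite combinations, not limits of them. Hence the list of series and the
    factor s have to be the same for all f; then only coefficients are summed, in a complete field.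
    The factor is the fourth root of |varpi|: absolute values on [Finf] are powers of s ^ 4 and an
    edge sits at an exponent 4n + 2, so beside its circle |z| = s ^ 2 there is room for the circles
    of radius s and s ^ 3, on which Cauchy estimates gain a factor s. Edges precede vertices because
    smallness of f on all edges is what bounds the pole orders and the degree of the fractions above
    a vertex. The bound is the right one: 2k poles can be grouped into pairs of distinct points
    without a point common to all pairs when no pole has order k or more. The same condition makes a
    product decay off its vertex, since its weighted size is multiplied by at least one power of a
    small distance. Averaging needs stabilizers of order prime to p, which comes from the absence of
    p-torsion in a division algebra of characteristic p. *)

Section NonArchimedean.
Variables (R : realType) (k : fieldType) (v : k -> R).
Hypothesis Hv : nonarch_abs v.

Lemma na_ge0 x : 0 <= v x. Proof. by case: Hv. Qed.
Lemma na_eq0 x : (v x == 0) = (x == 0).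
Proof. by case: Hv => _ h _ _; apply/eqP/eqP => /h. Qed.
Lemma na0 : v 0 = 0. Proof. by apply/eqP; rewrite na_eq0. Qed.
Lemma na_gt0 x : (0 < v x) = (x != 0).
Proof. by rewrite lt0r na_eq0 na_ge0 andbT. Qed.
Lemma naM x y : v (x * y) = v x * v y. Proof. by case: Hv. Qed.
Lemma naD x y : v (x + y) <= Num.max (v x) (v y). Proof. by case: Hv. Qed.
Lemma na1 : v 1 = 1.
Proof.
have : v 1 * v 1 = v 1 * 1 by rewrite -naM mulr1 mulr1.
by apply: mulfI; rewrite na_eq0 oner_eq0.
Qed.
Lemma naX x n : v (x ^+ n) = v x ^+ n.
Proof. by elim: n => [|n IH]; rewrite ?expr0 ?na1 // !exprS naM IH. Qed.
Lemma na_finite_order x n : (0 < n)%N -> x ^+ n = 1 -> v x = 1.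
Proof.
move=> n0 xn; have := congr1 v xn; rewrite naX na1 => /eqP.
by rewrite pexprn_eq1 ?na_ge0 // eqn0Ngt n0 /= => /eqP.
Qed.
Lemma naN x : v (- x) = v x.
Proof. by rewrite -mulN1r naM (@na_finite_order (-1) 2) ?mul1r // sqrrN expr1n. Qed.
Lemma naBC x y : v (x - y) = v (y - x). Proof. by rewrite -naN opprB. Qed.
Lemma naV x : v x^-1 = (v x)^-1.
Proof.
have [->|x0] := eqVneq x 0; first by rewrite invr0 na0 invr0.
have vx : v x != 0 by rewrite na_eq0.
by apply: (mulfI vx); rewrite -naM !mulfV // na1.
Qed.
Lemma naF x y : v (x / y) = v x / v y. Proof. by rewrite naM naV. Qed.
Lemma naXz x (n : int) : v (x ^ n) = v x ^ n.
Proof. by case: n => n; rewrite ?NegzE -?exprnP -?exprnN ?naV naX. Qed.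
Lemma na_le_add x y B : v x <= B -> v y <= B -> v (x + y) <= B.
Proof. by move=> hx hy; apply: le_trans (naD x y) _; rewrite ge_max hx hy. Qed.
Lemma na_lt_add x y B : v x < B -> v y < B -> v (x + y) < B.
Proof. by move=> hx hy; apply: le_lt_trans (naD x y) _; rewrite gt_max hx hy. Qed.
Lemma na_le_sub x y B : v x <= B -> v y <= B -> v (x - y) <= B.
Proof. by move=> hx hy; apply: na_le_add; rewrite ?naN. Qed.
Lemma na_lt_sub x y B : v x < B -> v y < B -> v (x - y) < B.
Proof. by move=> hx hy; apply: na_lt_add; rewrite ?naN. Qed.
Lemma na_eq_addl x y : v y < v x -> v (x + y) = v x.
Proof.
move=> h; apply/eqP; rewrite eq_le; apply/andP; split.
  by apply: na_le_add => //; apply: ltW.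
rewrite leNgt; apply/negP => h2; suff : v x < v x by rewrite ltxx.
by rewrite -{1}(addrK y x); apply: na_lt_sub.
Qed.
Lemma na_eq_addr x y : v x < v y -> v (x + y) = v y.
Proof. by move=> h; rewrite addrC na_eq_addl. Qed.
Lemma na_eq_subl x y : v y < v x -> v (x - y) = v x.
Proof. by move=> h; rewrite na_eq_addl ?naN. Qed.
Lemma na_eq_subr x y : v x < v y -> v (x - y) = v y.
Proof. by move=> h; rewrite naBC na_eq_subl. Qed.
Lemma na_eq_near x y : v (x - y) < v y -> v x = v y.
Proof. by move=> h; rewrite -(subrK y x) na_eq_addr. Qed.
Lemma na_trans x y z B : v (x - y) <= B -> v (y - z) <= B -> v (x - z) <= B.
Proof. by move=> h1 h2; rewrite -(subrKA y); apply: na_le_add. Qed.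
Lemma na_lt_trans x y z B : v (x - y) < B -> v (y - z) < B -> v (x - z) < B.
Proof. by move=> h1 h2; rewrite -(subrKA y); apply: na_lt_add. Qed.
Lemma na_sub_neq x y : v x != v y -> v (x - y) = Num.max (v x) (v y).
Proof.
rewrite neq_lt => /orP[h|h]; first by rewrite na_eq_subr // maxEle ltW.
by rewrite na_eq_subl // maxEge ltW.
Qed.
Lemma na_sum I (r : seq I) (P : pred I) (F : I -> k) B : 0 <= B ->
  (forall i, P i -> v (F i) <= B) -> v (\sum_(i <- r | P i) F i) <= B.
Proof.
move=> B0 h; elim/big_rec: _ => [|i x Pi hx]; first by rewrite na0.
by apply: na_le_add => //; apply: h.
Qed.
Lemma na_sum_in (I : eqType) (r : seq I) (F : I -> k) B : 0 <= B ->
  (forall i, i \in r -> v (F i) <= B) -> v (\sum_(i <- r) F i) <= B.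
Proof. by move=> B0 h; rewrite big_seq; apply: na_sum. Qed.
Lemma na_sum_lt I (r : seq I) (P : pred I) (F : I -> k) B : 0 < B ->
  (forall i, P i -> v (F i) < B) -> v (\sum_(i <- r | P i) F i) < B.
Proof.
move=> B0 h; elim/big_rec: _ => [|i x Pi hx]; first by rewrite na0.
by apply: na_lt_add => //; apply: h.
Qed.
Lemma na_prod I (r : seq I) (P : pred I) (F : I -> k) :
  v (\prod_(i <- r | P i) F i) = \prod_(i <- r | P i) v (F i).
Proof. by elim/big_rec2: _ => [|i x y Pi <-]; rewrite ?na1 ?naM. Qed.
Lemma na_nat_le1 n : v n%:R <= 1.
Proof. by elim: n => [|n IH]; rewrite ?na0 // -natr1; apply: na_le_add; rewrite ?na1. Qed.
Lemma na_nat_char p n : p \in [pchar k] -> n%:R != 0 :> k -> v n%:R = 1.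
Proof.
move=> cp n0.
have pp : prime p by case/andP: cp.
have e : n%:R ^+ p = n%:R :> k by rewrite -(pFrobenius_autE cp) pFrobenius_aut_nat.
apply: (@na_finite_order _ p.-1); first by case: p pp {cp e} => [|[|p]].
apply: (mulfI n0); rewrite -exprS prednK ?prime_gt0 //; first by rewrite e mulr1.
Qed.
End NonArchimedean.

Lemma expr_small (R : realType) (c eps : R) : 0 <= c -> c < 1 -> 0 < eps ->
  exists N, forall n, (N <= n)%N -> c ^+ n < eps.
Proof.
move=> c0 c1 e0; have [->|cn0] := eqVneq c 0.
  by exists 1%N => -[|n] // _; rewrite expr0n.
have {}c0 : 0 < c by rewrite lt0r cn0.
pose d := c^-1 - 1; have d0 : 0 < d by rewrite subr_gt0 invf_gt1.
have bern n : 1 + n%:R * d <= c^-1 ^+ n.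
  elim: n => [|n IH]; first by rewrite mul0r addr0 expr0.
  rewrite exprS; apply: le_trans (ler_wpM2l _ IH); last by rewrite invr_ge0 ltW.
  have : 0 <= (n%:R : R) * d * d by rewrite !mulr_ge0 // ltW.
  rewrite -[c^-1](subrK 1) -/d -natr1; nra.
exists (Num.bound (eps^-1 / d)) => n hn.
have h : eps^-1 < c^-1 ^+ n.
  apply: lt_le_trans (bern n); rewrite -ltrBlDl.
  apply: (@lt_trans _ _ (eps^-1)); first by rewrite ltrBlDl ltrDr.
  rewrite -ltr_pdivrMr //.
  apply: lt_le_trans (archi_boundP _) _; first by rewrite divr_ge0 // ltW // invr_gt0.
  by rewrite ler_nat.
by rewrite -ltf_pV2 ?posrE ?exprn_gt0 // -exprVn.
Qed.

Section Complete.
Variables (R : realType) (k : fieldType) (v : k -> R).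
Hypotheses (Hv : nonarch_abs v) (Hc : abs_complete v).

Lemma na_telescope (u : nat -> k) B N :
  (forall n, (N <= n)%N -> v (u n.+1 - u n) < B) ->
  forall m n, (N <= m)%N -> (N <= n)%N -> v (u m - u n) < B.
Proof.
move=> h.
have B0 : 0 < B by apply: le_lt_trans (h N (leqnn N)); rewrite na_ge0.
have key m d : (N <= m)%N -> v (u (m + d)%N - u m) < B.
  move=> hm; elim: d => [|d IH]; first by rewrite addn0 subrr na0.
  by apply: (na_lt_trans Hv (y := u (m + d)%N)) => //; rewrite addnS h ?leq_addr // (leq_trans hm) // leq_addr.
move=> m n hm hn; case: (leqP n m) => [/subnKC <-|/ltnW/subnKC <-]; first exact: key.
by rewrite (naBC Hv); apply: key.
Qed.

Lemma na_cauchy (u : nat -> k) :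
  (forall eps, 0 < eps -> exists N, forall n, (N <= n)%N -> v (u n.+1 - u n) < eps) ->
  exists x, forall eps, 0 < eps -> exists N, forall n, (N <= n)%N -> v (u n - x) < eps.
Proof.
move=> h; apply: Hc => eps /h[N hN]; exists N => m n.
exact: na_telescope.
Qed.
End Complete.

(** * The completion of an algebraically closed field is algebraically closed *)

Lemma closed_field_splits (k : fieldType) : GRing.closed_field_axiom k ->
  forall p : {poly k}, exists rs, p = lead_coef p *: \prod_(r <- rs) ('X - r%:P).
Proof.
move=> hk p; have [n] := ubnP (size p); elim: n p => // n IH p hp.
have [s1|s1] := leqP (size p) 1%N.
  exists [::]; rewrite big_nil alg_polyC.
  by rewrite [in RHS](size1_polyC s1) lead_coefC -size1_polyC.
have lp : lead_coef p != 0 by rewrite lead_coef_eq0 -size_poly_gt0 ltnW.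
have [x hx] := hk (size p).-1 (fun i => - p`_i / lead_coef p) ltac:(by rewrite -ltnS prednK // ltnW).
have rx : root p x.
  rewrite /root horner_coef; case: (size p) hx s1 (lead_coefE p) => [//|m] /= hx _ lpE.
  rewrite big_ord_recr /= -lpE hx mulr_sumr -big_split big1 //= => i _.
  by field.
have /factor_theorem[q qE] := rx.
have q0 : q != 0 by apply: contraNneq lp => q0; rewrite qE q0 mul0r lead_coef0.
have sq : (size q < n)%N by move: hp; rewrite qE size_Mmonic ?monicXsubC // size_XsubC addn2.
have [rs qrs] := IH q sq.
exists (x :: rs); rewrite big_cons {1}qE {1}qrs qE lead_coef_Mmonic ?monicXsubC //.
by rewrite mulrC scalerAr.
Qed.

Section CompletionClosed.
Variables (R : realType) (k C : fieldType) (vk : k -> R) (v : C -> R) (j : {rmorphism k -> C}).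
Hypotheses (hk : GRing.closed_field_axiom k) (hj : is_completion vk v j).

(** If v x > B >= 1, then x ^ d outweighs every other term. *)
Lemma monic_root_bound (d : nat) (Q : nat -> C) x B : 1 <= B -> nonarch_abs v ->
  (forall i, v (Q i) <= B) -> x ^+ d = \sum_(i < d) Q i * x ^+ i -> v x <= B.
Proof.
move=> B1 Hv hQ xd; rewrite leNgt; apply/negP => Bx.
have x1 : 1 < v x by apply: le_lt_trans Bx.
have x0 : 0 < v x by apply: lt_trans x1.
case: d xd => [|d] xd.
  by move/eqP: xd; rewrite big_ord0 expr0 oner_eq0.
have : v (x ^+ d.+1) <= B * v x ^+ d.
  rewrite xd; apply: na_sum => // [|i _].
    by rewrite mulr_ge0 ?exprn_ge0 ?(na_ge0 Hv) // (le_trans ler01).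
  rewrite naM // naX //; apply: ler_pM; rewrite ?exprn_ge0 ?(na_ge0 Hv) //.
  by apply: ler_weXn2l; rewrite ?ltW // -ltnS.
rewrite naX // exprS leNgt; apply/negP; rewrite negbK.
by rewrite ltr_pM2r // exprn_gt0.
Qed.

Lemma na_subX x y M i : nonarch_abs v -> 1 <= M -> v x <= M -> v y <= M ->
  v (x ^+ i - y ^+ i) <= v (x - y) * M ^+ i.-1.
Proof.
move=> Hv M1 xM yM; have M0 : 0 <= M by apply: le_trans M1.
rewrite subrXX naM //; apply: ler_wpM2l; first exact: na_ge0 Hv _.
apply: na_sum => // [|l _]; first exact: exprn_ge0.
rewrite (naM Hv) !(naX Hv).
have -> : M ^+ i.-1 = M ^+ (i.-1 - l) * M ^+ l.
  by rewrite -exprD subnK //; case: (i) l => [|i'] [].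
by apply: ler_pM; rewrite ?exprn_ge0 ?(na_ge0 Hv) // lerXn2r ?nnegrE ?(na_ge0 Hv).
Qed.

(** The coefficients are approximated in [k] ever more closely. At a root of one approximation the
    next one is small; as it splits into d linear factors, one of its roots is close. This gives a
    Cauchy sequence of roots, whose limit is a root. *)
Lemma completion_closed : GRing.closed_field_axiom C.
Proof.
case: hj => Hv hjv Hc dens d P d0.
pose B := 1 + \sum_(i < d) v (P i).
have sumv0 : 0 <= \sum_(i < d) v (P i) by apply: sumr_ge0 => i _; rewrite na_ge0.
have B1 : 1 <= B by rewrite /B lerDl.
have Bgt0 : 0 < B by apply: lt_le_trans B1.
have PB i : (i < d)%N -> v (P i) <= B.
  move=> hi; rewrite /B (bigD1 (Ordinal hi)) //= addrCA lerDl addr_ge0 //.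
  by apply: sumr_ge0 => l _; rewrite na_ge0.
(* The denominator compensates the powers of a root, at most B ^ d, so the next polynomial is at
   most (2^-n) ^ d at the current root. *)
pose eps n : R := (2^-1 ^+ n) ^+ d / B ^+ d.
have eps0 n : 0 < eps n by rewrite divr_gt0 ?exprn_gt0 ?invr_gt0.
have epsB n : eps n <= B.
  apply: (@le_trans _ _ 1) => //; rewrite ler_pdivrMr ?exprn_gt0 // mul1r.
  apply: (@le_trans _ _ 1); last by rewrite exprn_ege1.
  by rewrite !exprn_ile1 ?invr_ge0 ?exprn_ge0 ?invr_ge0 ?invf_le1 ?ler1n.
pose Rel n (x : k) := exists Q : nat -> k,
  (forall i, (i < d)%N -> v (P i - j (Q i)) < eps n) /\ x ^+ d = \sum_(i < d) Q i * x ^+ i.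
have approx n : exists Q : nat -> k, forall i, v (P i - j (Q i)) < eps n.
  exists (fun i => projT1 (cid (dens (P i) (eps n) (eps0 n)))) => i.
  by case: cid.
have relB n x : Rel n x -> v (j x) <= B.
  move=> [Q [hQ xQ]]; apply: (@monic_root_bound d (fun i => if (i < d)%N then j (Q i) else 0)) => //.
    move=> i; case: ifP => hi; last by rewrite na0 // ltW.
    rewrite -[j _](subrK (P i)); apply: na_le_add => //; last exact: PB.
    by rewrite naBC // (le_trans _ (epsB n)) // ltW // hQ.
  rewrite -rmorphXn xQ rmorph_sum; apply: eq_bigr => i _.
  by rewrite ltn_ord rmorphM rmorphXn.
have factor (Q : nat -> k) : exists2 rs, size rs = d &
    forall x, x ^+ d - \sum_(i < d) Q i * x ^+ i = \prod_(r <- rs) (x - r).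
  pose p := 'X^d - \poly_(i < d) Q i.
  have sp : size p = d.+1.
    by rewrite size_polyDl size_polyXn // size_polyN ltnS size_poly.
  have lp : lead_coef p = 1.
    by rewrite lead_coefDl ?lead_coefXn // size_polyXn size_polyN ltnS size_poly.
  have [rs prs] := closed_field_splits hk p; rewrite lp scale1r in prs.
  exists rs; first by move: sp; rewrite prs size_prod_XsubC => -[].
  move=> x; have -> : \prod_(r <- rs) (x - r) = p.[x].
    by rewrite prs horner_prod; apply: eq_bigr => r _; rewrite hornerXsubC.
  by rewrite /p hornerD hornerN hornerXn horner_poly.
have step n x : Rel n x -> exists y, Rel n.+1 y /\ v (j y - j x) <= 2^-1 ^+ n.
  move=> rx; have xB := relB _ _ rx; case: rx => Q [hQ xQ].
  have [Q' hQ'] := approx n.+1; have [rs srs frs] := factor Q'.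
  have small : v (j (\prod_(r <- rs) (x - r))) <= (2^-1 ^+ n) ^+ d.
    rewrite -frs xQ -sumrB rmorph_sum; apply: na_sum => // [|i _].
      by rewrite !exprn_ge0 // invr_ge0.
    rewrite -mulrBl rmorphM rmorphXn naM // naX //.
    have -> : (2^-1 ^+ n) ^+ d = eps n * B ^+ d by rewrite divfK // expf_neq0 // gt_eqF.
    apply: ler_pM; rewrite ?exprn_ge0 ?(na_ge0 Hv) //.
      rewrite rmorphB -(subrKA (P i)) addrC; apply: na_le_add => //; rewrite ltW //.
        apply: lt_le_trans (hQ' i) _; rewrite /eps ler_pM2r ?invr_gt0 ?exprn_gt0 //.
        rewrite lerXn2r ?nnegrE ?exprn_ge0 ?invr_ge0 //.
        by rewrite exprS ler_piMl ?exprn_ge0 ?invr_ge0 // invf_le1 ?ler1n.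
      by rewrite naBC // hQ.
    apply: (@le_trans _ _ (B ^+ i)); last by rewrite ler_weXn2l // ltnW.
    by rewrite lerXn2r ?nnegrE ?(na_ge0 Hv) ?(ltW Bgt0).
  have [y yrs hy] : exists2 y, y \in rs & v (j y - j x) <= 2^-1 ^+ n.
    apply: contrapT => hn.
    have hlt r : r \in rs -> 2^-1 ^+ n < v (j (x - r)).
      move=> hr; rewrite ltNge; apply/negP => h; apply: hn; exists r => //.
      by rewrite naBC // -rmorphB.
    move: small; rewrite rmorph_prod na_prod // leNgt => /negP; apply.
    rewrite -srs; have : (0 < size rs)%N by rewrite srs.
    elim: rs hlt {frs srs hn} => // r [|r' rs] IH hlt _.
      by rewrite big_seq1 expr1 hlt // mem_head.
    rewrite big_cons exprS; apply: ltr_pM; rewrite ?exprn_ge0 ?invr_ge0 ?hlt ?mem_head //.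
    by apply: IH => // r2 h2; apply: hlt; rewrite in_cons h2 orbT.
  exists y; split => //; exists Q'; split=> //.
  by apply/eqP; rewrite -subr_eq0 frs prodf_seq_eq0; apply/hasP; exists y => //; rewrite subrr eqxx.
have [x0 rx0] : exists x, Rel 0%N x.
  have [Q hQ] := approx 0%N; have [x hx] := hk Q d0.
  by exists x, Q; split.
pose f := fix f n : {x | Rel n x} := match n with
  | 0%N => exist _ x0 rx0
  | m.+1 => let: exist x rx := f m in
      exist _ (projT1 (cid (step m x rx))) (proj1 (projT2 (cid (step m x rx)))) end.
have fstep n : v (j (projT1 (f n.+1)) - j (projT1 (f n))) <= 2^-1 ^+ n.
  by rewrite /=; case: (f n) => x rx /=; case: cid => y [? ?].
have half0 : 0 <= 2^-1 :> R by rewrite invr_ge0.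
have half1 : 2^-1 < 1 :> R by rewrite invf_lt1 ?ltr1n.
have [x hx] := na_cauchy Hv Hc (u := fun n => j (projT1 (f n)))
  ltac:(by move=> e e0; have [N hN] := expr_small half0 half1 e0;
        exists N => n /hN; apply: le_lt_trans).
exists x; apply/eqP; rewrite -subr_eq0 -(na_eq0 Hv); apply: contraT => nz.
pose M := Num.max B (v x).
have M1 : 1 <= M by rewrite le_max B1.
have M0 : 0 < M by apply: lt_le_trans M1.
set val := x ^+ d - _ in nz.
have val0 : 0 < v val by rewrite lt0r nz na_ge0.
(* Small enough that passing to a late approximation of x and of the coefficients changes the value
   by less than [v val]. *)
pose e := v val / M ^+ d.
have e0 : 0 < e by rewrite divr_gt0 // exprn_gt0.
have [N1 hN1] := hx _ e0.
have [N2 hN2] := expr_small half0 half1 e0.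
pose n := maxn N1 N2.
have xn := hN1 n (leq_maxl _ _); have en := hN2 n (leq_maxr _ _).
have eE : v val = e * M ^+ d by rewrite divfK // expf_neq0 // gt_eqF.
case: (f n) xn => y [Q [hQ yQ]] /= xn.
have yB := relB _ _ (ex_intro _ Q (conj hQ yQ)).
have xM : v x <= M by rewrite le_max lexx orbT.
have yM : v (j y) <= M by rewrite le_max yB.
have Mle i : (i < d)%N -> v (j (Q i)) <= M.
  move=> hi; rewrite le_max; apply/orP; left; rewrite -[j _](subrK (P i)).
  by apply: na_le_add => //; [rewrite naBC // (le_trans _ (epsB n)) // ltW // hQ|exact: PB].
have eM0 : 0 < e * M ^+ d by rewrite mulr_gt0 // exprn_gt0.
have step2 a i : v a <= M -> (i <= d)%N -> v (a * (x ^+ i - j y ^+ i)) < e * M ^+ d.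
  move=> aM id; rewrite naM //.
  rewrite naBC // in xn.
  case: i id => [_ /=|i id]; first by rewrite subrr na0 // mulr0 mulr_gt0 // exprn_gt0.
  apply: (@le_lt_trans _ _ (M * (v (x - j y) * M ^+ i))).
    by apply: ler_pM; rewrite ?(na_ge0 Hv) // na_subX.
  rewrite mulrCA -exprS; apply: (@lt_le_trans _ _ (e * M ^+ i.+1)).
    by rewrite ltr_pM2r // exprn_gt0.
  by rewrite ler_pM2l // ler_weXn2l.
have : v val < e * M ^+ d.
  have -> : val = (x ^+ d - \sum_(i < d) j (Q i) * x ^+ i)
      + \sum_(i < d) (j (Q i) - P i) * x ^+ i.
    rewrite /val -addrA; congr (_ + _); under [X in _ = _ + X]eq_bigr do rewrite mulrBl.
    by rewrite sumrB addrA addNr add0r.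
  apply: na_lt_add => //.
    have -> : x ^+ d - \sum_(i < d) j (Q i) * x ^+ i = 
       (x ^+ d - (j y) ^+ d) - \sum_(i < d) j (Q i) * (x ^+ i - j y ^+ i).
      rewrite -rmorphXn yQ rmorph_sum -addrA; congr (_ + _).
      under [X in _ = _ - X]eq_bigr do rewrite mulrBr.
      rewrite sumrB; under [X in _ = - X + _]eq_bigr do rewrite rmorphM rmorphXn.
      by rewrite opprB addrA addNr add0r.
    apply: na_lt_sub => //.
      by rewrite -[_ - _]mul1r; apply: step2; rewrite ?na1.
    apply: na_sum_lt => // i _; apply: step2; rewrite ?Mle //; exact: ltnW.
  apply: na_sum_lt => // i _.
  rewrite naM // naX //.
  apply: (@lt_le_trans _ _ (e * M ^+ i)); last by rewrite ler_pM2l // ler_weXn2l // ltnW.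
  have epsn : eps n < e.
    apply: le_lt_trans en; rewrite ler_pdivrMr ?exprn_gt0 //.
    apply: (@le_trans _ _ (2^-1 ^+ n)); last first.
      by rewrite ler_peMr ?exprn_ge0 ?invr_ge0 // exprn_ege1.
    case: (d) d0 => // d' _; rewrite exprS ler_piMr ?exprn_ge0 ?invr_ge0 //.
    by rewrite !exprn_ile1 ?exprn_ge0 ?invr_ge0 ?invf_le1 ?ler1n.
  apply: (@le_lt_trans _ _ (v (j (Q i) - P i) * M ^+ i)).
    by rewrite ler_wpM2l ?(na_ge0 Hv) // lerXn2r ?nnegrE ?(na_ge0 Hv) // (ltW M0).
  rewrite ltr_pM2r ?exprn_gt0 //; apply: lt_trans epsn; rewrite naBC //; exact: hQ.
by rewrite eE ltxx.
Qed.
End CompletionClosed.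

(** * The half-plane *)

Section DrinfeldHalfPlane.
Variables (R : realType) (Fq : finFieldType) (K C : fieldType).
Variables (vK : K -> R) (v : C -> R) (i : {rmorphism K -> C}).
Variables (kap : {rmorphism Fq -> K}) (s : R) (sig : C) (vpi : K).
Hypotheses (HvK : nonarch_abs vK) (HcK : abs_complete vK).
Hypotheses (Hv : nonarch_abs v) (Hc : abs_complete v).
Hypothesis viE : forall x, v (i x) = vK x.
Hypothesis Cclosed : GRing.closed_field_axiom C.
(** Values of K have exponents divisible by 4 in base s. The other exponents belong to points off K:
    2 modulo 4 marks the middle of an edge, and the odd ones give auxiliary circles; [sig] is a
    point with such a value. *)
Hypotheses (s_gt0 : 0 < s) (s_lt1 : s < 1) (vsig : v sig = s) (vpiE : vK vpi = s ^+ 4).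
Hypothesis valK : forall x, x != 0 -> exists n : int, vK x = s ^ (4 * n).
Hypothesis resK : forall x, vK x <= 1 -> exists a, vK (x - kap a) < 1.

Local Notation Omega := (halfplane i).

Lemma s_neq0 : s != 0. Proof. by rewrite gt_eqF. Qed.
Lemma sX_gt0 n : 0 < s ^+ n. Proof. by rewrite exprn_gt0. Qed.
Lemma sz_gt0 (n : int) : 0 < s ^ n. Proof. by rewrite exprz_gt0. Qed.
Lemma le_sz (m n : int) : (s ^ m <= s ^ n) = (n <= m).
Proof.
have s1 : 1 < s^-1 by rewrite invf_gt1.
by have := ler_eXz2l s1 (- m) (- n); rewrite !exprz_inv !opprK lerN2.
Qed.
Lemma lt_sz (m n : int) : (s ^ m < s ^ n) = (n < m).
Proof. by rewrite !ltNge le_sz. Qed.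
Lemma eq_sz (m n : int) : (s ^ m == s ^ n) = (m == n).
Proof. by rewrite !eq_le !le_sz andbC. Qed.
Lemma szD (m n : int) : s ^ (m + n) = s ^ m * s ^ n.
Proof. by rewrite expfzDr // s_neq0. Qed.
Lemma sX_lt m n : (s ^+ m < s ^+ n) = (n < m)%N.
Proof. by rewrite !exprnP lt_sz. Qed.
Lemma sX_le m n : (s ^+ m <= s ^+ n) = (n <= m)%N.
Proof. by rewrite !exprnP le_sz. Qed.

Lemma small_s4 e : 0 < e -> exists n, (s ^+ 4) ^+ n <= e.
Proof.
move=> e0; have [N hN] := @expr_small R (s ^+ 4) e (ltW (sX_gt0 4)) ltac:(by rewrite exprn_ilt1 // ltW) e0.
by exists N; apply/ltW/hN.
Qed.
Lemma large_s4 M : exists n, M <= (s ^+ 4) ^- n.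
Proof.
have M0 : 0 < Num.max 1 M by rewrite lt_max ltr01.
have [n hn] := @small_s4 (Num.max 1 M)^-1 ltac:(by rewrite invr_gt0).
exists n; apply: (@le_trans _ _ (Num.max 1 M)); first by rewrite le_max lexx orbT.
by rewrite -[leLHS]invrK lef_pV2 ?posrE ?invr_gt0 ?exprn_gt0.
Qed.

Lemma scale r : 0 < r -> exists n : int, s ^ (4 * n) <= r < s ^ (4 * (n - 1)).
Proof.
move=> r0; have [N hN] := large_s4 r; have [N' hN'] := small_s4 r0.
have E4 (j : nat) : (s ^+ 4) ^+ j = s ^ (4 * j%:Z) by rewrite -exprM exprnP PoszM.
rewrite E4 invr_expz in hN; rewrite E4 in hN'.
have ex : exists m, s ^ (4 * (m%:Z - N%:Z - 1)) <= r.
  exists (N' + N + 1)%N; apply: le_trans hN'; rewrite le_sz; clear; lia.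
have [m hm mmin] := ex_minnP ex.
exists (m%:Z - N%:Z - 1); rewrite hm /= ltNge; apply/negP => h.
case: m hm mmin h => [_ _ h|m _ mmin h].
  suff : s ^ (4 * (0%:Z - N%:Z - 1 - 1)) <= s ^ (- (4 * N%:Z)) by rewrite le_sz; clear; lia.
  exact: le_trans h hN.
have : (m.+1 <= m)%N; last by rewrite ltnn.
apply: mmin; suff <- : m.+1%:Z - N%:Z - 1 - 1 = m%:Z - N%:Z - 1 by []; clear; lia.
Qed.

Lemma valK_gap x y : x != 0 -> vK x < vK y -> vK x <= s ^+ 4 * vK y.
Proof.
move=> x0; have [->|y0] := eqVneq y 0; first by rewrite (na0 HvK) ltNge (na_ge0 HvK).
have [m ->] := valK x0; have [n ->] := valK y0.
rewrite lt_sz => h; rewrite exprnP -szD le_sz; lia.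
Qed.

Lemma valK_half x (n : int) : vK x != s ^ (4 * n + 2).
Proof.
have [->|x0] := eqVneq x 0; first by rewrite (na0 HvK) lt_eqF // sz_gt0.
by have [m ->] := valK x0; rewrite eq_sz; apply/eqP; lia.
Qed.

Lemma vK_lt1 x : vK x < 1 -> vK x <= s ^+ 4.
Proof.
have [->|x0] := eqVneq x 0; first by rewrite (na0 HvK) ltW // sX_gt0.
by move=> h; have := @valK_gap x 1 x0; rewrite (na1 HvK) mulr1; apply.
Qed.

Lemma vkap a : a != 0 -> vK (kap a) = 1.
Proof.
move=> a0; apply: (na_finite_order HvK (n := #|Fq|.-1)).
  by rewrite -ltnS prednK ?finNzRing_gt1 // ltnW // finNzRing_gt1.
rewrite -rmorphXn; have -> : a ^+ #|Fq|.-1 = 1; last by rewrite rmorph1.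
by apply: (mulfI a0); rewrite -exprS prednK ?mulr1 ?expf_card // ltnW // finNzRing_gt1.
Qed.
Lemma vkap_le1 a : vK (kap a) <= 1.
Proof. by have [->|/vkap ->//] := eqVneq a 0; rewrite rmorph0 (na0 HvK). Qed.
Lemma vkap_sub a b : a != b -> vK (kap a - kap b) = 1.
Proof. by move=> ab; rewrite -rmorphB vkap // subr_eq0. Qed.

(** Otherwise every x has a strictly nearer neighbour. The distance from z to x then equals the
    distance between these two points of K, so it drops by s ^ 4 each time; the neighbours form a
    Cauchy sequence whose limit in K would be z. *)
Lemma iabs_attained z : exists x, forall y, v (z - i x) <= v (z - i y).
Proof.
apply: contrapT => no.
have step x : exists y, v (z - i y) < v (z - i x).
  apply: contrapT => nx; apply: no; exists x => y; rewrite leNgt.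
  by apply/negP => h; apply: nx; exists y.
pose nx x := projT1 (cid (step x)).
have hnx x : v (z - i (nx x)) < v (z - i x) by rewrite /nx; case: cid.
have eqd x : v (z - i x) = vK (nx x - x).
  by rewrite -(na_eq_subl Hv (hnx x)) -viE rmorphB opprB addrC subrKA.
have pos x : nx x - x != 0.
  by rewrite -(na_eq0 HvK) -eqd gt_eqF // (le_lt_trans (na_ge0 Hv _) (hnx x)).
have dec x : v (z - i (nx x)) <= s ^+ 4 * v (z - i x).
  by have := hnx x; rewrite !eqd => /valK_gap; apply; apply: pos.
pose u n := iter n nx 0.
have s4 : s ^+ 4 < 1 by rewrite exprn_ilt1 // ltW.
have ub n : v (z - i (u n)) <= (s ^+ 4) ^+ n * v (z - i 0).
  elim: n => [|n IH]; first by rewrite expr0 mul1r.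
  by rewrite exprS -mulrA; apply: le_trans (dec _) _; rewrite ler_pM2l ?sX_gt0.
have lim e : 0 < e -> exists N, forall n, (N <= n)%N -> v (z - i (u n)) < e.
  move=> e0; have M0 : 0 < v (z - i 0) by apply: le_lt_trans (hnx 0); apply: na_ge0.
  have [N hN] := expr_small (ltW (sX_gt0 4)) s4 (divr_gt0 e0 M0).
  exists N => n /hN h; apply: le_lt_trans (ub n) _.
  by rewrite -ltr_pdivlMr.
have [x hx] : exists x, forall eps, 0 < eps -> exists N, forall n, (N <= n)%N -> vK (u n - x) < eps.
  apply: HcK => e /lim[N hN]; exists N => m n hm hn.
  rewrite -viE rmorphB -(subrKA z) addrC; apply: na_lt_add => //; first exact: hN.
  by rewrite (naBC Hv) hN.
apply: no; exists x => y; suff -> : v (z - i x) = 0 by apply: na_ge0.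
apply/eqP; rewrite eq_le (na_ge0 Hv) andbT leNgt; apply/negP => h.
have [N1 h1] := lim _ h; have [N2 h2] := hx _ h.
have : v (z - i x) < v (z - i x); last by rewrite ltxx.
rewrite -{1}(subrKA (i (u (maxn N1 N2)))); apply: na_lt_add => //.
  by rewrite h1 ?leq_maxl.
by rewrite -rmorphB viE h2 ?leq_maxr.
Qed.

(* the distance from z to K, which plays the role of the imaginary part *)
Definition nearest z : K := xget 0 [set x | forall y, v (z - i x) <= v (z - i y)].
Definition iabs z := v (z - i (nearest z)).

Lemma iabs_le z y : iabs z <= v (z - i y).
Proof.
rewrite /iabs /nearest; case: xgetP => [x _ /(_ y)//|h].
by have [x hx] := iabs_attained z; case: (h x).
Qed.
Lemma le_iabs z e : (forall y, e <= v (z - i y)) -> e <= iabs z. Proof. exact. Qed.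
Lemma iabs_ge0 z : 0 <= iabs z. Proof. exact: na_ge0 Hv _. Qed.
Lemma iabs_gt0 z : Omega z -> 0 < iabs z.
Proof.
move=> hz; rewrite (na_gt0 Hv) subr_eq0; apply/eqP => e; apply: hz.
by exists (nearest z).
Qed.
Lemma OmegaP z : Omega z <-> 0 < iabs z.
Proof.
split=> [|h [x _ xz]]; first exact: iabs_gt0.
by have := iabs_le z x; rewrite xz subrr (na0 Hv) leNgt h.
Qed.
Lemma Omega_iabs z e : 0 < e -> (forall y, e <= v (z - i y)) -> Omega z.
Proof. by move=> e0 h; apply/OmegaP; apply: lt_le_trans e0 (le_iabs h). Qed.
Lemma iabs_le_v z : iabs z <= v z.
Proof. by have := iabs_le z 0; rewrite rmorph0 subr0. Qed.

Lemma det2 (g : 'M[K]_2) : \det g = g 0 0 * g 1 1 - g 0 1 * g 1 0.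
Proof.
rewrite (expand_det_row _ 0) !big_ord_recl big_ord0 addr0 /cofactor !det_mx11 !mxE /= expr0 expr1.
by rewrite mul1r mulN1r mulrN; congr (g 0 _ * g _ _ - g 0 _ * g _ _); apply/val_inj.
Qed.
Lemma mx2M (g h : 'M[K]_2) a b : (g * h) a b = g a 0 * h 0 b + g a 1 * h 1 b.
Proof. by rewrite mxE !big_ord_recl big_ord0 addr0; congr (_ + g a _ * h _ b); apply/val_inj. Qed.

Definition mx4 (a b c d : K) : 'M[K]_2 :=
  \matrix_(x, y) if x == 0 then (if y == 0 then a else b) else (if y == 0 then c else d).
Lemma mx4E a b c d : (mx4 a b c d 0 0 = a) * (mx4 a b c d 0 1 = b) * (mx4 a b c d 1 0 = c) * (mx4 a b c d 1 1 = d).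
Proof. by rewrite !mxE. Qed.
Lemma det_mx4 a b c d : \det (mx4 a b c d) = a * d - b * c.
Proof. by rewrite det2 !mx4E. Qed.
Lemma mx4M a b c d a' b' c' d' : mx4 a b c d * mx4 a' b' c' d' =
  mx4 (a * a' + b * c') (a * b' + b * d') (c * a' + d * c') (c * b' + d * d').
Proof.
have o2 (x : 'I_2) : x = 0 \/ x = 1 by case: x => [[|[|]]] // h; [left|right]; apply/val_inj.
by apply/matrixP => x y; rewrite mx2M; case: (o2 x) => ->; case: (o2 y) => ->; rewrite !mx4E.
Qed.
Lemma mx4_eta (g : 'M[K]_2) : g = mx4 (g 0 0) (g 0 1) (g 1 0) (g 1 1).
Proof.
have o2 (x : 'I_2) : x = 0 \/ x = 1 by case: x => [[|[|]]] // h; [left|right]; apply/val_inj.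
by apply/matrixP => x y; case: (o2 x) => ->; case: (o2 y) => ->; rewrite !mx4E.
Qed.

Lemma linform_ge z (e f : K) : v (i e * z + i f) >= vK e * iabs z.
Proof.
have [->|e0] := eqVneq e 0; first by rewrite (na0 HvK) mul0r (na_ge0 Hv).
have -> : i e * z + i f = i e * (z - i (- f / e)).
  by rewrite rmorphM rmorphN fmorphV; field; rewrite fmorph_eq0.
rewrite (naM Hv) viE ler_wpM2l ?(na_ge0 HvK) //; exact: iabs_le.
Qed.

Lemma cocycle_neq0 (g : 'M[K]_2) z : \det g != 0 -> Omega z -> cocycle i g z != 0.
Proof.
move=> dg hz; rewrite -(na_gt0 Hv) /cocycle.
have [c0|c0] := eqVneq (g 1 0) 0.
  rewrite c0 rmorph0 mul0r add0r viE (na_gt0 HvK).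
  by apply: contraNneq dg => d0; rewrite det2 c0 d0 !mulr0 subrr.
apply: lt_le_trans (linform_ge _ _ _); by rewrite mulr_gt0 ?(na_gt0 HvK) // iabs_gt0.
Qed.

Lemma cocycleM (g h : 'M[K]_2) z : \det h != 0 -> Omega z ->
  cocycle i (g * h) z = cocycle i g (moebius i h z) * cocycle i h z.
Proof.
move=> dh hz; have := cocycle_neq0 dh hz; rewrite /moebius /cocycle !mx2M !rmorphD !rmorphM.
by move=> h0; field.
Qed.
Lemma moebiusM (g h : 'M[K]_2) z : \det g != 0 -> \det h != 0 -> Omega z -> 
  Omega (moebius i h z) ->
  moebius i (g * h) z = moebius i g (moebius i h z).
Proof.
move=> dg dh hz hhz; have c1 := cocycle_neq0 dh hz; have c2 := cocycle_neq0 dg hhz.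
rewrite {1}/moebius cocycleM //.
rewrite {3}/moebius; apply: (mulIf c2); rewrite mulrVK ?unitfE //.
apply: (mulIf c1); rewrite -mulrA mulrVK ?unitfE ?mulf_neq0 //.
move: c1; rewrite /moebius /cocycle !mx2M !rmorphD !rmorphM => c1; by field.
Qed.

Lemma moebius_sub (g : 'M[K]_2) z x : \det g != 0 -> Omega z ->
  (moebius i g z - i x) = (i (g 0 0 - x * g 1 0) * z + i (g 0 1 - x * g 1 1)) / cocycle i g z.
Proof.
move=> dg hz; have := cocycle_neq0 dg hz; rewrite /moebius /cocycle !rmorphB !rmorphM => h.
by field.
Qed.

(** For L = ez + f and J = cz + d one has ed - fc = eJ - cL, which eliminates z, while [linform_ge]
    bounds |e| iabs z by |L| and |c| iabs z by |J|. *)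
Lemma iabs_moebius_ge (g : 'M[K]_2) z : \det g != 0 -> Omega z ->
  iabs (moebius i g z) >= vK (\det g) * iabs z / v (cocycle i g z) ^+ 2.
Proof.
move=> dg hz; apply: le_iabs => x; rewrite moebius_sub // (naF Hv).
have := cocycle_neq0 dg hz; rewrite -(na_gt0 Hv) => c0.
rewrite expr2 invfM mulrA ler_pM2r ?invr_gt0 // ler_pdivrMr //.
rewrite /cocycle.
set e := g 0 0 - _; set f := g 0 1 - _; set c := g 1 0; set d := g 1 1.
have -> : \det g = e * d - f * c by rewrite det2 /e /f /c /d; ring.
have key (a b a' b' : K) : vK (a * b' - b * a') * iabs z <=
    Num.max (v (i a * z + i b) * vK a') (v (i a' * z + i b') * vK a) * iabs z.
  apply: ler_wpM2r; first exact: iabs_ge0.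
  rewrite -viE; have -> : i (a * b' - b * a') = i a * (i a' * z + i b') - i a' * (i a * z + i b).
    by rewrite rmorphB !rmorphM; ring.
  by apply: na_le_sub => //; rewrite (naM Hv) viE le_max mulrC lexx ?orbT.
apply: le_trans (key _ _ _ _) _; rewrite maxr_pMl ?iabs_ge0 // ge_max -!mulrA; apply/andP; split.
  by rewrite ler_wpM2l ?(na_ge0 Hv) // linform_ge.
by rewrite mulrC ler_wpM2r ?(na_ge0 Hv) // linform_ge.
Qed.

Lemma moebius_Omega (g : 'M[K]_2) z : \det g != 0 -> Omega z -> Omega (moebius i g z).
Proof.
move=> dg hz; apply/OmegaP; apply: lt_le_trans (iabs_moebius_ge dg hz).
have c0 : 0 < v (cocycle i g z) by rewrite (na_gt0 Hv) cocycle_neq0.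
by rewrite divr_gt0 ?mulr_gt0 ?exprn_gt0 ?(na_gt0 HvK) ?iabs_gt0.
Qed.

Lemma moebius1 z : moebius i 1 z = z.
Proof. by rewrite /moebius /cocycle !mxE /= rmorph1 rmorph0 mul1r mul0r add0r addr0 divr1. Qed.
Lemma cocycle1 z : cocycle i 1 z = 1.
Proof. by rewrite /cocycle !mxE /= rmorph1 rmorph0 mul0r add0r. Qed.

Lemma det_neq0_unit (g : 'M[K]_2) : \det g != 0 -> g \is a GRing.unit.
Proof. by move=> dg; rewrite -[_ \is a _]/(g \in unitmx) unitmxE unitfE. Qed.
Lemma det_inv (g : 'M[K]_2) : \det (g^-1) = (\det g)^-1.
Proof. exact: det_inv. Qed.

(** The lower bound for g and the one for its inverse. *)
Lemma iabs_moebius (g : 'M[K]_2) z : \det g != 0 -> Omega z ->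
  iabs (moebius i g z) = vK (\det g) * iabs z / v (cocycle i g z) ^+ 2.
Proof.
move=> dg hz; apply/eqP; rewrite eq_le iabs_moebius_ge // andbT.
have gu := det_neq0_unit dg.
have dg' : \det (g^-1) != 0 by rewrite det_inv invr_eq0.
have hgz := moebius_Omega dg hz.
have c0 : 0 < v (cocycle i g z) by rewrite (na_gt0 Hv) cocycle_neq0.
have := iabs_moebius_ge dg' hgz; rewrite -moebiusM // mulVr // moebius1.
have : v (cocycle i g^-1 (moebius i g z)) = (v (cocycle i g z))^-1.
  have := cocycleM g^-1 dg hz; rewrite mulVr // cocycle1 => e.
  by apply: (mulIf (lt0r_neq0 c0)); rewrite -(naM Hv) -e (na1 Hv) mulVf // gt_eqF.
move=> ->; rewrite det_inv (naV HvK) exprVn invrK => h.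
have d0 : 0 < vK (\det g) by rewrite (na_gt0 HvK).
rewrite ler_pdivlMr ?exprn_gt0 // -ler_pdivrMl //.
by rewrite mulrA.
Qed.

Lemma sig_Omega : Omega sig.
Proof.
apply: (@Omega_iabs _ s) => // y.
have h : v sig != v (i y).
  rewrite vsig viE; have [->|y0] := eqVneq y 0; first by rewrite (na0 HvK) s_neq0.
  by have [n ->] := valK y0; rewrite -{1}[s]expr1z eq_sz; apply/eqP; lia.
by rewrite (na_sub_neq Hv h) le_max vsig lexx.
Qed.

Lemma Omega_sub z x : Omega z -> z - i x != 0.
Proof. by move=> hz; rewrite subr_eq0; apply/eqP => e; apply: hz; exists x. Qed.

Lemma inv_pt_inj z : Omega z -> injective (inv_pt i z).
Proof.
move=> hz [x|] [y|] //= e.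
- by move/invr_inj/addrI/oppr_inj/fmorph_inj: e => ->.
- by have := Omega_sub x hz; rewrite -invr_eq0 e eqxx.
- by have := Omega_sub y hz; rewrite -invr_eq0 -e eqxx.
Qed.

(** The last term does not depend on p, so it cancels in the difference that defines u. *)
Lemma inv_pt_moebius (g : 'M[K]_2) z p : \det g != 0 -> Omega z ->
  inv_pt i (moebius i g z) (moebiusP1 g p) =
  cocycle i g z ^+ 2 / i (\det g) * inv_pt i z p - i (g 1 0) * cocycle i g z / i (\det g).
Proof.
move=> dg hz; have c0 := cocycle_neq0 dg hz.
have hgz := moebius_Omega dg hz.
have id0 : i (\det g) != 0 by rewrite fmorph_eq0.
have sub x := moebius_sub x dg hz.
case: p => [x|]; rewrite /moebiusP1 /=; case: ifPn => den0 /=.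
- have e : i (g 1 1) = - (i (g 1 0) * i x).
    by rewrite -rmorphM -rmorphN; congr (i _); apply/eqP; rewrite -addr_eq0 addrC.
  have zx := Omega_sub x hz.
  have -> : cocycle i g z = i (g 1 0) * (z - i x) by rewrite /cocycle e; ring.
  by field; rewrite ?zx ?id0.
- have zx := Omega_sub x hz; set y := _ / _.
  have d0 : i (g 1 0) * i x + i (g 1 1) != 0 by rewrite -rmorphM -rmorphD fmorph_eq0.
  have := Omega_sub y hgz; rewrite sub /y => h.
  have E : (i (g 0 0 - (g 0 0 * x + g 0 1) / (g 1 0 * x + g 1 1) * g 1 0) * z +
      i (g 0 1 - (g 0 0 * x + g 0 1) / (g 1 0 * x + g 1 1) * g 1 1)) / cocycle i g z
     = i (\det g) * (z - i x) / (cocycle i g z * (i (g 1 0) * i x + i (g 1 1))).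
    rewrite det2 !rmorphB !rmorphM fmorphV !rmorphD !rmorphM.
    by field; rewrite d0.
  rewrite E; rewrite /cocycle in c0 *.
  by field; rewrite zx d0 c0 id0.
- by rewrite mulr0 (eqP den0) rmorph0 !mul0r subrr.
- have d0 : i (g 1 0) != 0 by rewrite fmorph_eq0.
  have E : i (g 0 0 - g 0 0 / g 1 0 * g 1 0) * z + i (g 0 1 - g 0 0 / g 1 0 * g 1 1) = - i (\det g) / i (g 1 0).
    rewrite divfK // subrr rmorph0 mul0r add0r det2 !rmorphB !rmorphM fmorphV.
    by field.
  rewrite sub E; rewrite mulr0 sub0r.
  by field; rewrite ?oppr_eq0 ?d0 ?c0 ?id0.
Qed.

Lemma u_moebius (g : 'M[K]_2) z a b : \det g != 0 -> Omega z ->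
  u_fun i (moebius i g z) (moebiusP1 g a) (moebiusP1 g b) =
  cocycle i g z ^+ 2 / i (\det g) * u_fun i z a b.
Proof. by move=> dg hz; rewrite /u_fun !inv_pt_moebius //; ring. Qed.

(** A point of P1 is determined by [inv_pt] at a single z in Omega, so the composition law follows
    from the one on Omega without a case analysis at infinity. *)
Lemma moebiusP1M (g h : 'M[K]_2) p : \det g != 0 -> \det h != 0 ->
  moebiusP1 (g * h) p = moebiusP1 g (moebiusP1 h p).
Proof.
move=> dg dh; have hz := sig_Omega; have hhz := moebius_Omega dh hz.
have dgh : \det (g * h) != 0 by rewrite det_mulmx mulf_neq0.
have hgz := moebius_Omega dg hhz.
apply: (inv_pt_inj hgz); rewrite [in RHS]inv_pt_moebius // [in RHS]inv_pt_moebius // -moebiusM //.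
rewrite inv_pt_moebius //.
have := cocycleM g dh hz; have := cocycle_neq0 dh hz.
have i1 : i (\det g) != 0 by rewrite fmorph_eq0.
have i2 : i (\det h) != 0 by rewrite fmorph_eq0.
rewrite det_mulmx rmorphM mx2M => j0 E; rewrite E.
move: E; set J := cocycle i g _; set j := cocycle i h sig in j0 *; set P := inv_pt _ _ p => E.
suff F : J * i (h 1 0) * j + i (g 1 0) * i (\det h) = i (g 1 0 * h 0 0 + g 1 1 * h 1 0) * j.
  have -> : i (g 1 0 * h 0 0 + g 1 1 * h 1 0) * (J * j) =  (i (g 1 0 * h 0 0 + g 1 1 * h 1 0) * j) * J by ring.
  by rewrite -F; field; rewrite i1.
have -> : J * i (h 1 0) * j = i (h 1 0) * (J * j) by ring.
rewrite -E /j /cocycle !mx2M det2 !rmorphB !rmorphD !rmorphM; ring.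
Qed.

Lemma moebiusP1_1 p : moebiusP1 (1 : 'M[K]_2) p = p.
Proof.
by case: p => [x|]; rewrite /moebiusP1 !mxE /= ?eqxx // mul0r add0r oner_eq0 mul1r addr0 divr1.
Qed.
Lemma moebiusP1K (g : 'M[K]_2) : \det g != 0 -> cancel (moebiusP1 g) (moebiusP1 g^-1).
Proof.
move=> dg p; rewrite -moebiusP1M // ?det_inv ?invr_eq0 // mulVr ?det_neq0_unit //.
exact: moebiusP1_1.
Qed.
Lemma moebiusP1_inj (g : 'M[K]_2) : \det g != 0 -> injective (moebiusP1 g).
Proof. by move=> dg; apply: can_inj (moebiusP1K dg). Qed.

Definition Phi (D : poincare_data K) (z : C) : C :=
  \prod_(t < pd_r D) u_fun i z (pd_a D t) (pd_b D t) ^+ pd_k D t.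
Definition act (g : 'M[K]_2) (D : poincare_data K) : poincare_data K :=
  PoincareData (pd_k D) (fun t => moebiusP1 g (pd_a D t)) (fun t => moebiusP1 g (pd_b D t)).

Lemma poincare_summandE l D z g :
  poincare_summand i l D z g = i (\det g) ^ (- l) * Phi (act g D) z.
Proof. by []. Qed.

Lemma actM g h D : \det g != 0 -> \det h != 0 -> act (g * h) D = act g (act h D).
Proof.
move=> dg dh; rewrite /act /=; congr PoincareData; apply/funext => t /=; exact: moebiusP1M.
Qed.
Lemma act1 D : act 1 D = D.
Proof.
by case: D => r k a b; rewrite /act /=; congr PoincareData; apply/funext => t /=; rewrite moebiusP1_1.
Qed.

Variable k : nat.
Local Notation adm := (poincare_admissible k).

Lemma adm_act g D : \det g != 0 -> adm D -> adm (act g D).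
Proof.
move=> dg [h1 h2 h3 h4 h5]; have gi := moebiusP1_inj dg.
have im (t : 'I_(pd_r D)) : [set moebiusP1 g (pd_a D t); moebiusP1 g (pd_b D t)] =
    [set moebiusP1 g x | x in [set pd_a D t; pd_b D t]].
  apply/seteqP; split => [x [->|->]|x [y [->|->] <-]] /=; [exists (pd_a D t)|exists (pd_b D t)|left|right] => //; by [left|right].
split => //= [t /gi /h3//|t t' tt'|].
- rewrite !im => e; apply: (h4 _ _ tt').
  apply/seteqP; split => x hx; [have : [set moebiusP1 g x | x in [set pd_a D t; pd_b D t]] (moebiusP1 g x) by exists x|
    have : [set moebiusP1 g x | x in [set pd_a D t'; pd_b D t']] (moebiusP1 g x) by exists x].
    by rewrite e => -[y hy /gi <-].
  by rewrite -e => -[y hy /gi <-].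
- apply/seteqP; split => // x hx; have : (\bigcap_t [set pd_a D t; pd_b D t]) (moebiusP1 g^-1 x).
    move=> t _; have : [set moebiusP1 g (pd_a D t); moebiusP1 g (pd_b D t)] x := hx t I.
    rewrite im => -[y hy <-].
    by rewrite moebiusP1K.
  by rewrite h5.
Qed.

Lemma Phi_moebius g D z : adm D -> \det g != 0 -> Omega z ->
  Phi (act g D) (moebius i g z) = (cocycle i g z ^+ 2 / i (\det g)) ^+ k * Phi D z.
Proof.
move=> [_ [_ <-] _ _ _] dg hz; rewrite /Phi /= -prodrXr -big_split /=; apply: eq_bigr => t _.
by rewrite u_moebius // exprMn.
Qed.

Lemma Phi_act g D z : adm D -> \det g != 0 -> Omega z ->
  Phi (act g D) z = (i (\det g^-1) / cocycle i g^-1 z ^+ 2) ^+ k * Phi D (moebius i g^-1 z).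
Proof.
move=> hD dg hz.
have dg' : \det (g^-1) != 0 by rewrite det_inv invr_eq0.
have := Phi_moebius (adm_act dg hD) dg' hz; rewrite -actM // mulVr ?det_neq0_unit // act1 => ->.
rewrite mulrA -exprMn; set x := i _; set y := cocycle _ _ _ ^+ 2.
have y0 : y != 0 by rewrite expf_neq0 // cocycle_neq0.
have x0 : x != 0 by rewrite fmorph_eq0.
by rewrite mulrA mulrVK ?unitfE // mulfV // expr1n mul1r.
Qed.

(* invariant under the weight 2k action of matrices with |det| = 1 *)
Definition nu (f : C -> C) z := v (f z) * iabs z ^+ k.

Lemma nu_ge0 f z : 0 <= nu f z. Proof. by rewrite mulr_ge0 ?exprn_ge0 ?(na_ge0 Hv). Qed.

Lemma v_slash g f z : vK (\det g) = 1 -> Omega z ->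
  v (f (moebius i g z) / cocycle i g z ^+ (2 * k)) * iabs z ^+ k = nu f (moebius i g z).
Proof.
move=> dg1 hz.
have dg : \det g != 0 by rewrite -(na_eq0 HvK) dg1 oner_eq0.
rewrite /nu iabs_moebius // dg1 mul1r (naF Hv) (naX Hv) expr_div_n -exprM mulrA mulrAC; ring.
Qed.

Definition nu1 z a b := v (u_fun i z a b) * iabs z.
Lemma nu1_ge0 z a b : 0 <= nu1 z a b. Proof. by rewrite mulr_ge0 ?(na_ge0 Hv). Qed.

Lemma inv_pt_le z p : Omega z -> v (inv_pt i z p) <= (iabs z)^-1.
Proof.
move=> hz; case: p => [x|] /=; last by rewrite (na0 Hv) invr_ge0 iabs_ge0.
by rewrite (naV Hv) lef_pV2 ?posrE ?iabs_gt0 ?(na_gt0 Hv) ?Omega_sub // iabs_le.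
Qed.

Lemma nu1_le z a b e : Omega z -> v (inv_pt i z a) <= e -> v (inv_pt i z b) <= e ->
  nu1 z a b <= e * iabs z.
Proof. by move=> hz ha hb; rewrite ler_pM2r ?iabs_gt0 //; apply: na_le_sub. Qed.

Lemma nu1_le1 z a b : Omega z -> nu1 z a b <= 1.
Proof.
move=> hz; rewrite -(mulVf (lt0r_neq0 (iabs_gt0 hz))).
by apply: nu1_le => //; apply: inv_pt_le.
Qed.

Lemma nu_Phi D z : adm D -> nu (Phi D) z = \prod_(t < pd_r D) nu1 z (pd_a D t) (pd_b D t) ^+ pd_k D t.
Proof.
rewrite /nu => -[_ [_ <-] _ _ _]; rewrite -prodrXr (na_prod Hv) -big_split /=; apply: eq_bigr => t _.
by rewrite exprMn (naX Hv).
Qed.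

(** All factors are at most 1 and all exponents are positive. *)
Lemma nu_Phi_le D z t : adm D -> Omega z -> nu (Phi D) z <= nu1 z (pd_a D t) (pd_b D t).
Proof.
move=> hD hz; rewrite nu_Phi // (bigD1 t) //=.
have [_ [/(_ t) k1 _] _ _ _] := hD.
have e0 t' : 0 <= nu1 z (pd_a D t') (pd_b D t') ^+ pd_k D t' by rewrite exprn_ge0 ?nu1_ge0.
rewrite -[leRHS]mulr1; apply: ler_pM => //; first exact: prodr_ge0.
- case: (pd_k D t) k1 => // n _; rewrite exprS ler_piMr ?nu1_ge0 //.
  by rewrite exprn_ile1 ?nu1_ge0 ?nu1_le1.
- by apply: prodr_ile1 => t' _; rewrite e0 exprn_ile1 ?nu1_ge0 ?nu1_le1.
Qed.
Lemma nu_Phi_le1 D z : adm D -> Omega z -> nu (Phi D) z <= 1.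
Proof.
move=> hD hz; have [r2 _ _ _ _] := hD.
have t : 'I_(pd_r D) by exists 0%N; apply: leq_trans r2.
exact: le_trans (nu_Phi_le t hD hz) (nu1_le1 _ _ hz).
Qed.

(** * Unconditional sums *)

Section Summation.
Variable I : choiceType.
Implicit Types (D : set I) (F G : I -> C).
Local Notation has_sum := (@has_sum R C v I).

Definition vanishing D F := forall e, 0 < e -> finite_set [set x | D x /\ e <= v (F x)].

Lemma fsum_out D F (J0 J : {fset I}) e : 0 < e -> (forall x, D x -> x \notin J0 -> v (F x) < e) ->
  [set` J] `<=` D -> (J0 `<=` J)%fset -> v (\sum_(x <- J) F x - \sum_(x <- J0) F x) < e.
Proof.
move=> e0 small JD J0J.
rewrite (big_fsetID _ (mem J0)) /=.
have -> : [fset x in J | x \in J0]%fset = J0.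
  apply/fsetP => x; rewrite !inE /= andbC; case: (boolP (x \in J0)) => //= /(fsubsetP J0J) -> //.
rewrite addrAC subrr add0r; rewrite big_seq; apply: na_sum_lt => // x.
by rewrite !inE => /andP[xJ xJ0]; apply: small => //; apply: JD.
Qed.

Lemma vanishing_fset D F e : vanishing D F -> 0 < e ->
  exists J0 : {fset I}, [set` J0] `<=` D /\ forall x, D x -> x \notin J0 -> v (F x) < e.
Proof.
move=> hF e0; have fin := hF _ e0; exists (fset_set [set x | D x /\ e <= v (F x)]); split.
  by move=> x /=; rewrite in_fset_set // inE => -[].
move=> x Dx; rewrite in_fset_set // notin_setE /= ltNge => h; apply/negP => h2; exact: h.
Qed.

(** In a complete ultrametric field it suffices that the terms tend to 0: the sums over the growing
    finite sets L n, off which all terms are below 2^-n, are Cauchy. *)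
Lemma vanishing_summable D F : vanishing D F -> summable v D F.
Proof.
move=> hF.
pose e n : R := 2^-1 ^+ n.
have e0 n : 0 < e n by rewrite exprn_gt0 // invr_gt0.
pose J n := projT1 (cid (vanishing_fset hF (e0 n))).
have JP n : [set` J n] `<=` D /\ forall x, D x -> x \notin J n -> v (F x) < e n.
  by rewrite /J; case: cid.
have half0 : 0 <= 2^-1 :> R by rewrite invr_ge0.
have half1 : 2^-1 < 1 :> R by rewrite invf_lt1 ?ltr1n.
pose L n := iteri n (fun m (a : {fset I}) => (J m `|` a)%fset) fset0.
have LD n : [set` L n] `<=` D.
  elim: n => [|n IH] x /=; first by rewrite inE.
  by rewrite inE => /orP[/(proj1 (JP n))|/IH].
have JL n : (J n `<=` L n.+1)%fset by rewrite /= fsubsetUl.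
have LL n : (L n `<=` L n.+1)%fset by rewrite /= fsubsetUr.
have Lsmall n x : D x -> x \notin L n.+1 -> v (F x) < e n.
  by move=> Dx; rewrite inE negb_or => /andP[h _]; apply: (proj2 (JP n)).
have [S hS] : exists S, forall eps, 0 < eps -> exists N, forall n, (N <= n)%N ->
    v (\sum_(x <- L n.+1) F x - S) < eps.
  apply: (na_cauchy Hv Hc) => eps eps0; have [N hN] := expr_small half0 half1 eps0.
  exists N => n hn; apply: lt_trans (hN _ hn).
  by apply: (@fsum_out D) => //; apply: Lsmall.
exists S => eps eps0; have [N1 h1] := hS _ eps0; have [N2 h2] := expr_small half0 half1 eps0.
pose n := maxn N1 N2; exists (L n.+1); split=> // J' J'D LJ'.
apply: (na_lt_trans Hv (y := \sum_(x <- L n.+1) F x)); last by rewrite h1 ?leq_maxl.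
apply: (fsum_out eps0 _ J'D LJ') => x Dx xL; apply: lt_trans (h2 n (leq_maxr _ _)).
exact: Lsmall.
Qed.

Lemma has_sum_near D F S e : 0 < e -> has_sum D F S -> vanishing D F ->
  forall J0 : {fset I}, [set` J0] `<=` D -> (forall x, D x -> x \notin J0 -> v (F x) < e) ->
  v (\sum_(x <- J0) F x - S) < e.
Proof.
move=> e0 hS _ J0 J0D small; have [J1 [J1D h1]] := hS _ e0.
apply: (na_lt_trans Hv (y := \sum_(x <- (J1 `|` J0)%fset) F x)).
  rewrite (naBC Hv); apply: (fsum_out e0 small); last exact: fsubsetUr.
  by move=> x /=; rewrite inE => /orP[/J1D|/J0D].
apply: h1; last exact: fsubsetUl.
by move=> x /=; rewrite inE => /orP[/J1D|/J0D].
Qed.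

Lemma has_sum_unique D F S S' : has_sum D F S -> has_sum D F S' -> S = S'.
Proof.
move=> h h'; apply/eqP; rewrite -subr_eq0 -(na_eq0 Hv); apply/eqP/le_anti; rewrite (na_ge0 Hv) andbT.
rewrite leNgt; apply/negP => e0; have [J [JD hJ]] := h _ e0; have [J' [J'D hJ']] := h' _ e0.
have UD : [set` (J `|` J')%fset] `<=` D by move=> x /=; rewrite inE => /orP[/JD|/J'D].
suff : v (S - S') < v (S - S') by rewrite ltxx.
apply: (na_lt_trans Hv (y := \sum_(x <- (J `|` J')%fset) F x)).
  by rewrite (naBC Hv) hJ // fsubsetUl.
by rewrite hJ' // fsubsetUr.
Qed.

Lemma total_sumE D F S : has_sum D F S -> total_sum v D F = S.
Proof.
by move=> h; rewrite /total_sum; case: xgetP => [S' _ /has_sum_unique/(_ h)//|/(_ S)].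
Qed.
Lemma total_sumP D F : summable v D F -> has_sum D F (total_sum v D F).
Proof. by case=> S hS; rewrite (total_sumE hS). Qed.

Lemma has_sum_le D F S B : has_sum D F S -> 0 <= B -> (forall x, D x -> v (F x) <= B) -> v S <= B.
Proof.
move=> hS B0 hF; rewrite leNgt; apply/negP => h.
have [J [JD hJ]] := hS (v S) (le_lt_trans B0 h).
have := hJ J JD (fsubset_refl _); rewrite (naBC Hv) => h2.
have : v (S - \sum_(x <- J) F x) = v S.
  apply: (na_eq_subl Hv); apply: le_lt_trans h; apply: (na_sum_in Hv) => // x xJ; exact/hF/JD.
by move=> e; rewrite e ltxx in h2.
Qed.

Lemma has_sumZ D F S c : has_sum D F S -> has_sum D (fun x => c * F x) (c * S).
Proof.
move=> hS e e0; have [->|c0] := eqVneq c 0.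
  exists fset0; split=> [x|J _ _] //=.
  by rewrite big1 ?mul0r ?subrr ?(na0 Hv) // => x _; rewrite mul0r.
have vc : 0 < v c by rewrite (na_gt0 Hv).
have [J [JD hJ]] := hS (e / v c) (divr_gt0 e0 vc).
exists J; split=> // J' J'D JJ'; rewrite -mulr_sumr -mulrBr (naM Hv) mulrC -ltr_pdivlMr //.
exact: hJ.
Qed.

Lemma has_sumD D F G S T : has_sum D F S -> has_sum D G T ->
  has_sum D (fun x => F x + G x) (S + T).
Proof.
move=> hS hT e e0; have [J [JD hJ]] := hS _ e0; have [J' [J'D hJ']] := hT _ e0.
exists (J `|` J')%fset; split=> [x /=|L LD LJ]; first by rewrite inE => /orP[/JD|/J'D].
rewrite big_split opprD addrACA; apply: (na_lt_add Hv); [apply: hJ|apply: hJ'] => //.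
  by apply: fsubset_trans LJ; rewrite fsubsetUl.
by apply: fsubset_trans LJ; rewrite fsubsetUr.
Qed.

Lemma has_sum0 D : has_sum D (fun=> 0) 0.
Proof. by move=> e e0; exists fset0; split=> [x|J _ _] //=; rewrite big1 // subrr (na0 Hv). Qed.

Lemma has_sum_lin D (T : finType) (c : T -> C) (F : T -> I -> C) (S : T -> C) :
  (forall t, has_sum D (F t) (S t)) ->
  has_sum D (fun x => \sum_t c t * F t x) (\sum_t c t * S t).
Proof.
move=> h; elim: (index_enum T) => [|t r IH].
  rewrite big_nil; under [X in has_sum _ X _]eq_fun do rewrite big_nil; exact: has_sum0.
rewrite big_cons; under [X in has_sum _ X _]eq_fun do rewrite big_cons.
by apply: has_sumD => //; apply: has_sumZ.
Qed.

Lemma has_sum_eq D F G S : (forall x, D x -> F x = G x) -> has_sum D F S -> has_sum D G S.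
Proof.
move=> e hS ep ep0; have [J [JD hJ]] := hS _ ep0; exists J; split=> // J' J'D JJ'.
have <- : \sum_(x <- J') F x = \sum_(x <- J') G x.
  by apply: eq_big_seq => x /J'D; apply: e.
exact: hJ.
Qed.

Lemma has_sum_fin D F (J : {fset I}) : [set` J] `<=` D -> (forall x, D x -> x \notin J -> F x = 0) ->
  has_sum D F (\sum_(x <- J) F x).
Proof.
move=> JD h e e0; exists J; split=> // J' J'D JJ'.
by apply: (@fsum_out D) => // x Dx xJ; rewrite h // (na0 Hv).
Qed.

Lemma has_sum_reindex D F S (f g : I -> I) : has_sum D F S ->
  (forall x, D x -> D (f x)) -> (forall x, D x -> D (g x)) ->
  (forall x, D x -> f (g x) = x) -> (forall x, D x -> g (f x) = x) ->
  has_sum D (F \o f) S.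
Proof.
move=> hS fD gD fgK gfK e e0; have [J [JD hJ]] := hS _ e0.
exists [fset g x | x in J]%fset; split.
  by move=> x /= /imfsetP[y /= yJ ->]; apply/gD/JD.
move=> J' J'D JJ'.
have -> : \sum_(x <- J') (F \o f) x = \sum_(x <- [fset f x | x in J']%fset) F x.
  rewrite big_imfset //= => x y xJ yJ exy.
  by rewrite -(gfK x) ?exy ?gfK //; apply: J'D.
apply: hJ => [x /= /imfsetP[y /= yJ ->]|]; first by apply/fD/J'D.
apply/fsubsetP => x xJ; apply/imfsetP; exists (g x) => /=; last by rewrite fgK //; apply: JD.
by apply: (fsubsetP JJ'); apply/imfsetP; exists x.
Qed.
End Summation.

Lemma pos_lower_bound (r : seq R) : exists2 e, 0 < e & forall x, x \in r -> 0 < x -> e <= x.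
Proof.
elim: r => [|y r [e e0 he]]; first by exists 1.
have [y0|y0] := ltP 0 y.
  exists (Num.min e y) => [|x]; first by rewrite lt_min e0.
  by rewrite inE => /orP[/eqP->|/he h] x0; rewrite ge_min ?lexx ?orbT // h.
exists e => // x; rewrite inE => /orP[/eqP->|/he//]; by rewrite ltNge y0.
Qed.
Lemma upper_bound (r : seq R) : exists2 e, 1 <= e & forall x, x \in r -> x <= e.
Proof.
elim: r => [|y r [e e0 he]]; first by exists 1.
exists (Num.max e y) => [|x]; first by rewrite le_max e0.
by rewrite inE => /orP[/eqP->|/he h]; rewrite le_max ?lexx ?orbT // h.
Qed.

(** The value 0 at infinity does no harm to an upper bound and is discarded by the positivity
    condition in [pos_lower_bound]. *)
Definition absP1 (p : P1 K) : R := if p is Some x then vK x else 0.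
Definition distP1 (p p' : P1 K) : R :=
  if p is Some x then (if p' is Some y then vK (x - y) else 0) else 0.

(** Here the empty intersection of the pairs enters. If every pair had a point closer to z than the
    least distance d, these points would coincide; so some pair stays away from z, and its factor is
    at most iabs z / d. For large z some pair avoids infinity, and its u is of the order of z ^
    (-2). *)
Lemma Phi_decay D : adm D -> exists2 B, 0 < B & forall z, Omega z ->
  nu (Phi D) z <= B * iabs z /\ nu (Phi D) z * v z <= B.
Proof.
move=> hD; have [r2 [k1 sk] ab dab int0] := hD.
pose pts := [seq pd_a D t | t <- enum 'I_(pd_r D)] ++ [seq pd_b D t | t <- enum 'I_(pd_r D)].
have pa t : pd_a D t \in pts by rewrite mem_cat map_f // mem_enum.
have pb t : pd_b D t \in pts by rewrite mem_cat [X in _ || X]map_f ?orbT // mem_enum.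
have [M M1 hM] := upper_bound [seq absP1 p | p <- pts].
have [d d0 hd] := pos_lower_bound [seq distP1 p p' | p <- pts, p' <- pts].
have {}hM x : Some x \in pts -> vK x <= M by move=> h; apply: hM; apply/mapP; exists (Some x).
have {}hd x y : Some x \in pts -> Some y \in pts -> x != y -> d <= vK (x - y).
  move=> hx hy xy; apply: hd; last by rewrite (na_gt0 HvK) subr_eq0.
  by apply/allpairsP; exists (Some x, Some y).
have M0 : 0 < M by apply: lt_le_trans M1.
exists (Num.max M d^-1) => [|z hz]; first by rewrite lt_max M0.
split.
  suff [t ht] : exists t, nu1 z (pd_a D t) (pd_b D t) <= d^-1 * iabs z.
    apply: le_trans (nu_Phi_le t hD hz) (le_trans ht _).
    by rewrite ler_pM2r ?iabs_gt0 // le_max lexx orbT.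
  apply: contrapT => no.
  have close t : exists x, (Some x = pd_a D t \/ Some x = pd_b D t) /\ v (z - i x) < d.
    have inv p : ~ (v (inv_pt i z p) <= d^-1) -> exists x, Some x = p /\ v (z - i x) < d.
      case: p => [x|] /=; last by rewrite (na0 Hv) invr_ge0 ltW.
      move=> h; exists x; split=> //; rewrite ltNge; apply/negP => h2; apply: h.
      by rewrite (naV Hv) lef_pV2 ?posrE ?(na_gt0 Hv) ?Omega_sub.
    have [ha|/inv[x [xE hx]]] := pselect (v (inv_pt i z (pd_a D t)) <= d^-1); last by exists x; split; [left|].
    have [hb|/inv[x [xE hx]]] := pselect (v (inv_pt i z (pd_b D t)) <= d^-1); last by exists x; split; [right|].
    by exfalso; apply: no; exists t; apply: nu1_le.
  pose t0 : 'I_(pd_r D) := Ordinal (ltnW r2).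
  have [x0 [x0E hx0]] := close t0.
  have : (\bigcap_t [set pd_a D t; pd_b D t]) (Some x0).
    move=> t _ /=; have [x [xE hx]] := close t.
    suff -> : x0 = x by case: xE => ->; [left|right].
    have inpts y t' : Some y = pd_a D t' \/ Some y = pd_b D t' -> Some y \in pts by case=> ->.
    apply/eqP; apply: contraT => /(hd _ _ (inpts _ _ x0E) (inpts _ _ xE)).
    rewrite leNgt -viE rmorphB -(subrKA z) addrC; suff -> : v (z - i x + (i x0 - z)) < d by [].
    by apply: (na_lt_add Hv) => //; rewrite (naBC Hv).
  by rewrite int0.
suff h : nu (Phi D) z * v z <= M by apply: le_trans h _; rewrite le_max lexx.
have [zM|zM] := leP (v z) M.
  by rewrite -[leRHS]mul1r; apply: ler_pM; rewrite ?nu_ge0 ?(na_ge0 Hv) // nu_Phi_le1.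
have z0 : 0 < v z by apply: lt_trans zM.
have [t [x [y [xE yE]]]] : exists t x y, pd_a D t = Some x /\ pd_b D t = Some y.
  apply: contrapT => no.
  have : (\bigcap_t [set pd_a D t; pd_b D t]) None.
    move=> t _ /=; case E: (pd_a D t) => [x|]; last by left.
    case E': (pd_b D t) => [y|]; last by right.
    by exfalso; apply: no; exists t, x, y.
  by rewrite int0.
have xM : vK x <= M by apply: hM; rewrite -xE.
have yM : vK y <= M by apply: hM; rewrite -yE.
have far w : vK w <= M -> v (z - i w) = v z.
  by move=> wM; apply: (na_eq_subl Hv); rewrite viE (le_lt_trans wM).
have : nu1 z (pd_a D t) (pd_b D t) <= M / v z.
  rewrite xE yE /nu1 /u_fun /=.
  have -> : (z - i y)^-1 - (z - i x)^-1 = (i y - i x) / ((z - i y) * (z - i x)).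
    by have := Omega_sub x hz; have := Omega_sub y hz => h1 h2; field; rewrite h1 h2.
  rewrite (naF Hv) (naM Hv) !far // -rmorphB viE -mulrA.
  apply: ler_pM; rewrite ?(na_ge0 HvK) ?mulr_ge0 ?invr_ge0 ?iabs_ge0 ?mulr_ge0 ?(na_ge0 Hv) //.
    exact: na_le_sub.
  by rewrite mulrC invfM mulrA ler_piMl ?invr_ge0 ?(na_ge0 Hv) // ler_pdivrMr // mul1r iabs_le_v.
move=> h; rewrite -ler_pdivlMr //; exact: le_trans (nu_Phi_le t hD hz) h.
Qed.

(** By [iabs_moebius] the square of |cz + d| is the quotient of iabs z by iabs (gz), hence bounded.
    Thus both rows of g are linear forms bounded at z, and [linform_ge] recovers their
    coefficients. *)
Lemma entries_bound d M d' M' : 0 < d -> 0 < d' -> exists B, forall (g : 'M[K]_2) z,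
  vK (\det g) = 1 -> d <= iabs z -> v z <= M -> d' <= iabs (moebius i g z) -> v (moebius i g z) <= M' ->
  forall a b, vK (g a b) <= B.
Proof.
move=> d0 d0'; pose J := Num.max 1 (M / d').
exists (Num.max (Num.max (J / d) (Num.max J (J / d * M))) (Num.max (M' * J / d) (Num.max (M' * J) (M' * J / d * M)))).
move=> g z dg1 dz zM dw wM.
have dg : \det g != 0 by rewrite -(na_eq0 HvK) dg1 oner_eq0.
have z0 : 0 < iabs z by apply: lt_le_trans dz.
have hz : Omega z by apply/OmegaP.
have w0 : 0 < iabs (moebius i g z) by apply: lt_le_trans dw.
have jne := cocycle_neq0 dg hz.
have jE := iabs_moebius dg hz; rewrite dg1 mul1r in jE.
have j0 : 0 < v (cocycle i g z) by rewrite (na_gt0 Hv).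
have M0 : 0 <= M by apply: le_trans zM; apply: na_ge0 Hv _.
have M0' : 0 <= M' by apply: le_trans wM; apply: na_ge0 Hv _.
have J0 : 0 <= J by rewrite le_max ler01.
have hJ : v (cocycle i g z) <= J.
  have h2 : v (cocycle i g z) ^+ 2 <= M / d'.
    have -> : v (cocycle i g z) ^+ 2 = iabs z / iabs (moebius i g z).
      by rewrite jE; field; rewrite !gt_eqF.
    apply: ler_pM; rewrite ?invr_ge0 ?iabs_ge0 ?lef_pV2 ?posrE //.
    exact: le_trans (iabs_le_v z) zM.
  rewrite le_max; have [//|h1] := leP (v (cocycle i g z)) 1.
  by rewrite (le_trans _ h2) ?orbT // expr2 ler_peMl ?(na_ge0 Hv) // ltW.
have key (e f : K) B : v (i e * z + i f) <= B -> vK e <= B / d /\ vK f <= Num.max B (B / d * M).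
  move=> h; have he : vK e <= B / d.
    rewrite ler_pdivlMr //; apply: le_trans h; apply: le_trans (linform_ge _ _ _).
    by rewrite ler_wpM2l ?(na_ge0 HvK).
  split=> //; rewrite -viE -[i f](addKr (i e * z)) addrC.
  apply: le_trans (naD Hv _ _) _; rewrite (naN Hv) ge_max !le_max h /= (naM Hv) viE.
  by apply/orP; right; apply: ler_pM; rewrite ?(na_ge0 HvK) ?(na_ge0 Hv).
have [hc hd] := key _ _ _ hJ.
have hn : v (i (g 0 0) * z + i (g 0 1)) <= M' * J.
  have -> : i (g 0 0) * z + i (g 0 1) = moebius i g z * cocycle i g z by rewrite mulrVK ?unitfE.
  by rewrite (naM Hv); apply: ler_pM; rewrite ?(na_ge0 Hv).
have [ha hb] := key _ _ _ hn.
move=> a b; have {}hd := hd; rewrite !le_max.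
have o2 (x : 'I_2) : x = 0 \/ x = 1 by case: x => [[|[|]]] // h; [left|right]; apply/val_inj.
case: (o2 a) => ->; case: (o2 b) => ->; rewrite ?hc ?ha ?orbT //.
  by move: hb; rewrite !le_max => ->; rewrite ?orbT.
by move: hd; rewrite !le_max => ->; rewrite ?orbT.
Qed.

(** * The group Gamma: cocompactness and center *)

Variables (Gamma : set 'M[K]_2) (l : int).
Hypotheses (Gamma1 : Gamma 1) (GammaM : forall g h, Gamma g -> Gamma h -> Gamma (g * h)).
Hypothesis GammaV : forall g, Gamma g -> Gamma g^-1.
Hypothesis Gamma_det : forall g, Gamma g -> vK (\det g) = 1.
Hypothesis Gamma_discrete : forall M, finite_set [set g | Gamma g /\ forall a b, vK (g a b) <= M].
(** Cocompactness modulo scalars: multiplication by a power of [vpi] brings the valuation m + n of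
    the determinant to 0 or 1. *)
Hypothesis Gamma_cobounded : exists B, forall (m n : int) y, 0 <= m + n <= 1 -> exists2 g, Gamma g &
  forall a b, vK ((g * mx4 (vpi ^ m) y 0 (vpi ^ n)) a b) <= B.
Hypothesis center_dvd : (#|` fset_set (center Gamma)|%:Z %| 2 * l)%Z.

Local Notation Z := (center Gamma).
Local Notation cosets := (lcosets Gamma Z).
Local Notation summand := (poincare_summand i l).
Local Notation term := (poincare_term i l).

Lemma Gamma_det0 g : Gamma g -> \det g != 0.
Proof. by move=> /Gamma_det h; rewrite -(na_eq0 HvK) h oner_eq0. Qed.
Lemma Gamma_unit g : Gamma g -> g \is a GRing.unit.
Proof. by move=> /Gamma_det0/det_neq0_unit. Qed.

(** If |cz + d| were too small at w, both entries of the lower row would be small, and then so would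
    the determinant. *)
Lemma bounded_entries_moebius (M : 'M[K]_2) B w : 0 < B -> (forall a b, vK (M a b) <= B) ->
  s ^+ 4 <= vK (\det M) -> 1 <= iabs w -> v w <= s ^- 4 ->
  s ^+ 12 / B ^+ 2 <= iabs (moebius i M w) /\ v (moebius i M w) <= B ^+ 2 / s ^+ 12.
Proof.
move=> B0 hB hdet w1 w4; have ow : Omega w by apply/OmegaP; apply: lt_le_trans w1.
have s4 := sX_gt0 4; have s8 := sX_gt0 8.
have dM : \det M != 0 by rewrite -(na_gt0 HvK); apply: lt_le_trans hdet.
have one4 : 1 <= s ^- 4 by rewrite invf_ge1 // exprn_ile1 // ltW.
have up a : v (i (M a 0) * w + i (M a 1)) <= B / s ^+ 4.
  apply: (na_le_add Hv); rewrite ?(naM Hv) viE; last first.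
    by apply: le_trans (hB _ _) _; rewrite ler_peMr // ltW.
  by apply: ler_pM; rewrite ?(na_ge0 Hv) ?(na_ge0 HvK).
have c0 : 0 < v (cocycle i M w) by rewrite (na_gt0 Hv) cocycle_neq0.
have low : s ^+ 8 / B <= v (cocycle i M w).
  rewrite leNgt; apply/negP => h.
  have hc : vK (M 1 0) < s ^+ 8 / B.
    apply: le_lt_trans h; apply: le_trans (linform_ge _ _ _); by rewrite ler_peMr // (na_ge0 HvK).
  have hL : 0 < s ^+ 8 / B by rewrite divr_gt0.
  have hLe : s ^+ 8 / B <= s ^+ 4 / B by rewrite ler_pM2r ?invr_gt0 // sX_le.
  have hd : vK (M 1 1) < s ^+ 4 / B.
    rewrite -viE -(addKr (i (M 1 0) * w) (i (M 1 1))) addrC; apply: (na_lt_sub Hv); first exact: lt_le_trans h hLe.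
    rewrite (naM Hv) viE; apply: le_lt_trans (_ : vK (M 1 0) * s ^- 4 < _); first by rewrite ler_wpM2l ?(na_ge0 HvK).
    by rewrite ltr_pdivrMr // mulrAC -exprD.
  have := hdet; rewrite leNgt => /negP; apply; rewrite det2; apply: (na_lt_sub HvK); rewrite (naM HvK).
    apply: le_lt_trans (_ : B * vK (M 1 1) < _); first by rewrite ler_wpM2r ?(na_ge0 HvK).
    by rewrite mulrC -ltr_pdivlMr.
  apply: le_lt_trans (_ : B * vK (M 1 0) < _); first by rewrite ler_wpM2r ?(na_ge0 HvK).
  by rewrite mulrC -ltr_pdivlMr //; apply: lt_le_trans hc hLe.
split.
  rewrite iabs_moebius // ler_pdivlMr ?exprn_gt0 //.
  apply: le_trans (_ : s ^+ 12 / B ^+ 2 * (B / s ^+ 4) ^+ 2 <= _).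
    rewrite ler_pM2l ?divr_gt0 ?exprn_gt0 // ler_pXn2r ?nnegrE ?(na_ge0 Hv) ?divr_ge0 ?(ltW B0) ?(ltW s4) //.
    exact: up.
  have -> : s ^+ 12 / B ^+ 2 * (B / s ^+ 4) ^+ 2 = s ^+ 4.
    have := s_neq0; have := lt0r_neq0 B0 => h1 h2; field; by rewrite h1 h2.
  by apply: le_trans hdet _; rewrite ler_peMr // (na_ge0 HvK).
rewrite /moebius (naF Hv) ler_pdivrMr //; apply: le_trans (up 0) _.
have -> : B / s ^+ 4 = B ^+ 2 / s ^+ 12 * (s ^+ 8 / B).
  have := s_neq0; have := lt0r_neq0 B0 => h1 h2; field; by rewrite h1 h2.
by rewrite ler_pM2l ?divr_gt0 ?exprn_gt0.
Qed.

(** Centred at a nearest point of K and rescaled, z becomes a point w at distance about 1 from K;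
    the affine matrix that undoes this is made bounded by an element of Gamma. *)
Lemma Gamma_cocompact : exists2 d, 0 < d & exists M, forall z, Omega z ->
  exists g, [/\ Gamma g, d <= iabs (moebius i g z) & v (moebius i g z) <= M].
Proof.
have [B0 hB0] := Gamma_cobounded; pose B := Num.max 1 B0.
have B1 : 0 < B by rewrite lt_max ltr01.
have pi0 : vpi != 0 by rewrite -(na_gt0 HvK) vpiE sX_gt0.
exists (s ^+ 12 / B ^+ 2); first by rewrite divr_gt0 ?exprn_gt0.
exists (B ^+ 2 / s ^+ 12) => z hz; set x := nearest z.
have [N /andP[N1 N2]] := scale (iabs_gt0 hz).
(* Only m - n = N matters for the action; the choice makes m + n the residue of N modulo 2. *)
have [m [n [mnN mn]]] : exists m n : int, m - n = N /\ 0 <= m + n <= 1.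
  by exists (N - (N %/ 2)%Z), (- (N %/ 2)%Z); split; [clear; lia|have := divz_eq N 2; have := modz_ge0 N (isT : 2 != 0 :> int);
    have := ltz_pmod N (isT : 0 < 2 :> int); clear; lia].
have [g Gg hg] := hB0 m n (x * vpi ^ n) mn.
set h := mx4 _ _ _ _ in hg.
have pz (j : int) : vpi ^ j != 0 by rewrite expfz_neq0.
have vz (j : int) : vK (vpi ^ j) = s ^ (4 * j) by rewrite (naXz HvK) vpiE exprnP exprz_exp.
have dh : \det h = vpi ^ (m + n) by rewrite det_mx4 mulr0 subr0 expfzDr.
have dh0 : \det h != 0 by rewrite dh.
pose w := (z - i x) / i (vpi ^ N).
have iN : i (vpi ^ N) != 0 by rewrite fmorph_eq0.
have vN : v (i (vpi ^ N)) = s ^ (4 * N) by rewrite viE vz.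
have hw : 1 <= iabs w.
  apply: le_iabs => y; have -> : w - i y = (z - i (x + y * vpi ^ N)) / i (vpi ^ N).
    by rewrite /w rmorphD rmorphM; field.
  by rewrite (naF Hv) vN ler_pdivlMr ?sz_gt0 // mul1r (le_trans N1) // iabs_le.
have ow : Omega w by apply/OmegaP; apply: lt_le_trans hw.
have zE : z = moebius i h w.
  have zw : z = w * i (vpi ^ N) + i x by rewrite /w divfK // subrK.
  rewrite /moebius /cocycle !mx4E rmorph0 mul0r add0r {1}zw.
  have -> : vpi ^ m = vpi ^ N * vpi ^ n by rewrite -expfzDr // -mnN subrK.
  by rewrite !rmorphM; field; rewrite fmorph_eq0.
have vw : v w <= s ^- 4.
  rewrite (naF Hv) vN ler_pdivrMr ?sz_gt0 // exprnN -szD; apply/ltW/(lt_le_trans N2).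
  by rewrite le_sz; clear; lia.
exists g; rewrite {1 2}zE -moebiusM //.
  have [||h1 h2] := @bounded_entries_moebius (g * h) B w B1 _ _ hw vw; last by split.
    by move=> a b; rewrite le_max hg orbT.
  rewrite det_mulmx (naM HvK) Gamma_det // mul1r dh vz exprnP le_sz; move: mn; clear; lia.
- exact: Gamma_det0.
- by rewrite -zE.
Qed.

Lemma moebius_diff (g : 'M[K]_2) z w : \det g != 0 -> Omega z -> Omega w ->
  moebius i g z - moebius i g w = i (\det g) * (z - w) / (cocycle i g z * cocycle i g w).
Proof.
move=> dg hz hw; have := cocycle_neq0 dg hz; have := cocycle_neq0 dg hw.
rewrite /moebius /cocycle det2 rmorphB !rmorphM => h1 h2; by field; rewrite h1 h2.
Qed.

Lemma center1 : Z 1. Proof. by split=> // g _; rewrite mul1r mulr1. Qed.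
Lemma centerM g h : Z g -> Z h -> Z (g * h).
Proof.
move=> [Gg cg] [Gh ch]; split; first exact: GammaM.
by move=> x Gx; rewrite -mulrA ch // mulrA cg // mulrA.
Qed.
Lemma centerV g : Z g -> Z g^-1.
Proof.
move=> [Gg cg]; split; first exact: GammaV.
move=> x Gx; have gu := Gamma_unit Gg.
by apply: (mulrI gu); rewrite mulrA mulrV // mul1r mulrA cg // -mulrA mulrV // mulr1.
Qed.

(* The quadratic polynomial vanishing at the fixed points of h is, relative to iabs, invariant under Gamma, hence
   bounded on Omega, which forces it to vanish on K. *)
Lemma center_scalar h : Z h -> h = (h 0 0)%:M.
Proof.
move=> [Gh ch]; pose Q z := i (h 1 0) * z ^+ 2 + i (h 1 1 - h 0 0) * z - i (h 0 1).
have dh := Gamma_det0 Gh.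
have QE z : Omega z -> Q z = cocycle i h z * (z - moebius i h z).
  move=> hz; have := cocycle_neq0 dh hz; rewrite /Q /moebius /cocycle rmorphB => h0; by field.
have Qinv g z : Gamma g -> Omega z -> Q (moebius i g z) = i (\det g) / cocycle i g z ^+ 2 * Q z.
  move=> Gg hz; have dg := Gamma_det0 Gg; have gz := moebius_Omega dg hz; have hhz := moebius_Omega dh hz.
  rewrite !QE // -moebiusM // ch // moebiusM // moebius_diff //.
  have := cocycleM h dg hz; rewrite ch // cocycleM // => e.
  have c1 := cocycle_neq0 dg hz; have c2 := cocycle_neq0 dg hhz.
  have -> : cocycle i h (moebius i g z) = cocycle i g (moebius i h z) * cocycle i h z / cocycle i g z by rewrite e mulfK.
  by field; rewrite c1 c2.
have [d d0 [M hM]] := Gamma_cocompact.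
have [B B0 hB] : exists2 B, 0 < B & forall z, v z <= M -> v (Q z) <= B.
  pose M1 := Num.max 1 M; pose B := \big[Num.max/1]_(x <- [:: vK (h 1 0); vK (h 1 1 - h 0 0); vK (h 0 1)]) x.
  have B1 : 1 <= B by rewrite /B !big_cons big_nil !le_max lexx !orbT.
  have [b1 b2 b3] : [/\ vK (h 1 0) <= B, vK (h 1 1 - h 0 0) <= B & vK (h 0 1) <= B].
    by rewrite /B !big_cons big_nil !le_max !lexx ?orbT; split.
  have M11 : 1 <= M1 by rewrite le_max lexx.
  have Mp n : 0 < M1 ^+ n by rewrite exprn_gt0 // (lt_le_trans ltr01).
  exists (B * M1 ^+ 2); first by rewrite mulr_gt0 // (lt_le_trans ltr01).
  move=> z zM; have zM1 : v z <= M1 by rewrite le_max zM orbT.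
  have Bp : 0 <= B by apply: le_trans B1.
  apply: (na_le_sub Hv); first apply: (na_le_add Hv).
  - rewrite (naM Hv) (naX Hv) viE; apply: ler_pM; rewrite ?(na_ge0 HvK) ?exprn_ge0 ?(na_ge0 Hv) //.
    by rewrite lerXn2r ?nnegrE ?(na_ge0 Hv) // (le_trans _ M11).
  - rewrite (naM Hv) viE; apply: ler_pM; rewrite ?(na_ge0 HvK) ?(na_ge0 Hv) //.
    by apply: le_trans zM1 _; rewrite expr2 ler_peMr // (le_trans _ M11).
  - by rewrite viE; apply: le_trans b3 _; rewrite ler_peMr // exprn_ege1.
have bound z : Omega z -> v (Q z) <= B / d * iabs z.
  move=> hz; have [g [Gg h1 h2]] := hM z hz; have := hB _ h2; rewrite Qinv //.
  have c0 : 0 < v (cocycle i g z) by rewrite (na_gt0 Hv) cocycle_neq0 // Gamma_det0.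
  move: h1; rewrite (iabs_moebius (Gamma_det0 Gg) hz) !(naM Hv) (naV Hv) (naX Hv) viE Gamma_det // !mul1r.
  rewrite ler_pdivlMr ?exprn_gt0 // => h1; rewrite ler_pdivrMl ?exprn_gt0 // => h3; apply: le_trans h3 _.
  rewrite [leLHS]mulrC -mulrA ler_pM2l // ler_pdivlMl //.
have Q0 x : Q (i x) = 0.
  apply/eqP; rewrite -(na_eq0 Hv) eq_le (na_ge0 Hv) andbT leNgt; apply/negP => Qpos.
  pose D := Num.max (v (i (h 1 0))) (v (i (h 1 0) * (i x + i x) + i (h 1 1 - h 0 0))).
  pose E := Num.max D (B / d); have E0 : 0 < E by rewrite lt_max divr_gt0 ?orbT.
  have [n hn] := small_s4 (divr_gt0 Qpos E0).
  (* The points x + t of Omega tend to x, where iabs tends to 0, while Q keeps the absolute value of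
     Q x. *)
  pose t := i (vpi ^+ n) * sig.
  have vt : v t = (s ^+ 4) ^+ n * s by rewrite (naM Hv) viE (naX HvK) vpiE vsig.
  have t4 : v t < (s ^+ 4) ^+ n by rewrite vt gtr_pMr ?exprn_gt0.
  have t1 : v t <= 1 by apply: le_trans (ltW t4) _; rewrite !exprn_ile1 ?exprn_ge0 ?ltW.
  have tn : i (vpi ^+ n) != 0 by rewrite -(na_gt0 Hv) viE (naX HvK) vpiE !exprn_gt0.
  have oz : Omega (i x + t).
    move=> [y _ yE]; apply: sig_Omega; exists ((y - x) / vpi ^+ n) => //.
    by rewrite rmorphM fmorphV rmorphB yE /t; field.
  have := bound _ oz; apply/negP; rewrite -ltNge.
  have iz : iabs (i x + t) <= v t by apply: le_trans (iabs_le _ x) _; rewrite addrC addKr.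
  have Et : E * v t < v (Q (i x)).
    by rewrite mulrC -ltr_pdivlMr //; apply: lt_le_trans t4 hn.
  have diff : v (Q (i x + t) - Q (i x)) <= E * v t.
    have -> : Q (i x + t) - Q (i x) = (i (h 1 0) * (i x + i x) + i (h 1 1 - h 0 0)) * t + i (h 1 0) * t * t by rewrite /Q; ring.
    apply: (na_le_add Hv); rewrite (naM Hv).
      by rewrite ler_wpM2r ?(na_ge0 Hv) // !le_max lexx !orbT.
    rewrite ler_wpM2r ?(na_ge0 Hv) // (naM Hv); apply: le_trans (_ : v (i (h 1 0)) * 1 <= _); first by rewrite ler_wpM2l ?(na_ge0 Hv).
    by rewrite mulr1 !le_max lexx.
  have -> : v (Q (i x + t)) = v (Q (i x)) by apply: (na_eq_near Hv); apply: le_lt_trans diff Et.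
  apply: le_lt_trans Et; apply: ler_pM; rewrite ?iabs_ge0 ?divr_ge0 ?(ltW B0) ?(ltW d0) //.
  by rewrite le_max lexx orbT.
have iQ x : h 1 0 * x ^+ 2 + (h 1 1 - h 0 0) * x - h 0 1 = 0.
  apply/(fmorph_inj i); rewrite rmorph0 -(Q0 x) /Q !rmorphD !rmorphN !rmorphM; ring.
(* The quadratic polynomial has the three roots 0, 1 and [vpi], so its coefficients vanish. *)
have h01 : h 0 1 = 0 by apply/eqP; rewrite -oppr_eq0; have := iQ 0; rewrite expr0n mulr0 mulr0 !add0r => ->.
have pi0 : vpi != 0 by rewrite -(na_gt0 HvK) vpiE sX_gt0.
have pi1 : vpi - 1 != 0.
  by rewrite subr_eq0; apply: contraTneq s_lt1 => e; rewrite -leNgt -[_ <= s]negbK -ltNge;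
    apply/negP => s1; have := vpiE; rewrite e (na1 HvK) => /esym/eqP; rewrite lt_eqF // exprn_ilt1 // ltW.
have e1 : h 1 0 + (h 1 1 - h 0 0) = 0 by have := iQ 1; rewrite h01 expr1n !mulr1 subr0.
have h10 : h 1 0 = 0.
  apply/(mulIf pi1)/(mulIf pi0); rewrite !mul0r.
  have -> : h 1 0 * (vpi - 1) * vpi = (h 1 0 * vpi ^+ 2 + (h 1 1 - h 0 0) * vpi - h 0 1) -
     (h 1 0 + (h 1 1 - h 0 0)) * vpi by rewrite h01; ring.
  by rewrite iQ e1 mul0r subr0.
have h11 : h 1 1 = h 0 0 by apply/eqP; rewrite -subr_eq0 -[X in X == _]add0r -{1}h10 e1.
rewrite [LHS]mx4_eta [RHS]mx4_eta !mxE h01 h10 h11 /= mulr0n mulr1n //.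
Qed.

(** Lagrange's theorem for Z, obtained by comparing the product of the entries g 0 0 over Z with the
    one over h Z; then #Z divides 2l. *)
Lemma Gamma_center h : Z h -> exists2 a, h = a%:M & a ^ (2 * l) = 1.
Proof.
move=> hh; have hs := center_scalar hh; exists (h 0 0) => //.
have scal0 g : Z g -> g 0 0 != 0.
  by move=> hg; have := Gamma_det0 (proj1 hg); rewrite (center_scalar hg) det_scalar mxE /= mulr1n expf_eq0.
(* [fset_set] counts Z only when Z is finite. The scalars in Z have absolute value 1, so
   discreteness applies. *)
have fin : finite_set Z.
  apply: sub_finite_set (Gamma_discrete 1) => g hg; have [Gg _] := hg; split=> // a b.
  have g1 : vK (g 0 0) = 1.
    have := Gamma_det Gg; rewrite (center_scalar hg) det_scalar mxE /= mulr1n (naX HvK) => /eqP.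
    by rewrite pexpr_eq1 ?(na_ge0 HvK) // => /eqP.
  rewrite (center_scalar hg) mxE; case: eqP => _ /=; by rewrite ?mulr1n ?mulr0n ?g1 ?(na0 HvK) ?ler01.
have hE (x g : 'M[K]_2) : Z x -> (x * g) 0 0 = x 0 0 * g 0 0.
  by move=> hx; rewrite {1}(center_scalar hx) -[_ * g]/(_ *m g) mul_scalar_mx mxE.
have cd := center_dvd; set S := fset_set Z in cd *.
have inS g : (g \in S) = (g \in Z) by rewrite in_fset_set.
have hu := Gamma_unit (proj1 hh).
have permS : perm_eq [seq h * g | g <- S] S.
  apply: uniq_perm; [by rewrite map_inj_uniq ?fset_uniq //; apply: mulrI|exact: fset_uniq|].
  move=> g; apply/mapP/idP => [[g']|].
    by rewrite !inS => /set_mem hg' ->; apply/mem_set/centerM.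
  rewrite inS => /set_mem hg; exists (h^-1 * g); last by rewrite mulVKr.
  by rewrite inS; apply/mem_set/centerM => //; apply: centerV.
have prod : \prod_(g <- S) (g 0 0) = h 0 0 ^+ #|` S| * \prod_(g <- S) (g 0 0).
  rewrite -{1}(perm_big _ permS) /= big_map (eq_bigr (fun g : 'M[K]_2 => h 0 0 * g 0 0)) => [|g _]; last exact: hE.
  by rewrite big_split big_const_seq count_predT iter_mulr_1 cardfE.
have p0 : \prod_(g <- S) (g 0 0) != 0.
  by rewrite prodf_seq_neq0; apply/allP => g; rewrite inS => /set_mem hg; apply: scal0.
have hS : h 0 0 ^+ #|` S| = 1 by apply: (mulIf p0); rewrite -prod mul1r.
have /dvdzP[m ->] := cd.
by rewrite mulrC -exprz_exp -exprnP hS exp1rz.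
Qed.

Lemma center_act h : Z h -> moebiusP1 h = id /\ i (\det h) ^ (- l) = 1.
Proof.
move=> hh; have [Gh _] := hh; have := Gamma_det0 Gh; have [a -> e] := Gamma_center hh.
rewrite det_scalar => a2; have a0 : a != 0 by move: a2; rewrite expf_eq0.
split.
  apply/funext => -[x|]; rewrite /moebiusP1 !mxE /= ?mulr0n ?mulr1n ?eqxx // mul0r add0r (negbTE a0) addr0.
  by rewrite mulrAC mulfV // mul1r.
rewrite -invr_expz exprnP -fmorphXz exprz_exp.
by rewrite e rmorph1 invr1.
Qed.

(** * Poincare series *)

Definition rep (c : set 'M[K]_2) : 'M[K]_2 := xget 1 c.

Lemma lcoset_eq g h : Z h -> lcoset (g * h) Z = lcoset g Z.
Proof.
move=> hh; have hu := Gamma_unit (proj1 hh); apply/seteqP; split=> x /=.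
  by move=> [y hy <-]; exists (h * y); rewrite ?mulrA //; apply: centerM.
move=> [y hy <-]; exists (h^-1 * y); first by apply: centerM => //; apply: centerV.
by rewrite -mulrA (mulrA h) mulrV // mul1r.
Qed.
Lemma mem_lcoset g : lcoset g Z g.
Proof. by exists 1; [exact: center1|rewrite mulr1]. Qed.

Lemma cosetP c g : cosets c -> c g -> Gamma g /\ c = lcoset g Z.
Proof.
move=> [g0 Gg0 <-] [h hh <-]; split; first by apply: GammaM => //; case: hh.
by rewrite lcoset_eq.
Qed.
Lemma repP c : cosets c -> Gamma (rep c) /\ c = lcoset (rep c) Z.
Proof.
move=> hc; apply: cosetP => //; rewrite /rep; case: xgetP => // h.
by case: hc h => g _ <- /(_ g); case; apply: mem_lcoset.
Qed.
Lemma rep_mem c : cosets c -> c (rep c).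
Proof. by move=> hc; have [_ {1}->] := repP hc; apply: mem_lcoset. Qed.
Lemma cosets_lcoset g : Gamma g -> cosets (lcoset g Z).
Proof. by move=> Gg; exists g. Qed.
Lemma rep_lcoset g : Gamma g -> exists2 h, Z h & rep (lcoset g Z) = g * h.
Proof.
move=> Gg; have := rep_mem (cosets_lcoset Gg); case=> h hh <-; by exists h.
Qed.

Lemma summandM D z g h : Gamma g -> Z h -> summand D z (g * h) = summand D z g.
Proof.
move=> Gg hh; have [Gh _] := hh; have [h1 h2] := center_act hh.
rewrite !poincare_summandE det_mulmx rmorphM expfzMl h2 mulr1 actM ?Gamma_det0 //.
by rewrite /act h1.
Qed.
Lemma termE D z c g : cosets c -> c g -> term D z c = summand D z g.
Proof.
move=> hc cg; have [Gg cE] := cosetP hc cg; rewrite /poincare_term -/(rep c) cE.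
by have [h hh ->] := rep_lcoset Gg; apply: summandM.
Qed.


(** The summand is [Phi D] slashed by g^-1. The weight contributes det ^ k and the series det ^ l,
    whence the type k + l. *)
Lemma summand_slash D z g : adm D -> Gamma g -> Omega z ->
  summand D z g = i (\det g^-1) ^ (k%:Z + l) / cocycle i g^-1 z ^+ (2 * k) * Phi D (moebius i g^-1 z).
Proof.
move=> hD Gg hz; rewrite poincare_summandE Phi_act ?Gamma_det0 //.
have d0 : i (\det g^-1) != 0 by rewrite fmorph_eq0 Gamma_det0 //; apply: GammaV.
have -> : i (\det g) = (i (\det g^-1))^-1 by rewrite det_inv fmorphV invrK.
rewrite exprz_inv opprK expfzDr // -exprnP exprM expr_div_n.
by rewrite !mulrA; congr (_ / _ * _); rewrite mulrC.
Qed.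

Lemma v_det g : Gamma g -> forall n : int, v (i (\det g) ^ n) = 1.
Proof. by move=> Gg n; rewrite (naXz Hv) viE Gamma_det // exp1rz. Qed.

Lemma v_summand D z g : adm D -> Gamma g -> Omega z ->
  v (summand D z g) * iabs z ^+ k = nu (Phi D) (moebius i g^-1 z).
Proof.
move=> hD Gg hz; have GV := GammaV Gg.
rewrite summand_slash // -(v_slash _ (Gamma_det GV) hz).
by rewrite !(naM Hv) v_det // mul1r [X in X * _]mulrC.
Qed.

(** If a term is not small, then nu (Phi D) is not small at (rep c)^-1 z; [Phi_decay] confines this
    point to a compact part and [entries_bound] leaves finitely many classes. As z varies in a
    bounded region, the convergence is locally uniform. *)
Lemma finite_terms D d M e : adm D -> 0 < d -> 0 < e ->
  finite_set [set c | cosets c /\ exists z, [/\ d <= iabs z, v z <= M & e <= v (term D z c)]].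
Proof.
move=> hD d0 e0.
have [B0 B00 hB0] := Phi_decay hD.
pose m := e * d ^+ k.
have m0 : 0 < m by rewrite mulr_gt0 // exprn_gt0.
have [B hB] := @entries_bound d M (m / B0) (B0 / m) d0 (divr_gt0 m0 B00).
apply: (@sub_finite_set _ _ [set lcoset (h^-1) Z | h in [set g | Gamma g /\ forall a b, vK (g a b) <= B]]).
  move=> c [hc [z [dz zM ez]]]; have [Gr cE] := repP hc.
  have hz : Omega z by apply/OmegaP; apply: lt_le_trans dz.
  exists (rep c)^-1; last by rewrite invrK.
  split; first exact: GammaV.
  have GV := GammaV Gr.
  move: ez; rewrite /poincare_term -/(rep c) => ez.
  have hm : m <= nu (Phi D) (moebius i (rep c)^-1 z).
    rewrite -v_summand //; apply: ler_pM => //; [exact: ltW|exact/exprn_ge0/ltW|].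
    by rewrite lerXn2r ?nnegrE ?iabs_ge0 // ltW.
  have hw := moebius_Omega (Gamma_det0 GV) hz.
  have [h1 h2] := hB0 _ hw.
  apply: (hB _ z) => //; first exact: Gamma_det.
    by rewrite ler_pdivrMr // mulrC (le_trans hm).
  rewrite ler_pdivlMr // mulrC; apply: le_trans h2.
  by rewrite ler_wpM2r ?(na_ge0 Hv).
apply: finite_image; exact: Gamma_discrete.
Qed.

Lemma term_vanishing D z : adm D -> Omega z -> vanishing cosets (term D z).
Proof.
move=> hD hz e e0; have := finite_terms (v z) hD (iabs_gt0 hz) e0; apply: sub_finite_set.
by move=> c [hc ez]; split=> //; exists z.
Qed.

Local Notation series := (poincare_series i v Gamma l).

Lemma series_has_sum D z : adm D -> Omega z -> has_sum v cosets (term D z) (series D z).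
Proof. by move=> hD hz; apply/total_sumP/vanishing_summable/term_vanishing. Qed.

Definition lmul (d : 'M[K]_2) (c : set 'M[K]_2) : set 'M[K]_2 := [set d * x | x in c].
Lemma lmul_lcoset d g : lmul d (lcoset g Z) = lcoset (d * g) Z.
Proof.
apply/seteqP; split=> x /=; first by move=> [_ [h hh <-] <-]; exists h; rewrite ?mulrA.
by move=> [h hh <-]; exists (g * h); [exists h|rewrite mulrA].
Qed.
Lemma lmul_cosets d c : Gamma d -> cosets c -> cosets (lmul d c).
Proof. by move=> Gd [g Gg <-]; rewrite lmul_lcoset; apply/cosets_lcoset/GammaM. Qed.
Lemma lmulK d c : Gamma d -> lmul d (lmul d^-1 c) = c.
Proof.
move=> Gd; have du := Gamma_unit Gd; apply/seteqP; split=> x /=.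
  by move=> [_ [y cy <-] <-]; rewrite mulVKr.
by move=> cx; exists (d^-1 * x); [exists x|rewrite mulVKr].
Qed.
Lemma lmulVK d c : Gamma d -> lmul d^-1 (lmul d c) = c.
Proof. by move=> Gd; rewrite -{2}[d]invrK lmulK //; apply: GammaV. Qed.

Lemma slash_const g z : Gamma g -> Omega z ->
  (i (\det g) ^ (k%:Z + l) / cocycle i g z ^+ (2 * k)) *
  (i (\det g) ^ (- l) * (cocycle i g z ^+ 2 / i (\det g)) ^+ k) = 1.
Proof.
move=> Gg hz; have d0 : i (\det g) != 0 by rewrite fmorph_eq0 Gamma_det0.
have j0 := cocycle_neq0 (Gamma_det0 Gg) hz.
rewrite expfzDr // -exprnP exprM expr_div_n -invr_expz.
have x0 : i (\det g) ^ l != 0 by rewrite expfz_neq0.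
have y0 : i (\det g) ^+ k != 0 by rewrite expf_neq0.
have z0 : (cocycle i g z ^+ 2) ^+ k != 0 by rewrite !expf_neq0.
by field; rewrite x0 y0 z0.
Qed.

(** Left translation by g permutes the cosets and multiplies all terms by the same factor. *)
Lemma series_modular D g z : adm D -> Gamma g -> Omega z ->
  i (\det g) ^ (k%:Z + l) / cocycle i g z ^+ (2 * k) * series D (moebius i g z) = series D z.
Proof.
move=> hD Gg hz; have hgz := moebius_Omega (Gamma_det0 Gg) hz.
have h1 := series_has_sum hD hgz.
have h2 := has_sum_reindex h1 (fun c => lmul_cosets (c := c) Gg)
   (fun c => lmul_cosets (c := c) (GammaV Gg)) (fun c _ => lmulK c Gg) (fun c _ => lmulVK c Gg).
have h3 := has_sumZ (i (\det g) ^ (- l) * (cocycle i g z ^+ 2 / i (\det g)) ^+ k) (series_has_sum hD hz).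
have e : series D (moebius i g z) = (i (\det g) ^ (- l) * (cocycle i g z ^+ 2 / i (\det g)) ^+ k) * series D z.
  apply: (has_sum_unique h2); apply: has_sum_eq h3 => c hc /=.
  have [Gr cE] := repP hc; have cr := rep_mem hc.
  have -> : term D (moebius i g z) (lmul g c) = summand D (moebius i g z) (g * rep c).
    by apply: termE; [exact: lmul_cosets|exists (rep c)].
  rewrite (termE _ _ hc cr).
  rewrite !poincare_summandE det_mulmx rmorphM expfzMl actM ?Gamma_det0 //.
  rewrite Phi_moebius ?Gamma_det0 //; first by rewrite -!mulrA; congr (_ * _); rewrite mulrCA.
  by apply: adm_act => //; apply: Gamma_det0.
by rewrite e mulrA slash_const // mul1r.
Qed.

(** * Rigid holomorphy of the Poincaré series *)

Definition is_rat (f : C -> C) := exists P Q : {poly C}, forall z, Omega z ->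
  Q.[z] != 0 /\ f z = P.[z] / Q.[z].
Lemma is_ratM f g : is_rat f -> is_rat g -> is_rat (fun z => f z * g z).
Proof.
move=> [P [Q h]] [P' [Q' h']]; exists (P * P'), (Q * Q') => z hz.
have [q0 ->] := h z hz; have [q0' ->] := h' z hz.
by rewrite !hornerM mulf_neq0 //; split=> //; field; rewrite q0 q0'.
Qed.
Lemma is_ratD f g : is_rat f -> is_rat g -> is_rat (fun z => f z + g z).
Proof.
move=> [P [Q h]] [P' [Q' h']]; exists (P * Q' + P' * Q), (Q * Q') => z hz.
have [q0 ->] := h z hz; have [q0' ->] := h' z hz.
by rewrite !hornerE mulf_neq0 //; split=> //; field; rewrite q0 q0'.
Qed.
Lemma is_rat_cst c : is_rat (fun=> c).
Proof. by exists c%:P, 1 => z _; rewrite !hornerE oner_eq0; split=> //; rewrite divr1. Qed.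
Lemma is_rat_inv_pt p : is_rat (inv_pt i ^~ p).
Proof.
case: p => [x|] /=; last exact: is_rat_cst.
by exists 1, ('X - (i x)%:P) => z hz; rewrite !hornerE Omega_sub //; split=> //; rewrite mul1r.
Qed.
Lemma is_rat_X f n : is_rat f -> is_rat (fun z => f z ^+ n).
Proof.
move=> hf; elim: n => [|n IH]; first exact: is_rat_cst.
by under eq_fun do rewrite exprS; apply: is_ratM.
Qed.
Lemma is_rat_Phi D : is_rat (Phi D).
Proof.
rewrite /Phi; elim: (index_enum _) => [|t r IH].
  by under eq_fun do rewrite big_nil; apply: is_rat_cst.
under eq_fun do rewrite big_cons; apply: is_ratM => //; apply: is_rat_X.
apply: is_ratD; first exact: is_rat_inv_pt.
under eq_fun do rewrite -mulN1r; apply: is_ratM; [exact: is_rat_cst|exact: is_rat_inv_pt].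
Qed.

(** An affinoid is stable under translations shorter than all its radii, so a point of K that near
    to z would belong to it. *)
Lemma affinoid_bounds c p r : p != 0 -> (forall x, x \in r -> x.2 != 0) ->
  affinoid v c p r `<=` Omega ->
  exists2 d, 0 < d & exists M, forall z, affinoid v c p r z -> d <= iabs z /\ v z <= M.
Proof.
move=> p0 r0 sub.
have [d d0 hd] := pos_lower_bound (v p :: [seq v x.2 | x <- r]).
have dp : d <= v p by apply: hd; rewrite ?mem_head // (na_gt0 Hv).
have dr x : x \in r -> d <= v x.2.
  by move=> xr; apply: hd; rewrite ?(na_gt0 Hv) ?r0 // inE [X in _ || X]map_f ?orbT.
exists d => //; exists (Num.max (v p) (v c)) => z [zc zr]; split; last first.
  by rewrite -[z](subrK c); apply: le_trans (naD Hv _ _) _; rewrite ge_max !le_max zc lexx orbT.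
apply: le_iabs => x; rewrite leNgt; apply/negP => h.
have nX : ~ affinoid v c p r (i x) by move/sub => h2; apply: h2; exists x.
apply: nX; split.
  rewrite -(subrKA z); apply: na_le_add => //; rewrite (naBC Hv).
  by apply: le_trans (ltW h) _.
move=> y yr; rewrite leNgt; apply/negP => h2.
have := zr y yr; rewrite leNgt => /negP; apply.
rewrite -(subrKA (i x)); apply: na_lt_add => //.
exact: lt_le_trans h (dr _ yr).
Qed.

Lemma rigid_uniform_limit f :
  (forall d M e, 0 < d -> 0 < e -> exists2 r, is_rat r &
     forall z, d <= iabs z -> v z <= M -> v (f z - r z) < e) -> rigid_holomorphic i v f.
Proof.
move=> h c p r p0 r0 sub e e0; have [d d0 [M hM]] := affinoid_bounds p0 r0 sub.
have [g [P [Q hg]] hf] := h d M e d0 e0; exists P, Q => z hz.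
have [q0 gE] := hg z (sub _ hz); split=> //; rewrite -gE; have [? ?] := hM z hz; exact: hf.
Qed.

Lemma series_rigid D : adm D -> rigid_holomorphic i v (series D).
Proof.
move=> hD; apply: rigid_uniform_limit => d M e d0 e0.
have fin := finite_terms M hD d0 e0.
set S := [set c | _] in fin.
exists (fun z => \sum_(c <- fset_set S) term D z c).
  have : all (fun c => c \in fset_set S) (enum_fset (fset_set S)) by apply/allP.
  elim: (enum_fset _) => [|c r IH] /=; first by move=> _; under eq_fun do rewrite big_nil; apply: is_rat_cst.
  move=> /andP[_ /IH h]; under eq_fun do rewrite big_cons; apply: is_ratD => //.
  by apply: (@is_ratM (fun=> _) (Phi (act (rep c) D))); [exact: is_rat_cst|exact: is_rat_Phi].
move=> z dz zM; have hz : Omega z by apply/OmegaP; apply: lt_le_trans dz.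
rewrite (naBC Hv); apply: has_sum_near (series_has_sum hD hz) (term_vanishing hD hz) _ _ _ => //.
  by move=> c /=; rewrite in_fset_set // inE => -[].
move=> c hc; rewrite in_fset_set // notin_setE /= ltNge => h; apply/negP => h2; apply: h.
by split=> //; exists z.
Qed.

Lemma rigid_lin n (c : 'I_n -> C) (g : 'I_n -> C -> C) f :
  (forall t, rigid_holomorphic i v (g t)) ->
  (forall z, Omega z -> f z = \sum_t c t * g t z) -> rigid_holomorphic i v f.
Proof.
move=> hg fE c0 p r p0 r0 sub; set X := affinoid v c0 p r in sub *.
have D (f1 f2 : C -> C) : rational_approx v X f1 -> rational_approx v X f2 -> rational_approx v X (fun z => f1 z + f2 z).
  move=> h1 h2 e e0; have [P [Q hf]] := h1 _ e0; have [P' [Q' hf']] := h2 _ e0.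
  exists (P * Q' + P' * Q), (Q * Q') => z hz; have [q0 fe] := hf z hz; have [q0' fe'] := hf' z hz.
  rewrite !hornerE mulf_neq0 //; split=> //.
  have -> : f1 z + f2 z - (P.[z] * Q'.[z] + P'.[z] * Q.[z]) / (Q.[z] * Q'.[z]) =
     (f1 z - P.[z] / Q.[z]) + (f2 z - P'.[z] / Q'.[z]) by field; rewrite q0 q0'.
  exact: na_lt_add.
have Zc a (f1 : C -> C) : rational_approx v X f1 -> rational_approx v X (fun z => a * f1 z).
  move=> h1 e e0; have [->|a0] := eqVneq a 0.
    by exists 0, 1 => z _; rewrite hornerE oner_eq0 horner0 !mul0r subrr (na0 Hv).
  have va : 0 < v a by rewrite (na_gt0 Hv).
  have [P [Q hf]] := h1 _ (divr_gt0 e0 va); exists (a *: P), Q => z hz; have [q0 fe] := hf z hz.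
  split=> //; rewrite hornerZ -mulrA -mulrBr (naM Hv) mulrC -ltr_pdivlMr //.
have S (rr : seq 'I_n) : rational_approx v X (fun z => \sum_(t <- rr) c t * g t z).
  elim: rr => [|t rr IH].
    move=> e e0; exists 0, 1 => z _; by rewrite big_nil hornerE oner_eq0 horner0 !mul0r subrr (na0 Hv).
  under [X in rational_approx _ _ X]eq_fun do rewrite big_cons; apply: D => //; apply: Zc; exact: hg.
move=> e e0; have [P [Q h]] := S (index_enum _) e e0; exists P, Q => z hz; have [q0 he] := h z hz.
by split=> //; rewrite fE //; apply: sub.
Qed.

Lemma span_sub_modular :
  span_halfplane i (poincare_family i v Gamma k l) `<=` modular_forms i v Gamma (2 * k) (k%:Z + l).
Proof.
move=> f [n [c [g [hg fE]]]]; split.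
  by apply: rigid_lin fE => t; have [D hD <-] := hg t; apply: series_rigid.
move=> x z Gx hz; rewrite !fE //; last exact: moebius_Omega (Gamma_det0 Gx) hz.
rewrite mulr_sumr; apply: eq_bigr => t _; have [D hD <-] := hg t.
by rewrite mulrCA series_modular.
Qed.

Lemma poincare_summableP D z : adm D -> Omega z -> poincare_summable i v Gamma l D z.
Proof. by move=> hD hz; apply/vanishing_summable/term_vanishing. Qed.

(** * Compact parts of the half-plane and boundedness of modular forms *)

Lemma net m n : exists L : seq K, forall y, vK y <= (s ^+ 4) ^- m ->
  exists2 x, x \in L & vK (y - x) <= (s ^+ 4) ^+ n.
Proof.
have pi0 : vpi != 0 by rewrite -(na_gt0 HvK) vpiE sX_gt0.
have s4 := sX_gt0 4.
(* Finite expansions in powers of [vpi] with digits in the image of [kap]. *)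
have unit_net : exists L : seq K, forall y, vK y <= 1 -> exists2 x, x \in L & vK (y - x) <= (s ^+ 4) ^+ (n + m).
  elim: (n + m)%N => [|d [L hL]].
    by exists [:: 0] => y y1; exists 0; rewrite ?mem_head // subr0 expr0.
  exists [seq x + vpi ^+ d * kap a | x <- L, a <- enum Fq] => y y1.
  have [x xL hx] := hL y y1.
  have h : vK ((y - x) / vpi ^+ d) <= 1.
    by rewrite (naF HvK) (naX HvK) vpiE ler_pdivrMr ?exprn_gt0 // mul1r.
  have [a ha] := resK h; exists (x + vpi ^+ d * kap a).
    by apply/allpairsP; exists (x, a); rewrite mem_enum.
  have -> : y - (x + vpi ^+ d * kap a) = ((y - x) / vpi ^+ d - kap a) * vpi ^+ d.
    by rewrite mulrBl divfK ?expf_neq0 // opprD addrA [kap a * _]mulrC.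
  rewrite (naM HvK) (naX HvK) vpiE (exprS (s ^+ 4) d); apply: ler_pM; rewrite ?(na_ge0 HvK) ?exprn_ge0 ?(ltW s_gt0) //.
  exact: vK_lt1.
have [L hL] := unit_net; exists [seq x / vpi ^+ m | x <- L] => y hy.
have h : vK (y * vpi ^+ m) <= 1.
  by rewrite (naM HvK) (naX HvK) vpiE -ler_pdivlMr ?exprn_gt0 // mul1r.
have [x xL hx] := hL _ h; exists (x / vpi ^+ m); first exact: map_f.
have -> : y - x / vpi ^+ m = (y * vpi ^+ m - x) / vpi ^+ m.
  by rewrite mulrBl mulfK ?expf_neq0.
rewrite (naF HvK) (naX HvK) vpiE ler_pdivrMr ?exprn_gt0 // -exprD.
exact: hx.
Qed.


Lemma compact_affinoid d M : 0 < d -> exists c p r, [/\ p != 0, forall x, x \in r -> x.2 != 0,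
  affinoid v c p r `<=` Omega & forall z, d <= iabs z -> v z <= M -> affinoid v c p r z].
Proof.
move=> d0; have [n hn] := small_s4 d0; have [m hm] := large_s4 M.
(* The holes are open discs of radius s ^ (4n) around the net; one more digit of precision puts
   every point of K strictly inside a hole. *)
have [L hL] := net m n.+1.
have pi0 : vpi != 0 by rewrite -(na_gt0 HvK) vpiE sX_gt0.
exists 0, (i (vpi ^- m)), [seq (i x, i (vpi ^+ n)) | x <- L].
have vp : v (i (vpi ^- m)) = (s ^+ 4) ^- m by rewrite viE (naV HvK) (naX HvK) vpiE.
have vh : v (i (vpi ^+ n)) = (s ^+ 4) ^+ n by rewrite viE (naX HvK) vpiE.
have ipi : i (vpi ^+ n) != 0 by rewrite fmorph_eq0 expf_neq0.
split.
- by rewrite fmorph_eq0 invr_eq0 expf_neq0.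
- by move=> x /mapP[y _ ->].
- move=> z [zp zh]; rewrite subr0 vp in zp; move=> [y _ yz].
  have hy : vK y <= (s ^+ 4) ^- m by rewrite -viE yz.
  have [x xL hx] := hL y hy.
  have := zh _ (map_f _ xL); rewrite /= vh -yz -rmorphB viE leNgt => /negP; apply.
  by apply: le_lt_trans hx _; rewrite exprS gtr_pMl ?exprn_gt0 // exprn_ilt1 // ltW.
- move=> z dz zM; split; first by rewrite subr0 vp (le_trans zM).
  move=> _ /mapP[x xL ->] /=; rewrite vh; exact: le_trans hn (le_trans dz (iabs_le _ _)).
Qed.

Lemma root_far c p r rho : p != 0 -> (forall x, x \in r -> x.2 != 0) -> ~ affinoid v c p r rho ->
  exists2 e, 0 < e & forall z, affinoid v c p r z -> e <= v (z - rho).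
Proof.
move=> p0 r0 hr.
have [h|h] := ltP (v p) (v (rho - c)).
  exists (v p); first by rewrite (na_gt0 Hv).
  move=> z [zc _]; rewrite -(subrKA c) addrC; suff -> : v (c - rho + (z - c)) = v (rho - c) by apply: ltW.
  by rewrite (na_eq_addl Hv) ?(naBC Hv c) // (le_lt_trans zc).
have [x xr hx] : exists2 x, x \in r & v (rho - x.1) < v x.2.
  apply: contrapT => no; apply: hr; split=> // x xr; rewrite leNgt; apply/negP => h2.
  by apply: no; exists x.
exists (v x.2); first by rewrite (na_gt0 Hv) r0.
move=> z [_ /(_ x xr) zx]; rewrite leNgt; apply/negP => h2.
move: zx; rewrite leNgt => /negP; apply; rewrite -(subrKA rho); exact: na_lt_add.
Qed.

Lemma horner_factor (Q : {poly C}) : exists c rs, forall z, Q.[z] = c * \prod_(r <- rs) (z - r).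
Proof.
have [rs e] := closed_field_splits Cclosed Q; exists (lead_coef Q), rs => z.
by rewrite {1}e hornerZ horner_prod; congr (_ * _); apply: eq_bigr => r _; rewrite hornerXsubC.
Qed.

(** Q splits, and each of its roots lies off the affinoid, hence at a positive distance from it. *)
Lemma inv_poly_bounded c p r (Q : {poly C}) : p != 0 -> (forall x, x \in r -> x.2 != 0) ->
  (forall z, affinoid v c p r z -> Q.[z] != 0) -> exists2 B, 0 < B & forall z, affinoid v c p r z -> v (Q.[z]^-1) <= B.
Proof.
move=> p0 r0 hQ; have [a [rs QE]] := horner_factor Q.
have [a0|a0] := eqVneq a 0.
  by exists 1 => // z /hQ; rewrite QE a0 mul0r eqxx.
have : forall x, x \in rs -> ~ affinoid v c p r x.
  move=> x xr /hQ; rewrite QE => /negP; apply; rewrite mulf_eq0 (negbTE a0) /= prodf_seq_eq0.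
  by apply/hasP; exists x => //; rewrite subrr eqxx.
move=> far.
suff [B B0 hB] : exists2 B, 0 < B & forall z, affinoid v c p r z -> v (\prod_(x <- rs) (z - x))^-1 <= B.
  exists (v a^-1 * B) => [|z hz]; first by rewrite mulr_gt0 // (na_gt0 Hv) invr_eq0.
  by rewrite QE invfM (naM Hv) ler_wpM2l ?(na_ge0 Hv) // hB.
elim: rs far {QE} => [|x rs IH] far.
  by exists 1 => // z _; rewrite big_nil invr1 (na1 Hv).
have [B B0 hB] := IH (fun y h => far y (@mem_behead _ (x :: rs) y h)).
have [e e0 he] := root_far p0 r0 (far x (mem_head _ _)).
exists (e^-1 * B) => [|z hz]; first by rewrite mulr_gt0 ?invr_gt0.
rewrite big_cons invfM (naM Hv); apply: ler_pM; rewrite ?(na_ge0 Hv) ?hB //.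
by rewrite (naV Hv) lef_pV2 ?posrE ?he // (lt_le_trans e0) // he.
Qed.

Lemma poly_bounded (P : {poly C}) M : exists2 B, 0 < B & forall z, v z <= M -> v P.[z] <= B.
Proof.
have [B B1 hB] := upper_bound [seq v x | x <- P].
pose M1 := Num.max 1 M.
have M11 : 1 <= M1 by rewrite le_max lexx.
exists (B * M1 ^+ size P) => [|z hz].
  by rewrite mulr_gt0 ?exprn_gt0 ?(lt_le_trans ltr01).
rewrite horner_coef; apply: (na_sum Hv) => [|j _].
  by rewrite mulr_ge0 ?exprn_ge0 ?(le_trans ler01).
rewrite (naM Hv) (naX Hv); apply: ler_pM; rewrite ?exprn_ge0 ?(na_ge0 Hv) //.
  by apply: hB; apply: map_f; apply: mem_nth.
apply: (@le_trans _ _ (M1 ^+ j)); last by rewrite ler_weXn2l // ltnW.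
by rewrite lerXn2r ?nnegrE ?(na_ge0 Hv) ?(le_trans ler01) // le_max hz orbT.
Qed.

Lemma affinoid_v c p r z : affinoid v c p r z -> v z <= Num.max (v p) (v c).
Proof.
by move=> [h _]; rewrite -[z](subrK c); apply: le_trans (naD Hv _ _) _; rewrite ge_max !le_max h lexx orbT.
Qed.

Lemma rational_approx_bounded c p r f : p != 0 -> (forall x, x \in r -> x.2 != 0) ->
  rational_approx v (affinoid v c p r) f -> exists2 B, 0 < B & forall z, affinoid v c p r z -> v (f z) <= B.
Proof.
move=> p0 r0 /(_ 1 ltr01)[P [Q h]].
have [B1 B10 h1] := inv_poly_bounded p0 r0 (fun z hz => proj1 (h z hz)).
have [B2 B20 h2] := poly_bounded P (Num.max (v p) (v c)).
exists (Num.max 1 (B2 * B1)) => [|z hz]; first by rewrite lt_max ltr01.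
have [q0 /ltW hf] := h z hz; rewrite -[f z](subrK (P.[z] / Q.[z])); apply: le_trans (naD Hv _ _) _.
rewrite ge_max !le_max hf /= (naM Hv); apply/orP; right; apply: ler_pM; rewrite ?(na_ge0 Hv) ?h1 //.
by apply/h2/(affinoid_v hz).
Qed.

Local Notation modular := (modular_forms i v Gamma (2 * k) (k%:Z + l)).

Lemma modularP f g z : modular f -> Gamma g -> Omega z ->
  i (\det g) ^ (k%:Z + l) / cocycle i g z ^+ (2 * k) * f (moebius i g z) = f z.
Proof. by move=> [_ h]; apply: h. Qed.

Lemma nu_modular f g z : modular f -> Gamma g -> Omega z -> nu f (moebius i g z) = nu f z.
Proof.
move=> hf Gg hz; rewrite -(v_slash _ (Gamma_det Gg) hz) /nu -[in RHS](modularP hf Gg hz).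
by rewrite !(naM Hv) v_det // mul1r [X in X * _]mulrC.
Qed.

Lemma modular_bounded f : modular f -> exists2 N, 0 < N & forall z, Omega z -> nu f z <= N.
Proof.
move=> hf; have [d d0 [M hM]] := Gamma_cocompact.
have [c [p [r [p0 r0 sub hY]]]] := compact_affinoid M d0.
have [B B0 hB] := rational_approx_bounded p0 r0 (proj1 hf c p r p0 r0 sub).
have M0 : 0 <= Num.max 0 M by rewrite le_max lexx.
exists (B * (Num.max 1 M) ^+ k) => [|z hz]; first by rewrite mulr_gt0 // exprn_gt0 // lt_max ltr01.
have [g [Gg h1 h2]] := hM z hz; rewrite -(nu_modular hf Gg hz).
apply: ler_pM; rewrite ?(na_ge0 Hv) ?exprn_ge0 ?iabs_ge0 //; first exact/hB/hY.
rewrite lerXn2r ?nnegrE ?iabs_ge0 ?le_max ?ler01 //.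
by rewrite (le_trans (iabs_le_v _) h2) orbT.
Qed.

(** * Runge approximation and coefficient bounds *)

Section Runge.
Variables (p p2 : C) (hs : seq C).
Hypotheses (p_neq0 : p != 0) (p2_neq0 : p2 != 0).
Let X := affinoid v 0 p [seq (a, p2) | a <- hs].
Let H : {poly C} := \prod_(a <- hs) ('X - a%:P).

Lemma holeP z : X z -> v z <= v p /\ forall a, a \in hs -> v p2 <= v (z - a).
Proof.
move=> [h1 h2]; rewrite subr0 in h1; split=> // a ah.
by have := h2 (a, p2) (map_f _ ah).
Qed.
Lemma hole_neq z a : X z -> a \in hs -> z - a != 0.
Proof.
by move=> /holeP[_ h] /h; rewrite -(na_gt0 Hv); apply: lt_le_trans; rewrite (na_gt0 Hv).
Qed.
Lemma H_neq0 z : X z -> H.[z] != 0.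
Proof.
move=> hz; rewrite horner_prod prodf_seq_neq0; apply/allP => a ah.
by rewrite hornerXsubC hole_neq.
Qed.

(** Poles only at the centres of the holes and at infinity. Such fractions have expansions in powers
    of H, whose coefficients can be estimated. *)
Definition laurent (f : C -> C) := exists (P : {poly C}) (N : nat), forall z, X z -> f z = P.[z] / H.[z] ^+ N.
Lemma laurentM f g : laurent f -> laurent g -> laurent (fun z => f z * g z).
Proof.
move=> [P [N h]] [P' [N' h']]; exists (P * P'), (N + N')%N => z hz.
have h0 := H_neq0 hz; rewrite h // h' // hornerM exprD.
by field; rewrite !expf_neq0.
Qed.
Lemma laurentD f g : laurent f -> laurent g -> laurent (fun z => f z + g z).
Proof.
move=> [P [N h]] [P' [N' h']]; exists (P * H ^+ N' + P' * H ^+ N), (N + N')%N => z hz.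
have h0 := H_neq0 hz; rewrite h // h' // !(hornerE, horner_exp) exprD.
by field; rewrite !expf_neq0.
Qed.
Lemma laurent_cst c : laurent (fun=> c).
Proof. by exists c%:P, 0%N => z _; rewrite hornerC expr0 divr1. Qed.
Lemma laurent_id : laurent id.
Proof. by exists 'X, 0%N => z _; rewrite hornerX expr0 divr1. Qed.
Lemma laurent_hole a : a \in hs -> laurent (fun z => (z - a)^-1).
Proof.
move=> ah; exists (\prod_(b <- rem a hs) ('X - b%:P)), 1%N => z hz.
have h0 := H_neq0 hz; rewrite /H (perm_big _ (perm_to_rem ah)) big_cons hornerM hornerXsubC /= in h0 *.
by move: h0; rewrite mulf_eq0 negb_or => /andP[h1 h2]; field; rewrite h1 h2.
Qed.
Lemma laurent_X f n : laurent f -> laurent (fun z => f z ^+ n).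
Proof.
move=> hf; elim: n => [|n IH]; first exact: laurent_cst.
by under eq_fun do rewrite exprS; apply: laurentM.
Qed.
Lemma laurent_sum n (f : nat -> C -> C) : (forall m, laurent (f m)) -> laurent (fun z => \sum_(m < n) f m z).
Proof.
move=> hf; elim: n => [|n IH].
  by under eq_fun do rewrite big_ord0; apply: laurent_cst.
by under eq_fun do rewrite big_ord_recr; apply: laurentD.
Qed.

Definition appr (f : C -> C) := forall e, 0 < e -> exists2 g, laurent g & forall z, X z -> v (f z - g z) < e.
Lemma appr_laurent f : laurent f -> appr f.
Proof. by move=> hf e e0; exists f => // z _; rewrite subrr (na0 Hv). Qed.

Lemma apprM f g B B' : appr f -> appr g -> (forall z, X z -> v (f z) <= B) -> (forall z, X z -> v (g z) <= B') ->
  0 < B -> 0 < B' -> appr (fun z => f z * g z).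
Proof.
move=> hf hg fB gB B0 B0' e e0.
have [f' lf' hf'] := hf _ (divr_gt0 e0 B0').
pose B1 := Num.max B (e / B').
have B10 : 0 < B1 by rewrite lt_max B0.
have [g' lg' hg'] := hg _ (divr_gt0 e0 B10).
exists (fun z => f' z * g' z); first exact: laurentM.
move=> z hz; have -> : f z * g z - f' z * g' z = (f z - f' z) * g z + f' z * (g z - g' z) by ring.
have f1 : v (f' z) <= B1.
  rewrite -[f' z](subrK (f z)) addrC; apply: le_trans (naD Hv _ _) _; rewrite ge_max !le_max fB //=.
  by rewrite (naBC Hv) (ltW (hf' _ hz)) orbT.
apply: (na_lt_add Hv); rewrite (naM Hv).
  apply: (@le_lt_trans _ _ (v (f z - f' z) * B')); first by rewrite ler_wpM2l ?(na_ge0 Hv) ?gB.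
  by rewrite -ltr_pdivlMr // hf'.
apply: (@le_lt_trans _ _ (B1 * v (g z - g' z))); first by rewrite ler_wpM2r ?(na_ge0 Hv).
by rewrite mulrC -ltr_pdivlMr // hg'.
Qed.

Lemma geometric_appr (g t : C -> C) th B : laurent g -> laurent t -> 0 <= th -> th < 1 -> 0 < B ->
  (forall z, X z -> v (t z) <= th) -> (forall z, X z -> v (g z) <= B) -> appr (fun z => g z / (1 - t z)).
Proof.
move=> lg lt th0 th1 B0 ht hg e e0.
have [N hN] := expr_small th0 th1 (divr_gt0 e0 B0).
exists (fun z => g z * \sum_(m < N) t z ^+ m).
  by apply: laurentM => //; apply: (@laurent_sum N (fun m z => t z ^+ m)) => m; apply: laurent_X.
move=> z hz.
have t1 : v (t z) < v 1 by rewrite (na1 Hv) (le_lt_trans (ht z hz)).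
have d0 : v (1 - t z) = 1 by rewrite (na_eq_subl Hv t1) (na1 Hv).
have d1 : 1 - t z != 0 by rewrite -(na_eq0 Hv) d0 oner_eq0.
have -> : g z / (1 - t z) - g z * (\sum_(m < N) t z ^+ m) = g z * t z ^+ N / (1 - t z).
  have : t z ^+ N - 1 = (t z - 1) * \sum_(m < N) t z ^+ m by rewrite subrX1.
  move=> /eqP; rewrite subr_eq => /eqP ->; by field.
rewrite (naF Hv) d0 divr1 (naM Hv) (naX Hv).
apply: (@le_lt_trans _ _ (B * th ^+ N)); last by rewrite mulrC -ltr_pdivlMr // hN.
by apply: ler_pM; rewrite ?exprn_ge0 ?(na_ge0 Hv) ?hg // lerXn2r ?nnegrE ?(na_ge0 Hv) ?ht.
Qed.

Lemma appr_ext f g : (forall z, X z -> f z = g z) -> appr f -> appr g.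
Proof.
by move=> e hf ep ep0; have [h lh hh] := hf _ ep0; exists h => // z hz; rewrite -e // hh.
Qed.

(** A geometric series: in z / rho if rho lies outside the disc, otherwise around the centre of the
    hole that contains rho. *)
Lemma appr_pole rho : ~ X rho -> appr (fun z => (z - rho)^-1).
Proof.
move=> hr; have [h|h] := ltP (v p) (v rho).
  have r0 : rho != 0 by rewrite -(na_gt0 Hv) (le_lt_trans (na_ge0 Hv p)).
  have vr : 0 < v rho by rewrite (na_gt0 Hv).
  apply: (@appr_ext (fun z => (- rho^-1) / (1 - z / rho))).
    move=> z hz; have : z - rho != 0.
      rewrite subr_eq0; apply: contraTneq h => <-; rewrite -leNgt; by case: (holeP hz).
    move=> zr; have -> : 1 - z / rho = - (z - rho) / rho by field.
    have rz : rho - z != 0 by rewrite -opprB oppr_eq0.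
    by field; rewrite ?zr ?rz ?oppr_eq0 ?r0 ?zr ?rz.
  apply: (@geometric_appr _ _ (v p / v rho) (v rho^-1)).
  - exact: laurent_cst.
  - by apply: laurentM; [exact: laurent_id|exact: laurent_cst].
  - by rewrite divr_ge0 ?(na_ge0 Hv).
  - by rewrite ltr_pdivrMr // mul1r.
  - by rewrite (na_gt0 Hv) invr_eq0.
  - by move=> z /holeP[hz _]; rewrite (naF Hv) ler_pM2r ?invr_gt0.
  - by move=> z _; rewrite (naN Hv).
have [a ah ha] : exists2 a, a \in hs & v (rho - a) < v p2.
  apply: contrapT => no; apply: hr; split; first by rewrite subr0.
  move=> _ /mapP[a ah ->] /=; rewrite leNgt; apply/negP => h2; by apply: no; exists a.
have vp2 : 0 < v p2 by rewrite (na_gt0 Hv).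
apply: (@appr_ext (fun z => (z - a)^-1 / (1 - (rho - a) / (z - a)))).
  move=> z hz; have za := hole_neq hz ah.
  have zr : z - rho != 0.
    rewrite subr_eq0; apply: contraTneq ha => <-; rewrite -leNgt.
    by have [_ /(_ a ah)] := holeP hz.
  have -> : 1 - (rho - a) / (z - a) = (z - rho) / (z - a) by field.
  by field; rewrite za zr.
apply: (@geometric_appr _ _ (v (rho - a) / v p2) (v p2)^-1).
- exact: laurent_hole.
- by apply: laurentM; [exact: laurent_cst|exact: laurent_hole].
- by rewrite divr_ge0 ?(na_ge0 Hv).
- by rewrite ltr_pdivrMr // mul1r.
- by rewrite invr_gt0.
- move=> z hz; have [_ /(_ a ah) h2] := holeP hz; rewrite (naF Hv) ler_wpM2l ?(na_ge0 Hv) //.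
  by rewrite lef_pV2 ?posrE // (lt_le_trans vp2).
- move=> z hz; have [_ /(_ a ah) h2] := holeP hz; rewrite (naV Hv).
  by rewrite lef_pV2 ?posrE // (lt_le_trans vp2).
Qed.

Lemma holes_neq0 x : x \in [seq (a, p2) | a <- hs] -> x.2 != 0.
Proof. by move=> /mapP[a _ ->]. Qed.

Lemma appr_inv (Q : {poly C}) : (forall z, X z -> Q.[z] != 0) -> appr (fun z => Q.[z]^-1).
Proof.
move=> hQ; have [c [rs QE]] := horner_factor Q.
(* If Q is zero, then [hQ] says that X is empty. *)
have [c0|c0] := eqVneq c 0.
  move=> e e0; exists (fun=> 0); first exact: laurent_cst.
  by move=> z /hQ; rewrite QE c0 mul0r eqxx.
have : forall x, x \in rs -> ~ X x.
  move=> x xr /hQ; rewrite QE => /negP; apply; rewrite mulf_eq0 (negbTE c0) /= prodf_seq_eq0.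
  by apply/hasP; exists x => //; rewrite subrr eqxx.
move=> far; under eq_fun do rewrite QE invfM.
have bnd rs' : (forall x, x \in rs' -> ~ X x) ->
    exists2 B, 0 < B & forall z, X z -> v (\prod_(r <- rs') (z - r))^-1 <= B.
  move=> far'; have E z : \prod_(r <- rs') (z - r) = (\prod_(r <- rs') ('X - r%:P)).[z].
    by rewrite horner_prod; apply: eq_bigr => r _; rewrite hornerXsubC.
  have [|B B0 hB] := @inv_poly_bounded 0 p _ (\prod_(r <- rs') ('X - r%:P)) p_neq0 holes_neq0; last first.
    by exists B => // z hz; rewrite E; apply: hB.
  move=> z hz; rewrite -E prodf_seq_neq0; apply/allP => r /far' hr; rewrite subr_eq0.
  by apply/eqP => e; apply: hr; rewrite -e.
have [B B0 hB] := bnd rs far.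
apply: (@apprM _ _ (v c^-1) B) => //; last by rewrite (na_gt0 Hv) invr_eq0.
  by apply/appr_laurent/laurent_cst.
elim: rs far {QE hB} => [|x rs IH] far.
  by under eq_fun do rewrite big_nil; apply/appr_laurent/laurent_cst.
have far' y : y \in rs -> ~ X y by move=> h; apply: far; rewrite inE h orbT.
have farx y : y \in [:: x] -> ~ X y by rewrite inE => /eqP->; apply: far; rewrite mem_head.
have [B1 B10 h1] := bnd _ far'; have [B2 B20 h2] := bnd _ farx.
under eq_fun do rewrite big_cons invfM.
apply: (@apprM _ _ B2 B1) => //; [exact/appr_pole/farx/mem_head|exact: IH|].
by move=> z /h2; rewrite big_seq1.
Qed.

Lemma runge f : rational_approx v X f -> forall e, 0 < e ->
  exists (P : {poly C}) N, forall z, X z -> v (f z - P.[z] / H.[z] ^+ N) < e.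
Proof.
move=> hf e e0; have [P [Q h]] := hf _ e0.
have hQ z : X z -> Q.[z] != 0 by move=> /h[].
have [B B0 hB] := inv_poly_bounded p_neq0 holes_neq0 hQ.
have [B' B0' hB'] := poly_bounded P (v p).
have : appr (fun z => P.[z] * Q.[z]^-1).
  apply: (@apprM _ _ B' B) => //; last by move=> z /holeP[/hB'].
    by apply: appr_laurent; exists P, 0%N => z _; rewrite expr0 divr1.
  exact: appr_inv.
move=> /(_ e e0)[g [P' [N gE]] hg]; exists P', N => z hz; rewrite -gE //.
by apply: (na_lt_trans Hv (y := P.[z] / Q.[z])); [have [] := h z hz|apply: hg].
Qed.
End Runge.

Lemma charC : exists2 p, prime p & p \in [pchar C].
Proof.
have [p pp cp] := finPcharP Fq; exists p => //.
by apply: (rmorph_pchar i); apply: (rmorph_pchar kap).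
Qed.

(** For m = p ^ (d + 1) - 1 one has m = -1 in C, so |m| = 1 and X ^ m - 1 is separable. *)
Lemma exists_prim_root d : exists2 m, (d < m)%N & (v m%:R = 1) /\ exists w : C, m.-primitive_root w.
Proof.
have [p pp cp] := charC; have p1 := prime_gt1 pp.
have pd : (d.+2 <= p ^ d.+1)%N by apply: ltn_expl.
pose m := (p ^ d.+1).-1.
have mE : m.+1 = (p ^ d.+1)%N by rewrite /m prednK // (leq_trans _ pd).
have mC : m%:R = -1 :> C.
  apply/eqP; rewrite -addr_eq0 -[1]/(1%:R) -natrD addn1 mE expnS natrM (pcharf0 cp) mul0r //.
have m0 : m%:R != 0 :> C by rewrite mC oppr_eq0 oner_eq0.
exists m; first by rewrite -ltnS mE.
split; first by rewrite mC (naN Hv) (na1 Hv).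
have [rs e] := closed_field_splits Cclosed ('X^m - 1 : {poly C}).
have mpos : (0 < m)%N by rewrite -ltnS mE (leq_trans _ pd).
have lc : lead_coef ('X^m - 1 : {poly C}) = 1 by rewrite (monicP (monicXnsubC _ _)) ?polyC1.
rewrite lc scale1r in e.
have srs : size rs = m.
  by have := congr1 (fun q : {poly C} => size q) e; rewrite size_prod_XsubC size_XnsubC // => -[].
have /hasP[w _ hw] : has m.-primitive_root rs.
  apply: cyclic.has_prim_root => //; rewrite ?srs //.
    apply/allP => x xr; apply/unity_rootP; apply/eqP; rewrite -subr_eq0.
    have : root ('X^m - 1 : {poly C}) x by rewrite e root_prod_XsubC.
    by rewrite /root !hornerE.
  by rewrite -separable_prod_XsubC -e separable_Xn_sub_1.
by exists w.
Qed.

(** Cauchy's estimate by Fourier inversion over the m-th roots of unity: m exceeds the degree, so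
    one coefficient survives, and the division by m costs nothing as |m| = 1. *)
Lemma gauss_coef (P : {poly C}) t B n : 0 <= B -> (forall z, v z = v t -> v P.[z] <= B) ->
  v P`_n * v t ^+ n <= B.
Proof.
move=> B0 hP; have [nP|nP] := leqP (size P) n; first by rewrite nth_default // (na0 Hv) mul0r.
have [m Pm [vm [w hw]]] := exists_prim_root (size P).
have vw a : v (w ^+ a) = 1.
  rewrite (naX Hv) (@na_finite_order _ _ _ Hv w m) ?expr1n ?(prim_expr_order hw) //.
  by apply: leq_ltn_trans Pm.
have E : \sum_(j < m) w ^+ (j * (m - n)) * P.[w ^+ j * t] = m%:R * (P`_n * t ^+ n).
  under eq_bigr do rewrite horner_coef mulr_sumr.
  rewrite exchange_big /= (bigD1 (Ordinal nP)) //= [X in _ + X]big1 ?addr0.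
    under eq_bigr => j _.
      have -> : w ^+ (j * (m - n)) * (P`_n * (w ^+ j * t) ^+ n) = P`_n * t ^+ n.
        have -> : w ^+ (j * (m - n)) * (P`_n * (w ^+ j * t) ^+ n) = (w ^+ (j * (m - n)) * (w ^+ j) ^+ n) * (P`_n * t ^+ n).
          by rewrite exprMn; ring.
        by rewrite -exprM -exprD -mulnDr subnK ?(leq_trans _ (ltnW Pm)) ?(ltnW nP) // mulnC exprM (prim_expr_order hw) expr1n mul1r.
      over.
    by rewrite sumr_const card_ord mulr_natl.
  move=> a an; have -> : \sum_(j < m) w ^+ (j * (m - n)) * (P`_a * (w ^+ j * t) ^+ a) =
      P`_a * t ^+ a * \sum_(j < m) (w ^+ (m - n + a)) ^+ j.
    rewrite mulr_sumr; apply: eq_bigr => j _.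
    by rewrite exprMn -!exprM mulnDl exprD [(j * (m - n))%N]mulnC [(j * a)%N]mulnC; ring.
  have y1 : w ^+ (m - n + a) != 1.
    rewrite -(prim_order_dvd hw); apply: contraNN an => dv.
    have nm : (n < m)%N by apply: ltn_trans Pm.
    have am : (a < m)%N by apply: ltn_trans Pm.
    apply/eqP/val_inj => /=; case: (ltngtP a n) => // h; move: dv.
      by rewrite gtnNdvd //; lia.
    have -> : (m - n + a = m + (a - n))%N by lia.
    by rewrite dvdn_addr // gtnNdvd //; lia.
  have : (w ^+ (m - n + a) - 1) * \sum_(j < m) (w ^+ (m - n + a)) ^+ j = 0.
    by rewrite -subrX1 -exprM mulnC exprM (prim_expr_order hw) expr1n subrr.
  by move=> /eqP; rewrite mulf_eq0 subr_eq0 (negbTE y1) /= => /eqP->; rewrite mulr0.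
have := congr1 v E; rewrite !(naM Hv) (naX Hv) vm mul1r => <-.
apply: (na_sum Hv) => // j _; rewrite (naM Hv) vw mul1r; apply: hP.
by rewrite (naM Hv) vw mul1r.
Qed.

(** * Approximation over an edge *)

Lemma vK_nonint (n : int) x : (n %% 4 != 0)%Z -> vK x != s ^ n.
Proof.
move=> h; have [->|x0] := eqVneq x 0; first by rewrite (na0 HvK) lt_eqF // sz_gt0.
by have [m ->] := valK x0; rewrite eq_sz; apply: contraNneq h => <-; rewrite modzMr.
Qed.

Lemma iabs_nonint z : (forall x, vK x != v z) -> iabs z = v z.
Proof.
move=> h; apply/le_anti/andP; split; first exact: iabs_le_v.
by apply: le_iabs => x; rewrite (na_sub_neq Hv) ?viE 1?eq_sym // le_max lexx.
Qed.
Lemma iabs_annulus z : s ^+ 4 < v z -> v z < 1 -> iabs z = v z.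
Proof.
move=> h1 h2; apply: iabs_nonint => x; apply/eqP => e.
have : vK x <= s ^+ 4 by apply: vK_lt1; rewrite e.
by rewrite e leNgt h1.
Qed.


(** On the closed annulus from s ^ 3 to s the function is close to a Laurent polynomial. Its
    coefficients are estimated on the two boundary circles; on the middle circle every term except
    the one in z ^ (-k) is then smaller by a factor s. *)
Lemma edge_local f N : rigid_holomorphic i v f -> 0 < N -> (forall z, Omega z -> nu f z <= N) ->
  exists2 lam, v lam <= N & forall z, v z = s ^+ 2 -> v (f z - lam / z ^+ k) * s ^+ (2 * k) <= s * N.
Proof.
move=> hf N0 fN.
have sig0 : sig != 0 by rewrite -(na_gt0 Hv) vsig.
have sig3 : sig ^+ 3 != 0 by rewrite expf_neq0.
have vs3 : v (sig ^+ 3) = s ^+ 3 by rewrite (naX Hv) vsig.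
have sub : affinoid v 0 sig [seq (a, sig ^+ 3) | a <- [:: 0]] `<=` Omega.
  move=> z /holeP[h1 /(_ 0 (mem_head _ _))]; rewrite subr0 vs3 => h2.
  apply/OmegaP; rewrite iabs_annulus; first exact: lt_le_trans (sX_gt0 3) h2.
    by apply: lt_le_trans h2; rewrite sX_lt.
  by apply: le_lt_trans h1 _; rewrite vsig.
have sN0 : 0 < s * N by rewrite mulr_gt0.
have holes := @holes_neq0 (sig ^+ 3) [:: 0] sig3.
have [P [m hP]] := runge sig0 sig3 (hf _ _ _ sig0 holes sub) sN0.
rewrite big_seq1 subr0 in hP.
(* With denominator z ^ (m + k), coefficient m of P' is the coefficient of z ^ (-k), whether or not
   m >= k. *)
pose P' := P * 'X^k.
have hP' z : s ^+ 3 <= v z -> v z <= s -> v (f z - P'.[z] / z ^+ (m + k)) < s * N.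
  move=> h1 h2; have z0 : z != 0 by rewrite -(na_gt0 Hv) (lt_le_trans (sX_gt0 3)).
  have -> : P'.[z] / z ^+ (m + k) = P.[z] / 'X.[z] ^+ m.
    by rewrite hornerM hornerXn hornerX exprD; field; rewrite !expf_neq0.
  apply: hP; split; first by rewrite subr0 vsig.
  by move=> x; rewrite inE => /eqP -> /=; rewrite subr0 vs3.
have bnd z (j : nat) : (0 < j < 4)%N -> v z = s ^+ j -> v P'.[z] <= N * s ^+ (j * m).
  move=> /andP[j0 j4] vz.
  have z0 : z != 0 by rewrite -(na_gt0 Hv) vz sX_gt0.
  have vz1 : v z <= s by rewrite vz -{2}[s]expr1 sX_le.
  have vz3 : s ^+ 3 <= v z by rewrite vz sX_le.
  have iz : iabs z = v z.
    by apply: iabs_annulus; [apply: lt_le_trans vz3; rewrite sX_lt|apply: le_lt_trans vz1 _].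
  have hz : Omega z by apply/OmegaP; rewrite iz vz sX_gt0.
  have : v (P'.[z] / z ^+ (m + k)) * v z ^+ k <= N.
    rewrite -[_ / _](subrK (f z)) addrC; apply: le_trans (_ : Num.max (v (f z)) (s * N) * v z ^+ k <= N).
      rewrite ler_wpM2r ?exprn_ge0 ?(na_ge0 Hv) //; apply: le_trans (naD Hv _ _) _.
      by rewrite ge_max !le_max lexx (naBC Hv) (ltW (hP' _ vz3 vz1)) orbT.
    rewrite maxr_pMl ?exprn_ge0 ?(na_ge0 Hv) // ge_max; have := fN _ hz; rewrite /nu iz => -> /=.
    rewrite vz -exprM -mulrA mulrCA -exprS ler_piMr ?(ltW N0) // exprn_ile1 ?(ltW s_gt0) ?(ltW s_lt1) //.
  rewrite (naF Hv) (naX Hv) vz -!exprM mulnDr exprD invfM => h.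
  rewrite -ler_pdivrMr ?sX_gt0 //; apply: le_trans h.
  by rewrite !mulrA mulfVK ?gt_eqF ?sX_gt0.
have vsj (j : nat) : v (sig ^+ j) = s ^+ j by rewrite (naX Hv) vsig.
have g1 n : v P'`_n * s ^+ n <= N * s ^+ m.
  rewrite -{1}vsig; apply: gauss_coef => [|z]; first by rewrite mulr_ge0 ?(ltW N0) ?(ltW (sX_gt0 _)).
  by rewrite vsig => vz; rewrite -[m]mul1n; apply: bnd.
have g3 n : v P'`_n * s ^+ (3 * n) <= N * s ^+ (3 * m).
  rewrite exprM -{1}(vsj 3%N); apply: gauss_coef => [|z]; first by rewrite mulr_ge0 ?(ltW N0) ?(ltW (sX_gt0 _)).
  by rewrite vsj => vz; apply: bnd.
have Nm j : 0 <= N * s ^+ j by rewrite mulr_ge0 ?(ltW N0) ?(ltW (sX_gt0 _)).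
exists P'`_m; first by have := g1 m; rewrite ler_pM2r ?sX_gt0.
move=> z vz; have z0 : z != 0 by rewrite -(na_gt0 Hv) vz sX_gt0.
have s2k : s ^+ (2 * k) = v (z ^+ k) by rewrite (naX Hv) vz exprM.
rewrite s2k -(naM Hv).
have -> : (f z - P'`_m / z ^+ k) * z ^+ k =
   (f z - P'.[z] / z ^+ (m + k)) * z ^+ k + (P' - P'`_m *: 'X^m).[z] / z ^+ m.
  by rewrite hornerD hornerN hornerZ hornerXn exprD; field; rewrite !expf_neq0.
apply: (na_le_add Hv).
  rewrite (naM Hv) -[leRHS]mulr1; apply: ler_pM; rewrite ?(na_ge0 Hv) //.
    by apply/ltW/hP'; rewrite vz ?sX_le // -{2}[s]expr1 sX_le.
  by rewrite (naX Hv) vz -exprM exprn_ile1 ?(ltW s_gt0) ?(ltW s_lt1).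
rewrite (naF Hv) (naX Hv) vz -exprM ler_pdivrMr ?sX_gt0 //.
rewrite horner_coef; apply: (na_sum Hv) => [|n _].
  by rewrite mulr_ge0 ?(ltW (sX_gt0 _)) ?(ltW sN0).
rewrite (naM Hv) (naX Hv) vz -exprM coefB coefZ coefXn.
(* Below degree m the inner circle gives the gain, above degree m the outer one: each step away from
   m is worth a factor s. *)
case: (ltngtP n m) => h.
- rewrite mulr0 subr0 -(ler_pM2r (sX_gt0 n)) -mulrA -exprD.
  have -> : (2 * n + n = 3 * n)%N by clear; lia.
  apply: le_trans (g3 n) _; have -> : s * N * s ^+ (2 * m) * s ^+ n = N * s ^+ (1 + 2 * m + n).
    by rewrite !exprD expr1; ring.
  by rewrite ler_pM2l // sX_le; move: h; clear; lia.
- rewrite mulr0 subr0.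
  have -> : (2 * n = n + n)%N by clear; lia.
  rewrite exprD mulrA; apply: (@le_trans _ _ (N * s ^+ m * s ^+ n)).
    by rewrite ler_pM2r ?sX_gt0.
  have -> : s * N * s ^+ (2 * m) = N * s ^+ m * s ^+ (m + 1) by rewrite mul2n -addnn !exprD expr1; ring.
  by rewrite ler_pM2l ?mulr_gt0 ?sX_gt0 // sX_le; move: h; clear; lia.
- by rewrite h mulr1 subrr (na0 Hv) mul0r mulr_ge0 ?(ltW (sX_gt0 _)) ?(ltW sN0).
Qed.

Hypothesis k_ge2 : (2 <= k)%N.

(* the geodesics from 0 to oo and from vpi to 1 share exactly one edge *)
Definition edge_data : poincare_data K :=
  @PoincareData K 2 (fun t => if t == 0 then k.-1 else 1%N)
    (fun t => Some (if t == 0 then 0 else vpi)) (fun t => if t == 0 then None else Some 1).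

Lemma vpi_neq0 : vpi != 0. Proof. by rewrite -(na_gt0 HvK) vpiE sX_gt0. Qed.
Lemma vpi_neq1 : vpi != 1.
Proof. by apply/eqP => e; have := vpiE; rewrite e (na1 HvK) => /eqP; rewrite gt_eqF // exprn_ilt1 ?(ltW s_gt0). Qed.

Lemma edge_adm : adm edge_data.
Proof.
have o2 (x : 'I_2) : x = 0 \/ x = 1 by case: x => [[|[|]]] // h; [left|right]; apply/val_inj.
split=> //=.
- split=> [t|]; first by case: eqP => // _; case: (k) k_ge2 => [|[]].
  by rewrite !big_ord_recl big_ord0 /= addn0 addn1 prednK // ltnW.
- move=> t; case: ifP => // _ [e]; have := vpi_neq1; by rewrite e eqxx.
- have key : [set Some 0; None] <> [set Some vpi; Some 1 : P1 K].
    move=> /seteqP[/(_ None) h _]; case: (h (or_intror erefl)) => //.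
  by move=> t t'; case: (o2 t) => ->; case: (o2 t') => -> //= _ // /esym.
- apply/seteqP; split => // x hx; have /= h0 := hx 0 I; have /= h1 := hx 1 I.
  case: h0 => e0; case: h1; rewrite e0 // => -[e].
    by have := vpi_neq0; rewrite -e eqxx.
  by have := oner_neq0 K; rewrite -e eqxx.
Qed.

Lemma edge_Phi z : Omega z ->
  Phi edge_data z = (- z^-1) ^+ k.-1 * ((1 - i vpi) / ((z - 1) * (z - i vpi))).
Proof.
move=> hz; rewrite /Phi /edge_data /= !big_ord_recl big_ord0 mulr1 /u_fun /= expr1 rmorph0 subr0 rmorph1 sub0r.
congr (_ * _); have h1 := Omega_sub 1 hz; have h2 := Omega_sub vpi hz; rewrite rmorph1 in h1.
by field; rewrite h1 h2.
Qed.

(** For |vpi| < |z| < 1 the factor u(z; vpi, 1) is close to -1/z, which is the other factor. The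
    error has numerator z ^ 2 - 2 vpi z + vpi, of absolute value at most s ^ 4. *)
Lemma edge_Phi_near z : v z = s ^+ 2 ->
  v (Phi edge_data z - (-1) ^+ k / z ^+ k) * s ^+ (2 * k) <= s.
Proof.
move=> vz.
have iz : iabs z = v z by apply: iabs_annulus; rewrite vz ?sX_lt // exprn_ilt1 ?(ltW s_gt0).
have hz : Omega z by apply/OmegaP; rewrite iz vz sX_gt0.
have z0 : z != 0 by rewrite -(na_gt0 Hv) vz sX_gt0.
have h1 := Omega_sub 1 hz; have h2 := Omega_sub vpi hz; rewrite rmorph1 in h1.
have vi : v (i vpi) = s ^+ 4 by rewrite viE.
have v1 : v (z - 1) = 1 by rewrite (na_eq_subr Hv) (na1 Hv) // vz exprn_ilt1 ?(ltW s_gt0).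
have v2 : v (z - i vpi) = s ^+ 2 by rewrite (na_eq_subl Hv) ?vz // vi sX_lt.
rewrite edge_Phi //; case: (k) k_ge2 => // k' _; rewrite /=.
have -> : (- z^-1) ^+ k' * ((1 - i vpi) / ((z - 1) * (z - i vpi))) - (-1) ^+ k'.+1 / z ^+ k'.+1
   = (-1) ^+ k' / z ^+ k' * ((z ^+ 2 - i vpi *+ 2 * z + i vpi) / (z * (z - 1) * (z - i vpi))).
  have -> : (- z^-1) ^+ k' = (-1) ^+ k' / z ^+ k' by rewrite (exprNn z^-1) exprVn.
  by rewrite !exprS; field; rewrite h1 h2 z0 expf_neq0.
rewrite (naM Hv) !(naF Hv) !(naM Hv) !(naX Hv) (naN Hv) (na1 Hv) expr1n v1 v2 vz mulr1 mul1r.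
have num : v (z ^+ 2 - i vpi *+ 2 * z + i vpi) <= s ^+ 4.
  apply: (na_le_add Hv); last by rewrite vi.
  apply: (na_le_sub Hv); first by rewrite (naX Hv) vz -exprM.
  rewrite -mulr_natr !(naM Hv) vi vz -mulrA ler_piMr ?(ltW (sX_gt0 _)) //.
  by rewrite mulr_ile1 ?(na_ge0 Hv) ?(ltW (sX_gt0 _)) ?(na_nat_le1 Hv) // exprn_ile1 ?(ltW s_gt0) ?(ltW s_lt1).
apply: (@le_trans _ _ ((s ^+ 2 ^+ k')^-1 * 1 * s ^+ (2 * k'.+1))).
  rewrite ler_pM2r ?sX_gt0 // ler_pM2l ?invr_gt0 ?exprn_gt0 // ler_pdivrMr ?mulr_gt0 ?sX_gt0 //.
  by rewrite mul1r -exprD.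
rewrite mulr1 -exprM mulnS exprD mulrCA mulVf ?gt_eqF ?sX_gt0 // mulr1 -{2}[s]expr1 sX_le //.
Qed.

(** If iabs z < |z|, then z is off the geodesic from 0 to infinity and the first factor is small.
    Otherwise z lies over another edge of this geodesic, which is not on the second geodesic, and
    the second factor is small. *)
Lemma edge_Phi_small z (n : int) : Omega z -> iabs z = s ^ (4 * n + 2) -> v z != s ^+ 2 ->
  nu (Phi edge_data) z <= s.
Proof.
move=> hz iz vz.
have z0 : 0 < v z by apply: lt_le_trans (iabs_le_v z); apply: iabs_gt0.
have s2 : s ^+ 2 <= s by rewrite -{2}[s]expr1 sX_le.
have n1 : nu1 z (Some 0) None = iabs z / v z.
  by rewrite /nu1 /u_fun /= rmorph0 subr0 sub0r (naN Hv) (naV Hv) mulrC.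
have [lt|ge] := ltP (iabs z) (v z).
  have [x xz] : exists x, vK x = v z.
    apply: contrapT => no; suff e : iabs z = v z by rewrite e ltxx in lt.
    by apply: iabs_nonint => x; apply/eqP => e; apply: no; exists x.
  have x0 : x != 0 by rewrite -(na_gt0 HvK) xz.
  have [m xm] := valK x0.
  apply: le_trans (@nu_Phi_le edge_data z (0 : 'I_2) edge_adm hz) _; rewrite /= n1 ler_pdivrMr //.
  apply: le_trans (_ : s ^+ 2 * v z <= _); last by rewrite ler_pM2r.
  rewrite iz -xz xm exprnP -szD le_sz; move: lt; rewrite iz -xz xm lt_sz; clear; lia.
have e : v z = s ^ (4 * n + 2) by rewrite -iz; apply/le_anti; rewrite ge iabs_le_v.
have n0 : n <> 0 by move=> n0; move: vz; rewrite e n0 mulr0 add0r eqxx.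
apply: le_trans (@nu_Phi_le edge_data z (1 : 'I_2) edge_adm hz) _; rewrite /= /nu1 /u_fun /=.
have h1 := Omega_sub 1 hz; have h2 := Omega_sub vpi hz.
have -> : (z - i 1)^-1 - (z - i vpi)^-1 = (i 1 - i vpi) / ((z - i 1) * (z - i vpi)).
  by rewrite rmorph1 in h1 *; field; rewrite h1 h2.
rewrite (naF Hv) (naM Hv) -rmorphB viE.
have v1p : vK (1 - vpi) = 1.
  by rewrite (na_eq_subl HvK) (na1 HvK) // vpiE exprn_ilt1 ?(ltW s_gt0).
rewrite v1p mul1r; apply: le_trans s2.
have [npos|nneg] : (1 <= n) \/ (n <= -1) by move: n0; clear; lia.
  have zsmall : v z < s ^+ 4 by rewrite e exprnP lt_sz; move: npos; clear; lia.
  have -> : v (z - i 1) = 1.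
    by rewrite (na_eq_subr Hv) viE (na1 HvK) // (lt_trans zsmall) // exprn_ilt1 ?(ltW s_gt0).
  have -> : v (z - i vpi) = s ^+ 4 by rewrite (na_eq_subr Hv) viE vpiE.
  by rewrite mul1r mulrC ler_pdivrMr ?sX_gt0 // iz -exprD exprnP le_sz; move: npos; clear; lia.
have zbig : 1 < v z by rewrite e -[1](expr0z s) lt_sz; move: nneg; clear; lia.
have -> : v (z - i 1) = v z by rewrite (na_eq_subl Hv) // viE (na1 HvK).
have -> : v (z - i vpi) = v z.
  by rewrite (na_eq_subl Hv) // viE vpiE (lt_trans _ zbig) // exprn_ilt1 ?(ltW s_gt0).
rewrite mulrC ler_pdivrMr ?mulr_gt0 // iz e exprnP -!szD le_sz; move: nneg; clear; lia.
Qed.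

(** * Pieces above vertices and edges *)

Definition aff a b := mx4 a b 0 1.
Lemma det_aff a b : \det (aff a b) = a. Proof. by rewrite det_mx4 mulr1 mulr0 subr0. Qed.
Lemma aff_neq0 a b : a != 0 -> \det (aff a b) != 0. Proof. by rewrite det_aff. Qed.
Lemma affE a b z : moebius i (aff a b) z = i a * z + i b.
Proof. by rewrite /moebius /cocycle !mx4E rmorph0 rmorph1 mul0r add0r divr1. Qed.
Lemma cocycle_aff a b z : cocycle i (aff a b) z = 1.
Proof. by rewrite /cocycle !mx4E rmorph0 rmorph1 mul0r add0r. Qed.
Lemma iabs_aff a b z : a != 0 -> Omega z -> iabs (i a * z + i b) = vK a * iabs z.
Proof.
by move=> a0 hz; rewrite -affE iabs_moebius ?aff_neq0 // cocycle_aff det_aff (na1 Hv) expr1n divr1.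
Qed.
Lemma Omega_aff a b z : a != 0 -> Omega z -> Omega (i a * z + i b).
Proof. by move=> a0 hz; rewrite -affE; apply: moebius_Omega => //; apply: aff_neq0. Qed.

(** The weight 2k slash by [aff a b], with the power of the determinant that preserves nu even when
    |a| is not 1. *)
Definition faff a b (f : C -> C) : C -> C := fun z => i a ^+ k * f (i a * z + i b).

Lemma nu_faff a b f z : a != 0 -> Omega z -> nu (faff a b f) z = nu f (i a * z + i b).
Proof. by move=> a0 hz; rewrite /nu /faff iabs_aff // (naM Hv) (naX Hv) viE exprMn; ring. Qed.

Lemma rigid_faff a b f : a != 0 -> rigid_holomorphic i v f -> rigid_holomorphic i v (faff a b f).
Proof.
move=> a0 hf c p r p0 r0 sub e e0.
have ia0 : i a != 0 by rewrite fmorph_eq0.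
have va : 0 < v (i a) by rewrite (na_gt0 Hv).
pose r' := [seq (i a * x.1 + i b, i a * x.2) | x <- r].
have img z : affinoid v c p r z <-> affinoid v (i a * c + i b) (i a * p) r' (i a * z + i b).
  have e1 y : i a * z + i b - (i a * y + i b) = i a * (z - y) by ring.
  split=> -[h1 h2]; split.
  - by rewrite e1 !(naM Hv) ler_pM2l.
  - by move=> _ /mapP[x xr ->] /=; rewrite e1 !(naM Hv) ler_pM2l // h2.
  - by move: h1; rewrite e1 !(naM Hv) ler_pM2l.
  - move=> x xr; have := h2 _ (map_f _ xr); by rewrite /= e1 !(naM Hv) ler_pM2l.
have p1 : i a * p != 0 by rewrite mulf_neq0.
have r1 x : x \in r' -> x.2 != 0 by move=> /mapP[y yr ->] /=; rewrite mulf_neq0 // r0.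
have sub1 : affinoid v (i a * c + i b) (i a * p) r' `<=` Omega.
  move=> w hw; have wE : w = i a * (i a^-1 * w + i (- b / a)) + i b.
    by rewrite rmorphM !fmorphV rmorphN; field.
  rewrite wE; apply: Omega_aff => //; apply: sub; apply/img; by rewrite -wE.
have [P [Q h]] := hf _ _ _ p1 r1 sub1 (e / v (i a) ^+ k) (divr_gt0 e0 (exprn_gt0 _ va)).
exists (i a ^+ k *: (P \Po (i a *: 'X + (i b)%:P))), (Q \Po (i a *: 'X + (i b)%:P)) => z hz.
have [q0 hh] := h _ (proj1 (img z) hz).
rewrite hornerZ !horner_comp !hornerE; split=> //.
by rewrite /faff -mulrA -mulrBr (naM Hv) (naX Hv) mulrC -ltr_pdivlMr ?exprn_gt0.
Qed.

Lemma Phi_aff a b D z : adm D -> a != 0 -> Omega z -> faff a b (Phi (act (aff a b) D)) z = Phi D z.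
Proof.
move=> hD a0 hz; rewrite /faff -affE Phi_moebius ?aff_neq0 // cocycle_aff det_aff expr1n mulrA -exprMn.
by rewrite mul1r mulfV ?expr1n ?mul1r // fmorph_eq0.
Qed.

Lemma int_range_mem (m : int) (n : nat) : - n%:Z <= m <= n%:Z ->
  m \in [seq j%:Z - n%:Z | j <- iota 0 (n + n).+1].
Proof.
move=> /andP[h1 h2]; have h0 : 0 <= m + n%:Z by rewrite -lerBlDr sub0r.
apply/mapP; exists (absz (m + n%:Z)); last by rewrite gez0_abs // addrK.
by rewrite mem_iota add0n /= ltnS -lez_nat gez0_abs // PoszD lerD2r.
Qed.

Hypothesis Gamma_tame : forall G, G `<=` Gamma -> finite_set G -> G 1 ->
  (forall g h, G g -> G h -> G (g * h)) -> (forall g, G g -> G g^-1) -> #|` fset_set G|%:R != 0 :> K.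

(* A piece is the part of the half-plane lying above a vertex or an edge of the tree. *)
Section Pieces.
Variables (P0 : set C) (rho : K).
Hypothesis P0_Omega : P0 `<=` Omega.
(** rho is 1 for the vertex and [vpi] for the edge. Unit dilations, the translations by |b| <= |rho|
    and the inversion z to rho / z generate enough of the stabilizer of P0; by [P0_disj] every other
    affine map moves P0 off itself. *)
Hypothesis rho_val : vK rho = 1 \/ vK rho = s ^+ 4.
Hypothesis P0_unit : forall a w, vK a = 1 -> P0 w -> P0 (i a * w).
Hypothesis P0_trans : forall b w, vK b <= vK rho -> P0 w -> P0 (w + i b).
Hypothesis P0_inv : forall w, P0 w -> P0 (i rho / w).
Hypothesis P0_disj : forall a b w, a != 0 -> P0 w -> P0 (i a * w + i b) -> vK a = 1 /\ vK b <= vK rho.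
Hypothesis P0_bounded : exists2 d, 0 < d & exists M, forall w, P0 w -> d <= iabs w /\ v w <= M.
Hypothesis P0_nonempty : exists w, P0 w.

Lemma rho_neq0 : rho != 0.
Proof. by rewrite -(na_gt0 HvK); case: rho_val => ->; rewrite ?ltr01 ?sX_gt0. Qed.

Definition tr (g : 'M[K]_2) (S : set C) : set C := [set moebius i g z | z in S].

Lemma trM g h S : \det g != 0 -> \det h != 0 -> S `<=` Omega -> tr (g * h) S = tr g (tr h S).
Proof.
move=> dg dh SO; apply/seteqP; split=> x /=.
  move=> [z hz <-]; exists (moebius i h z); first by exists z.
  by rewrite -moebiusM //; [exact: SO|exact/moebius_Omega/SO].
move=> [_ [z hz <-] <-]; exists z => //; rewrite moebiusM //; [exact: SO|exact/moebius_Omega/SO].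
Qed.
Lemma tr_Omega g S : \det g != 0 -> S `<=` Omega -> tr g S `<=` Omega.
Proof. by move=> dg SO _ [z /SO hz <-]; apply: moebius_Omega. Qed.
Lemma tr1 S : tr 1 S = S.
Proof. by apply/seteqP; split=> x /=; [move=> [z hz <-]; rewrite moebius1|move=> hx; exists x; rewrite ?moebius1]. Qed.
Lemma trK g S : \det g != 0 -> S `<=` Omega -> tr g^-1 (tr g S) = S.
Proof.
by move=> dg SO; rewrite -trM ?det_inv ?invr_eq0 // mulVr ?tr1 // det_neq0_unit.
Qed.

Lemma tr_self h : \det h != 0 -> (forall w, P0 w -> P0 (moebius i h w)) ->
  (forall w, P0 w -> P0 (moebius i h^-1 w)) -> tr h P0 = P0.
Proof.
move=> dh h1 h2; apply/seteqP; split=> x /=; first by move=> [z hz <-]; apply: h1.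
move=> hx; exists (moebius i h^-1 x); first exact: h2.
by rewrite -moebiusM ?det_inv ?invr_eq0 ?mulrV ?moebius1 ?det_neq0_unit //; apply: P0_Omega => //; apply: h2.
Qed.

Lemma tr_aff_self a b : vK a = 1 -> vK b <= vK rho -> tr (aff a b) P0 = P0.
Proof.
move=> a1 hb.
have a0 : a != 0 by rewrite -(na_gt0 HvK) a1.
have inv : (aff a b)^-1 = aff a^-1 (- b / a).
  apply: (mulrI (det_neq0_unit (aff_neq0 b a0))); rewrite mulrV ?det_neq0_unit ?aff_neq0 //.
  have -> : (1 : 'M[K]_2) = mx4 1 0 0 1 by rewrite [LHS]mx4_eta !mxE.
  by rewrite mx4M; congr mx4; field.
apply: tr_self; first exact: aff_neq0.
  by move=> w hw; rewrite affE; apply: P0_trans => //; apply: P0_unit.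
move=> w hw; rewrite inv affE; apply: P0_trans; last by apply: P0_unit => //; rewrite (naV HvK) a1 invr1.
by rewrite (naF HvK) (naN HvK) a1 divr1.
Qed.

Definition invol := mx4 0 rho 1 0.
Lemma det_invol : \det invol != 0.
Proof. by rewrite det_mx4 mul0r mulr1 sub0r oppr_eq0 rho_neq0. Qed.
Lemma involE w : moebius i invol w = i rho / w.
Proof. by rewrite /moebius /cocycle !mx4E rmorph0 rmorph1 mul0r mul1r addr0 add0r. Qed.
Lemma tr_invol : tr invol P0 = P0.
Proof.
have w0 w : P0 w -> w != 0.
  by move=> /P0_Omega hw; have := Omega_sub 0 hw; rewrite rmorph0 subr0.
apply/seteqP; split=> x /=; first by move=> [z hz <-]; rewrite involE; apply: P0_inv.
move=> hx; exists (i rho / x); first exact: P0_inv.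
by rewrite involE; have := w0 _ hx => x0; field; rewrite x0 fmorph_eq0 rho_neq0.
Qed.

(** The inversion conjugates lower unipotent matrices to translations. *)
Lemma tr_lower e : vK e <= 1 -> tr (mx4 1 0 e 1) P0 = P0.
Proof.
move=> he; pose U := aff 1 (e * rho).
have hU : tr U P0 = P0.
  by apply: tr_aff_self; rewrite ?(na1 HvK) // (naM HvK) ler_piMl ?(na_ge0 HvK).
have dU : \det U != 0 by rewrite det_aff oner_eq0.
have dL : \det (mx4 1 0 e 1) != 0 by rewrite det_mx4 mul0r mulr1 subr0 oner_eq0.
have eqn : mx4 1 0 e 1 * invol = invol * U.
  by rewrite !mx4M; congr mx4; ring.
by rewrite -{1}tr_invol -trM ?det_invol // eqn trM ?det_invol // hU tr_invol.
Qed.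

(** Iwasawa decomposition: a right factor that preserves P0, lower unipotent and if necessary
    preceded by the inversion, makes g upper triangular, and scalars act trivially. *)
Lemma tr_affine g : \det g != 0 -> exists a b, a != 0 /\ tr g P0 = tr (aff a b) P0.
Proof.
move=> dg.
have low g' : \det g' != 0 -> vK (g' 1 0) <= vK (g' 1 1) -> exists a b, a != 0 /\ tr g' P0 = tr (aff a b) P0.
  move=> dg' le.
  have d0 : g' 1 1 != 0.
    apply: contraNneq dg' => d0; move: le; rewrite d0 (na0 HvK) le_eqVlt (na_eq0 HvK) ltNge (na_ge0 HvK) orbF => /eqP c0.
    by rewrite det2 c0 d0 !mulr0 subrr.
  pose e := - g' 1 0 / g' 1 1.
  have he : vK e <= 1 by rewrite (naF HvK) (naN HvK) ler_pdivrMr ?(na_gt0 HvK) // mul1r.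
  have dL : \det (mx4 1 0 e 1) != 0 by rewrite det_mx4 mul0r mulr1 subr0 oner_eq0.
  pose a := (g' 0 0 + g' 0 1 * e) / g' 1 1; pose b := g' 0 1 / g' 1 1.
  have E : g' * mx4 1 0 e 1 = mx4 (a * g' 1 1) (b * g' 1 1) 0 (g' 1 1).
    rewrite [in LHS](mx4_eta g') mx4M /a /b /e !mulr1 !mulr0 !add0r !divfK //; congr mx4.
    by field.
  have a0 : a != 0.
    have : \det (g' * mx4 1 0 e 1) != 0 by rewrite det_mulmx mulf_neq0.
    by rewrite E det_mx4 mulr0 subr0 !mulf_eq0 !negb_or => /andP[/andP[]].
  exists a, b; split=> //.
  rewrite -{1}(tr_lower he) -trM // E; apply: eq_imagel => w hw.
  rewrite affE /moebius /cocycle !mx4E rmorph0 mul0r add0r !rmorphM; field; by rewrite fmorph_eq0.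
have [le|gt] := leP (vK (g 1 0)) (vK (g 1 1)); first exact: low.
have -> : tr g P0 = tr (g * invol) P0 by rewrite trM ?det_invol // tr_invol.
apply: low; first by rewrite det_mulmx mulf_neq0 ?det_invol.
rewrite !mx2M !mx4E !mulr0 mulr1 add0r addr0 (naM HvK).
have c0 : 0 < vK (g 1 0) by apply: le_lt_trans gt; apply: na_ge0 HvK _.
case: rho_val => ->; first by rewrite mulr1 ltW.
have [d0|d0] := eqVneq (g 1 1) 0; first by rewrite d0 (na0 HvK) mulr_ge0 ?(ltW c0) ?(ltW (sX_gt0 _)).
by rewrite mulrC; apply: valK_gap.
Qed.

Lemma tr_eq_or_disjoint g w : \det g != 0 -> P0 w -> tr g P0 w -> tr g P0 = P0.
Proof.
move=> dg hw; have [a [b [a0 ->]]] := tr_affine dg => -[w' hw' e].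
rewrite affE in e; have hb : P0 (i a * w' + i b) by rewrite e.
have [a1 b1] := P0_disj a0 hw' hb.
exact: tr_aff_self.
Qed.

Definition piece (S : set C) := exists2 g, \det g != 0 & S = tr g P0.

Lemma piece_Omega S : piece S -> S `<=` Omega.
Proof. by move=> [g dg ->]; apply: tr_Omega. Qed.
Lemma piece_tr g S : \det g != 0 -> piece S -> piece (tr g S).
Proof. by move=> dg [h dh ->]; exists (g * h); rewrite ?det_mulmx ?mulf_neq0 // trM. Qed.
Lemma piece_disjoint S S' z : piece S -> piece S' -> S z -> S' z -> S = S'.
Proof.
move=> [g dg ->] [h dh ->] [w hw <-] [w' hw' e].
have dg' : \det g^-1 != 0 by rewrite det_inv invr_eq0.
have : tr (g^-1 * h) P0 = P0.
  apply: (@tr_eq_or_disjoint _ w) => //; first by rewrite det_mulmx mulf_neq0.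
  exists w' => //; rewrite moebiusM ?e //; try exact: P0_Omega; try exact/moebius_Omega/P0_Omega.
  by rewrite -moebiusM ?mulVr ?moebius1 ?det_neq0_unit //; [exact: P0_Omega|exact/moebius_Omega/P0_Omega].
by move=> e2; rewrite -{1}e2 -trM ?mulVKr ?det_neq0_unit // ?det_mulmx ?mulf_neq0.
Qed.
Lemma piece_affine S : piece S -> exists a b, a != 0 /\ S = tr (aff a b) P0.
Proof. by move=> [g dg ->]; have [a [b [a0 e]]] := tr_affine dg; exists a, b. Qed.
Lemma piece_bounded S : piece S -> exists2 d, 0 < d & exists M, forall z, S z -> d <= iabs z /\ v z <= M.
Proof.
move=> /piece_affine[a [b [a0 ->]]]; have [d d0 [M hM]] := P0_bounded.
have va : 0 < vK a by rewrite (na_gt0 HvK).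
exists (vK a * d); first by rewrite mulr_gt0.
exists (Num.max (vK a * M) (vK b)) => _ [w hw <-]; have [h1 h2] := hM w hw.
rewrite affE iabs_aff //; last exact: P0_Omega.
rewrite ler_pM2l // h1; split=> //; apply: le_trans (naD Hv _ _) _.
by rewrite (naM Hv) !viE ge_max !le_max ler_pM2l // h2 lexx orbT.
Qed.

Lemma finite_stab S : piece S -> finite_set [set g | Gamma g /\ tr g S = S].
Proof.
move=> hS; have [d d0 [M hM]] := piece_bounded hS.
have [B hB] := @entries_bound d M d M d0 d0.
apply: sub_finite_set (Gamma_discrete B) => g [Gg gS]; split=> //.
have [z hz] : exists z, S z.
  by have [h dh ->] := hS; have [w hw] := P0_nonempty; exists (moebius i h w); exists w.
have [h1 h2] := hM z hz; have hgz : S (moebius i g z) by rewrite -gS; exists z.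
have [h3 h4] := hM _ hgz; apply: (hB g z) => //; exact: Gamma_det.
Qed.

(** The piece of z to az + b depends only on |a| and on b modulo translations by |rho a|. The bounds
    leave finitely many values of |a|, and a finite net for b. *)
Lemma finite_pieces d M : 0 < d ->
  finite_set [set S | piece S /\ exists z, [/\ S z, d <= iabs z & v z <= M]].
Proof.
move=> d0; have [d1 d10 [M1 hM1]] := P0_bounded.
have [w0 hw0] := P0_nonempty.
have M10 : 0 < M1 by have [h1 h2] := hM1 _ hw0; apply: lt_le_trans d10 (le_trans h1 (le_trans (iabs_le_v _) h2)).
have [n1 hn1] := @small_s4 (d / M1) (divr_gt0 d0 M10).
have [n2 hn2] := large_s4 (M / d1).
pose n := maxn n1 n2.
have [n3 hn3] := large_s4 (Num.max M ((s ^+ 4) ^- n2 * M1)).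
(* The precision s ^ 4 |a| suffices for both values of rho. *)
have [L hL] := net n3 (n + 1).
pose ns : seq int := [seq m%:Z - n%:Z | m <- iota 0 (n + n).+1].
pose T := [seq tr (aff (vpi ^ m) x) P0 | m <- ns, x <- L].
apply: (@sub_finite_set _ _ [set` T]); last exact: finite_seq.
move=> S [/piece_affine[a [b [a0 ->]]] [z [[w hw <-]]]]; rewrite affE.
have hwO := P0_Omega hw; have [h1 h2] := hM1 _ hw.
rewrite iabs_aff // => dz zM /=.
have va : 0 < vK a by rewrite (na_gt0 HvK).
have iM : iabs w <= M1 by apply: le_trans (iabs_le_v _) h2.
have a_ge : (s ^+ 4) ^+ n1 <= vK a.
  apply: le_trans hn1 _; rewrite ler_pdivrMr //; apply: le_trans dz _.
  by rewrite ler_pM2l.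
have a_le : vK a <= (s ^+ 4) ^- n2.
  apply: le_trans hn2; rewrite ler_pdivlMr //; apply: (@le_trans _ _ (vK a * iabs w)).
    by rewrite ler_pM2l.
  by apply: le_trans zM; rewrite -(iabs_aff b a0 hwO); apply: iabs_le_v.
have [m am] := valK a0.
have E4 (j : nat) : (s ^+ 4) ^+ j = s ^ (4 * j%:Z) by rewrite -exprM exprnP PoszM.
have E4V (j : nat) : (s ^+ 4) ^- j = s ^ (- (4 * j%:Z)) by rewrite E4 invr_expz.
rewrite E4 am le_sz in a_ge; rewrite E4V am le_sz in a_le.
have mn : m \in ns.
  apply: int_range_mem; have := leq_maxl n1 n2; have := leq_maxr n1 n2; rewrite -/n.
  by clear -a_ge a_le; lia.
have vpim : vK (vpi ^ m) = vK a by rewrite (naXz HvK) vpiE am exprnP exprz_exp.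
have bM : vK b <= (s ^+ 4) ^- n3.
  apply: le_trans hn3; rewrite -viE -[i b](addKr (i a * w)) addrC.
  apply: le_trans (naD Hv _ _) _; rewrite (naN Hv) ge_max !le_max zM /=.
  rewrite (naM Hv) viE; apply/orP; right; apply: ler_pM; rewrite ?(na_ge0 Hv) ?(na_ge0 HvK) //.
  by rewrite am E4V le_sz.
have [x xL hx] := hL b bM.
have -> : tr (aff a b) P0 = tr (aff (vpi ^ m) x) P0.
  pose u := a / vpi ^ m.
  have pm0 : vpi ^ m != 0 by rewrite expfz_neq0 // vpi_neq0.
  have u1 : vK u = 1 by rewrite (naF HvK) vpim mulfV // gt_eqF.
  have hbx : vK ((b - x) / vpi ^ m) <= vK rho.
    rewrite (naF HvK) vpim ler_pdivrMr //; apply: le_trans hx _.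
    rewrite E4 am; apply: (@le_trans _ _ (s ^+ 4 * s ^ (4 * m))).
      by rewrite exprnP -szD le_sz; have := leq_maxl n1 n2; rewrite -/n; clear -a_ge a_le; lia.
    rewrite ler_pM2r ?sz_gt0 //; case: rho_val => -> //.
    by rewrite exprn_ile1 ?(ltW s_gt0) ?(ltW s_lt1).
  rewrite -[in RHS](tr_aff_self u1 hbx) -trM ?det_aff //; last by rewrite -(na_gt0 HvK) u1.
  rewrite /aff mx4M /u; congr (tr (mx4 _ _ _ _) P0); by [field|field|ring|ring].
by apply/allpairsP; exists (m, x).
Qed.

Lemma center_moebius h z : Z h -> moebius i h z = z.
Proof.
move=> hh; have := Gamma_det0 (proj1 hh); have [a -> _] := Gamma_center hh.
rewrite det_scalar expf_eq0 /= => a0.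
rewrite /moebius /cocycle !mxE /= mulr0n mulr1n rmorph0 addr0 mul0r add0r.
by rewrite mulrAC mulfV ?mul1r // fmorph_eq0.
Qed.

Lemma finite_center : finite_set Z.
Proof.
apply: sub_finite_set (Gamma_discrete 1) => h hh; split; first by case: hh.
have := Gamma_det (proj1 hh); have [a -> _] := Gamma_center hh.
rewrite det_scalar (naX HvK) => /eqP; rewrite pexprn_eq1 ?(na_ge0 HvK) // => /eqP a1 x y.
by rewrite !mxE; case: eqP => _; rewrite ?mulr1n ?mulr0n ?a1 ?(na0 HvK) ?ler01.
Qed.

(** The fibres of g to gZ have #Z elements, so the number of cosets divides the order of G. The
    average has to be taken modulo Z because the series is a sum over Gamma / Z. *)
Lemma coset_card (G : set 'M[K]_2) : G `<=` Gamma -> finite_set G -> Z `<=` G ->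
  (forall g h, G g -> G h -> G (g * h)) -> (forall g, G g -> G g^-1) ->
  #|` fset_set [set lcoset g Z | g in G]|%:R != 0 :> C.
Proof.
move=> GG fG ZG GM GV.
have G1 : G 1 by apply: ZG; apply: center1.
have := Gamma_tame GG fG G1 GM GV; rewrite -(fmorph_eq0 i) rmorph_nat; apply: contraNneq => n0.
set n := #|` _| in n0.
have fZ := finite_center.
suff -> : #|` fset_set G| = (n * #|` fset_set Z|)%N by rewrite natrM n0 mul0r.
rewrite card_fset_sum1 (partition_big_imfset _ (fun g => lcoset g Z)) /= -fset_set_image //.
rewrite /n card_fset_sum1 big_distrl /= big_seq [RHS]big_seq; apply: eq_bigr => c.
rewrite in_fset_set ?inE; last exact: finite_image.
move=> -[g0 Gg0 <-]; rewrite mul1n -big_filter big_const_seq count_predT iter_addn_0 mul1n.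
have gu := Gamma_unit (GG _ Gg0).
rewrite -(size_map (fun h => g0 * h) (fset_set Z)); apply/perm_size/uniq_perm.
- by rewrite filter_uniq // fset_uniq.
- by rewrite map_inj_uniq ?fset_uniq //; apply: mulrI.
move=> g; rewrite mem_filter; apply/andP/mapP => [[/eqP e _]|[h + ->]].
  have := mem_lcoset g; rewrite e => -[h hh <-]; exists h => //.
  by rewrite in_fset_set // inE.
rewrite in_fset_set // inE => hh; rewrite lcoset_eq // eqxx; split=> //.
by rewrite in_fset_set // inE; apply: GM => //; apply: ZG.
Qed.

Section Step.
(** [region] is where the local products are known to be small off P0: the edge points for edges,
    all of Omega for vertices. [cond f N] collects what the local approximation requires of f. *)
Variables (T0 : finType) (D0 : T0 -> poincare_data K) (region : set C) (cond : (C -> C) -> R -> Prop).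
Hypothesis D0_adm : forall t, adm (D0 t).
Hypothesis region_Omega : region `<=` Omega.
Hypothesis region_inv : forall g z, \det g != 0 -> region z -> region (moebius i g z).
Hypothesis piece_region : forall S, piece S -> S `<=` region.
Hypothesis D0_small : forall t z, region z -> ~ P0 z -> nu (Phi (D0 t)) z <= s.
Hypothesis cond_aff : forall a b f N, a != 0 -> cond f N -> cond (faff a b f) N.
Hypothesis cond_gt0 : forall f N, cond f N -> 0 < N.
Hypothesis local : forall f N, cond f N -> exists2 c : T0 -> C, (forall t, v (c t) <= N) &
  forall z, P0 z -> nu (fun z => f z - \sum_t c t * Phi (D0 t) z) z <= s * N.

Lemma nu_sum (T : finType) (F : T -> C -> C) z B : 0 <= B -> (forall t, nu (F t) z <= B) -> nu (fun z => \sum_t F t z) z <= B.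
Proof.
move=> B0 h; rewrite /nu.
have [i0|i0] := eqVneq (iabs z ^+ k) 0; first by rewrite i0 mulr0.
have ip : 0 < iabs z ^+ k by rewrite lt0r i0 exprn_ge0 // iabs_ge0.
rewrite -ler_pdivlMr //; apply: (na_sum Hv) => [|t _]; first by rewrite divr_ge0 // ltW.
by rewrite ler_pdivlMr //; apply: h.
Qed.
Lemma nuZ c f z : nu (fun z => c * f z) z = v c * nu f z.
Proof. by rewrite /nu (naM Hv) mulrA. Qed.

Definition orbit_pieces (S : set C) : set (set C) := [set S' | piece S' /\ exists2 g, Gamma g & S' = tr g S].

Lemma orbit_pieces_tr g S : Gamma g -> piece S -> orbit_pieces (tr g S) = orbit_pieces S.
Proof.
move=> Gg hS; have SO := piece_Omega hS; have dg := Gamma_det0 Gg.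
apply/seteqP; split=> S' [hS' [h Gh e]]; subst S'; split=> //; have dh := Gamma_det0 Gh.
  by exists (h * g); [exact: GammaM|rewrite trM].
exists (h * g^-1); first by apply: GammaM => //; apply: GammaV.
by rewrite -trM ?det_mulmx ?det_inv ?mulf_neq0 ?invr_eq0 // mulrVK // Gamma_unit.
Qed.

(* Approximate f on one piece of each Gamma-orbit and average over the stabilizer, whose order modulo Z is invertible;
   the terms of the series that do not belong to the piece at hand are small there. *)
Lemma step : exists (T : finType) (E : T -> poincare_data K), (forall t, adm (E t)) /\
  forall f N, modular f -> cond f N -> exists2 c : T -> C, (forall t, v (c t) <= N) &
    (forall S z, piece S -> S z -> nu (fun z => f z - \sum_t c t * series (E t) z) z <= s * N) /\
    (forall z, region z -> (forall S, piece S -> ~ S z) -> nu (fun z => \sum_t c t * series (E t) z) z <= s * N).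
Proof.
have [d d0 [M hM]] := Gamma_cocompact.
have fin := finite_pieces M d0; set Fp := [set S | _] in fin.
have FpP S : Fp S -> piece S by case.
have rep_ex S : piece S -> exists2 g, Gamma g & Fp (tr g S).
  move=> hS; have [z hz] : exists z, S z.
    by have [h dh ->] := hS; have [w hw] := P0_nonempty; exists (moebius i h w); exists w.
  have [g [Gg h1 h2]] := hM z (piece_Omega hS hz); exists g => //; split.
    by apply: piece_tr => //; apply: Gamma_det0.
  by exists (moebius i g z); split=> //; exists z.
(* The choice depends only on the set of candidates, so [rp] is constant on Gamma-orbits of
   pieces. *)
pose rp S := xget set0 (Fp `&` orbit_pieces S).
have rpP S : piece S -> Fp (rp S) /\ exists2 g, Gamma g & rp S = tr g S.
  move=> hS; have [g Gg gS] := rep_ex S hS; rewrite /rp; case: xgetP => [S' _ [h1 [_ h2]]//|/(_ (tr g S))].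
  by case; split=> //; split; [exact: FpP|exists g].
have rp_tr g S : Gamma g -> piece S -> rp (tr g S) = rp S.
  by move=> Gg hS; rewrite /rp orbit_pieces_tr.
pose r := fset_set [set S | Fp S /\ rp S = S].
have finr : finite_set [set S | Fp S /\ rp S = S] by apply: sub_finite_set fin => S [].
have rE S : (S \in r) = `[< Fp S /\ rp S = S >] by rewrite in_fset_set //; apply/idP/idP; rewrite inE asboolE.
pose J := 'I_(size r).
pose Sj (j : J) : set C := nth set0 r j.
have SjP j : Fp (Sj j) /\ rp (Sj j) = Sj j.
  by have : Sj j \in r by [apply: mem_nth]; rewrite rE => /asboolP.
have Sj_piece j : piece (Sj j) by have [/FpP] := SjP j.
have affj (j : J) : exists ab : K * K, ab.1 != 0 /\ Sj j = tr (aff ab.1 ab.2) P0.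
  by have [a [b h]] := piece_affine (Sj_piece j); exists (a, b).
pose ab j := projT1 (cid (affj j)).
have abP j : (ab j).1 != 0 /\ Sj j = tr (aff (ab j).1 (ab j).2) P0 by rewrite /ab; case: cid.
pose E (t : J * T0) := act (aff (ab t.1).1 (ab t.1).2) (D0 t.2).
have E_adm t : adm (E t) by apply: adm_act => //; apply: aff_neq0; apply: (proj1 (abP t.1)).
pose stab j : set 'M[K]_2 := [set g | Gamma g /\ tr g (Sj j) = Sj j].
pose nj j := #|` fset_set [set lcoset g Z | g in stab j]|.
have stab_fin j : finite_set (stab j) by apply: finite_stab.
have SjO j := piece_Omega (Sj_piece j).
have stabM j g h : stab j g -> stab j h -> stab j (g * h).
  move=> [Gg gS] [Gh hS]; split; first exact: GammaM.
  by rewrite trM ?Gamma_det0 // hS gS.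
have stabV j g : stab j g -> stab j g^-1.
  move=> [Gg gS]; split; first exact: GammaV.
  by rewrite -{1}gS trK ?Gamma_det0.
have Zstab j : Z `<=` stab j.
  move=> h hh; split; first by case: hh.
  apply/seteqP; split=> x /=; first by move=> [z hz <-]; rewrite center_moebius.
  by move=> hx; exists x => //; rewrite center_moebius.
have nj0 j : (nj j)%:R != 0 :> C.
  by apply: coset_card => //; [move=> g []|exact: stabM|exact: stabV].
have vnj j : v (nj j)%:R^-1 = 1.
  by have [p pp cp] := charC; rewrite (naV Hv) (na_nat_char Hv cp) ?invr1.
exists (J * T0)%type, E; split=> // f N hf fN.
have N0 := cond_gt0 fN.
have sN0 : 0 <= s * N by rewrite mulr_ge0 ?ltW.
pose cj j := projT1 (cid2 (local (cond_aff (ab j).2 (proj1 (abP j)) fN))).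
have [cN cS] : (forall j t, v (cj j t) <= N) /\ forall j z, Sj j z ->
    nu (fun z => f z - \sum_t cj j t * Phi (E (j, t)) z) z <= s * N.
  split=> j; rewrite /cj; case: cid2 => //= c c1 c2.
  have [a0 ->] := abP j; move=> _ [w hw <-]; rewrite affE.
  have hwO := P0_Omega hw.
  rewrite -nu_faff //; apply: le_trans (c2 w hw); rewrite /nu ler_wpM2r ?exprn_ge0 ?iabs_ge0 //.
  rewrite le_eqVlt; apply/orP; left; apply/eqP; congr v.
  rewrite /faff mulrBr; congr (_ - _); rewrite mulr_sumr; apply: eq_bigr => t _.
  by rewrite -(Phi_aff (ab j).2 (D0_adm t) a0 hwO) /faff /E /=; ring.
have cS' j t z : region z -> ~ Sj j z -> nu (fun z => cj j t * Phi (E (j, t)) z) z <= s * N.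
  move=> hz nz; rewrite nuZ mulrC; apply: ler_pM; rewrite ?nu_ge0 ?(na_ge0 Hv) //.
  have [a0 SE] := abP j.
  have da := aff_neq0 (ab j).2 a0.
  have dav : \det (aff (ab j).1 (ab j).2)^-1 != 0 by rewrite det_inv invr_eq0.
  pose w := moebius i (aff (ab j).1 (ab j).2)^-1 z.
  have hw : region w by apply: region_inv.
  have zw : z = i (ab j).1 * w + i (ab j).2.
    by rewrite -affE /w -moebiusM ?mulrV ?moebius1 ?det_neq0_unit //; apply: region_Omega.
  rewrite zw -nu_faff //; last exact: region_Omega.
  rewrite /nu (Phi_aff _ (D0_adm t)) //; last exact: region_Omega.
  apply: D0_small => // hP; apply: nz; rewrite SE; exists w => //; by rewrite affE -zw.
pose c (t : J * T0) := (nj t.1)%:R^-1 * cj t.1 t.2.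
exists c; first by move=> t; rewrite /c (naM Hv) vnj mul1r.
pose phi z := \sum_t c t * Phi (E t) z.
pose ind j (w : C) : C := (`[< Sj j w >] : bool)%:R.
(* On the region [phi] is close to [hval] times f: to f divided by nj on a chosen piece, to 0 off
   these pieces. Summing the slashes over the cosets replaces [hval] by 1 on the pieces, since
   exactly nj cosets carry a given point into the chosen piece of its orbit. *)
pose hval w := \sum_(j : J) (nj j)%:R^-1 * ind j w.
have phi_hval w : region w -> nu (fun w => phi w - hval w * f w) w <= s * N.
  move=> hw; suff h : nu (fun w => \sum_(j : J) (nj j)%:R^-1 * (\sum_t cj j t * Phi (E (j, t)) w - ind j w * f w)) w <= s * N.
    apply: le_trans h; rewrite /nu ler_wpM2r ?exprn_ge0 ?iabs_ge0 // le_eqVlt; apply/orP; left; apply/eqP; congr v.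
    under [RHS]eq_bigr do rewrite mulrBr mulr_sumr mulrA; rewrite sumrB -mulr_suml pair_bigA.
    by congr (_ - _); apply: eq_bigr => t _; rewrite /c mulrA; case: t.
  apply: nu_sum => // j; rewrite nuZ vnj mul1r /nu /ind.
  have [hS|nS] := pselect (Sj j w).
    rewrite (asboolT hS) mul1r (naBC Hv); exact: cS.
  rewrite (asboolF nS) mul0r subr0.
  by apply: (@nu_sum _ (fun t z => cj j t * Phi (E (j, t)) z)) => // t; apply: cS'.
have sums z : Omega z -> has_sum v cosets (fun x => \sum_t c t * term (E t) z x) (\sum_t c t * series (E t) z).
  by move=> hz; apply: has_sum_lin => t; apply: series_has_sum.
have termJ z x : Omega z -> cosets x -> \sum_t c t * term (E t) z x =
   i (\det (rep x)^-1) ^ (k%:Z + l) / cocycle i (rep x)^-1 z ^+ (2 * k) * phi (moebius i (rep x)^-1 z).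
  move=> hz hx; have [Gr xE] := repP hx; rewrite /phi mulr_sumr; apply: eq_bigr => t _.
  by rewrite (termE _ _ hx (rep_mem hx)) summand_slash // mulrCA.
have nuJ z x F : Omega z -> cosets x ->
   v (i (\det (rep x)^-1) ^ (k%:Z + l) / cocycle i (rep x)^-1 z ^+ (2 * k) * F (moebius i (rep x)^-1 z)) * iabs z ^+ k
     = nu F (moebius i (rep x)^-1 z).
  move=> hz hx; have [Gr xE] := repP hx; have GV := GammaV Gr.
  by rewrite -(v_slash _ (Gamma_det GV) hz) !(naM Hv) v_det // mul1r [X in X * _]mulrC.
(* If z is in no piece, none of its translates is in a chosen one; so [hval] vanishes there and
   [phi] itself is small. *)
split; last first.
  move=> z hz nS; have hzO := region_Omega hz; have ip := iabs_gt0 hzO.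
  rewrite /nu -ler_pdivlMr ?exprn_gt0 //; apply: has_sum_le (sums z hzO) _ _.
    by rewrite divr_ge0 // exprn_ge0 // ltW.
  move=> x hx; rewrite termJ // ler_pdivlMr ?exprn_gt0 // nuJ //.
  have [Gr xE] := repP hx; have GV := GammaV Gr; have dV := Gamma_det0 GV.
  apply: le_trans (phi_hval _ (region_inv dV hz)); rewrite /nu; suff -> : hval (moebius i (rep x)^-1 z) = 0 by rewrite mul0r subr0.
  rewrite /hval big1 // => j _; rewrite /ind asboolF ?mulr0 // => hS.
  apply: (nS (tr (rep x) (Sj j))); first by apply: piece_tr => //; apply: Gamma_det0.
  exists (moebius i (rep x)^-1 z) => //; rewrite -moebiusM ?Gamma_det0 // ?mulrV ?moebius1 ?Gamma_unit //.
  exact: moebius_Omega.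
move=> S z hS Sz; have hz := piece_region hS Sz; have hzO := region_Omega hz; have ip := iabs_gt0 hzO.
have hsum : has_sum v cosets (fun x => \sum_(j : J) (nj j)%:R^-1 * ind j (moebius i (rep x)^-1 z))
    (\sum_(j : J) (nj j)%:R^-1 * (if Sj j == rp S then (nj j)%:R else 0)).
  apply: has_sum_lin => j; case: eqP => jS; last first.
    apply: has_sum_eq (has_sum0 _) => x hx; rewrite /ind asboolF // => hSj; apply: jS.
    have [Gr xE] := repP hx; have GV := GammaV Gr; have dV := Gamma_det0 GV.
    have e : Sj j = tr (rep x)^-1 S by apply: piece_disjoint hSj _ => //; [exact: piece_tr|exists z].
    by have [_ <-] := SjP j; rewrite e rp_tr.
  have [_ [g0 Gg0 g0S]] := rpP S hS; rewrite -jS in g0S.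
  have dg0 := Gamma_det0 Gg0; have SO := piece_Omega hS.
  (* As g0 carries S to Sj j, the cosets whose inverses carry z into Sj j are the g0^-1 multiples of
     those of the stabilizer. *)
  pose A := [set lmul g0^-1 x | x in [set lcoset g Z | g in stab j]].
  have finA0 : finite_set [set lcoset g Z | g in stab j] by apply: finite_image.
  have finA : finite_set A by apply: finite_image.
  have cardA : #|` fset_set A| = nj j.
    rewrite /A fset_set_image // card_in_imfset //= => x y _ _ e.
    by rewrite -(lmulK x Gg0) e lmulK.
  have AP x : cosets x -> ((x \in fset_set A) : bool) = `[< Sj j (moebius i (rep x)^-1 z) >].
    move=> hx; have [Gr xE] := repP hx; have GV := GammaV Gr; have dV := Gamma_det0 GV.
    rewrite in_fset_set //; apply/idP/idP; rewrite inE asboolE.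
      move=> [_ [g [Gg gS] <-] e].
      have : cosets (lcoset (g0^-1 * g) Z) by apply/cosets_lcoset/GammaM => //; apply: GammaV.
      rewrite lmul_lcoset in e; have := rep_mem hx; rewrite -{1}e => -[h hh re] _.
      have GV0 := GammaV Gg0; have Gh := proj1 hh.
      have rE' : (rep x)^-1 = h^-1 * (g^-1 * g0).
        have u1 := Gamma_unit (GammaM GV0 Gg).
        by rewrite -re (invrM u1 (Gamma_unit Gh)) (invrM (Gamma_unit GV0) (Gamma_unit Gg)) invrK.
      have Ghg : Gamma (g^-1 * g0) by apply: GammaM => //; apply: GammaV.
      have hV := centerV hh.
      rewrite rE' moebiusM ?Gamma_det0 //; [|exact: GammaV| exact: moebius_Omega (Gamma_det0 Ghg) hzO].
      rewrite center_moebius // moebiusM ?Gamma_det0 //; [|exact: GammaV|exact: moebius_Omega].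
      have [_ <-] := stabV _ _ (conj Gg gS); exists (moebius i g0 z) => //.
      by rewrite g0S; exists z.
    move=> hSj.
    have e : Sj j = tr (rep x)^-1 S by apply: piece_disjoint hSj _ => //; [exact: piece_tr|exists z].
    have st : stab j (g0 * rep x).
      split; first exact: GammaM.
      have dr := Gamma_det0 Gr.
      have rS : tr (rep x) (Sj j) = S by rewrite e -trM // mulrV ?tr1 // Gamma_unit.
      by rewrite trM // rS.
    exists (lcoset (g0 * rep x) Z); first by exists (g0 * rep x).
    by rewrite lmul_lcoset mulKr ?Gamma_unit // -xE.
  have -> : (nj j)%:R = \sum_(x <- fset_set A) ind j (moebius i (rep x)^-1 z) :> C.
    rewrite -cardA card_fset_sum1 natr_sum big_seq [RHS]big_seq; apply: eq_bigr => x hxA.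
    have hx : cosets x.
      move: hxA; rewrite in_fset_set // inE => -[_ [g [Gg _] <-] <-].
      by rewrite lmul_lcoset; apply/cosets_lcoset/GammaM => //; apply: GammaV.
    by rewrite /ind -AP // hxA.
  apply: has_sum_fin => [x /=|x hx nA].
    rewrite in_fset_set // inE => -[_ [g [Gg _] <-] <-].
    by rewrite lmul_lcoset; apply/cosets_lcoset/GammaM => //; apply: GammaV.
  by rewrite /ind -AP // (negbTE nA).
have one : \sum_(j : J) (nj j)%:R^-1 * (if Sj j == rp S then (nj j)%:R else 0) = 1 :> C.
  have [hFp [g0 Gg0 g0S]] := rpP S hS.
  have rr : rp S \in r by rewrite rE; apply/asboolP; split=> //; rewrite {1}g0S rp_tr.
  have lt : (index (rp S) r < size r)%N by rewrite index_mem.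
  rewrite (bigD1 (Ordinal lt)) //= /Sj /= nth_index // eqxx mulVf // big1 ?addr0 // => j ne.
  case: eqP => [e|_]; last by rewrite mulr0.
  exfalso; move/negP: ne; apply; apply/eqP/val_inj => /=; rewrite -e index_uniq //; exact: fset_uniq.
rewrite one in hsum.
(* The weights sum to 1, so f z minus the combination is a sum of slashes of hval f - phi, each of
   them small. *)
have main := has_sumD (has_sumZ (f z) hsum) (has_sumZ (-1) (sums z hzO)).
rewrite mulr1 mulN1r in main.
rewrite /nu -ler_pdivlMr ?exprn_gt0 //; apply: has_sum_le main _ _.
  by rewrite divr_ge0 // exprn_ge0 // ltW.
move=> x hx; rewrite termJ // ler_pdivlMr ?exprn_gt0 //.
have [Gr xE] := repP hx; have GV := GammaV Gr; have dV := Gamma_det0 GV.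
apply: le_trans (phi_hval _ (region_inv dV hz)).
rewrite -(nuJ z x (fun w => phi w - hval w * f w)) // le_eqVlt; apply/orP; left; apply/eqP; congr (_ * _).
rewrite -[in RHS](naN Hv); congr v.
have fz := modularP hf GV hzO; rewrite -{1}fz /hval; ring.
Qed.
End Step.
End Pieces.

(** * Edges and vertices of the tree *)

Lemma sz_lt1 (m : int) : (s ^ m < 1) = (0 < m). Proof. by rewrite -(lt_sz m 0) expr0z. Qed.
Lemma sz_le1 (m : int) : (s ^ m <= 1) = (0 <= m). Proof. by rewrite -(le_sz m 0) expr0z. Qed.

Definition edge0 : set C := [set z | v z = s ^+ 2].
Lemma edge0_iabs z : edge0 z -> iabs z = s ^+ 2.
Proof. by move=> vz; rewrite iabs_annulus ?vz ?sX_lt // exprn_ilt1 ?(ltW s_gt0). Qed.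
Lemma edge0_Omega : edge0 `<=` Omega.
Proof. by move=> z hz; apply/OmegaP; rewrite edge0_iabs // sX_gt0. Qed.
Lemma edge0_disj a b w : a != 0 -> edge0 w -> edge0 (i a * w + i b) -> vK a = 1 /\ vK b <= vK vpi.
Proof.
move=> a0 vw; rewrite /edge0 /=; have [m am] := valK a0.
have va : v (i a * w) = s ^ (4 * m + 2) by rewrite (naM Hv) viE vw am szD.
have ne : v (i b) != v (i a * w) by rewrite viE va valK_half.
have -> : v (i a * w + i b) = Num.max (v (i a * w)) (v (i b)).
  have ne' : v (i a * w) != v (- i b) by rewrite (naN Hv) eq_sym.
  by rewrite -[X in v (_ + X)]opprK (na_sub_neq Hv ne') (naN Hv).
rewrite va viE maxEle; case: ifP => h e.
  by exfalso; have := valK_half b 0; rewrite mulr0 add0r e eqxx.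
have m0 : m = 0 by move/eqP: e; rewrite exprnP eq_sz => /eqP; clear; lia.
split; first by rewrite am m0 mulr0.
rewrite vpiE; apply: vK_lt1; move/negbT: h; rewrite -ltNge => h; apply: lt_trans h _.
by rewrite e exprn_ilt1 ?(ltW s_gt0).
Qed.

(** An intrinsic description of the union of the edge pieces: the distance to K is halfway between
    two values of K. *)
Definition is_edge (z : C) := Omega z /\ exists n : int, iabs z = s ^ (4 * n + 2).
Local Notation edge_piece := (piece edge0).

Lemma edge_pieceP z : is_edge z <-> exists2 S, edge_piece S & S z.
Proof.
split=> [[hz [n zn]]|].
  exists (tr (aff (vpi ^ n) (nearest z)) edge0).
    by exists (aff (vpi ^ n) (nearest z)) => //; apply: aff_neq0; rewrite expfz_neq0 ?vpi_neq0.
  exists ((z - i (nearest z)) / i (vpi ^ n)).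
    rewrite /edge0 /= (naF Hv) -/(iabs z) zn viE (naXz HvK) vpiE exprnP exprz_exp szD mulrC mulKf //.
    by rewrite gt_eqF ?sz_gt0.
  by rewrite affE mulrC divfK ?subrK // fmorph_eq0 expfz_neq0 ?vpi_neq0.
have inst := @tr_affine edge0 vpi edge0_Omega (or_intror vpiE).
move=> [_ [g dg ->]] [w hw <-].
have hO := edge0_Omega hw.
split; first exact: moebius_Omega.
have [] := inst _ _ _ g dg.
- by move=> a x a1 hx; rewrite /edge0 /= (naM Hv) viE a1 mul1r.
- move=> b x hb hx; rewrite /edge0 /= (na_eq_addl Hv) // viE hx (le_lt_trans hb) // vpiE sX_lt //.
- move=> x hx; rewrite /edge0 /= (naF Hv) viE vpiE hx.
  by rewrite (exprD s 2 2) mulfK // gt_eqF // sX_gt0.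
move=> a [b [a0 e]].
have : tr g edge0 (moebius i g w) by exists w.
rewrite e => -[x hx <-]; rewrite affE iabs_aff //; last exact: edge0_Omega.
have [m ->] := valK a0; exists m; by rewrite edge0_iabs // szD.
Qed.

Lemma is_edge_moebius g z : \det g != 0 -> is_edge z -> is_edge (moebius i g z).
Proof.
move=> dg /edge_pieceP[S hS Sz]; apply/edge_pieceP; exists (tr g S); last by exists z.
exact: piece_tr edge0_Omega _ _ dg hS.
Qed.

Definition cond_edge (f : C -> C) N := [/\ rigid_holomorphic i v f, 0 < N & forall z, Omega z -> nu f z <= N].

Lemma cond_edge_aff a b f N : a != 0 -> cond_edge f N -> cond_edge (faff a b f) N.
Proof.
move=> a0 [h1 h2 h3]; split=> //; first exact: rigid_faff.
by move=> z hz; rewrite nu_faff //; apply: h3; apply: Omega_aff.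
Qed.

Lemma edge_step : exists (T : finType) (E : T -> poincare_data K), (forall t, adm (E t)) /\
  forall f N, modular f -> cond_edge f N -> exists2 c : T -> C, (forall t, v (c t) <= N) &
    forall z, is_edge z -> nu (fun z => f z - \sum_t c t * series (E t) z) z <= s * N.
Proof.
have [||||||||||||||T [E [hE h]]] := @step edge0 vpi edge0_Omega (or_intror vpiE) _ _ _ _ _ _ unit (fun=> edge_data) is_edge cond_edge.
- by move=> a x a1 hx; rewrite /edge0 /= (naM Hv) viE a1 mul1r.
- move=> b x hb hx; rewrite /edge0 /= (na_eq_addl Hv) // viE hx (le_lt_trans hb) // vpiE sX_lt //.
- move=> x hx; rewrite /edge0 /= (naF Hv) viE vpiE hx.
  by rewrite (exprD s 2 2) mulfK // gt_eqF // sX_gt0.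
- exact: edge0_disj.
- exists (s ^+ 2); first exact: sX_gt0.
  by exists (s ^+ 2) => w hw; rewrite edge0_iabs // hw.
- by exists (sig ^+ 2); rewrite /edge0 /= (naX Hv) vsig.
- by move=> _; apply: edge_adm.
- by move=> z [].
- exact: is_edge_moebius.
- by move=> S hS z Sz; apply/edge_pieceP; exists S.
- move=> _ z [hz [n zn]] nz; apply: (@edge_Phi_small z n) => //; exact/eqP.
- exact: cond_edge_aff.
- by move=> f N [].
- move=> f N [hf N0 fN]; have [lam l1 l2] := edge_local hf N0 fN.
  exists (fun=> lam * (-1) ^+ k).
    by move=> _; rewrite (naM Hv) (naX Hv) (naN Hv) (na1 Hv) expr1n mulr1.
  move=> z hz; rewrite /nu (edge0_iabs hz) -exprM.
  rewrite (big_pred1 tt) => [|[]//].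
  have -> : f z - lam * (-1) ^+ k * Phi edge_data z =
     (f z - lam / z ^+ k) - lam * (-1) ^+ k * (Phi edge_data z - (-1) ^+ k / z ^+ k).
    have sq : (-1) ^+ k * (-1) ^+ k = 1 :> C by rewrite -exprMn mulN1r opprK expr1n.
    have -> : lam / z ^+ k = lam * ((-1) ^+ k * (-1) ^+ k) / z ^+ k by rewrite sq mulr1.
    ring.
  rewrite -ler_pdivlMr ?sX_gt0 //; apply: (na_le_sub Hv); rewrite ler_pdivlMr ?sX_gt0 //.
    exact: l2.
  rewrite !(naM Hv) (naX Hv) (naN Hv) (na1 Hv) expr1n mulr1 -mulrA mulrC.
  by apply: ler_pM; rewrite ?mulr_ge0 ?(na_ge0 Hv) ?(ltW (sX_gt0 _)) ?edge_Phi_near.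
exists T, E; split=> // f N hf fN; have [c c1 [c2 _]] := h f N hf fN.
by exists c => // z /edge_pieceP[S hS Sz]; apply: c2 Sz.
Qed.

(** It reaches to the middle circles of the adjacent edges, which are excluded. Thus vertex pieces
    are disjoint and together with the edges cover Omega. *)
Definition vertex0 : set C := [set z | v z < s ^- 2 /\ forall x, s ^+ 2 < v (z - i x)].

Lemma vertex0_iabs z : vertex0 z -> s ^+ 2 < iabs z /\ iabs z < s ^- 2.
Proof. by move=> [h1 h2]; split; [apply: h2|apply: le_lt_trans (iabs_le_v _) h1]. Qed.
Lemma vertex0_Omega : vertex0 `<=` Omega.
Proof. by move=> z /vertex0_iabs[h _]; apply/OmegaP; apply: lt_trans h; apply: sX_gt0. Qed.

Lemma vK_lt_inv2 x : vK x < s ^- 2 -> vK x <= 1.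
Proof.
have [->|x0] := eqVneq x 0; first by rewrite (na0 HvK) ler01.
have [m ->] := valK x0; rewrite exprnN lt_sz sz_le1; clear; lia.
Qed.

Lemma s_lt_inv2 n : s ^+ n < s ^- 2.
Proof. by rewrite exprnN exprnP lt_sz; clear; lia. Qed.

Lemma vertex0_inv w : vertex0 w -> vertex0 (i 1 / w).
Proof.
move=> hw; have hO := vertex0_Omega hw; case: hw => h1 h2.
have w0 : w != 0 by have := Omega_sub 0 hO; rewrite rmorph0 subr0.
have vw : 0 < v w by rewrite (na_gt0 Hv).
have hw2 : s ^+ 2 < v w by have := h2 0; rewrite rmorph0 subr0.
rewrite rmorph1 mul1r; split; first by rewrite (naV Hv) ltf_pV2 ?posrE ?sX_gt0.
have vinv : s ^+ 2 < (v w)^-1 by rewrite -[ltLHS]invrK ltf_pV2 ?posrE ?invr_gt0 ?sX_gt0.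
have s21 : s ^+ 2 < 1 by rewrite exprn_ilt1 ?(ltW s_gt0).
move=> x; have [->|x0] := eqVneq x 0; first by rewrite rmorph0 subr0 (naV Hv).
have vx : 0 < vK x by rewrite (na_gt0 HvK).
have e : w^-1 - i x = (1 - i x * w) / w by field.
have [m xm] := valK x0.
rewrite e (naF Hv).
have [mpos|[mneg|m0]] : m >= 1 \/ m <= -1 \/ m = 0 by clear; lia.
- rewrite (na_eq_subl Hv) ?(na1 Hv) ?mul1r // (naM Hv) viE.
  apply: (@lt_trans _ _ (vK x * s ^- 2)); first by rewrite ltr_pM2l.
  by rewrite xm exprnN -szD sz_lt1; clear -mpos; lia.
- rewrite (na_eq_subr Hv) ?(na1 Hv); last first.
    rewrite (naM Hv) viE; apply: (@lt_trans _ _ (vK x * s ^+ 2)); last by rewrite ltr_pM2l.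
    by rewrite xm exprnP -szD -[X in X < _](expr0z s) lt_sz; clear -mneg; lia.
  by rewrite (naM Hv) mulfK ?gt_eqF // viE xm exprnP lt_sz; clear -mneg; lia.
have x1 : vK x = 1 by rewrite xm m0 mulr0.
have -> : 1 - i x * w = - i x * (w - i x^-1) by rewrite fmorphV; field; rewrite fmorph_eq0.
rewrite (naM Hv) (naN Hv) viE x1 mul1r.
have vix : v (i x^-1) = 1 by rewrite viE (naV HvK) x1 invr1.
have [w1|w1|w1] := ltgtP (v w) 1.
- by rewrite (na_eq_subr Hv) vix // mul1r.
- by rewrite (na_eq_subl Hv) ?vix // mulfV ?gt_eqF.
- by rewrite w1 divr1.
Qed.

Lemma vertex0_disj a b w : a != 0 -> vertex0 w -> vertex0 (i a * w + i b) -> vK a = 1 /\ vK b <= vK 1.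
Proof.
move=> a0 hw haw; have hO := vertex0_Omega hw.
have [h1 h2] := vertex0_iabs hw; have [h3 h4] := vertex0_iabs haw; rewrite iabs_aff // in h3 h4.
have va : 0 < vK a by rewrite (na_gt0 HvK).
have [m am] := valK a0.
have m0 : m = 0.
  have : vK a < s ^- 4.
    have : vK a * s ^+ 2 < s ^- 2 by apply: lt_trans h4; rewrite ltr_pM2l.
    by rewrite -ltr_pdivlMr ?sX_gt0 // -invfM -exprD.
  have : s ^+ 4 < vK a.
    have : s ^+ 2 < vK a * s ^- 2 by apply: lt_trans h3 _; rewrite ltr_pM2l.
    by rewrite ltr_pdivlMr ?sX_gt0 // -exprD.
  rewrite am exprnP exprnN !lt_sz; clear; lia.
have a1 : vK a = 1 by rewrite am m0 mulr0.
split=> //; rewrite (na1 HvK); apply: vK_lt_inv2; rewrite -viE -[i b](addKr (i a * w)) addrC.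
apply: (na_lt_add Hv); first by case: haw.
by rewrite (naN Hv) (naM Hv) viE a1 mul1r; case: hw.
Qed.

Local Notation vertex_piece := (piece vertex0).

(** iabs z lies between s ^ (4n+2), excluded, and s ^ (4n-2), included. The upper end is an edge
    value; below it, centring at a nearest point of K and dividing by vpi ^ n leads to [vertex0]. *)
Lemma vertex_cover z : Omega z -> is_edge z \/ exists2 S, vertex_piece S & S z.
Proof.
move=> hz; have t0 := iabs_gt0 hz.
have [N hN] := large_s4 (iabs z); have [N' hN'] := small_s4 t0.
have E4 (j : nat) : (s ^+ 4) ^+ j = s ^ (4 * j%:Z) by rewrite -exprM exprnP PoszM.
rewrite E4 invr_expz in hN; rewrite E4 in hN'.
have ex : exists m, s ^ (4 * (m%:Z - N%:Z) - 2) < iabs z.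
  exists (N' + N + 1)%N; apply: lt_le_trans hN'; rewrite lt_sz; clear; lia.
have [m hm mmin] := ex_minnP ex.
have m0 : (0 < m)%N.
  rewrite lt0n; apply: contraTneq hm => ->; rewrite -leNgt; apply: le_trans hN _.
  by rewrite le_sz; clear; lia.
pose n : int := m%:Z - 1 - N%:Z.
have up : iabs z <= s ^ (4 * n - 2).
  rewrite leNgt; apply/negP => h.
  have : (m <= m.-1)%N.
    apply: mmin; suff -> : (m.-1)%:Z - N%:Z = n by [].
    by rewrite /n -[in RHS](prednK m0); clear; lia.
  by rewrite -[X in (X <= _)%N](prednK m0) ltnn.
have low : s ^ (4 * n + 2) < iabs z.
  by rewrite (_ : 4 * n + 2 = 4 * (m%:Z - N%:Z) - 2) //; rewrite /n; clear; lia.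
have [lt|ge] := ltP (iabs z) (s ^ (4 * n - 2)); last first.
  left; split=> //; exists (n - 1); have -> : 4 * (n - 1) + 2 = 4 * n - 2 by clear; lia.
  exact/le_anti/andP.
right; have p0 : vpi ^ n != 0 by rewrite expfz_neq0 ?vpi_neq0.
have ip0 : i (vpi ^ n) != 0 by rewrite fmorph_eq0.
have vp : v (i (vpi ^ n)) = s ^ (4 * n) by rewrite viE (naXz HvK) vpiE exprnP exprz_exp.
exists (tr (aff (vpi ^ n) (nearest z)) vertex0); first by exists (aff (vpi ^ n) (nearest z)); rewrite ?aff_neq0.
exists ((z - i (nearest z)) / i (vpi ^ n)); last first.
  by rewrite affE mulrC divfK ?subrK.
split.
  rewrite (naF Hv) -/(iabs z) vp ltr_pdivrMr ?sz_gt0 // exprnN -szD.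
  by rewrite (_ : - 2%:Z + 4 * n = 4 * n - 2) //; clear; lia.
move=> x; have -> : (z - i (nearest z)) / i (vpi ^ n) - i x = (z - i (nearest z + x * vpi ^ n)) / i (vpi ^ n).
  by rewrite rmorphD rmorphM; field.
rewrite (naF Hv) vp ltr_pdivlMr ?sz_gt0 // exprnP -szD.
apply: lt_le_trans (iabs_le _ _); by rewrite (_ : 2%:Z + 4 * n = 4 * n + 2) //; clear; lia.
Qed.

(** * Approximation over a vertex *)

(* In [split_span] the missing degree, at most m, is the multiplicity of the root at infinity. *)
Section SplitPolynomials.
Variable F : fieldType.
Implicit Types (r : seq F) (p : {poly F}) (e : F -> nat).

Lemma exponents_exist r m n : (n <= size r * m)%N -> uniq r ->
  exists e, (forall b, e b <= m)%N /\ (\sum_(b <- r) e b = n)%N.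
Proof.
elim: r n => [|a r IH] n /=.
  by rewrite mul0n leqn0 => /eqP-> _; exists (fun=> 0%N); rewrite big_nil.
move=> hn /andP[ar ur]; pose x := minn n m.
have [|e [em es]] := IH (n - x)%N _ ur; first by rewrite /x; lia.
exists (fun b => if b == a then x else e b); split=> [b|].
  by case: ifP => _ //; rewrite /x geq_minr.
rewrite big_cons eqxx big_seq (eq_bigr e) => [|b br]; last first.
  by rewrite (negbTE (memPn ar _ br)).
by rewrite -big_seq es /x; lia.
Qed.

Lemma split_span m r : uniq r -> forall d (V : {poly F} -> Prop),
  (d <= size r * m)%N ->
  (forall c p, V p -> V (c *: p)) -> (forall p q, V p -> V q -> V (p + q)) ->
  (forall e, (forall b, e b <= m)%N -> (\sum_(b <- r) e b <= d)%N -> (d <= m + \sum_(b <- r) e b)%N ->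
     V (\prod_(b <- r) ('X - b%:P) ^+ e b)) ->
  forall p, (size p <= d.+1)%N -> V p.
Proof.
elim: r => [|a r IH] /=.
  move=> _ d V; rewrite mul0n leqn0 => /eqP -> VZ VD Vg p /size1_polyC ->.
  rewrite -[_%:P]mulr1 mul_polyC; apply: VZ.
  have := Vg (fun=> 0%N); rewrite !big_nil; apply => //; exact: leq0n.
move=> /andP[ar ur] d V hd VZ VD Vg.
pose T := minn m d.
have upd t e : (forall b, e b <= m)%N -> (t <= m)%N -> (t + \sum_(b <- r) e b <= d)%N ->
    (d <= m + (t + \sum_(b <- r) e b))%N -> V (('X - a%:P) ^+ t * \prod_(b <- r) ('X - b%:P) ^+ e b).
  move=> em tm le ge; pose e' b := if b == a then t else e b.
  have eE b : b \in r -> e' b = e b by move=> br; rewrite /e' (negbTE (memPn ar _ br)).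
  have e1 : (\sum_(b <- r) e' b = \sum_(b <- r) e b)%N by apply: eq_big_seq.
  have e2 : \prod_(b <- r) ('X - b%:P) ^+ e' b = \prod_(b <- r) ('X - b%:P) ^+ e b.
    by apply: eq_big_seq => b br; rewrite eE.
  have := Vg e'; rewrite !big_cons e1 e2 /e' eqxx; apply=> // b; case: ifP => _ //.
(* Lowers the power of X - a step by step: subtracting a multiple of a product G that does not
   vanish at a makes the remaining factor divisible by X - a. *)
have key j : (j <= T)%N -> forall p, (size p <= (d - (T - j)).+1)%N -> V (('X - a%:P) ^+ (T - j) * p).
  elim: j => [_ p|j IHj jT p hp].
    rewrite !subn0 => hp; have [md|dm] := leqP m d; last first.
      have TE : T = d by rewrite /T (minn_idPr (ltnW dm)).
      rewrite TE subnn in hp *; rewrite (size1_polyC hp) mulrC mul_polyC; apply: VZ.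
      have := upd d (fun=> 0%N); rewrite big1_eq addn0 big1 ?mulr1 => [|b _]; last by rewrite expr0.
      by apply=> //; [rewrite ltnW|rewrite leq_addl].
    have TE : T = m by rewrite /T (minn_idPl md).
    rewrite TE in hp *.
    apply: (IH ur (d - m)%N (fun q => V (('X - a%:P) ^+ m * q))) => //.
    - by rewrite leq_subLR.
    - by move=> c q h; rewrite -scalerAr; apply: VZ.
    - by move=> q1 q2 h1 h2; rewrite mulrDr; apply: VD.
    - move=> e em le ge; apply: upd => //; lia.
  pose t := (T - j.+1)%N.
  have tS : (T - j = t.+1)%N by rewrite /t; lia.
  have tm : (t < m)%N by move: jT; rewrite /t /T; lia.
  have td : (t < d)%N by move: jT; rewrite /t /T; lia.
  (* With as much as possible of the degree put at infinity, d - m - t is left to the roots in r,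
     which [hd] allows. *)
  have [|e [em es]] := @exponents_exist r m (d - m - t) _ ur; first by lia.
  pose G := \prod_(b <- r) ('X - b%:P) ^+ e b.
  have sG : size G = (d - m - t).+1.
    rewrite /G -(eq_bigr _ (fun b _ => erefl)) size_prod_seq => [|b _]; last by rewrite expf_neq0 // polyXsubC_eq0.
    under eq_bigr do rewrite size_exp_XsubC; rewrite -es.
    by rewrite -(addn1 (\sum_(b <- r) e b)); under eq_bigr do rewrite -addn1; rewrite big_split /= sum1_size; lia.
  have Ga : G.[a] != 0.
    rewrite /G horner_prod prodf_seq_neq0; apply/allP => b br; rewrite horner_exp hornerXsubC expf_neq0 //.
    by rewrite subr_eq0; apply: contraNneq ar => ->.
  pose c := p.[a] / G.[a].
  have : root (p - c *: G) a by rewrite /root hornerD hornerN hornerZ /c divfK // subrr.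
  move=> /factor_theorem[q qE].
  have pE : p = c *: G + q * ('X - a%:P) by rewrite -qE addrC subrK.
  have sq : (size q <= (d - (T - j)).+1)%N.
    have [->|q0] := eqVneq q 0; first by rewrite size_poly0.
    have := size_Mmonic q0 (monicXsubC a); rewrite -qE size_XsubC addn2 /= => sE.
    have : (size (p - c *: G)%R <= (d - t).+1)%N.
      apply: leq_trans (size_polyD _ _) _; rewrite geq_max size_polyN hp.
      by apply: leq_trans (size_scale_leq _ _) _; rewrite sG; lia.
    by rewrite sE tS; lia.
  rewrite -/t pE mulrDr; apply: VD.
    by rewrite -scalerAr; apply: VZ; apply: upd => //; [exact: ltnW|lia|lia].
  rewrite [q * _]mulrC mulrA -exprSr -tS; apply: IHj => //; exact: ltnW.
move=> p hp; have := key T (leqnn T) p; rewrite subnn subn0 expr0 mul1r; exact.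
Qed.
End SplitPolynomials.

Definition pt (p : option Fq) : P1 K := omap kap p.
(** Infinity contributes the factor 1 but is counted among the 2k poles. *)
Definition pole_factor (z : C) (p : option Fq) : C := if p is Some a then (z - i (kap a))^-1 else 1.

Lemma pt_inj : injective pt.
Proof. by move=> [a|] [b|] //= [/fmorph_inj ->]. Qed.

Lemma u_factor p p' : p != p' -> exists2 c, v c = 1 & forall z, Omega z ->
  u_fun i z (pt p) (pt p') = c * (pole_factor z p * pole_factor z p').
Proof.
case: p => [a|]; case: p' => [b|] // ne.
- exists (i (kap b - kap a)).
    by rewrite viE vkap_sub // eq_sym; apply: contraNneq ne => ->.
  move=> z hz; have h1 := Omega_sub (kap a) hz; have h2 := Omega_sub (kap b) hz.
  by rewrite /u_fun /= rmorphB; field; rewrite h1 h2.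
- by exists (-1); [rewrite (naN Hv) (na1 Hv)|move=> z hz; rewrite /u_fun /= sub0r mulr1 mulN1r].
- by exists 1; [rewrite (na1 Hv)|move=> z hz; rewrite /u_fun /= subr0 !mul1r].
Qed.

(* Sort the 2k poles and pair the j-th one with the (j + k)-th one: they differ because no pole has multiplicity k. *)
Lemma pairing (m : option Fq -> nat) : (\sum_p m p = k + k)%N -> (forall p, m p <= k.-1)%N ->
  exists D, adm D /\ exists2 c, v c = 1 & forall z, Omega z -> Phi D z = c * \prod_p pole_factor z p ^+ m p.
Proof.
move=> msum mle.
pose idx (p : option Fq) : nat := enum_rank p.
have idx_inj : injective idx by move=> p p' /val_inj/enum_rank_inj.
pose le_idx p p' := (idx p <= idx p')%N.
pose L0 := flatten [seq nseq (m p) p | p <- index_enum (option Fq)].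
have big_L0 (T : Type) (x0 : T) (op : Monoid.com_law x0) (f : option Fq -> T) :
    \big[op/x0]_(p <- L0) f p = \big[op/x0]_p iterop (m p) op (f p) x0.
  rewrite /L0 big_flatten big_map; apply: eq_bigr => p _.
  by rewrite big_nseq Monoid.iteropE.
have count_L0 p : count_mem p L0 = m p.
  rewrite count_flatten -map_comp sumnE big_map (bigD1 p) //= count_nseq /= eqxx mul1n big1 ?addn0 // => p' ne.
  by rewrite count_nseq /= (negbTE ne).
have size_L0 : size L0 = (k + k)%N.
  by rewrite -msum size_flatten /shape -map_comp sumnE big_map; apply: eq_bigr => p _ /=; rewrite size_nseq.
pose L := sort le_idx L0.
have pL : perm_eq L L0 by rewrite perm_sort.
have sL : size L = (k + k)%N by rewrite size_sort.
have cL p : count_mem p L = m p by rewrite -count_L0; apply/permP.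
have tot : total le_idx by move=> p p'; apply: leq_total.
have tr_le : transitive le_idx by move=> p q p'; apply: leq_trans.
have srt : sorted le_idx L by apply: sort_sorted.
have mono a b : (a <= b)%N -> (b < k + k)%N -> le_idx (nth None L a) (nth None L b).
  move=> ab bk; apply: (sorted_leq_nth tr_le) => //; first by move=> p; apply: leqnn.
    by rewrite inE sL (leq_ltn_trans ab).
  by rewrite inE sL.
have k0 : (0 < k)%N by apply: ltnW.
have strict j : (j < k)%N -> (idx (nth None L j) < idx (nth None L (j + k)))%N.
  move=> jk; rewrite ltn_neqAle; apply/andP; split; last by apply: mono; [exact: leq_addr|rewrite ltn_add2r].
  (* In the sorted list equality would force k + 1 consecutive entries to be p. *)
  apply/eqP => /idx_inj e; set p := nth None L j in e.
  have : (k.+1 <= count_mem p L)%N.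
    pose B := take k.+1 (drop j L).
    have sB : size B = k.+1 by rewrite /B size_takel // size_drop sL; lia.
    have aB : all (pred1 p) B.
      apply/(all_nthP None) => t; rewrite sB => tk; rewrite /B nth_take // nth_drop.
      apply/eqP/idx_inj/eqP; rewrite eqn_leq; apply/andP; split.
        by rewrite e; apply: mono; [rewrite leq_add2l -ltnS|rewrite ltn_add2r].
      by apply: mono; [exact: leq_addr|apply: leq_ltn_trans (_ : j + k < k + k)%N; [rewrite leq_add2l -ltnS|rewrite ltn_add2r]].
    rewrite -{1}sB -[X in (X <= _)%N](eqP (_ : count (pred1 p) B == size B)); last by rewrite -all_count.
    have -> : count_mem p L = (count_mem p (take j L) + (count_mem p B + count_mem p (drop k.+1 (drop j L))))%N.
      by rewrite -!count_cat !cat_take_drop.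
    by rewrite addnCA leq_addr.
  by rewrite cL leqNgt ltnS (leq_trans (mle p)) // leq_pred.
pose Lp := [seq (nth None L j, nth None L (j + k)) | j <- iota 0 k].
have sLp : size Lp = k by rewrite size_map size_iota.
have Lp1 : [seq x.1 | x <- Lp] = take k L.
  rewrite -map_comp; apply: (@eq_from_nth _ None); first by rewrite size_map size_iota size_takel // sL leq_addr.
  move=> j; rewrite size_map size_iota => jk.
  by rewrite (nth_map 0%N) ?size_iota // nth_iota // add0n nth_take.
have Lp2 : [seq x.2 | x <- Lp] = drop k L.
  rewrite -map_comp; apply: (@eq_from_nth _ None); first by rewrite size_map size_iota size_drop sL addnK.
  move=> j; rewrite size_map size_iota => jk.
  by rewrite (nth_map 0%N) ?size_iota // nth_iota // add0n nth_drop addnC.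
have Lp_lt x : x \in Lp -> (idx x.1 < idx x.2)%N.
  by move=> /mapP[j]; rewrite mem_iota add0n => jk ->; apply: strict.
(* Admissible data have distinct pairs, so repeated pairs become exponents. *)
pose U := undup Lp.
have U_in t : (t < size U)%N -> nth (None, None) U t \in Lp by move=> h; rewrite -mem_undup mem_nth.
pose D := @PoincareData K (size U) (fun t => count_mem (nth (None, None) U t) Lp)
  (fun t => pt (nth (None, None) U t).1) (fun t => pt (nth (None, None) U t).2).
have int0 : \bigcap_t [set pd_a D t; pd_b D t] = set0.
  apply/seteqP; split=> // x hx.
  have U0 : (0 < size U)%N.
    rewrite lt0n size_eq0; apply/eqP => e.
    have : nth (None, None) Lp 0 \in U by rewrite mem_undup mem_nth // sLp.
    by rewrite e.
  have [p xp] : exists p, x = pt p.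
    by have [->|->] := hx (Ordinal U0) I; eexists.
  have all_p y : y \in Lp -> (y.1 == p) || (y.2 == p).
    rewrite -mem_undup => yU; have lt : (index y U < size U)%N by rewrite index_mem.
    have := hx (Ordinal lt) I; rewrite /= nth_index // xp => -[/pt_inj->|/pt_inj->]; by rewrite eqxx ?orbT.
  (* A point common to all k pairs would occur k times. *)
  have : (k <= count_mem p L)%N.
    have -> : count_mem p L = (count_mem p (take k L) + count_mem p (drop k L))%N.
      by rewrite -count_cat cat_take_drop.
    rewrite -Lp1 -Lp2 (count_map _ _ Lp) (count_map _ _ Lp) -count_predUI.
    suff /eqP -> : count (predU (preim fst (pred1 p)) (preim snd (pred1 p))) Lp == size Lp by rewrite sLp leq_addr.
    by rewrite -all_count; apply/allP => y yL; apply: all_p.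
  by rewrite cL leqNgt => /negP; apply; apply: leq_ltn_trans (mle p) _; rewrite ltn_predL.
exists D; split.
  split=> //.
  - rewrite ltnNge; apply/negP => r1; have [t0 ht0] : exists t0 : 'I_(size U), True.
      have U0 : (0 < size U)%N.
        rewrite lt0n size_eq0; apply/eqP => e.
        have : nth (None, None) Lp 0 \in U by rewrite mem_undup mem_nth // sLp.
        by rewrite e.
      by exists (Ordinal U0).
    have : (\bigcap_t [set pd_a D t; pd_b D t]) (pd_a D t0).
      move=> t _; left; congr (pd_a D _); apply/val_inj => /=.
      have := ltn_ord t; have := ltn_ord t0; rewrite /= in r1 *; lia.
    by rewrite int0.
  - split=> [t /=|]; first by rewrite -has_count has_pred1 U_in.
    transitivity (size Lp); last exact: sLp.
    rewrite -sum1_size -(big_undup_iterop_count _ Lp xpredT (fun=> 1%N)) -/U (big_nth (None, None)) big_mkord.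
    by apply: eq_bigr => t _; rewrite Monoid.iteropE iter_addn_0 mul1n.
  - move=> t /= /pt_inj e; have := Lp_lt _ (U_in t (ltn_ord t)); by rewrite e ltnn.
  - move=> t t' tt' /= /seteqP[h1 h2]; apply: tt'; apply/val_inj/eqP.
    rewrite -(nth_uniq (None, None) (ltn_ord t) (ltn_ord t')) ?undup_uniq //; apply/eqP.
    have lt := Lp_lt _ (U_in t (ltn_ord t)); have lt' := Lp_lt _ (U_in t' (ltn_ord t')).
    have := h1 _ (or_introl erefl); have := h1 _ (or_intror erefl).
    move: lt lt'; case: (nth _ U t) => a b; case: (nth _ U t') => a' b' /= lt lt'.
    case=> /pt_inj eb; case=> /pt_inj ea; move: lt; rewrite ea eb ?ltnn // => lt.
    by move: (ltn_trans lt lt'); rewrite ltnn.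
pose cu (x : option Fq * option Fq) : C := if pselect (x.1 != x.2) is left h then projT1 (cid2 (u_factor h)) else 1.
have cuP x : x \in Lp -> v (cu x) = 1 /\ forall z, Omega z ->
    u_fun i z (pt x.1) (pt x.2) = cu x * (pole_factor z x.1 * pole_factor z x.2).
  move=> /Lp_lt lt; have ne : x.1 != x.2 by apply: contraTneq lt => ->; rewrite ltnn.
  by rewrite /cu; case: pselect => // h; case: cid2.
exists (\prod_(x <- Lp) cu x).
  by rewrite (na_prod Hv) big_seq big1 // => x /cuP[].
move=> z hz; rewrite /Phi /=.
have -> : \prod_(t < size U) u_fun i z (pt (nth (None, None) U t).1) (pt (nth (None, None) U t).2) ^+ count_mem (nth (None, None) U t) Lp
   = \prod_(x <- Lp) u_fun i z (pt x.1) (pt x.2).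
  by rewrite -[RHS]prodr_undup_exp_count -/U [RHS](big_nth (None, None)) big_mkord.
rewrite (eq_big_seq (fun x => cu x * (pole_factor z x.1 * pole_factor z x.2))) => [|x /cuP[_ ->]//].
rewrite big_split /=; congr (_ * _); rewrite big_split /=.
rewrite -(big_map (fun x => x.1) xpredT (pole_factor z)) -(big_map (fun x => x.2) xpredT (pole_factor z)).
rewrite Lp1 Lp2 -big_cat cat_take_drop (perm_big _ pL) big_L0.
exact: eq_bigr.
Qed.

Local Notation q := #|Fq|.
(** This is X ^ q - X; the factored form shows its absolute value near each residue class. *)
Definition Hp : {poly C} := \prod_(a : Fq) ('X - (i (kap a))%:P).

Lemma HpE z : Hp.[z] = \prod_(a : Fq) (z - i (kap a)).
Proof. by rewrite horner_prod; apply: eq_bigr => a _; rewrite hornerXsubC. Qed.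
Lemma size_Hp : size Hp = q.+1.
Proof.
rewrite /Hp -(big_map (fun a => i (kap a)) xpredT (fun x => 'X - x%:P)) size_prod_XsubC size_map.
by rewrite -[index_enum _]enumT -cardE.
Qed.
Lemma Hp_monic : Hp \is monic. Proof. exact: monic_prod_XsubC. Qed.
Lemma q_gt0 : (0 < q)%N. Proof. exact: ltnW (finNzRing_gt1 _). Qed.

Lemma Hp_trans z b : Hp.[z + i (kap b)] = Hp.[z].
Proof.
rewrite !HpE (reindex (fun a => a + b)) /=; last by exists (fun a => a - b) => a _; rewrite ?addrK ?subrK.
by apply: eq_bigr => a _; rewrite !rmorphD opprD addrACA subrr addr0.
Qed.
Lemma v_Hp z : v Hp.[z] = \prod_(a : Fq) v (z - i (kap a)).
Proof. by rewrite HpE (na_prod Hv). Qed.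
Lemma v_ikap a : v (i (kap a)) <= 1. Proof. by rewrite viE vkap_le1. Qed.
Lemma v_sub_ikap z a : v z <= 1 -> v (z - i (kap a)) <= 1.
Proof. by move=> z1; apply: (na_le_sub Hv) => //; apply: v_ikap. Qed.
Lemma Hp_le z a : v z <= 1 -> v Hp.[z] <= v (z - i (kap a)).
Proof.
move=> z1; rewrite v_Hp (bigD1 a) //= ler_piMr ?(na_ge0 Hv) //.
by apply: prodr_ile1 => b _; rewrite (na_ge0 Hv) v_sub_ikap.
Qed.
Lemma Hp_near z a : v z <= 1 -> v (z - i (kap a)) < 1 -> v Hp.[z] = v (z - i (kap a)).
Proof.
move=> z1 za; rewrite v_Hp (bigD1 a) //= big1 ?mulr1 // => b ba.
rewrite -(subrKA (i (kap a))) (na_eq_addr Hv) -rmorphB viE vkap_sub //; by rewrite eq_sym.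
Qed.
Lemma Hp_le1 z : v z <= 1 -> v Hp.[z] <= 1.
Proof. by move=> z1; apply: le_trans (Hp_le 0 z1) (v_sub_ikap _ z1). Qed.
Lemma Hp_far z : 1 < v z -> v Hp.[z] = v z ^+ q.
Proof.
move=> z1; rewrite v_Hp (eq_bigr (fun=> v z)) => [|a _]; first by rewrite prodr_const.
by rewrite (na_eq_subl Hv) // (le_lt_trans (v_ikap a)).
Qed.
Lemma near_dicho z : v z <= 1 -> (exists a, v (z - i (kap a)) < 1) \/ v Hp.[z] = 1.
Proof.
move=> z1; have [h|h] := pselect (exists a, v (z - i (kap a)) < 1); first by left.
right; rewrite v_Hp big1 // => a _; apply/le_anti; rewrite v_sub_ikap // leNgt.
by apply/negP => h2; apply: h; exists a.
Qed.
Lemma iabs_le_Hp z : v z <= 1 -> iabs z <= v Hp.[z].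
Proof.
move=> z1; have [[a za]|->] := near_dicho z1; first by rewrite (Hp_near z1 za) iabs_le.
exact: le_trans (iabs_le_v _) z1.
Qed.
(** An integral x is within s ^ 4 of some residue a, which is less than |z - a|, so |z - x| = |z -
    a|. With [iabs_le_Hp] this identifies iabs and |H| on the circles used below. *)
Lemma Hp_le_iabs z : v z <= 1 -> s ^+ 4 < v Hp.[z] -> v Hp.[z] <= iabs z.
Proof.
move=> z1 h; apply: le_iabs => x; have [x1|x1] := leP (vK x) 1; last first.
  rewrite (na_eq_subr Hv) viE; last exact: le_lt_trans x1.
  exact: le_trans (Hp_le1 z1) (ltW x1).
have [a /vK_lt1 ha] := resK x1.
rewrite -(subrKA (i (kap a))) (na_eq_addl Hv); first exact: Hp_le.
by rewrite (naBC Hv) -rmorphB viE (le_lt_trans ha) // (lt_le_trans h) // Hp_le.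
Qed.
Lemma Hp_root y : v y <= 1 -> exists2 z, v z <= 1 & Hp.[z] = y.
Proof.
move=> y1; have [rs e] := closed_field_splits Cclosed (Hp - y%:P).
have sz : size (Hp - y%:P) = q.+1.
  by rewrite size_polyDl size_Hp // size_polyN ltnS (leq_trans (size_polyC_leq1 _)) ?q_gt0.
have [z zr] : exists z, z \in rs.
  case: rs e => [|z rs] e; last by exists z; rewrite mem_head.
  have := congr1 (fun p : {poly C} => size p) e; rewrite big_nil alg_polyC sz => h.
  by have := size_polyC_leq1 (lead_coef (Hp - y%:P)); rewrite -h ltnS leqNgt q_gt0.
have zy : Hp.[z] = y.
  apply/eqP; rewrite -subr_eq0 -[y in _ - y](hornerC y z) -hornerN -hornerD e hornerZ mulf_eq0.
  by rewrite -/(root _ z) root_prod_XsubC zr orbT.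
exists z => //; rewrite leNgt; apply/negP => z1; move: y1; rewrite -zy Hp_far // leNgt exprn_egt1 //.
by rewrite -lt0n q_gt0.
Qed.

Definition bnd (p : {poly C}) (B : R) := forall n, v p`_n <= B.
Lemma bnd0 B : 0 <= B -> bnd 0 B. Proof. by move=> B0 n; rewrite coef0 (na0 Hv). Qed.
Lemma bndD p p' B : bnd p B -> bnd p' B -> bnd (p + p') B.
Proof. by move=> h h' n; rewrite coefD; apply: (na_le_add Hv). Qed.
Lemma bndZ c p B : 0 <= B -> v c <= B -> bnd p 1 -> bnd (c *: p) B.
Proof.
move=> B0 hc hp n; rewrite coefZ (naM Hv) -[leRHS]mulr1.
by apply: ler_pM; rewrite ?(na_ge0 Hv).
Qed.
Lemma bndM p p' B : 0 <= B -> bnd p B -> bnd p' 1 -> bnd (p * p') B.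
Proof.
move=> B0 h h' n; rewrite coefM; apply: (na_sum Hv) => // j _; rewrite (naM Hv) -[leRHS]mulr1.
by apply: ler_pM; rewrite ?(na_ge0 Hv).
Qed.
Lemma bnd_sum (I : Type) (r : seq I) (P : pred I) (F : I -> {poly C}) B : 0 <= B ->
  (forall j, P j -> bnd (F j) B) -> bnd (\sum_(j <- r | P j) F j) B.
Proof. by move=> B0 h; elim/big_rec: _ => [|j p Pj hp]; [exact: bnd0|apply: bndD => //; apply: h]. Qed.
Lemma bnd1 : bnd 1 1.
Proof. by move=> n; rewrite coef1; case: eqP => _; rewrite ?(na1 Hv) ?(na0 Hv) ?ler01. Qed.
Lemma bndXsubC c : v c <= 1 -> bnd ('X - c%:P) 1.
Proof.
move=> hc n; rewrite coefB coefX coefC; apply: (na_le_sub Hv); case: eqP => _ //; by rewrite ?(na1 Hv) ?(na0 Hv) ?ler01.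
Qed.
Lemma bnd_prod (I : Type) (r : seq I) (P : pred I) (F : I -> {poly C}) :
  (forall j, P j -> bnd (F j) 1) -> bnd (\prod_(j <- r | P j) F j) 1.
Proof. by move=> h; elim/big_rec: _ => [|j p Pj hp]; [exact: bnd1|apply: bndM => //; apply: h]. Qed.
Lemma bndX p n : bnd p 1 -> bnd (p ^+ n) 1.
Proof. by move=> h; elim: n => [|n IH]; [exact: bnd1|rewrite exprS; apply: bndM]. Qed.
Lemma bnd_Hp : bnd Hp 1.
Proof. by apply: bnd_prod => a _; apply/bndXsubC/v_ikap. Qed.
Lemma bnd_horner p B z : 0 <= B -> bnd p B -> v z <= 1 -> v p.[z] <= B.
Proof.
move=> B0 hp z1; rewrite horner_coef; apply: (na_sum Hv) => // j _; rewrite (naM Hv) (naX Hv) -[leRHS]mulr1.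
by apply: ler_pM; rewrite ?(na_ge0 Hv) ?exprn_ge0 ?(na_ge0 Hv) // exprn_ile1 ?(na_ge0 Hv).
Qed.
Lemma bnd_horner_far p B z n : 0 <= B -> bnd p B -> (size p <= n.+1)%N -> 1 <= v z -> v p.[z] <= B * v z ^+ n.
Proof.
move=> B0 hp sp z1; rewrite horner_coef; apply: (na_sum Hv) => [|j _]; first by rewrite mulr_ge0 ?exprn_ge0 ?(na_ge0 Hv).
rewrite (naM Hv) (naX Hv); apply: ler_pM; rewrite ?(na_ge0 Hv) ?exprn_ge0 ?(na_ge0 Hv) // ler_weXn2l //.
by rewrite -ltnS (leq_trans _ sp).
Qed.

Definition Lag (a : Fq) : {poly C} := \prod_(b | b != a) ((i (kap a - kap b))^-1 *: ('X - (i (kap b))%:P)).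
Lemma bnd_Lag a : bnd (Lag a) 1.
Proof.
apply: bnd_prod => b ba; apply: bndZ => //; last exact/bndXsubC/v_ikap.
by rewrite (naV Hv) viE vkap_sub ?invr1 // eq_sym.
Qed.
Lemma Lag_val a c : (Lag a).[i (kap c)] = (c == a)%:R.
Proof.
rewrite horner_prod; have [->|ca] := eqVneq c a.
  rewrite big1 // => b ba; rewrite hornerZ hornerXsubC [i (kap a - _)](rmorphB i) mulVf // subr_eq0.
  by rewrite (inj_eq (fmorph_inj i)) (inj_eq (fmorph_inj kap)) eq_sym.
by rewrite (bigD1 c) //= hornerZ hornerXsubC subrr mulr0 mul0r.
Qed.
Lemma size_Lag a : (size (Lag a) <= q)%N.
Proof.
have nz b : b != a -> (i (kap a - kap b))^-1 *: ('X - (i (kap b))%:P) != 0.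
  move=> ba; rewrite scaler_eq0 negb_or polyXsubC_eq0 andbT invr_eq0 fmorph_eq0 -rmorphB fmorph_eq0.
  by rewrite subr_eq0 eq_sym.
rewrite size_prod //; under eq_bigr => b ba.
  rewrite size_scale ?size_XsubC; last by have := nz b ba; rewrite scaler_eq0 negb_or => /andP[].
  over.
by rewrite sum_nat_const muln2 -addnn subSn ?leq_addr // addnK cardC1 prednK ?q_gt0.
Qed.

Lemma lagrange (Q : {poly C}) : (size Q <= q)%N -> Q = \sum_a Q.[i (kap a)] *: Lag a.
Proof.
move=> sQ; apply/eqP; rewrite -subr_eq0; set D := _ - _.
have sD : (size D <= q)%N.
  apply: leq_trans (size_polyD _ _) _; rewrite geq_max sQ size_polyN.
  apply: leq_trans (size_sum _ _ _) _; apply/bigmax_leqP => a _.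
  exact: leq_trans (size_scale_leq _ _) (size_Lag a).
apply/eqP; apply: (@roots_geq_poly_eq0 _ D [seq i (kap a) | a <- enum Fq]).
- apply/allP => _ /mapP[c _ ->]; rewrite /root /D hornerD hornerN horner_sum (bigD1 c) //= hornerZ Lag_val eqxx mulr1.
  rewrite big1 ?addr0 ?subrr // => a ac; by rewrite hornerZ Lag_val eq_sym (negbTE ac) mulr0.
- by rewrite map_inj_uniq ?enum_uniq // => a b /fmorph_inj/fmorph_inj.
- by rewrite size_map -cardE.
Qed.

(** The nodes differ by units, so the Lagrange polynomials have coefficients of absolute value at
    most 1, and a shift by z0 preserves bounds on coefficients. *)
Lemma interp (Q : {poly C}) z0 B : (size Q <= q)%N -> 0 <= B -> v z0 <= 1 ->
  (forall a, v Q.[z0 + i (kap a)] <= B) -> bnd Q B.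
Proof.
move=> sQ B0 z1 h; pose Q' := Q \Po ('X + z0%:P).
have sQ' : (size Q' <= q)%N.
  by rewrite /Q' -[z0%:P]opprK -polyCN size_comp_poly2 // size_XsubC.
have bQ' : bnd Q' B.
  rewrite (lagrange sQ'); apply: bnd_sum => // a _; apply: bndZ => //; last exact: bnd_Lag.
  by rewrite /Q' horner_comp !hornerE addrC.
have -> : Q = Q' \Po ('X - z0%:P) by rewrite -comp_polyA comp_polyD comp_polyX comp_polyC subrK comp_polyXr.
rewrite comp_polyE; apply: bnd_sum => // j _; apply: bndZ => //; apply: bndX; exact: bndXsubC.
Qed.

Lemma base_expand (P : {poly C}) : exists (B : nat -> {poly C}) L0, (forall n, (size (B n) <= q)%N) /\
  forall L, (L0 <= L)%N -> P = \sum_(n < L) B n * Hp ^+ n.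
Proof.
have [n] := ubnP (size P); elim: n P => // n IH P hP.
have [sP|sP] := leqP (size P) q.
  exists (fun n => if n == 0%N then P else 0), 1%N; split=> [m|[|L] // _].
    by case: eqP; rewrite ?size_poly0.
  by rewrite big_ord_recl /= expr0 mulr1 big1 ?addr0 // => j _; rewrite mul0r.
have hd := divp_eq P Hp.
have Hp0 : Hp != 0 by apply: monic_neq0 Hp_monic.
have [|B [L0 [sB hB]]] := IH (P %/ Hp).
  rewrite size_divp // size_Hp /=; move: q_gt0 hP sP; move: (size P) q => x y; clear; lia.
exists (fun n => if n is m.+1 then B m else P %% Hp), L0.+1; split=> [[|m] //|[|L] // hL].
  by rewrite -ltnS -size_Hp ltn_modp.
rewrite big_ord_recl /= expr0 mulr1 {1}hd {1}(hB L hL) addrC mulr_suml; congr (_ + _).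
by apply: eq_bigr => j _; rewrite exprSr mulrA.
Qed.

(** For |y| = |t| the solutions of H(z) = y are the z0 + a with a in Fq. The values there control,
    through [interp], the coefficients of the sum of the y ^ n B_n; [gauss_coef] in the variable y
    then separates the indices n. *)
Lemma expand_coef (B : nat -> {poly C}) L t M : (forall n, (size (B n) <= q)%N) -> v t <= 1 -> 0 <= M ->
  (forall z, v z <= 1 -> v Hp.[z] = v t -> v (\sum_(n < L) B n * Hp ^+ n).[z] <= M) ->
  forall n j, (n < L)%N -> v (B n)`_j * v t ^+ n <= M.
Proof.
move=> sB t1 M0 h n j nL; pose P := \poly_(n < L) (B n)`_j.
have -> : (B n)`_j = P`_n by rewrite coef_poly nL.
apply: gauss_coef => // y yt; have [z0 z1 zy] : exists2 z, v z <= 1 & Hp.[z] = y by apply: Hp_root; rewrite yt.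
pose Q := \sum_(n < L) y ^+ n *: B n.
have -> : P.[y] = Q`_j.
  by rewrite horner_poly coef_sum; apply: eq_bigr => m _; rewrite coefZ mulrC.
apply: (@interp Q z0 M) => //.
  by apply: leq_trans (size_sum _ _ _) _; apply/bigmax_leqP => m _; apply: leq_trans (size_scale_leq _ _) _.
move=> a; have e : Hp.[z0 + i (kap a)] = y by rewrite Hp_trans.
have -> : Q.[z0 + i (kap a)] = (\sum_(n < L) B n * Hp ^+ n).[z0 + i (kap a)].
  by rewrite !horner_sum; apply: eq_bigr => m _; rewrite hornerM horner_exp e hornerZ mulrC.
by apply: h; rewrite ?e //; apply: (na_le_add Hv) => //; apply: v_ikap.
Qed.

Lemma Hp_neq0 z : Omega z -> Hp.[z] != 0.
Proof. by move=> hz; rewrite HpE prodf_seq_neq0; apply/allP => a _; apply: Omega_sub. Qed.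

(** A closed affinoid containing [vertex0] and the bounding middle circles of edges. One hole for
    each residue class suffices because integral points of K are within s ^ 4 of a
    representative. *)
Let X : set C := affinoid v 0 (sig ^- 2) [seq (a, sig ^+ 2) | a <- [seq i (kap a) | a <- index_enum Fq]].

Lemma vertex_affinoidP z : X z <-> v z <= s ^- 2 /\ forall a, s ^+ 2 <= v (z - i (kap a)).
Proof.
rewrite /X /affinoid /= subr0 (naV Hv) (naX Hv) vsig; split=> -[h1 h2]; split=> //.
  move=> a; have := h2 (i (kap a), sig ^+ 2); rewrite /= (naX Hv) vsig; apply.
  by rewrite -map_comp; apply/mapP; exists a; rewrite // mem_index_enum.
by move=> x; rewrite -map_comp => /mapP[a _ ->]; rewrite /= (naX Hv) vsig.
Qed.

Lemma vertex_affinoid_iabs z : X z -> s ^+ 2 <= iabs z.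
Proof.
move=> /vertex_affinoidP[z1 z2]; apply: le_iabs => x; have [x1|x1] := leP (vK x) 1.
  have [a /vK_lt1 ha] := resK x1.
  rewrite -(subrKA (i (kap a))) (na_eq_addl Hv) //.
  by rewrite (naBC Hv) -rmorphB viE (le_lt_trans ha) // (lt_le_trans _ (z2 a)) // sX_lt.
have x2 : s ^- 2 < vK x by rewrite ltNge; apply/negP => h; move: x1; rewrite ltNge vK_lt_inv2 // lt_neqAle h andbT; have := @vK_nonint (-2) x; rewrite exprnN; apply.
rewrite (na_eq_subr Hv) viE ?(le_lt_trans z1) //; apply: le_trans (ltW x2); rewrite ltW //; exact: s_lt_inv2.
Qed.
Lemma vertex_affinoid_Omega : X `<=` Omega.
Proof. by move=> z /vertex_affinoid_iabs h; apply/OmegaP; apply: lt_le_trans h; apply: sX_gt0. Qed.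
Lemma vertex0_affinoid : vertex0 `<=` X.
Proof. by move=> z [h1 h2]; apply/vertex_affinoidP; split; [exact: ltW|move=> a; apply: ltW]. Qed.
Lemma vertex_affinoid_Hp z : X z -> v z <= 1 -> s ^+ 2 <= v Hp.[z].
Proof.
move=> /vertex_affinoidP[_ h] z1; have [[a za]|->] := near_dicho z1; first by rewrite (Hp_near z1 za).
by rewrite exprn_ile1 // ltW.
Qed.

Lemma iabs_outer z : v z = s ^- 2 -> X z /\ is_edge z /\ iabs z = s ^- 2.
Proof.
move=> z2; have e : iabs z = v z by apply: iabs_nonint => x; rewrite z2 exprnN; apply: vK_nonint.
have one : 1 < s ^- 2 by rewrite invf_gt1 ?sX_gt0 // exprn_ilt1 // ltW.
have xz : X z.
  apply/vertex_affinoidP; rewrite z2; split=> // a; rewrite (na_eq_subl Hv) z2; last exact: le_lt_trans (v_ikap a) one.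
  exact/ltW/s_lt_inv2.
by split=> //; split; [split; [exact: vertex_affinoid_Omega|exists (-1); rewrite e z2 exprnN]|rewrite e].
Qed.

Hypothesis q_gt2 : (2 < q)%N.
(** Chosen so that z ^ deg z ^ k / H ^ (k - 1) has absolute value 1 for |z| > 1; terms of P from
    this degree on are controlled by the edge towards infinity. *)
Local Notation deg := (q * k.-1 - k)%N.

Lemma deg_ge : (k <= q * k.-1)%N.
Proof. move: k_ge2 q_gt2; move: (k) (#|Fq|) => x y; nia. Qed.

Lemma vertex_exponent x y w m : (x <= m)%N -> (2 < y)%N -> (2 <= w)%N -> (y.-1 + y * x + w <= y * (m + w))%N.
Proof. by move=> /(leq_mul (leqnn y)); clear; nia. Qed.

(* In the Hp-adic expansion of an approximation of f on X, the terms below Hp ^ (1 - k) are small because f is small on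
   the circles |Hp| = s ^ 2, which lie above edges. *)
Lemma vertex_truncate f N : rigid_holomorphic i v f -> 0 < N -> (forall z, Omega z -> nu f z <= N) ->
  (forall z, is_edge z -> nu f z <= s * N) ->
  exists2 P : {poly C}, bnd P N & forall z, X z -> nu (fun z => f z - P.[z] / Hp.[z] ^+ k.-1) z <= s * N.
Proof.
move=> hf N0 fN fE; have sN : 0 < s * N by rewrite mulr_gt0.
have sNN : s * N <= N by rewrite ger_pMl // ltW.
pose e1 := s * N * s ^+ (2 * k); have e10 : 0 < e1 by rewrite mulr_gt0 // sX_gt0.
have sig0 : sig != 0 by rewrite -(na_gt0 Hv) vsig.
have sigX n : sig ^+ n != 0 by rewrite expf_neq0.
have fX : rational_approx v X f.
  apply: hf; [by rewrite invr_eq0| by apply: holes_neq0|exact: vertex_affinoid_Omega].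
have [||P [m0 hP]] := runge _ _ fX e10; [by rewrite invr_eq0|by []|].
have HE : \prod_(a <- [seq i (kap a) | a <- index_enum Fq]) ('X - a%:P) = Hp by rewrite big_map.
rewrite HE in hP.
have iab2 z : X z -> iabs z <= s ^- 2.
  by move=> /vertex_affinoidP[h _]; apply: le_trans h; apply: iabs_le_v.
have hP2 z : X z -> nu (fun z => f z - P.[z] / Hp.[z] ^+ m0) z <= s * N.
  move=> hz; apply: le_trans (_ : e1 * (s ^- 2) ^+ k <= _).
    apply: ler_pM; [exact: (na_ge0 Hv)|exact/exprn_ge0/iabs_ge0|exact/ltW/hP|].
    by rewrite lerXn2r ?nnegrE ?iabs_ge0 ?invr_ge0 ?(ltW (sX_gt0 _)) ?iab2.
  by rewrite /e1 exprM exprVn mulfK // expf_neq0 // gt_eqF // sX_gt0.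
pose g z := P.[z] / Hp.[z] ^+ m0.
have nu_sub f1 f2 z B : nu f1 z <= B -> nu (fun z => f1 z - f2 z) z <= B -> Omega z -> nu f2 z <= B.
  rewrite /nu => h1 h2 hz; have ip : 0 < iabs z ^+ k by rewrite exprn_gt0 // iabs_gt0.
  rewrite -ler_pdivlMr // in h1 *; rewrite -ler_pdivlMr // in h2 *; rewrite -ler_pdivlMr //.
  by rewrite -[f2 z](subKr (f1 z)); apply: (na_le_sub Hv).
have gN z : X z -> nu g z <= N.
  move=> hz; have oz := vertex_affinoid_Omega hz.
  by apply: (nu_sub f) => //; [exact: fN|apply: le_trans (hP2 z hz) _].
have gE z : X z -> is_edge z -> nu g z <= s * N.
  by move=> hz ez; apply: (nu_sub f) => //; [exact: fE|exact: hP2|exact: vertex_affinoid_Omega].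
(* After multiplication by H ^ k digit n belongs to H ^ (n - m0 - k), so the digits to be discarded
   are those with n <= m0. *)
have [B [L0 [sB hB]]] := base_expand (P * Hp ^+ k).
pose L := (L0 + (m0 + 1))%N; have {}hB := hB L (leq_addr _ _).
have PE z : (\sum_(n < L) B n * Hp ^+ n).[z] = P.[z] * Hp.[z] ^+ k by rewrite -hB hornerM horner_exp.
have vPE z : X z -> v z <= 1 -> iabs z = v Hp.[z] ->
    v (P.[z] * Hp.[z] ^+ k) = nu g z * v Hp.[z] ^+ m0.
  move=> hz z1 ie; rewrite /nu /g ie (naF Hv) !(naM Hv) !(naX Hv).
  have : v Hp.[z] != 0 by rewrite (na_eq0 Hv) Hp_neq0 //; apply: vertex_affinoid_Omega.
  by move: (v Hp.[z]) (v P.[z]) => h p h0; field; rewrite expf_neq0.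
have circ j z : (j <= 2)%N -> v z <= 1 -> v Hp.[z] = s ^+ j -> X z /\ iabs z = v Hp.[z].
  move=> j2 z1 hz; split.
    apply/vertex_affinoidP; split=> [|a]; first by apply: le_trans z1 _; rewrite invf_ge1 ?sX_gt0 // exprn_ile1 // ltW.
    by apply: le_trans (Hp_le a z1); rewrite hz sX_le.
  by apply/le_anti; rewrite iabs_le_Hp // Hp_le_iabs // hz sX_lt (leq_ltn_trans j2).
(* On |H| = 1 the bound N passes to all digits. On |H| = s ^ 2, above edges, the estimate [c2]
   improves this by a factor s for n <= m0. *)
have c0 n j : (n < L)%N -> v (B n)`_j <= N.
  move=> nL; have := @expand_coef B L 1 N sB; rewrite (na1 Hv) => h.
  have := h (lexx 1) (ltW N0) _ n j nL; rewrite expr1n mulr1; apply.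
  move=> z z1 hz; have [xz iz] := @circ 0%N z isT z1 hz.
  by rewrite PE vPE // hz expr1n mulr1 gN.
have c2 n j : (n < L)%N -> v (B n)`_j * s ^+ (2 * n) <= s * N * s ^+ (2 * m0).
  move=> nL; have := @expand_coef B L (sig ^+ 2) (s * N * s ^+ (2 * m0)) sB.
  have vs2 : v (sig ^+ 2) = s ^+ 2 by rewrite (naX Hv) vsig.
  rewrite (exprM s 2 n) -vs2; apply=> //.
  - by rewrite vs2 exprn_ile1 // ltW.
  - by rewrite mulr_ge0 // ltW // sX_gt0.
  move=> z z1; rewrite vs2 => hz; have [xz iz] := @circ 2%N z isT z1 hz.
  rewrite PE vPE // hz -exprM ler_pM2r ?sX_gt0 //; apply: gE => //; split; first exact: vertex_affinoid_Omega.
  by exists 0; rewrite iz hz.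
exists (\sum_(n < L0) B (m0 + 1 + n)%N * Hp ^+ n).
  apply: bnd_sum => [|n _]; first exact: ltW.
  by apply: bndM; [exact: ltW|move=> j; apply: c0; rewrite /L addnC ltn_add2r|apply/bndX/bnd_Hp].
move=> z hz; have oz := vertex_affinoid_Omega hz; have H0 := Hp_neq0 oz.
have -> : nu (fun z => f z - (\sum_(n < L0) B (m0 + 1 + n)%N * Hp ^+ n).[z] / Hp.[z] ^+ k.-1) z
  = nu (fun z => (f z - g z) + \sum_(n < m0 + 1) (B n).[z] * Hp.[z] ^+ n / Hp.[z] ^+ (m0 + k)) z.
  congr (v _ * _); rewrite -addrA; congr (_ + _).
  have kE : (m0 + k = m0 + 1 + k.-1)%N by rewrite -addnA add1n prednK // ltnW.
  have e2 : P.[z] * Hp.[z] ^+ k = \sum_(n < m0 + 1) (B n).[z] * Hp.[z] ^+ n +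
      Hp.[z] ^+ (m0 + 1) * (\sum_(n < L0) B (m0 + 1 + n)%N * Hp ^+ n).[z].
    rewrite -PE /L addnC big_split_ord /= hornerD; congr (_ + _).
      by rewrite horner_sum; apply: eq_bigr => n _; rewrite hornerM horner_exp.
    rewrite !horner_sum mulr_sumr; apply: eq_bigr => n _; rewrite !hornerM !horner_exp exprD; ring.
  have gEq : g z = P.[z] * Hp.[z] ^+ k / Hp.[z] ^+ (m0 + k).
    by rewrite /g exprD; field; rewrite !expf_neq0.
  rewrite -mulr_suml gEq e2 kE (exprD _ (m0 + 1)); field; by rewrite !expf_neq0.
rewrite /nu; have ip : 0 < iabs z ^+ k by rewrite exprn_gt0 // iabs_gt0.
rewrite -ler_pdivlMr //; apply: (na_le_add Hv).
  by rewrite ler_pdivlMr //; apply: hP2.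
apply: (na_sum Hv) => [|n _]; first by rewrite divr_ge0 ?ltW.
rewrite ler_pdivlMr // (naF Hv) (naM Hv) !(naX Hv).
have nm : (n <= m0)%N by have := ltn_ord n; rewrite {2}addn1 ltnS.
have nL : (n < L)%N by rewrite /L; move: nm; clear; lia.
have h0 : 0 < v Hp.[z] by rewrite (na_gt0 Hv).
have [z1|z1] := leP (v z) 1.
  set h := v Hp.[z] in h0 *; have h2 : s ^+ 2 <= h by apply: vertex_affinoid_Hp.
  have ih : iabs z ^+ k <= h ^+ k by rewrite lerXn2r ?nnegrE ?iabs_ge0 ?(ltW h0) ?iabs_le_Hp.
  apply: le_trans (_ : v (B n).[z] * h ^+ n / h ^+ (m0 + k) * h ^+ k <= _).
    by rewrite ler_wpM2l // divr_ge0 ?mulr_ge0 ?(na_ge0 Hv) ?exprn_ge0 ?(ltW h0).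
  have -> : v (B n).[z] * h ^+ n / h ^+ (m0 + k) * h ^+ k = v (B n).[z] / h ^+ (m0 - n).
    have -> : (m0 + k = n + ((m0 - n) + k))%N by move: nm; clear; lia.
    by rewrite !exprD; field; rewrite !expf_neq0 ?gt_eqF.
  rewrite ler_pdivrMr ?exprn_gt0 //.
  apply: le_trans (_ : s * N * s ^+ (2 * (m0 - n)) <= _); last first.
    by rewrite ler_pM2l // exprM lerXn2r ?nnegrE ?(ltW h0) ?(ltW (sX_gt0 _)).
  apply: bnd_horner => // [|j]; first by rewrite mulr_ge0 ?(ltW sN) ?(ltW (sX_gt0 _)).
  rewrite -(ler_pM2r (sX_gt0 (2 * n))).
  have -> : s * N * s ^+ (2 * (m0 - n)) * s ^+ (2 * n) = s * N * s ^+ (2 * m0).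
    by rewrite -[LHS]mulrA -exprD -mulnDr subnK.
  exact: c2.
(* Here |H| = |z| ^ q while B n has degree below q, and [vertex_exponent] compares the powers of
   |z|. *)
rewrite Hp_far //; set t := v z in z1 *; have t0 : 0 < t by apply: lt_trans z1.
have B2 : v (B n).[z] <= s * N * t ^+ q.-1.
  apply: bnd_horner_far => //; [exact: ltW| |by rewrite prednK ?q_gt0|exact: ltW].
  move=> j; rewrite -(ler_pM2r (sX_gt0 (2 * n))); apply: le_trans (c2 n j nL) _.
  by rewrite ler_pM2l // sX_le leq_mul2l nm orbT.
have it : iabs z ^+ k <= t ^+ k by rewrite lerXn2r ?nnegrE ?iabs_ge0 ?(ltW t0) ?iabs_le_v.
apply: le_trans (_ : (s * N * t ^+ q.-1) * t ^+ q ^+ n / t ^+ q ^+ (m0 + k) * t ^+ k <= _).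
  apply: ler_pM => //; rewrite ?exprn_ge0 ?iabs_ge0 // ?divr_ge0 ?mulr_ge0 ?(na_ge0 Hv) ?exprn_ge0 ?(ltW t0) //.
  by rewrite ler_pM2r ?invr_gt0 ?exprn_gt0 // ler_pM2r // !exprn_gt0.
have -> : s * N * t ^+ q.-1 * t ^+ q ^+ n / t ^+ q ^+ (m0 + k) * t ^+ k
    = s * N * (t ^+ (q.-1 + q * n + k) / t ^+ (q * (m0 + k))).
  rewrite -!exprM (exprD t (q.-1 + q * n)) (exprD t q.-1); ring.
rewrite ger_pMr // ler_pdivrMr ?exprn_gt0 // mul1r ler_weXn2l ?(ltW z1) //.
exact: vertex_exponent.
Qed.

(** The circle |z| = s ^ (-2) lies above the edge towards infinity, where f and hence P / H ^ (k -
    1) is small; Gauss estimates on it make the coefficients of P from [deg] on negligible. *)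
Lemma vertex_approx f N : rigid_holomorphic i v f -> 0 < N -> (forall z, Omega z -> nu f z <= N) ->
  (forall z, is_edge z -> nu f z <= s * N) ->
  exists P : {poly C}, [/\ (size P <= deg)%N, bnd P N &
    forall z, vertex0 z -> nu (fun z => f z - P.[z] / Hp.[z] ^+ k.-1) z <= s * N].
Proof.
move=> hf N0 fN fE; have sN : 0 < s * N by rewrite mulr_gt0.
have [P bP hP] := vertex_truncate hf N0 fN fE.
have outer z : v z = s ^- 2 -> v P.[z] <= s * N * (s ^- 2) ^+ deg.
  move=> z2; have [xz [ez iz]] := iabs_outer z2; have [oz _] := ez.
  have z1 : 1 < v z by rewrite z2 invf_gt1 ?sX_gt0 // exprn_ilt1 // ltW.
  have ip : 0 < iabs z ^+ k by rewrite exprn_gt0 // iabs_gt0.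
  have h1 := fE z ez; have h2 := hP z xz.
  rewrite /nu -ler_pdivlMr // in h1; rewrite /nu -ler_pdivlMr // in h2.
  have := na_le_sub Hv h1 h2; rewrite subKr (naF Hv) (naX Hv) Hp_far // -exprM iz z2.
  have t0 : 0 < s ^- 2 by rewrite invr_gt0 sX_gt0.
  set t := s ^- 2 in t0 *; rewrite ler_pdivrMr ?exprn_gt0 // => h; apply: le_trans h _.
  rewrite -mulrA ler_pM2l // -(ler_pM2l (exprn_gt0 k t0)) mulrA mulfV ?mul1r ?gt_eqF ?exprn_gt0 //.
  by rewrite -exprD subnKC // deg_ge.
have high j : (deg <= j)%N -> v P`_j <= s * N * s ^+ (2 * (j - deg)).
  move=> dj; have := @gauss_coef P (sig ^- 2) (s * N * (s ^- 2) ^+ deg) j.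
  rewrite (naV Hv) (naX Hv) vsig => /(_ _ outer) h.
  have t0 : 0 < (s ^- 2) ^+ j by rewrite exprn_gt0 // invr_gt0 sX_gt0.
  rewrite -(ler_pM2r t0); apply: le_trans (h _) _.
    by rewrite mulr_ge0 ?(ltW sN) // exprn_ge0 // invr_ge0 ltW // sX_gt0.
  rewrite -[leRHS]mulrA ler_pM2l // -{2}(subnK dj) exprD mulrA exprM -exprMn mulfV ?expr1n ?mul1r //.
  by rewrite gt_eqF // sX_gt0.
exists (take_poly deg P); split.
- exact: size_take_poly.
- by move=> j; rewrite coef_take_poly; case: ifP => _ //; rewrite (na0 Hv) ltW.
move=> z hz; have xz := vertex0_affinoid hz; have oz := vertex0_Omega hz; have H0 := Hp_neq0 oz.
have ip : 0 < iabs z ^+ k by rewrite exprn_gt0 // iabs_gt0.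
have := hP z xz; rewrite /nu -ler_pdivlMr // => h; rewrite -ler_pdivlMr //.
rewrite -{1}(poly_take_drop deg P) in h; rewrite hornerD hornerM hornerXn in h.
pose E := (drop_poly deg P).[z] * z ^+ deg / Hp.[z] ^+ k.-1.
have -> : f z - (take_poly deg P).[z] / Hp.[z] ^+ k.-1 =
   (f z - ((take_poly deg P).[z] + (drop_poly deg P).[z] * z ^+ deg) / Hp.[z] ^+ k.-1) + E.
  by rewrite /E mulrDl; ring.
apply: (na_le_add Hv) => //; rewrite /E horner_coef mulr_suml mulr_suml.
apply: (na_sum Hv) => [|j _]; first by rewrite divr_ge0 ?ltW.
rewrite coef_drop_poly -(mulrA _ (z ^+ j)) -exprD (naF Hv) (naM Hv) !(naX Hv) ler_pdivlMr //.
have hj : v P`_(j + deg) <= s * N * s ^+ (2 * j) by have := high (j + deg)%N (leq_addl _ _); rewrite addnK.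
have hb : 0 < v Hp.[z] by rewrite (na_gt0 Hv).
have sNj : 0 <= s * N * s ^+ (2 * j) by rewrite mulr_ge0 ?(ltW sN) ?(ltW (sX_gt0 _)).
have [z1|z1] := leP (v z) 1.
  apply: le_trans (_ : (s * N * s ^+ (2 * j) * 1) / v Hp.[z] ^+ k.-1 * v Hp.[z] ^+ k <= _).
    apply: ler_pM; rewrite ?(divr_ge0, mulr_ge0, exprn_ge0, (na_ge0 Hv), iabs_ge0) //.
      rewrite ler_pM2r ?invr_gt0 ?exprn_gt0 //; apply: ler_pM; rewrite ?(na_ge0 Hv) ?exprn_ge0 ?(na_ge0 Hv) //.
      by rewrite exprn_ile1 ?(na_ge0 Hv).
    by rewrite lerXn2r ?nnegrE ?iabs_ge0 ?(na_ge0 Hv) ?iabs_le_Hp.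
  have -> : v Hp.[z] ^+ k = v Hp.[z] ^+ k.-1 * v Hp.[z] by rewrite -exprSr prednK // ltnW.
  rewrite mulr1 mulrA divfK ?expf_neq0 ?gt_eqF // -mulrA ger_pMr // mulr_ile1 ?(ltW hb) ?(ltW (sX_gt0 _)) ?Hp_le1 //.
  by rewrite exprn_ile1 ?ltW.
rewrite Hp_far //; have [zs _] := hz; set t := v z in z1 zs *; have t0 : 0 < t by apply: lt_trans z1.
apply: le_trans (_ : (s * N * s ^+ (2 * j) * t ^+ (j + deg)) / t ^+ q ^+ k.-1 * t ^+ k <= _).
  apply: ler_pM; rewrite ?(divr_ge0, mulr_ge0, exprn_ge0, (na_ge0 Hv), iabs_ge0, (ltW t0)) //.
    by rewrite ler_pM2r ?invr_gt0 ?exprn_gt0 // ler_pM2r ?exprn_gt0.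
  by rewrite lerXn2r ?nnegrE ?iabs_ge0 ?(ltW t0) ?iabs_le_v.
have -> : s * N * s ^+ (2 * j) * t ^+ (j + deg) / t ^+ q ^+ k.-1 * t ^+ k =
   s * N * (s ^+ 2 * t) ^+ j * (t ^+ (deg + k) / t ^+ (q * k.-1)).
  by rewrite -exprM exprMn -exprM !(exprD t); ring.
rewrite subnK ?deg_ge // mulfV ?mulr1 ?gt_eqF ?exprn_gt0 // ger_pMr // exprn_ile1 //.
  by rewrite mulr_ge0 ?(ltW t0) ?(ltW (sX_gt0 _)).
by rewrite mulrC -ler_pdivlMr ?sX_gt0 // div1r ltW.
Qed.

Lemma big_option (T : Type) (x0 : T) (op : Monoid.com_law x0) (F : option Fq -> T) :
  \big[op/x0]_p F p = op (F None) (\big[op/x0]_(a : Fq) F (Some a)).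
Proof.
rewrite (bigD1 None) //=; congr (op _ _); rewrite (reindex_omap Some id) => [|[]//].
by apply: eq_bigl => a; rewrite eqxx.
Qed.

(** Off [vertex0] the point z is near infinity or within s ^ 2 of one residue class. The pole there
    has order at most k - 1, so the weight iabs z ^ k leaves at least one small factor. *)
Lemma pairing_small (m : option Fq -> nat) D c z : (\sum_p m p = k + k)%N -> (forall p, m p <= k.-1)%N ->
  v c = 1 -> (Omega z -> Phi D z = c * \prod_p pole_factor z p ^+ m p) ->
  Omega z -> ~ vertex0 z -> nu (Phi D) z <= s.
Proof.
move=> sm hm vc PhiE hz nz; have k0 : (0 < k)%N by apply: ltnW.
have s2 : s ^+ 2 <= s by rewrite expr2 ger_pMl // ltW.
rewrite /nu PhiE // (naM Hv) vc mul1r big_option /= expr1n mul1r (na_prod Hv).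
under eq_bigr => a _ do rewrite (naX Hv) (naV Hv) exprVn.
have [z1|z1] := leP (s ^- 2) (v z).
  set t := v z in z1; have t0 : 0 < t by apply: lt_le_trans z1; rewrite invr_gt0 sX_gt0.
  have t1 : 1 < t by apply: lt_le_trans z1; rewrite invf_gt1 ?sX_gt0 // exprn_ilt1 // ltW.
  rewrite (eq_bigr (fun a => t ^- m (Some a))) => [|a _]; last first.
    by rewrite (na_eq_subl Hv) // (le_lt_trans (v_ikap a)).
  rewrite prodfV prodrXr.
  have e : (m None + \sum_a m (Some a) = k + k)%N by rewrite -sm big_option.
  apply: le_trans (_ : t ^- (\sum_a m (Some a)) * t ^+ k <= _).
    by rewrite ler_pM2l ?invr_gt0 ?exprn_gt0 // lerXn2r ?nnegrE ?iabs_ge0 ?(ltW t0) ?iabs_le_v.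
  apply: le_trans s2; rewrite mulrC ler_pdivrMr ?exprn_gt0 // -ler_pdivrMl ?sX_gt0 //.
  apply: le_trans (_ : t * t ^+ k <= _); first by rewrite ler_pM2r ?exprn_gt0.
  rewrite -exprS ler_weXn2l ?(ltW t1) //; have := hm None; move: e k0; clear; lia.
have [x hx] : exists x, v (z - i x) <= s ^+ 2.
  by apply: contrapT => nx; apply: nz; split=> // x; rewrite ltNge; apply/negP => h; apply: nx; exists x.
have x1 : vK x <= 1.
  apply: vK_lt_inv2; rewrite -viE -[i x](subKr z); apply: (na_lt_sub Hv) => //; exact: le_lt_trans hx (s_lt_inv2 _).
have [a0 /vK_lt1 ha] := resK x1.
have za0 : v (z - i (kap a0)) <= s ^+ 2.
  rewrite -(subrKA (i x)); apply: (na_le_add Hv) => //; rewrite -rmorphB viE; apply: le_trans ha _.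
  by rewrite sX_le.
set h := v (z - i (kap a0)) in za0.
have h0 : 0 < h by rewrite (na_gt0 Hv) Omega_sub.
have h1 : h < 1 by apply: le_lt_trans za0 _; rewrite exprn_ilt1 // ltW.
rewrite (bigD1 a0) //= big1 => [|b ba]; last first.
  have -> : v (z - i (kap b)) = 1; last by rewrite expr1n invr1.
  by rewrite -(subrKA (i (kap a0))) (na_eq_addr Hv) -rmorphB viE vkap_sub // eq_sym.
rewrite mulr1 -/h; apply: le_trans (_ : h ^- m (Some a0) * h ^+ k <= _).
  by rewrite ler_pM2l ?invr_gt0 ?exprn_gt0 // lerXn2r ?nnegrE ?iabs_ge0 ?(ltW h0) ?iabs_le.
have mk : (m (Some a0) + (k.-1 - m (Some a0)) + 1 = k)%N by have := hm (Some a0); move: k0; clear; lia.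
rewrite -{1}mk -addnA exprD mulrA mulVf ?mul1r ?expf_neq0 ?gt_eqF // addn1 exprS.
apply: le_trans (le_trans za0 s2); rewrite ger_pMr // exprn_ile1 // ltW //.
Qed.

(** e a is the order of the numerator at a, so over H ^ (k - 1) there is a pole of order k - 1 - e
    a. The two inequalities place the order at infinity between 0 and k - 1; it is defined so that
    the total is q (k - 1) + k - deg = 2k. *)
Let expo := {e : {ffun Fq -> 'I_k} |
  (\sum_a (e a : nat) <= deg.-1)%N && (deg.-1 <= k.-1 + \sum_a (e a : nat))%N}.
Let expo_mult (t : expo) (p : option Fq) : nat :=
  if p is Some a then k.-1 - val t a else (k.-1 + \sum_a (val t a : nat)) - deg.-1.

Lemma deg_gt0 : (0 < deg)%N.
Proof. move: k_ge2 q_gt2; move: (k) (#|Fq|) => x y; nia. Qed.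

Lemma expo_mult_le t p : (expo_mult t p <= k.-1)%N.
Proof. by case: t p => e he [a|] /=; rewrite ?leq_subr //; move: he => /andP[h _]; by rewrite leq_subLR addnC leq_add2r. Qed.

Lemma expo_mult_sum t : (\sum_p expo_mult t p = k + k)%N.
Proof.
rewrite big_option /=; case: t => e /= /andP[h1 h2].
have e1 : (\sum_a (k.-1 - e a) + \sum_a (e a : nat) = q * k.-1)%N.
  rewrite -big_split /= (eq_bigr (fun=> k.-1)) => [|a _]; first by rewrite sum_nat_const.
  by rewrite subnK // -ltnS prednK ?ltn_ord // ltnW.
have h3 := deg_gt0; have h4 := deg_ge; have h5 := k_ge2.
move: e1 h1 h2 h3 h4 h5; move: (\sum_a (k.-1 - e a))%N (\sum_a (e a : nat))%N (q * k.-1)%N => x y w; clear; lia.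
Qed.

Let expo_poly (F : comNzRingType) (c : Fq -> F) (t : expo) : {poly F} := \prod_a ('X - (c a)%:P) ^+ val t a.

(** Stated over Fq and not over C: coefficients from Fq have absolute value at most 1, so expressing
    P by these products keeps the bound N. *)
Lemma expo_span (p : {poly Fq}) : (size p <= deg)%N -> exists lam : expo -> Fq, p = \sum_t lam t *: expo_poly id t.
Proof.
move=> sp; pose V (p : {poly Fq}) := exists lam : expo -> Fq, p = \sum_t lam t *: expo_poly id t.
apply: (@split_span Fq k.-1 (index_enum Fq) (index_enum_uniq _) deg.-1 V).
- have -> : size (index_enum Fq) = q by rewrite -[index_enum _]enumT -cardE.
  by apply: leq_trans (leq_pred _) (leq_subr _ _).
- move=> c _ [lam ->]; exists (fun t => c * lam t); rewrite scaler_sumr; apply: eq_bigr => t _; by rewrite scalerA.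
- move=> _ _ [lam ->] [mu ->]; exists (fun t => lam t + mu t); rewrite -big_split; apply: eq_bigr => t _; by rewrite scalerDl.
- move=> e em le ge.
  have ek b : (e b < k)%N by rewrite (leq_ltn_trans (em b)) // prednK ?leqnn // ltnW.
  pose e0 : {ffun Fq -> 'I_k} := [ffun b => Ordinal (ek b)].
  have e0E : (\sum_a (e0 a : nat) = \sum_a e a)%N by apply: eq_bigr => a _; rewrite ffunE.
  have he0 : (\sum_a (e0 a : nat) <= deg.-1)%N && (deg.-1 <= k.-1 + \sum_a (e0 a : nat))%N by rewrite e0E le ge.
  exists (fun t => (t == exist _ e0 he0)%:R).
  rewrite [RHS](bigD1 (exist _ e0 he0)) //= eqxx scale1r [X in _ = _ + X]big1 ?addr0 => [|t ht]; last by rewrite (negbTE ht) scale0r.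
  by apply: eq_bigr => a _; rewrite ffunE.
- by rewrite prednK ?deg_gt0.
Qed.

Lemma expo_horner t z : Omega z ->
  \prod_p pole_factor z p ^+ expo_mult t p = (expo_poly (fun a => i (kap a)) t).[z] / Hp.[z] ^+ k.-1.
Proof.
move=> hz; rewrite big_option /= expr1n mul1r HpE horner_prod -prodrXl -prodf_div.
apply: eq_bigr => a _; rewrite horner_exp hornerXsubC exprVn.
have ek : (val t a <= k.-1)%N by rewrite -ltnS prednK ?ltn_ord // ltnW.
have key (x : C) m n : x != 0 -> (n <= m)%N -> x ^- (m - n) = x ^+ n / x ^+ m.
  by move=> x0 nm; rewrite -[in RHS](subnK nm) exprD; field; rewrite !expf_neq0.
by apply: key; rewrite ?Omega_sub.
Qed.

Definition cond_vertex (f : C -> C) N := cond_edge f N /\ forall z, is_edge z -> nu f z <= s * N.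

Lemma vertex_local : exists (T : finType) (D : T -> poincare_data K), [/\ forall t, adm (D t),
  forall t z, Omega z -> ~ vertex0 z -> nu (Phi (D t)) z <= s &
  forall f N, cond_vertex f N -> exists2 c : T -> C, (forall t, v (c t) <= N) &
    forall z, vertex0 z -> nu (fun z => f z - \sum_t c t * Phi (D t) z) z <= s * N].
Proof.
pose pr t := cid (pairing (expo_mult_sum t) (expo_mult_le t)).
pose D t := projT1 (pr t).
have hD t : adm (D t) by rewrite /D; case: (pr t) => ? [].
have [c1 hc1] : exists c1 : expo -> C, forall t, v (c1 t) = 1 /\
   forall z, Omega z -> Phi (D t) z = c1 t * \prod_p pole_factor z p ^+ expo_mult t p.
  suff h t : exists c, v c = 1 /\ forall z, Omega z -> Phi (D t) z = c * \prod_p pole_factor z p ^+ expo_mult t p.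
    by exists (fun t => projT1 (cid (h t))) => t; case: (cid _).
  by rewrite /D; case: (pr t) => D' /= [_ [c ? ?]]; exists c.
exists expo, D; split=> //.
  move=> t z hz nz; have [vc PhiE] := hc1 t.
  by apply: (pairing_small (expo_mult_sum t) (expo_mult_le t) vc) => //; apply: PhiE.
move=> f N [[hf N0 fN] fE]; have [P [sP bP hP]] := vertex_approx hf N0 fN fE.
have [lam hlam] : exists lam : nat -> expo -> Fq, forall j, (j < deg)%N -> 'X^j = \sum_t lam j t *: expo_poly id t.
  have h j : exists lam : expo -> Fq, (j < deg)%N -> 'X^j = \sum_t lam t *: expo_poly id t.
    have [jd|] := boolP (j < deg)%N; last by exists (fun=> 0).
    by have [|lam e] := @expo_span 'X^j; [rewrite size_polyXn|exists lam].
  by exists (fun j => projT1 (cid (h j))) => j; case: (cid _).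
pose c t := (\sum_(j < deg) P`_j * i (kap (lam j t))) / c1 t.
exists c.
  move=> t; have [vc _] := hc1 t; rewrite (naF Hv) vc divr1; apply: (na_sum Hv) => [|j _]; first exact: ltW.
  rewrite (naM Hv) -[leRHS]mulr1; apply: ler_pM; rewrite ?(na_ge0 Hv) ?bP //; exact: v_ikap.
move=> z hz; have oz := vertex0_Omega hz; apply: le_trans (hP z hz); rewrite /nu.
suff -> : \sum_t c t * Phi (D t) z = P.[z] / Hp.[z] ^+ k.-1 by [].
have -> : P.[z] = \sum_(j < deg) P`_j * z ^+ j.
  by rewrite (horner_coef_wide _ sP).
have XE j : (j < deg)%N -> z ^+ j = \sum_t i (kap (lam j t)) * (expo_poly (fun a => i (kap a)) t).[z].
  move=> /hlam h; have := congr1 (fun p => (map_poly i (map_poly kap p)).[z]) h.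
  rewrite !map_polyXn hornerXn => ->; rewrite !rmorph_sum horner_sum; apply: eq_bigr => t _ /=.
  rewrite !map_polyZ hornerZ; congr (_ * _.[z]); rewrite /expo_poly !rmorph_prod; apply: eq_bigr => a _.
  by rewrite !rmorphXn /= !rmorphB /= !map_polyX !map_polyC.
rewrite (eq_bigr (fun j : 'I_deg => \sum_t P`_j * i (kap (lam j t)) * (expo_poly (fun a => i (kap a)) t).[z])); last first.
  by move=> j _; rewrite XE // mulr_sumr; apply: eq_bigr => t _; rewrite mulrA.
rewrite exchange_big /= mulr_suml; apply: eq_bigr => t _; have [vc ->] := hc1 t => //.
rewrite expo_horner // -mulr_suml /c; have c0 : c1 t != 0 by rewrite -(na_gt0 Hv) vc.
by rewrite mulrA divfK // mulrA.
Qed.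

Lemma cond_vertex_aff a b f N : a != 0 -> cond_vertex f N -> cond_vertex (faff a b f) N.
Proof.
move=> a0 [h1 h2]; split; first exact: cond_edge_aff.
move=> z ez; have [oz _] := ez; rewrite nu_faff //; apply: h2; rewrite -affE; apply: is_edge_moebius => //; exact: aff_neq0.
Qed.

Lemma vertex_step : exists (T : finType) (E : T -> poincare_data K), (forall t, adm (E t)) /\
  forall f N, modular f -> cond_vertex f N -> exists2 c : T -> C, (forall t, v (c t) <= N) &
    forall z, Omega z -> nu (fun z => f z - \sum_t c t * series (E t) z) z <= s * N.
Proof.
have [T0 [D0 [D0_adm D0_small hloc]]] := vertex_local.
have [||||||||||||T [E [hE h]]] := @step vertex0 1 vertex0_Omega (or_introl (na1 HvK)) _ _ vertex0_inv vertex0_disj _ _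
    T0 D0 Omega cond_vertex.
- move=> a w a1 [w1 w2]; have a0 : a != 0 by rewrite -(na_gt0 HvK) a1.
  split; first by rewrite (naM Hv) viE a1 mul1r.
  move=> x; have -> : i a * w - i x = i a * (w - i (x / a)).
    by rewrite rmorphM fmorphV; field; rewrite fmorph_eq0.
  by rewrite (naM Hv) viE a1 mul1r.
- move=> b w; rewrite (na1 HvK) => b1 [w1 w2]; split=> [|x].
    apply: (na_lt_add Hv) => //; rewrite viE; apply: le_lt_trans b1 _.
    by rewrite invf_gt1 ?sX_gt0 // exprn_ilt1 // ltW.
  by have -> : w + i b - i x = w - i (x - b) by rewrite rmorphB; ring.
- exists (s ^+ 2); first exact: sX_gt0.
  by exists (s ^- 2) => w hw; have [h1 _] := vertex0_iabs hw; have [h2 _] := hw; split; apply: ltW.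
- exists sig; split; first by rewrite vsig -{1}[s]expr1 s_lt_inv2.
  move=> x; have : v sig != v (i x) by rewrite viE vsig -{1}[s]expr1 eq_sym exprnP vK_nonint.
  move=> /(na_sub_neq Hv) ->; by rewrite lt_max vsig expr2 gtr_pMl // s_lt1.
- exact: D0_adm.
- by [].
- exact: moebius_Omega.
- exact: piece_Omega vertex0_Omega.
- exact: D0_small.
- exact: cond_vertex_aff.
- by move=> f N [[]].
- exact: hloc.
exists T, E; split=> // f N hf [hc hN]; have [c c1 [c2 c3]] := h f N hf (conj hc hN).
exists c => // z hz; have [[S hS Sz]|nS] := pselect (exists2 S, vertex_piece S & S z); first exact: c2 Sz.
(* Off the vertex pieces z is an edge point, where f is small by assumption and the combination by
   the second part of [step]. *)
have ez : is_edge z by case: (vertex_cover hz).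
have ip : 0 < iabs z ^+ k by rewrite exprn_gt0 // iabs_gt0.
have := c3 z hz (fun S hS Sz => nS (ex_intro2 _ _ S hS Sz)); have := hN z ez.
by rewrite /nu -!ler_pdivlMr //; apply: na_le_sub.
Qed.

(** * The contraction and its iteration *)

Lemma nu_series_le1 D z : adm D -> Omega z -> nu (series D) z <= 1.
Proof.
move=> hD hz; have ip : 0 < iabs z ^+ k by rewrite exprn_gt0 // iabs_gt0.
rewrite /nu -ler_pdivlMr //; apply: (has_sum_le (series_has_sum hD hz)); first by rewrite div1r invr_ge0 ltW.
move=> c hc; have [Gr _] := repP hc.
rewrite ler_pdivlMr // /poincare_term -/(rep c) v_summand //.
by apply: nu_Phi_le1 => //; apply: moebius_Omega => //; apply/Gamma_det0/GammaV.
Qed.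

Lemma span_combination (T : finType) (c : T -> C) (E : T -> poincare_data K) f : (forall t, adm (E t)) ->
  (forall z, Omega z -> f z = \sum_t c t * series (E t) z) -> span_halfplane i (poincare_family i v Gamma k l) f.
Proof.
move=> hE fE; exists #|T|, (fun t => c (enum_val t)), (fun t => series (E (enum_val t))); split.
  by move=> t; exists (E (enum_val t)).
by move=> z hz; rewrite fE // (reindex (@enum_val _ T)) //=; exists enum_rank => t _; rewrite ?enum_valK ?enum_rankK.
Qed.

Lemma modularB f g : modular f -> modular g -> modular (fun z => f z - g z).
Proof.
move=> [rf hf] [rg hg]; split.
  apply: (@rigid_lin 2 (fun t => if t == 0 then 1 else -1) (fun t => if t == 0 then f else g)).
    by move=> t; case: ifP.
  by move=> z _; rewrite big_ord_recl big_ord1 /= mul1r mulN1r.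
by move=> x z Gx hz; rewrite mulrBr hf // hg.
Qed.

Lemma modular_combination (T : finType) (c : T -> C) (E : T -> poincare_data K) : (forall t, adm (E t)) ->
  modular (fun z => \sum_t c t * series (E t) z).
Proof. by move=> hE; apply/span_sub_modular/(span_combination hE). Qed.

(** The edge combination has coefficients at most N and series with nu at most 1, so subtracting it
    keeps the bound N and makes the vertex step applicable. *)
Lemma contraction : exists (T : finType) (E : T -> poincare_data K), (forall t, adm (E t)) /\
  forall f N, modular f -> cond_edge f N -> exists2 c : T -> C, (forall t, v (c t) <= N) &
    forall z, Omega z -> nu (fun z => f z - \sum_t c t * series (E t) z) z <= s * N.
Proof.
have [T1 [E1 [hE1 h1]]] := edge_step; have [T2 [E2 [hE2 h2]]] := vertex_step.
exists (T1 + T2)%type, (fun t => match t with inl t => E1 t | inr t => E2 t end); split; first by case.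
move=> f N hf hN; have [c1 c1N e1] := h1 f N hf hN.
have [rf N0 fN] := hN.
pose f1 z := f z - \sum_t c1 t * series (E1 t) z.
have hf1 : modular f1 by apply: modularB => //; apply: modular_combination.
have hN1 : cond_vertex f1 N.
  split=> //; split=> // [|z hz]; first by case: hf1.
  have ip : 0 < iabs z ^+ k by rewrite exprn_gt0 // iabs_gt0.
  have := fN z hz; rewrite /nu -!ler_pdivlMr // => h; apply: (na_le_sub Hv) => //.
  apply: (na_sum Hv) => [|t _]; first by rewrite divr_ge0 ?ltW.
  rewrite ler_pdivlMr // (naM Hv) -mulrA -[leRHS]mulr1; apply: ler_pM; rewrite ?(na_ge0 Hv) ?c1N ?nu_ge0 //.
  exact: nu_series_le1.
have [c2 c2N e2] := h2 f1 N hf1 hN1.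
exists (fun t => match t with inl t => c1 t | inr t => c2 t end); first by case.
move=> z hz; have := e2 z hz; rewrite /nu /f1.
by rewrite [X in _ -> _ (_ - X) * _ <= _]big_sumType /= opprD addrA.
Qed.

Lemma modular_sub_span : modular `<=` span_halfplane i (poincare_family i v Gamma k l).
Proof.
move=> f hf; have [T [E [hE hc]]] := contraction.
have [N N0 fN] := modular_bounded hf.
(* A total choice function for the coefficients, with arbitrary values where the hypotheses fail. *)
have [cc hcc] : exists cc : (C -> C) -> R -> T -> C, forall f N, modular f -> cond_edge f N ->
    (forall t, v (cc f N t) <= N) /\
    forall z, Omega z -> nu (fun z => f z - \sum_t cc f N t * series (E t) z) z <= s * N.
  have h f0 N1 : exists c : T -> C, modular f0 -> cond_edge f0 N1 -> (forall t, v (c t) <= N1) /\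
      forall z, Omega z -> nu (fun z => f0 z - \sum_t c t * series (E t) z) z <= s * N1.
    have [m0|m0] := pselect (modular f0); last by exists (fun=> 0).
    have [n0|n0] := pselect (cond_edge f0 N1); last by exists (fun=> 0).
    by have [c c1 c2] := hc f0 N1 m0 n0; exists c.
  by exists (fun f0 N1 => projT1 (cid (h f0 N1))) => f0 N1; case: (cid _).
pose F := fix F n := match n with
  | 0%N => f
  | m.+1 => fun z => F m z - \sum_t cc (F m) (N * s ^+ m) t * series (E t) z end.
have FP n : modular (F n) /\ cond_edge (F n) (N * s ^+ n).
  elim: n => [|n [m1 m2]]; first by rewrite mulr1; split=> //; split=> //; case: hf.
  have m3 : modular (F n.+1) by apply: modularB => //; apply: modular_combination.
  split=> //; split; [by case: m3|by rewrite mulr_gt0 // sX_gt0|].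
  by move=> z hz; have [_ h] := hcc _ _ m1 m2; rewrite exprS mulrCA; apply: h.
pose S n t := \sum_(m < n) cc (F m) (N * s ^+ m) t.
have SS n t : S n.+1 t - S n t = cc (F n) (N * s ^+ n) t by rewrite /S big_ord_recr /= [X in X - _]addrC addrK.
have small e : 0 < e -> exists M, forall n, (M <= n)%N -> N * s ^+ n < e.
  move=> e0; have [M hM] := expr_small (ltW s_gt0) s_lt1 (divr_gt0 e0 N0).
  by exists M => n /hM; rewrite ltr_pdivlMr // mulrC.
have cN n t : v (cc (F n) (N * s ^+ n) t) <= N * s ^+ n by have [m1 m2] := FP n; have [] := hcc _ _ m1 m2.
have Sle n m t : (n <= m)%N -> v (S m t - S n t) <= N * s ^+ n.
  move=> /subnKC <-; elim: (m - n)%N => [|d IH].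
    by rewrite addn0 subrr (na0 Hv) mulr_ge0 ?(ltW N0) ?(ltW (sX_gt0 _)).
  rewrite -(subrKA (S (n + d)%N t)) addnS SS; apply: (na_le_add Hv) => //; apply: le_trans (cN _ _) _.
  by rewrite ler_pM2l // sX_le leq_addr.
have lim t : exists L, forall e, 0 < e -> exists M, forall n, (M <= n)%N -> v (S n t - L) < e.
  apply: (na_cauchy Hv Hc) => e /small[M hM]; exists M => n /hM; apply: le_lt_trans; by rewrite SS.
pose L t := projT1 (cid (lim t)).
have LS n t : v (S n t - L t) <= N * s ^+ n.
  have p0 : 0 < N * s ^+ n by rewrite mulr_gt0 // sX_gt0.
  have [M hM] := projT2 (cid (lim t)) _ p0.
  apply: (na_trans Hv (y := S (maxn M n) t)); first by rewrite (naBC Hv) Sle // leq_maxr.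
  by apply: ltW; apply: hM; apply: leq_maxl.
have FE n z : F n z = f z - \sum_t S n t * series (E t) z.
  elim: n => [|n /= ->]; first by rewrite big1 ?subr0 // => t _; rewrite /S big_ord0 mul0r.
  rewrite -addrA -opprD -big_split; congr (_ - _); apply: eq_bigr => t _ /=.
  by rewrite -mulrDl /S big_ord_recr.
(* The difference is F M plus a combination with coefficients S M - L; both have nu at most N s ^ M
   for every M. *)
apply: (span_combination (c := L) hE) => z hz; apply/eqP; rewrite -subr_eq0; apply: contraT.
have ip : 0 < iabs z ^+ k by rewrite exprn_gt0 // iabs_gt0.
rewrite -(na_gt0 Hv) => w0; have [M hM] := small _ (mulr_gt0 w0 ip).
have := hM M (leqnn _); rewrite ltNge -ler_pdivlMr // => /negP[].
have -> : f z - \sum_t L t * series (E t) z = F M z + \sum_t (S M t - L t) * series (E t) z.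
  by rewrite FE; under [X in _ = _ + X]eq_bigr do rewrite mulrBl; rewrite sumrB addrA subrK.
apply: (na_le_add Hv); first by rewrite ler_pdivlMr //; have [_ [_ _]] := FP M; apply.
apply: (na_sum Hv) => [|t _]; first by rewrite divr_ge0 ?mulr_ge0 ?(ltW N0) ?(ltW ip) ?(ltW (sX_gt0 _)).
rewrite ler_pdivlMr // (naM Hv) -mulrA -[leRHS]mulr1; apply: ler_pM; rewrite ?(na_ge0 Hv) ?LS ?nu_ge0 //.
exact: nu_series_le1.
Qed.

Lemma poincare_spanning :
  (forall D, adm D -> forall z, Omega z -> poincare_summable i v Gamma l D z) /\
  modular = span_halfplane i (poincare_family i v Gamma k l).
Proof.
split=> [D hD z hz|]; first exact: poincare_summableP.
by apply/seteqP; split; [exact: modular_sub_span|exact: span_sub_modular].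
Qed.
End DrinfeldHalfPlane.

(** * The completed function field *)

Section FunctionField.
Variables (R : realType) (Fq : finFieldType) (K : fieldType) (vK : K -> R).
Local Notation A := {poly Fq}.
Local Notation F := {fraction A}.
Local Notation "x %:F" := (@FracField.tofrac _ x).
Local Notation q := #|Fq|.
Variable j : {rmorphism F -> K}.
Hypothesis Kcomp : is_completion (@abs_at_infty R Fq) vK j.

Definition polyK : {rmorphism A -> K} := GRing.RMorphism.clone _ _ (j \o @FracField.tofrac A) _.
Definition constK : {rmorphism Fq -> K} := GRing.RMorphism.clone _ _ (polyK \o polyC) _.

Lemma polyK_eq0 p : (polyK p == 0) = (p == 0).
Proof. by rewrite /= fmorph_eq0 tofrac_eq0. Qed.

Lemma completion_abs : nonarch_abs vK. Proof. by case: Kcomp. Qed.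
Local Notation HvK := completion_abs.

Lemma frac_ratio (x : F) : exists n d : A, [/\ d != 0, x = n%:F / d%:F &
  x != 0 -> vK (j x) = q%:R ^+ size n / q%:R ^+ size d].
Proof.
exists (\n_(repr x)), (\d_(repr x)); have d0 := denom_ratioP (repr x).
split=> // [|x0]; last by case: Kcomp => _ -> _ _; rewrite /abs_at_infty (negbTE x0).
have dF : (\d_(repr x))%:F != 0 by rewrite tofrac_eq0.
apply: (mulIf dF); rewrite divfK //.
apply/eqP; rewrite -{1}[x]reprK; unlock FracField.tofrac; rewrite !piE.
by rewrite FracField.equivfE /= !numden_Ratio ?mulf_neq0 ?oner_eq0 // !mulr1 mulrC.
Qed.

Lemma q_gt1 : 1 < q%:R :> R. Proof. by rewrite ltr1n finNzRing_gt1. Qed.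
Lemma q_gt0R : 0 < q%:R :> R. Proof. exact: lt_trans ltr01 q_gt1. Qed.

(** [abs_at_infty] uses a chosen representative n / d, possibly with a common factor; n = p d shows
    that the sizes differ by the degree of p. *)
Lemma v_polyK p : p != 0 -> vK (polyK p) = q%:R ^+ (size p).-1.
Proof.
move=> p0; have [n [d [d0 pE vE]]] := frac_ratio p%:F.
have nE : n = p * d.
  apply/eqP; rewrite -tofrac_eq; apply/eqP; have dF : d%:F != 0 by rewrite tofrac_eq0.
  by apply: (mulIf (invr_neq0 dF)); rewrite -pE tofracM mulfK.
rewrite /= vE ?tofrac_eq0 // nE size_mul //.
have : (0 < size p)%N by rewrite size_poly_gt0.
case: (size p) => // m _ /=; by rewrite exprD mulfK // expf_neq0 // gt_eqF // q_gt0R.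
Qed.

Lemma v_polyK_le1 p : vK (polyK p) <= 1 -> exists c, p = c%:P.
Proof.
have [->|p0] := eqVneq p 0; first by exists 0.
rewrite v_polyK // => h; exists p`_0; apply: size1_polyC; rewrite leqNgt; apply/negP => s1.
by move: h; rewrite leNgt exprn_egt1 ?q_gt1 //; move: s1; case: (size p) => [|[]].
Qed.
Lemma v_polyK_ge1 p : p != 0 -> 1 <= vK (polyK p).
Proof. by move=> p0; rewrite v_polyK // exprn_ege1 // ltW // q_gt1. Qed.

Lemma v_polyK_size (p : A) n : (size p <= n.+1)%N -> vK (polyK p) <= q%:R ^+ n.
Proof.
have [->|p0] := eqVneq p 0; first by rewrite rmorph0 (na0 HvK) exprn_ge0 // ltW // q_gt0R.
rewrite v_polyK // => h; rewrite ler_weXn2l ?(ltW q_gt1) //.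
by case: (size p) h.
Qed.
Lemma size_v_polyK (p : A) n : vK (polyK p) < q%:R ^+ n -> (size p <= n)%N.
Proof.
have [->|p0] := eqVneq p 0; first by rewrite size_poly0.
rewrite v_polyK // ltr_eXn2l ?q_gt1 //; by case: (size p).
Qed.

Lemma v_frac (x : F) : x != 0 -> exists n : int, vK (j x) = q%:R ^ n.
Proof.
move=> x0; have [n [d [_ _ /(_ x0)->]]] := frac_ratio x.
by exists ((size n)%:Z - (size d)%:Z); rewrite expfzDr ?gt_eqF ?q_gt0R // -exprnN.
Qed.

Lemma v_dense y : y != 0 -> exists2 x, x != 0 & vK y = vK (j x).
Proof.
move=> y0; have vy : 0 < vK y by rewrite (na_gt0 HvK).
have [x hx] : exists x, vK (y - j x) < vK y by case: Kcomp => _ _ _; apply.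
have e : vK y = vK (j x) by rewrite -[j x](subKr y) (na_eq_subl HvK).
by exists x => //; apply: contraTneq vy => x0; rewrite e x0 rmorph0 (na0 HvK) ltxx.
Qed.

Lemma v_value y : y != 0 -> exists n : int, vK y = q%:R ^ n.
Proof. by move=> /v_dense[x x0 ->]; apply: v_frac. Qed.

(** Division with remainder in a nearby fraction n / d; its proper part has absolute value below
    1. *)
Lemma floor y : exists p, vK (y - polyK p) < 1.
Proof.
have [x hx] : exists x, vK (y - j x) < 1 by case: Kcomp => _ _ _; apply.
have [n [d [d0 xE _]]] := frac_ratio x; exists (n %/ d).
rewrite -(subrKA (j x)); apply: (na_lt_add HvK) => //.
have jd : polyK d != 0 by rewrite polyK_eq0.
have -> : j x - polyK (n %/ d) = polyK (n %% d) / polyK d.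
  apply: (mulIf jd); rewrite divfK // mulrBl xE rmorphM fmorphV divfK //.
  rewrite -[j n%:F]/(polyK n) {1}(divp_eq n d) rmorphD rmorphM; ring.
rewrite (naF HvK) ltr_pdivrMr ?(na_gt0 HvK) // mul1r.
have [->|r0] := eqVneq (n %% d) 0; first by rewrite rmorph0 (na0 HvK) (na_gt0 HvK).
rewrite !v_polyK // ltr_eXn2l ?q_gt1 //; have := ltn_modp n d; rewrite d0 => h.
have : (0 < size (n %% d)%R)%N by rewrite size_poly_gt0.
by move=> p0; rewrite -ltnS !prednK ?size_poly_gt0 // h.
Qed.

Lemma residue y : vK y <= 1 -> exists a, vK (y - constK a) < 1.
Proof.
move=> y1; have [p hp] := floor y; have [|c pE] := @v_polyK_le1 p; last by exists c; rewrite /= -pE.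
by rewrite -[polyK p](subKr y); apply: (na_le_sub HvK) => //; apply: ltW.
Qed.

Definition varpi : K := (polyK 'X)^-1.
Lemma v_varpi : vK varpi = q%:R^-1.
Proof. by rewrite (naV HvK) v_polyK ?polyX_eq0 // size_polyX expr1. Qed.

(** * Orders in quaternion algebras *)

Variable B : falgType F.
Variable iota : {lrmorphism scalar_ext j B -> 'M[K]_2}.
Hypothesis iota_bij : bijective iota.
Local Notation BK := (scalar_ext j B).
Local Notation e := (vbasis {:B}).
Local Notation ib x := (iota (ext1 j x)).

Lemma ibM x y : ib (x * y) = ib x * ib y. Proof. by rewrite ext1M -rmorphM. Qed.
Lemma ib1 : ib 1 = 1. Proof. exact: rmorph1. Qed.
Lemma ibZ a x : ib (a *: x) = j a *: ib x. Proof. by rewrite ext1Z linearZ. Qed.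
Lemma ib_inj x y : ib x = ib y -> x = y.
Proof. by move=> /(bij_inj iota_bij)/ext1_inj. Qed.

Lemma linear_bound (f : {linear BK -> 'M[K]_2}) : exists2 c, 1 <= c & forall (x : BK) M, 0 <= M ->
  (forall k, vK ((x : 'rV[K]__) 0 k) <= M) -> forall a b, vK (f x a b) <= c * M.
Proof.
have [c c1 hc] := upper_bound [seq vK (f (ext1 j e`_(t.1 : 'I_(\dim {:B}))) t.2.1 t.2.2) |
  t <- enum {: 'I_(\dim {:B}) * ('I_2 * 'I_2)}].
exists c => // x M M0 hx a b; rewrite (ext_decomp x) linear_sum summxE.
apply: (na_sum HvK) => [|k _]; first by rewrite mulr_ge0 // (le_trans ler01).
rewrite linearZ mxE (naM HvK) mulrC; apply: ler_pM; rewrite ?(na_ge0 HvK) //.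
by apply: hc; apply/mapP; exists (k, (a, b)); rewrite ?mem_enum.
Qed.

(** With [linear_bound] this makes coordinates and matrix entries equivalent norms on the extended
    algebra. *)
Lemma iota_inv_bound : exists2 c, 1 <= c & forall (x : BK) M, 0 <= M ->
  (forall a b, vK (iota x a b) <= M) -> forall k, vK ((x : 'rV[K]__) 0 k) <= c * M.
Proof.
have [g gK Kg] := iota_bij.
have [c c1 hc] := upper_bound [seq vK ((g (delta_mx t.1.1 t.1.2) : 'rV[K]__) 0 t.2) |
  t <- enum {: ('I_2 * 'I_2) * 'I_(\dim {:B})}].
exists c => // x M M0 hx k.
have -> : x = \sum_a \sum_b iota x a b *: g (delta_mx a b).
  apply: (bij_inj iota_bij); rewrite linear_sum {1}(matrix_sum_delta (iota x)); apply: eq_bigr => a _.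
  by rewrite linear_sum; apply: eq_bigr => b _; rewrite linearZ /= Kg.
have cM : 0 <= c * M by rewrite mulr_ge0 // (le_trans ler01).
rewrite summxE; apply: (na_sum HvK) => // a _; rewrite summxE; apply: (na_sum HvK) => // b _.
rewrite mxE (naM HvK) mulrC; apply: ler_pM; rewrite ?(na_ge0 HvK) //.
by apply: hc; apply/mapP; exists ((a, b), k); rewrite ?mem_enum.
Qed.

Definition integral (x : F) := exists p : A, x = p%:F.
Lemma integralD x y : integral x -> integral y -> integral (x + y).
Proof. by move=> [p ->] [p' ->]; exists (p + p'); rewrite tofracD. Qed.
Lemma integralM x y : integral x -> integral y -> integral (x * y).
Proof. by move=> [p ->] [p' ->]; exists (p * p'); rewrite tofracM. Qed.
Lemma integral0 : integral 0. Proof. by exists 0; rewrite tofrac0. Qed.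
Lemma integral_tofrac p : integral p%:F. Proof. by exists p. Qed.
Lemma integral_sum I (r : seq I) (P : pred I) (f : I -> F) : (forall x, P x -> integral (f x)) -> integral (\sum_(x <- r | P x) f x).
Proof. by move=> h; elim/big_ind: _ => //; [exact: integral0|exact: integralD]. Qed.

Lemma common_denominator (r : seq F) : exists2 D : A, D != 0 & forall x, x \in r -> integral (D%:F * x).
Proof.
elim: r => [|x r [D D0 hD]]; first by exists 1; rewrite ?oner_eq0.
have [n [d [d0 xE _]]] := frac_ratio x; exists (d * D); first by rewrite mulf_neq0.
move=> y; rewrite inE => /predU1P[->|yr].
  exists (D * n); rewrite xE !tofracM; have dF : d%:F != 0 by rewrite tofrac_eq0.
  by rewrite [d%:F * _]mulrC -mulrA [d%:F * _]mulrC divfK.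
by rewrite tofracM -mulrA; apply: integralM; [exact: integral_tofrac|exact: hD].
Qed.

Variable O : set B.
Hypothesis O_order : is_order O.

Lemma order_closed1 : O 1. Proof. by case: O_order. Qed.
Lemma order_closedM x y : O x -> O y -> O (x * y). Proof. by case: O_order => _ + _; apply. Qed.
Lemma order_closedB x y : O x -> O y -> O (x - y).
Proof.
case: O_order => _ _ [s [_ hs]] /hs[c ->] /hs[c' ->]; apply/hs; exists (fun t => c t - c' t).
by rewrite -sumrB; apply: eq_bigr => t _; rewrite tofracB scalerBl.
Qed.
Lemma order_closed0 : O 0. Proof. by rewrite -(subrr 1); apply: order_closedB; apply: order_closed1. Qed.
Lemma order_closedD x y : O x -> O y -> O (x + y).
Proof. by move=> hx hy; rewrite -[y]opprK -[- y]sub0r; apply: order_closedB => //; apply: order_closedB => //; apply: order_closed0. Qed.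
Lemma order_closed_sum I (r : seq I) (P : pred I) (f : I -> B) : (forall x, P x -> O (f x)) -> O (\sum_(x <- r | P x) f x).
Proof. by move=> h; elim/big_ind: _ => //; [exact: order_closed0|exact: order_closedD]. Qed.
Lemma order_closedZ (p : A) x : O x -> O (p%:F *: x).
Proof.
case: O_order => _ _ [s [_ hs]] /hs[c ->]; apply/hs; exists (fun t => p * c t).
by rewrite scaler_sumr; apply: eq_bigr => t _; rewrite tofracM scalerA.
Qed.
Lemma order_closedX x n : O x -> O (x ^+ n).
Proof. by move=> hx; elim: n => [|n IH]; [exact: order_closed1|rewrite exprS; apply: order_closedM]. Qed.

Lemma order_coord : exists2 D : A, D != 0 & forall x k, O x -> integral (D%:F * coord e k x).
Proof.
have [_ _ [s [_ hs]]] := O_order.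
have [D D0 hD] := common_denominator [seq coord e t.1 s`_(t.2 : 'I_(size s)) | t <- enum {: 'I_(\dim {:B}) * 'I_(size s)}].
exists D => // x k /hs[c ->]; rewrite linear_sum mulr_sumr; apply: integral_sum => t _.
rewrite linearZ /= mulrCA; apply: integralM; first exact: integral_tofrac.
by apply: hD; apply/mapP; exists (k, t); rewrite ?mem_enum.
Qed.

Lemma order_denominator (r : seq B) : exists2 D : A, D != 0 & forall x, x \in r -> O (D%:F *: x).
Proof.
elim: r => [|x r [D D0 hD]]; first by exists 1; rewrite ?oner_eq0.
have [_ _ [s [sV hs]]] := O_order.
have xs : x \in <<in_tuple s>>%VS by rewrite /= sV memvf.
have [D' D'0 hD'] := common_denominator [seq coord (in_tuple s) t x | t <- enum 'I_(size s)].
exists (D * D'); first by rewrite mulf_neq0.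
move=> y; rewrite inE => /predU1P[->|yr]; last by rewrite mulrC tofracM -scalerA; apply/order_closedZ/hD.
rewrite tofracM -scalerA; apply: order_closedZ; apply/hs.
have h t : exists p : A, D'%:F * coord (in_tuple s) t x = p%:F.
  by apply: hD'; apply/mapP; exists t; rewrite ?mem_enum.
exists (fun t => projT1 (cid (h t))); rewrite {1}(coord_span xs) scaler_sumr; apply: eq_bigr => t _.
by case: cid => p /= <-; rewrite scalerA.
Qed.

(** Families of polynomials with at most N coefficients are coded by a finite type, so that they can
    be counted. *)
Definition decode (T : finType) N (f : {ffun T * 'I_N -> Fq}) (t : T) : A := \sum_(m < N) f (t, m) *: 'X^m.
Lemma decodeP (T : finType) N (c : T -> A) : (forall t, (size (c t) <= N)%N) ->
  exists f : {ffun T * 'I_N -> Fq}, forall t, decode f t = c t.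
Proof.
move=> h; exists [ffun x : T * 'I_N => (c x.1)`_(x.2 : 'I_N)] => t; apply/polyP => m; rewrite coef_sum.
under eq_bigr => l _ do rewrite ffunE coefZ coefXn /=.
have [mN|Nm] := ltnP m N.
  rewrite (bigD1 (Ordinal mN)) //= eqxx mulr1 big1 ?addr0 // => l lm.
  by case: eqP => [e|_]; rewrite ?mulr0 //; case/eqP: lm; apply/val_inj.
rewrite big1 ?nth_default // ?(leq_trans (h t)) // => l _.
by case: eqP => [e|_]; rewrite ?mulr0 //; move: Nm; rewrite e leqNgt ltn_ord.
Qed.
Lemma size_decode (T : finType) N (f : {ffun T * 'I_N -> Fq}) t : (size (decode f t) <= N)%N.
Proof.
apply: leq_trans (size_sum _ _ _) _; apply/bigmax_leqP => m _.
by apply: leq_trans (size_scale_leq _ _) _; rewrite size_polyXn.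
Qed.

Lemma large_power M : exists n, M < q%:R ^+ n :> R.
Proof.
have [n hn] := @expr_small R q%:R^-1 (Num.max 1 M)^-1 ltac:(by rewrite invr_ge0 ltW // q_gt0R)
  ltac:(by rewrite invf_lt1 ?q_gt1 // q_gt0R) ltac:(by rewrite invr_gt0 lt_max ltr01).
exists n; apply: (@le_lt_trans _ _ (Num.max 1 M)); first by rewrite le_max lexx orbT.
have := hn n (leqnn n); rewrite exprVn ltf_pV2 // posrE ?exprn_gt0 ?q_gt0R //.
by rewrite lt_max ltr01.
Qed.

(** Bounded entries give bounded coordinates; over a common denominator the numerators are
    polynomials of bounded degree. *)
Lemma order_discrete M : finite_set [set x | O x /\ forall a b, vK (ib x a b) <= M].
Proof.
have [D D0 hD] := order_coord; have [c c1 hc] := iota_inv_bound.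
have [N hN] := large_power (vK (polyK D) * (c * Num.max 0 M)).
pose G (f : {ffun 'I_(\dim {:B}) * 'I_N -> Fq}) : B := \sum_k ((decode f k)%:F / D%:F) *: e`_k.
apply: (@sub_finite_set _ _ (G @` setT)); last exact: finite_image.
move=> x [Ox hx].
have h k : exists p : A, D%:F * coord e k x = p%:F by apply: hD.
have [|f hf] := @decodeP _ N (fun k => projT1 (cid (h k))).
  move=> k; case: cid => p /= hp; apply: size_v_polyK; apply: le_lt_trans hN.
  rewrite /= -hp rmorphM (naM HvK) ler_wpM2l ?(na_ge0 HvK) //.
  have := hc (ext1 j x) (Num.max 0 M) _ _ k; rewrite mxE; apply; first by rewrite le_max lexx.
  by move=> a b; rewrite le_max hx orbT.
exists f => //; rewrite [RHS](coord_vbasis_full x); apply: eq_bigr => k _; congr (_ *: _).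
rewrite hf; case: cid => p /= <-; have dF : D%:F != 0 by rewrite tofrac_eq0.
by rewrite [D%:F * _]mulrC mulfK.
Qed.

Lemma coef_decode (T : finType) N (f : {ffun T * 'I_N -> Fq}) t (m : 'I_N) : (decode f t)`_m = f (t, m).
Proof.
rewrite coef_sum (bigD1 m) //= coefZ coefXn eqxx mulr1 big1 ?addr0 // => l lm.
rewrite coefZ coefXn; case: eqP => [e|_]; rewrite ?mulr0 //; case/eqP: lm; exact/val_inj.
Qed.
Lemma decode_inj (T : finType) N (f g : {ffun T * 'I_N -> Fq}) : (forall t, decode f t = decode g t) -> f = g.
Proof. by move=> h; apply/ffunP => -[t m]; rewrite -!coef_decode h. Qed.

Lemma v_varpiX (m : int) : vK (varpi ^ m) = q%:R ^ (- m).
Proof. by rewrite (naXz HvK) v_varpi exprz_inv. Qed.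
Lemma varpiX_neq0 (m : int) : varpi ^ m != 0.
Proof. by rewrite -(na_gt0 HvK) v_varpiX exprz_gt0 // q_gt0R. Qed.

Lemma floor_size y (m : int) (N : nat) : vK y <= q%:R ^ m -> N%:Z = m + 1 -> exists (p : A) al, [/\ (size p <= N)%N, vK al < 1 & y = polyK p + al].
Proof.
move=> ym Nm; have [p hp] := floor y; exists p, (y - polyK p); split=> //; last by rewrite addrC subrK.
apply: size_v_polyK; rewrite exprnP Nm expfzDr ?gt_eqF ?q_gt0R // expr1z.
have m0 : 0 <= m + 1 by rewrite -Nm.
rewrite -[polyK p](subKr y); apply: (na_lt_sub HvK).
  by apply: le_lt_trans ym _; rewrite ltr_pMr ?q_gt1 // exprz_gt0 // q_gt0R.
apply: lt_le_trans hp _; rewrite -[X in _ * X]expr1z -expfzDr ?gt_eqF ?q_gt0R //.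
by rewrite -Nm -exprnP exprn_ege1 // ltW // q_gt1.
Qed.

(* Reduction modulo the lattice over the valuation ring spanned by the columns of
   (varpi ^ (m - lam), y varpi ^ - lam; 0, varpi ^ (n - lam)); the size bounds count the classes. *)
Lemma column_box (m n : int) y m1 m2 (lam N N1 N2 : nat) :
  vK m1 <= q%:R ^+ N -> vK m2 <= q%:R ^+ N -> vK y * q%:R ^+ lam <= q%:R ^+ N ->
  N1%:Z = N%:Z + m - lam%:Z + 1 -> N2%:Z = N%:Z + n - lam%:Z + 1 ->
  exists (p1 p2 : A) al be, [/\ (size p1 <= N1)%N /\ (size p2 <= N2)%N, vK al < 1 /\ vK be < 1,
    m2 = varpi ^ (n - lam%:Z) * (polyK p2 + be) & m1 = varpi ^ (m - lam%:Z) * (polyK p1 + al) + y * varpi ^ (- lam%:Z) * be].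
Proof.
move=> hm1 hm2 hy e1 e2; have q0 : q%:R != 0 :> R by rewrite gt_eqF // q_gt0R.
have quo t (l : int) : vK t <= q%:R ^+ N -> vK (t / varpi ^ (l - lam%:Z)) <= q%:R ^ (N%:Z + l - lam%:Z).
  move=> ht; rewrite (naF HvK) v_varpiX ler_pdivrMr ?exprz_gt0 ?q_gt0R // -expfzDr //.
  by have -> : N%:Z + l - lam%:Z + - (l - lam%:Z) = N by clear; lia.
have [p2 [be [s2 b1 e2']]] := floor_size (quo m2 n hm2) e2.
have hm1' : vK (m1 - y * varpi ^ (- lam%:Z) * be) <= q%:R ^+ N.
  apply: (na_le_sub HvK) => //; rewrite !(naM HvK) v_varpiX opprK -exprnP -[leRHS]mulr1.
  by apply: ler_pM => //; rewrite ?(na_ge0 HvK) ?mulr_ge0 ?(na_ge0 HvK) ?exprn_ge0 ?(ltW q_gt0R) ?(ltW b1).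
have [p1 [al [s1 a1 e1']]] := floor_size (quo _ m hm1') e1.
exists p1, p2, al, be; split=> //; first by rewrite -e2' mulrC divfK ?varpiX_neq0.
by rewrite -e1' mulrC divfK ?varpiX_neq0 // subrK.
Qed.

(** * Minkowski's theorem for the order *)

Hypothesis B_dim : \dim {:B} = 4%N.

(* Minkowski's theorem, by the pigeonhole principle *)
Lemma minkowski (f : {linear BK -> 'M[K]_2}) : exists C, forall (m n : int) y, m + n <= 1 ->
  exists x M, [/\ O x, x != 0, f (ext1 j x) = mx4 (varpi ^ m) y 0 (varpi ^ n) * M & forall a b, vK (M a b) <= C].
Proof.
have [c c1 hc] := linear_bound f.
have [D D0 hD] := order_denominator [seq e`_(t : 'I_(\dim {:B})) | t <- enum 'I_(\dim {:B})].
have [ka hka] := large_power (c * vK (polyK D)).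
(* [ka] absorbs the constants c and D. With 2 more, N1 + N2 = 2n' + m + n - 2 is at most 2n' - 1, so
   a class has fewer digits than the 4n' digits of a vector. *)
pose lam := ka.+2; exists (q%:R ^+ lam) => m n y mn.
have [N0 hN0] := large_power (vK y * q%:R ^+ lam).
(* Large enough for N1 and N2 to be natural numbers and for y to satisfy the hypothesis of
   [column_box]. *)
pose n' := (N0 + (`|m| + `|n|) + 2)%N; pose N := (ka + n')%N.
have q1 := q_gt1; have q0 : q%:R != 0 :> R by rewrite gt_eqF // q_gt0R.
pose N1 := absz (n'%:Z + m - 1)%R; pose N2 := absz (n'%:Z + n - 1)%R.
have N1E : N1%:Z = n'%:Z + m - 1 by rewrite /N1 /n'; clear; lia.
have N2E : N2%:Z = n'%:Z + n - 1 by rewrite /N2 /n'; clear; lia.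
pose X := {ffun 'I_(\dim {:B}) * 'I_n' -> Fq}.
pose Y := ({ffun 'I_2 * 'I_N1 -> Fq} * {ffun 'I_2 * 'I_N2 -> Fq})%type.
pose x_ (p : X) : B := \sum_k (decode p k * D)%:F *: e`_k.
have Ox p : O (x_ p).
  apply: order_closed_sum => k _; rewrite tofracM -scalerA; apply: order_closedZ; apply: hD; apply/mapP; exists k => //.
  by rewrite mem_enum.
have coordx p k : coord e k (x_ p) = (decode p k * D)%:F.
  by rewrite /x_ coord_sum_free // (basis_free (vbasisP _)).
have fx p a b : vK (f (ext1 j (x_ p)) a b) <= q%:R ^+ N.
  apply: le_trans (hc _ (vK (polyK D) * q%:R ^+ n') _ _ a b) _.
  - by rewrite mulr_ge0 ?(na_ge0 HvK) ?exprn_ge0 ?(ltW q_gt0R).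
  - move=> k; rewrite mxE coordx -[j _]/(polyK _) rmorphM (naM HvK) mulrC ler_wpM2l ?(na_ge0 HvK) //.
    by apply: v_polyK_size; apply: leq_trans (size_decode _ _) _.
  - by rewrite mulrA /N exprD ler_pM2r ?exprn_gt0 ?q_gt0R // ltW.
have hy : vK y * q%:R ^+ lam <= q%:R ^+ N.
  apply: le_trans (ltW hN0) _; rewrite ler_weXn2l ?(ltW q1) // /N /n'; clear; lia.
have cls p : exists yy : Y, forall b, exists al be, [/\ vK al < 1, vK be < 1,
    f (ext1 j (x_ p)) 1 b = varpi ^ (n - lam%:Z) * (polyK (decode yy.2 b) + be) &
    f (ext1 j (x_ p)) 0 b = varpi ^ (m - lam%:Z) * (polyK (decode yy.1 b) + al) + y * varpi ^ (- lam%:Z) * be].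
  have h b := @column_box m n y _ _ lam N N1 N2 (fx p 0 b) (fx p 1 b) hy
     ltac:(by rewrite N1E /N /lam; clear; lia) ltac:(by rewrite N2E /N /lam; clear; lia).
  pose P1 b := projT1 (cid (h b)); pose P2 b := projT1 (cid (projT2 (cid (h b)))).
  have hP b : exists al be, [/\ (size (P1 b) <= N1)%N /\ (size (P2 b) <= N2)%N, vK al < 1 /\ vK be < 1,
    f (ext1 j (x_ p)) 1 b = varpi ^ (n - lam%:Z) * (polyK (P2 b) + be) &
    f (ext1 j (x_ p)) 0 b = varpi ^ (m - lam%:Z) * (polyK (P1 b) + al) + y * varpi ^ (- lam%:Z) * be].
    exact: (projT2 (cid (projT2 (cid (h b))))).
  have [f1 hf1] : exists f1 : {ffun 'I_2 * 'I_N1 -> Fq}, forall b, decode f1 b = P1 b.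
    by apply: decodeP => b; have [? [? [[]]]] := hP b.
  have [f2 hf2] : exists f2 : {ffun 'I_2 * 'I_N2 -> Fq}, forall b, decode f2 b = P2 b.
    by apply: decodeP => b; have [? [? [[]]]] := hP b.
  exists (f1, f2) => b /=; have [al [be [_ [a1 b1] e1 e2]]] := hP b.
  by exists al, be; rewrite hf1 hf2; split.
pose G p := projT1 (cid (cls p)).
have card : (#|{: Y}| < #|{: X}|)%N.
  rewrite card_prod !card_ffun !card_prod !card_ord B_dim -expnD ltn_exp2l ?finNzRing_gt1 //.
  by move: N1E N2E mn; clear; lia.
have /injectivePn[p [p' pp' Gpp']] : ~~ injectiveb G.
  by apply/negP => /injectiveP/leq_card; rewrite leqNgt card.
exists (x_ p - x_ p').
have hM b : exists M0 M1, [/\ vK M0 <= q%:R ^+ lam, vK M1 <= q%:R ^+ lam,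
    f (ext1 j (x_ p - x_ p')) 1 b = varpi ^ n * M1 & f (ext1 j (x_ p - x_ p')) 0 b = varpi ^ m * M0 + y * M1].
  have [al [be [a1 b1 e1 e2]]] := projT2 (cid (cls p)) b.
  have [al' [be' [a1' b1' e1' e2']]] := projT2 (cid (cls p')) b.
  rewrite -/(G p') -Gpp' in e1' e2'; rewrite -/(G p) in e1 e2.
  exists (varpi ^ (- lam%:Z) * (al - al')), (varpi ^ (- lam%:Z) * (be - be')).
  have sm z z' : vK z < 1 -> vK z' < 1 -> vK (varpi ^ (- lam%:Z) * (z - z')) <= q%:R ^+ lam.
    move=> z1 z1'; rewrite (naM HvK) v_varpiX opprK -exprnP -[leRHS]mulr1 ler_wpM2l ?exprn_ge0 ?(ltW q_gt0R) //.
    by apply: ltW; apply: (na_lt_sub HvK).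
  have pE (t : int) : varpi ^ (t - lam%:Z) = varpi ^ t * varpi ^ (- lam%:Z).
    by rewrite expfzDr // -[varpi]expr1z varpiX_neq0.
  by split; [exact: sm|exact: sm| |]; rewrite !raddfB !mxE ?e1 ?e1' ?e2 ?e2' !pE; ring.
pose M0 b := projT1 (cid (hM b)); pose M1 b := projT1 (cid (projT2 (cid (hM b)))).
have hMb b := projT2 (cid (projT2 (cid (hM b)))).
exists (\matrix_(a, b) if a == 0 then M0 b else M1 b); split.
- exact: order_closedB.
- apply: contra_neqN pp' => /eqP x0; apply: decode_inj => k; have : coord e k (x_ p) = coord e k (x_ p').
    by rewrite (subr0_eq x0).
  by rewrite !coordx => /eqP; rewrite tofrac_eq => /eqP/(mulIf D0).
- apply/matrixP => a b; rewrite mx2M !mxE; have [_ _ h1 h0] := hMb b.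
  case: a => [[|[|]]] // ha.
    by have -> : Ordinal ha = 0 by [apply/val_inj]; rewrite h0.
  by have -> : Ordinal ha = 1 by [apply/val_inj]; rewrite h1 /= mul0r add0r.
- by move=> a b; rewrite mxE; have [h1 h2 _ _] := hMb b; case: ifP.
Qed.

(** * The reduced norm on the order *)

Lemma cayley_hamilton2 (m : 'M[K]_2) : m * m = (m 0 0 + m 1 1) *: m - (\det m) *: 1.
Proof.
rewrite [LHS]mx4_eta [RHS]mx4_eta !mx2M det2 !mxE /=; congr mx4; rewrite ?mulr0n ?mulr1n; ring.
Qed.

Lemma scalar_rational b lam : ib b = lam *: 1 -> exists a, lam = j a.
Proof.
move=> h; have E : ext1 j b = lam *: ext1 j 1.
  by apply: (bij_inj iota_bij); rewrite linearZ /= rmorph1.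
have [k hk] : exists k, coord e k (1 : B) != 0.
  apply: contrapT => h0; have : (1 : B) != 0 by apply: oner_neq0.
  rewrite (coord_vbasis_full (1 : B)) big1 ?eqxx // => k _.
  by have [->|hk] := eqVneq (coord e k (1 : B)) 0; [rewrite scale0r|case: h0; exists k].
exists (coord e k b / coord e k 1); rewrite fmorph_div.
have := congr1 (fun x : BK => (x : 'rV[K]__) 0 k) E; rewrite !mxE => ->.
by rewrite mulfK // fmorph_eq0.
Qed.

(* x is a root of its characteristic polynomial over K; since x ^ 2 is a K-combination of x and 1 it is also an F-combination. *)
Lemma norm_rational x : exists y, \det (ib x) = j y.
Proof.
pose r (y : B) : 'rV[F]_(\dim {:B}) := \row_k coord e k y.
have rE y : ext1 j y = map_mx j (r y) by apply/rowP => k; rewrite !mxE.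
pose xx := x * x; set t := ib x 0 0 + ib x 1 1; set d := \det (ib x).
have E : ext1 j (x * x) = t *: ext1 j x - d *: ext1 j 1.
  by apply: (bij_inj iota_bij); rewrite ibM cayley_hamilton2 linearB !linearZ /= rmorph1.
have : (map_mx j (r xx) <= map_mx j (col_mx (r x) (r 1)))%MS.
  apply/submxP; exists (row_mx t%:M (- d%:M)).
  by rewrite map_col_mx mul_row_col -!rE mulNmx !mul_scalar_mx; exact: E.
rewrite map_submx => /submxP[w wE].
have E2 : x * x = w 0 (lshift 1 0) *: x + w 0 (rshift 1 0) *: 1.
  rewrite [LHS]coord_vbasis_full [in RHS](coord_vbasis_full x) [in RHS](coord_vbasis_full 1) !scaler_sumr -big_split /=.
  apply: eq_bigr => k _; rewrite !scalerA -scalerDl; congr (_ *: _).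
  have := congr1 (fun y : 'rV_ _ => y 0 k) wE; rewrite mxE => ->.
  rewrite mxE big_split_ord !big_ord1 /= col_mxEu col_mxEd !mxE //.
set u0 := w 0 _ in E2; set u1 := w 0 _ in E2.
have E3 : (t - j u0) *: ib x = (d + j u1) *: 1.
  have := congr1 (fun y => ib y) E2; rewrite raddfD /= raddfD /= !ibZ ib1 ibM cayley_hamilton2 -/t -/d => h.
  move/eqP: h; rewrite subr_eq => /eqP h; apply/eqP.
  by rewrite scalerBl subr_eq h (scalerDl _ d) addrC -addrA [X in _ == _ + X]addrC.
have [tu|tu] := eqVneq (t - j u0) 0.
  move: E3; rewrite tu scale0r => /esym/eqP; rewrite scaler_eq0 oner_eq0 orbF addr_eq0 => /eqP->.
  by exists (- u1); rewrite rmorphN.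
have E4 : ib x = ((d + j u1) / (t - j u0)) *: 1.
  by rewrite mulrC -scalerA -E3 scalerA mulVf // scale1r.
have [a ha] := scalar_rational E4; exists (a ^+ 2); rewrite /d E4 ha.
by rewrite detZ det1 mulr1 rmorphXn.
Qed.

Definition norm x : F := projT1 (cid (norm_rational x)).
Lemma normE x : \det (ib x) = j (norm x). Proof. by rewrite /norm; case: cid. Qed.
Lemma normM x y : norm (x * y) = norm x * norm y.
Proof. by apply: (fmorph_inj j); rewrite rmorphM -!normE ibM det_mulmx. Qed.
Lemma norm1 : norm 1 = 1.
Proof. by apply: (fmorph_inj j); rewrite rmorph1 -normE ib1 det1. Qed.
Lemma normX x n : norm (x ^+ n) = norm x ^+ n.
Proof. by elim: n => [|n IH]; rewrite ?expr0 ?norm1 // !exprS normM IH. Qed.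

(** The symmetric bilinear form with polar m m = 2 det m. *)
Definition polar (m m' : 'M[K]_2) := m 0 0 * m' 1 1 + m 1 1 * m' 0 0 - m 0 1 * m' 1 0 - m 1 0 * m' 0 1.
Lemma polar_norm x y : polar (ib x) (ib y) = j (norm (x + y) - norm x - norm y).
Proof. by rewrite !rmorphB -!normE raddfD /= raddfD /= !det2 /polar !mxE; ring. Qed.
Lemma polar_sumr I (s : seq I) (a : I -> K) (m : I -> 'M[K]_2) m0 :
  polar m0 (\sum_(t <- s) a t *: m t) = \sum_(t <- s) a t * polar m0 (m t).
Proof.
elim: s => [|t s IH]; first by rewrite !big_nil /polar !mxE; ring.
by rewrite !big_cons -IH /polar !mxE; ring.
Qed.
Lemma polarC m m' : polar m m' = polar m' m. Proof. by rewrite /polar; ring. Qed.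

Lemma two_neq0 : odd q -> 2 != 0 :> A.
Proof.
move=> qo; have q0 : q%:R = 0 :> Fq.
  (* Translating the summation variable by 1 adds q to the sum. *)
  have : \sum_(x : Fq) x = \sum_(x : Fq) x + q%:R.
    rewrite {1}(reindex_inj (addIr 1)) big_split /= sumr_const //.
  by move=> h; apply: (addrI (\sum_(x : Fq) x)); rewrite -h addr0.
rewrite -polyC_natr polyC_eq0; apply/eqP => h2; move/eqP: q0.
by rewrite -[q]odd_double_half qo natrD -mul2n natrM h2 mul0r addr0 oner_eq0.
Qed.

Hypothesis q_odd : odd q.

(** Twice the norm is a quadratic form in the coordinates with the finitely many coefficients [be];
    both coordinates and coefficients have common denominators. *)
Lemma norm_denominator : exists2 D : A, D != 0 & forall x, O x -> integral (D%:F * norm x).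
Proof.
have [D1 D10 h1] := order_coord.
pose be (t : 'I_(\dim {:B}) * 'I_(\dim {:B})) := norm (e`_t.1 + e`_t.2) - norm e`_t.1 - norm e`_t.2.
have [D2 D20 h2] := common_denominator [seq be t | t <- enum {: 'I_(\dim {:B}) * 'I_(\dim {:B})}].
exists (2 * (D1 ^+ 2 * D2)); first by rewrite !mulf_neq0 ?two_neq0 ?expf_neq0.
move=> x Ox.
have E : norm x *+ 2 = \sum_k coord e k x * \sum_l coord e l x * be (k, l).
  apply: (fmorph_inj j); rewrite rmorphMn /= -normE.
  have -> : \det (ib x) *+ 2 = polar (ib x) (ib x) by rewrite /polar det2; ring.
  have xE : ib x = \sum_k j (coord e k x) *: ib e`_k.
    rewrite {1}(coord_vbasis_full x) raddf_sum raddf_sum; apply: eq_bigr => k _; exact: ibZ.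
  rewrite {1}xE polarC polar_sumr rmorph_sum; apply: eq_bigr => k _; rewrite rmorphM; congr (_ * _).
  rewrite polarC {1}xE polar_sumr rmorph_sum; apply: eq_bigr => l _; rewrite rmorphM; congr (_ * _).
  exact: polar_norm.
have -> : (2 * (D1 ^+ 2 * D2))%:F * norm x = (D1 ^+ 2 * D2)%:F * (norm x *+ 2).
  by rewrite tofracM rmorph_nat mulrnAr -mulrnAl -[in RHS]mulr_natl.
rewrite E mulr_sumr; apply: integral_sum => k _.
rewrite mulr_sumr mulr_sumr; apply: integral_sum => l _.
rewrite expr2 !tofracM.
have -> : D1%:F * D1%:F * D2%:F * (coord e k x * (coord e l x * be (k, l))) =
  (D1%:F * coord e k x) * ((D1%:F * coord e l x) * (D2%:F * be (k, l))).
  by rewrite [X in _ = _ * X]mulrACA [RHS]mulrACA [X in _ = X * _]mulrA.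
apply: integralM; first exact: h1.
apply: integralM; first exact: h1.
by apply: h2; apply/mapP; exists (k, l); rewrite ?mem_enum.
Qed.

(* A nonzero D of minimal degree with D y ^ n integral for all n divides D y, as the remainder has the same property. *)
Lemma bounded_powers_integral y (D : A) : D != 0 -> (forall n, integral (D%:F * y ^+ n)) -> integral y.
Proof.
have [N] := ubnP (size D); elim: N D => // N IH D hN D0 h.
have [D' hD'] := h 1%N; rewrite expr1 in hD'.
have dF : D%:F != 0 by rewrite tofrac_eq0.
have rE : (D' %% D)%:F = D%:F * y - (D' %/ D)%:F * D%:F.
  by rewrite hD'; apply/eqP; rewrite eq_sym subr_eq addrC -tofracM -tofracD -divp_eq.
have [r0|r0] := eqVneq (D' %% D) 0.
  exists (D' %/ D); apply: (mulfI dF); move: rE; rewrite r0 tofrac0 => /esym/eqP.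
  by rewrite subr_eq0 => /eqP ->; rewrite mulrC.
apply: (IH (D' %% D)) => //.
  by rewrite -ltnS (leq_trans _ hN) // ltnS ltn_modp.
move=> n; rewrite rE mulrBl -mulrA -exprS -mulrA -[_ - _]/(_ + - _) -mulNr -tofracN.
by apply: integralD; [exact: h|apply: integralM; [exact: integral_tofrac|exact: h]].
Qed.

(** Powers of u stay in O, so the powers of its norm have a common denominator and the norm is a
    polynomial; the same holds for u'. As the two norms multiply to 1, they are constants. *)
Lemma order_unit u u' : O u -> O u' -> u * u' = 1 -> order_units iota O (ib u).
Proof.
move=> Ou Ou' uu; exists u => //; split=> //.
have [D D0 hD] := norm_denominator.
have int x : O x -> integral (norm x).
  by move=> Ox; apply: (bounded_powers_integral D0) => n; rewrite -normX; apply/hD/order_closedX.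
have [p pE] := int u Ou; have [p' pE'] := int u' Ou'.
have pp : p%:F * p'%:F = 1 by rewrite -pE -pE' -normM uu norm1.
have p0 : p != 0 by apply: contra_eqN pp => /eqP ->; rewrite tofrac0 mul0r eq_sym oner_eq0.
have p'0 : p' != 0 by apply: contra_eqN pp => /eqP ->; rewrite tofrac0 mulr0 eq_sym oner_eq0.
have [|c cE] := @v_polyK_le1 p.
  have e1 : vK (polyK p) * vK (polyK p') = 1 by rewrite -(naM HvK) /= -rmorphM pp rmorph1 (na1 HvK).
  by rewrite -e1 ler_peMr ?(na_ge0 HvK) // v_polyK_ge1.
exists c; first by apply: contraNneq p0 => c0; rewrite cE c0.
by rewrite /reduced_norm normE pE cE.
Qed.

(** * Finiteness of ideal classes and Fujisaki's argument *)

Hypothesis B_div : is_division_algebra B.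

(** O / DO is finite: [rho] records the coefficients modulo D. *)
Lemma residue_map (D : A) : D != 0 -> exists (W : finType) (rho : B -> W), forall x y, O x -> O y -> rho x = rho y ->
  exists2 z, O z & x - y = D%:F *: z.
Proof.
move=> D0; have [_ _ [s [_ hs]]] := O_order.
have h x : exists c : 'I_(size s) -> A, O x -> x = \sum_(t < size s) (c t)%:F *: s`_t.
  have [/hs[c xc]|nO] := pselect (O x); first by exists c.
  by exists (fun=> 0).
pose c x := projT1 (cid (h x)).
have hd x : exists f : {ffun 'I_(size s) * 'I_(size D) -> Fq}, forall t, decode f t = c x t %% D.
  by apply: decodeP => t; apply: ltnW; rewrite ltn_modp.
exists {ffun 'I_(size s) * 'I_(size D) -> Fq}, (fun x => projT1 (cid (hd x))) => x y Ox Oy e.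
have cE t : c x t %% D = c y t %% D.
  by rewrite -(projT2 (cid (hd x)) t) -(projT2 (cid (hd y)) t) e.
exists (\sum_(t < size s) (c x t %/ D - c y t %/ D)%:F *: s`_t); first by apply/hs; eexists.
rewrite {1}(projT2 (cid (h x)) Ox) {1}(projT2 (cid (h y)) Oy) -/(c x) -/(c y) -sumrB scaler_sumr.
apply: eq_bigr => t _; rewrite -scalerBl scalerA -tofracB -tofracM; congr (_%:F *: _).
rewrite {1}(divp_eq (c x t) D) {1}(divp_eq (c y t) D) cE opprD addrACA subrr addr0.
by rewrite -mulrBl mulrC.
Qed.

(** A left ideal Ox containing DO is determined by its image in the finite set O / DO, so there are
    finitely many; two generators of one ideal differ by a unit of O. *)
Lemma ideal_classes (D : A) : D != 0 -> exists r : seq B, forall x, O x -> x != 0 ->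
  (forall z, O z -> exists2 z', O z' & D%:F *: z = z' * x) ->
  exists x1 u u', [/\ x1 \in r, O u, O u', u * u' = 1 & x1 = u * x].
Proof.
move=> D0; have [W [rho hrho]] := residue_map D0.
pose inv x : {set W} := [set w | `[< exists2 z, O z & rho (z * x) = w >]]%SET.
pose good x := [/\ O x, x != 0 & forall z, O z -> exists2 z', O z' & D%:F *: z = z' * x].
pose rep I : B := xget 0 [set x | good x /\ inv x = I].
have mult x y : good x -> good y -> inv x = inv y -> exists2 u, O u & x = u * y.
  move=> [Ox _ _] [Oy _ hy] e.
  have : rho (1 * x) \in inv x by rewrite inE; apply/asboolP; exists 1 => //; apply: order_closed1.
  rewrite e inE => /asboolP[z Oz ze].
  have [w Ow we] := hrho (1 * x) (z * y) ltac:(by rewrite mul1r) (order_closedM Oz Oy) (esym ze).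
  have [w' Ow' we'] := hy w Ow; exists (w' + z); first exact: order_closedD.
  by rewrite mulrDl -we' -we mul1r subrK.
exists (codom rep) => x Ox x0 hx.
have gx : good x by [].
have [g1 e1] : good (rep (inv x)) /\ inv (rep (inv x)) = inv x.
  by rewrite /rep; case: xgetP => [y _ //|/(_ x) h]; case: h.
have [u Ou xu] := mult _ _ gx g1 (esym e1); have [u' Ou' xu'] := mult _ _ g1 gx e1.
exists (rep (inv x)), u', u; split=> //; first exact: codom_f.
have [_ x10 _] := g1; have x1u := B_div x10.
by apply: (mulIr x1u); rewrite -mulrA -xu -xu' mul1r.
Qed.

Lemma mul_bound (M N : 'M[K]_2) a b c d : (forall x y, vK (M x y) <= a) -> (forall x y, vK (N x y) <= b) ->
  vK ((M * N) c d) <= a * b.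
Proof.
move=> hM hN; rewrite mx2M; apply: (na_le_add HvK); rewrite (naM HvK); apply: ler_pM; by rewrite ?(na_ge0 HvK).
Qed.

Let swap : 'M[K]_2 := mx4 0 1 1 0.

(* Fujisaki's argument: Minkowski's theorem gives x, x' in O with g^-1 x and x' g bounded, so x' x takes finitely many
   values; hence O x takes finitely many values, and x is a unit times one of finitely many elements. *)
Lemma units_cobounded : exists C, forall (m n : int) y, 0 <= m + n <= 1 -> exists2 h, order_units iota O h &
  forall a b, vK ((h * mx4 (varpi ^ m) y 0 (varpi ^ n)) a b) <= C.
Proof.
have [C1 hC1] := minkowski iota.
have [C2 hC2] := minkowski (mulmx swap \o trmx \o iota).
have fin := order_discrete (C2 * C1).
pose S : seq B := fset_set [set x | O x /\ forall a b, vK (ib x a b) <= C2 * C1].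
have inS x : O x -> (forall a b, vK (ib x a b) <= C2 * C1) -> x \in S.
  by move=> Ox hx; rewrite /S in_fset_set // inE.
have [D D0 hD] := order_denominator [seq x^-1 | x <- S].
have [r hr] := ideal_classes D0.
have [C3 _ hC3] := upper_bound [seq vK (ib (t.1 * t.2.1^-1) t.2.2.1 t.2.2.2) |
   t <- [seq (x, y) | x <- r, y <- [seq (x, y) | x <- S, y <- enum {: 'I_2 * 'I_2}]]].
have {}hC3 x1 x a b : x1 \in r -> x \in S -> vK (ib (x1 * x^-1) a b) <= C3.
  move=> h1 h2; apply: hC3; apply/mapP; exists (x1, (x, (a, b))) => //.
  by apply/allpairsP; exists (x1, (x, (a, b))); split=> //; apply/allpairsP; exists (x, (a, b)); rewrite mem_enum.
exists (C3 * C2) => m n y mn; have pn := varpiX_neq0.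
have [x [M [Ox x0 xE hM]]] := hC1 m n y ltac:(by move: mn; clear; lia).
(* Transposing and swapping turns this into a bound for x' g. The lower bound on m + n makes the sum
   of the exponents -n and -m small enough. *)
have [x' [M' [Ox' x'0 x'E hM']]] := hC2 (- n) (- m) (- y * varpi ^ (- m - n)) ltac:(by move: mn; clear; lia).
set g := mx4 _ _ _ _ in xE *.
have x'g : ib x' * g = M'^T * swap.
  have trE (a b c d : K) : (mx4 a b c d)^T = mx4 a c b d by rewrite [LHS]mx4_eta !mxE.
  have sw : swap * swap = 1 by rewrite mx4M [RHS]mx4_eta !mxE /=; congr mx4; ring.
  have pE (t t' : int) : varpi ^ (t - t') * varpi ^ t' = varpi ^ t by rewrite -expfzDr ?subrK // -[varpi]expr1z.
  have E : ib x' * swap = M'^T * mx4 (varpi ^ (- n)) 0 (- y * varpi ^ (- m - n)) (varpi ^ (- m)).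
    by have := congr1 trmx x'E; rewrite /= !trmx_mul trmxK !trE.
  rewrite -[ib x']mulr1 -sw mulrA E -2!mulrA; congr (_ * _); rewrite !mx4M; congr mx4.
  - by ring.
  - by rewrite !(mul0r, mul1r, mulr0, mulr1, add0r, addr0) -expfzDr ?addNr // -[varpi]expr1z.
  - by rewrite !(mul0r, mul1r, mulr0, mulr1, add0r, addr0) -expfzDr ?addNr // -[varpi]expr1z.
  - rewrite !(mul0r, mul1r, mulr0, mulr1, add0r, addr0) -mulrA pE; ring.
have hx'g a b : vK ((ib x' * g) a b) <= C2.
  rewrite x'g mx2M ![M'^T _ _]mxE; case: b => [[|[|]]] // hb.
    have -> : Ordinal hb = 0 by apply/val_inj.
    by rewrite !mx4E mulr0 mulr1 add0r.
  have -> : Ordinal hb = 1 by apply/val_inj.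
  by rewrite !mx4E mulr0 mulr1 addr0.
pose z := x' * x; have Oz : O z by apply: order_closedM.
have zS : z \in S.
  apply: inS => // a b; rewrite ibM [ib x](xE) mulrA; exact: mul_bound.
have xu := B_div x0; have x'u := B_div x'0.
have zu : z \is a GRing.unit by rewrite unitrMl.
(* D w = (w D z^-1 x') x, where D z^-1 is in O since z is in the finite set S. *)
have [|x1 [u [u' [x1r Ou Ou' uu x1E]]]] := hr x Ox x0.
  move=> w Ow; exists (w * (D%:F *: z^-1) * x').
    by apply: order_closedM => //; apply: order_closedM => //; apply: hD; apply: map_f.
  by rewrite -mulrA -/z -scalerAr -scalerAl -mulrA mulVr // mulr1.
exists (ib u); first exact: order_unit uu.
(* u = x1 x^-1 with x^-1 = z^-1 x': a factor from a finite list times the bounded x' g. *)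
move=> a b; have -> : ib u * g = ib (x1 * z^-1) * (ib x' * g).
  rewrite mulrA -ibM; congr (ib _ * g); rewrite x1E -2!mulrA invrM //.
  by rewrite (mulrA x) mulrV // mul1r mulVr // mulr1.
apply: mul_bound => // c d; exact: hC3.
Qed.

(** * Finite-index subgroups of the unit group *)

Variable Gamma : set 'M[K]_2.
Hypothesis Gamma_sub : finite_index_subgroup Gamma (order_units iota O).

Lemma Gamma_order g : Gamma g -> exists x, [/\ O x, g = ib x & vK (\det g) = 1].
Proof.
have [sub _ _ _ _] := Gamma_sub; move=> /sub[x [Ox [c c0 hc]] <-]; exists x; split=> //.
rewrite -/(reduced_norm iota x) hc -[j _]/(polyK c%:P) v_polyK ?polyC_eq0 // size_polyC c0 expr0 //.
Qed.

Lemma group_discrete M : finite_set [set g | Gamma g /\ forall a b, vK (g a b) <= M].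
Proof.
apply: (@sub_finite_set _ _ ((fun x => ib x) @` [set x | O x /\ forall a b, vK (ib x a b) <= M])).
  by move=> g [/Gamma_order[x [Ox -> _]] hg]; exists x.
exact/finite_image/order_discrete.
Qed.

Lemma det_v1_unit (g : 'M[K]_2) : vK (\det g) = 1 -> g \is a GRing.unit.
Proof. by move=> g1; apply: det_neq0_unit; rewrite -(na_eq0 HvK) g1 oner_eq0. Qed.

Lemma order_units_unit g : order_units iota O g -> g \is a GRing.unit.
Proof.
move=> [x [_ [c c0 hc]] <-]; apply: det_neq0_unit; rewrite -/(reduced_norm iota x) hc fmorph_eq0 tofrac_eq0.
by rewrite polyC_eq0.
Qed.

(** A unit is brought into Gamma by the inverse of one of finitely many coset representatives, which
    costs a constant factor. *)
Lemma group_cobounded : exists C, forall (m n : int) y, 0 <= m + n <= 1 -> exists2 g, Gamma g &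
  forall a b, vK ((g * mx4 (varpi ^ m) y 0 (varpi ^ n)) a b) <= C.
Proof.
have [C hC] := units_cobounded; have [_ G1 GM GV fin] := Gamma_sub.
pose L := fset_set (lcosets (order_units iota O) Gamma).
have [C' _ hC'] := upper_bound [seq vK ((xget 1 c : 'M[K]_2)^-1 t.1 t.2) | c <- L, t <- enum {: 'I_2 * 'I_2}].
exists (C' * C) => m n y mn; have [t Ut ht] := hC m n y mn.
set c := lcoset t Gamma.
have ct : c t by exists 1; rewrite ?mulr1.
have [g0 Gg0 g0E] : c (xget 1 c) by case: xgetP => // /(_ t).
have cL : c \in L by rewrite in_fset_set // inE; exists t.
have g0u : g0 \is a GRing.unit by have [_ [_ _ h]] := Gamma_order Gg0; apply: det_v1_unit.
have tu := order_units_unit Ut.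
exists g0^-1; first exact: GV.
have -> : g0^-1 = (xget 1 c)^-1 * t by rewrite -g0E invrM // mulrVK.
move=> a b; rewrite -mulrA; apply: mul_bound => // x z; apply: hC'.
by apply/allpairsP; exists (c, (x, z)); rewrite mem_enum.
Qed.

(** In characteristic p one has x ^ p - 1 = (x - 1) ^ p, and a division algebra has no nonzero
    nilpotents. *)
Lemma no_p_torsion p x : prime p -> p%:R = 0 :> F -> x ^+ p = 1 :> B -> x = 1.
Proof.
move=> pp p0 xp; have cB : p \in [pchar B].
  by rewrite inE pp /= -scaler_nat p0 scale0r eqxx.
have : (x - 1) ^+ p = 0.
  rewrite -(pFrobenius_autE cB) (pFrobenius_autB_comm cB); last exact: commr1.
  by rewrite !pFrobenius_autE xp expr1n subrr.
move=> h; apply/eqP; rewrite -subr_eq0; apply: contraT => /B_div h1.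
by have := unitrX p h1; rewrite h unitr0.
Qed.

(* By Cauchy's theorem G would contain an element of order p, but a division algebra of characteristic p has none. *)
Lemma group_tame G : G `<=` Gamma -> finite_set G -> G 1 -> (forall g h, G g -> G h -> G (g * h)) ->
  (forall g, G g -> G g^-1) -> #|` fset_set G|%:R != 0 :> K.
Proof.
move=> sub fin G1 GM GV; set S := fset_set G.
have SG (x : S) : G (val x) by have := valP x; rewrite in_fset_set // inE.
have inS x : G x -> x \in S by move=> h; rewrite in_fset_set // inE.
have unitS (x : S) : val x \is a GRing.unit.
  by have [_ [_ _ h]] := Gamma_order (sub _ (SG x)); apply: det_v1_unit.
pose one : S := [` inS 1 G1]%fset.
pose mulS (g x : S) : S := [` inS _ (GM _ _ (SG g) (SG x))]%fset.
have mulS_inj g : injective (mulS g).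
  by move=> x y /(congr1 val)/= /(mulrI (unitS g))/val_inj.
(* The regular representation makes the set of matrices a permutation group, to which Cauchy's
   theorem applies. *)
pose rho g := perm (@mulS_inj g).
have rhoE g x : val (rho g x) = val g * val x by rewrite permE.
have rho1 : rho one = 1%g by apply/perm.permP => x; rewrite perm1; apply/val_inj; rewrite rhoE /= mul1r.
pose H := [set rho g | g : S]%SET.
have gH : group_set H.
  apply/group_setP; split; first by apply/imsetP; exists one.
  (* Permutations compose from left to right, hence the product in reverse order. *)
  move=> _ _ /imsetP[g _ ->] /imsetP[h _ ->]; apply/imsetP; exists (mulS h g) => //.
  by apply/perm.permP => x; rewrite permM; apply/val_inj; rewrite !rhoE /= mulrA.
have rho_inj : injective rho.
  by move=> g h /perm.permP/(_ one)/(congr1 val); rewrite !rhoE /= !mulr1 => /val_inj.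
have cH : #|fingroup.group gH| = #|` S| by rewrite card_imset // -cardfE.
have [p pp pF] := finPcharP Fq.
have p0 : p%:R = 0 :> F by have := pcharf0 pF => h; rewrite -(rmorph_nat (@FracField.tofrac A \o polyC)) h rmorph0.
have cK : p \in [pchar K] by rewrite inE pp -(rmorph_nat j) p0 rmorph0 eqxx.
rewrite -(dvdn_pcharf cK) -cH; apply/negP => /(Cauchy pp)[x /imsetP[g _ ->] ox].
have gp : val g ^+ p = 1.
  have : (rho g ^+ p)%g one = one by rewrite -ox expg_order perm1.
  rewrite permX => /(congr1 val) /= <-.
  by elim: (p) => [|n IH] //=; rewrite exprS IH rhoE.
have [b [_ bE _]] := Gamma_order (sub _ (SG g)).
have b1 : b = 1.
  apply: (no_p_torsion pp p0); apply: ib_inj; rewrite ib1 -gp bE.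
  by elim: (p) => [|n IH]; rewrite ?expr0 ?ib1 // !exprS ibM IH.
have g1 : g = one by apply/val_inj; rewrite bE b1 ib1.
by move: ox pp; rewrite g1 rho1 order1 => <-.
Qed.
End FunctionField.

Theorem theorem5p2p1
  (R : realType)
  (Fq : finFieldType) (q_odd : odd #|Fq|)
  (* Finf = Fq((1/T)), the completion of Fq(T) at infinity *)
  (Finf : fieldType) (vinf : Finf -> R)
  (jinf : {rmorphism {fraction {poly Fq}} -> Finf})
  (Finf_completion : is_completion (@abs_at_infty R Fq) vinf jinf)
  (* Fbar, an algebraic closure of Finf, with the extended absolute value *)
  (Fbar : fieldType) (vbar : Fbar -> R)
  (jbar : {rmorphism Finf -> Fbar})
  (Fbar_closure : is_alg_closure jbar)
  (vbar_abs : nonarch_abs vbar)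
  (vbar_ext : forall x, vbar (jbar x) = vinf x)
  (* Cinf, the completion of Fbar *)
  (Cinf : fieldType) (v : Cinf -> R)
  (jC : {rmorphism Fbar -> Cinf})
  (Cinf_completion : is_completion vbar v jC)
  (B : falgType {fraction {poly Fq}})
  (B_quat : is_quaternion_algebra B) (B_div : is_division_algebra B)
  (iota : {lrmorphism scalar_ext jinf B -> 'M[Finf]_2})
  (iota_bij : bijective iota)
  (O : set B) (O_max : is_maximal_order O)
  (Gamma : set 'M[Finf]_2)
  (Gamma_sub : finite_index_subgroup Gamma (order_units iota O))
  (k : nat) (k_ge2 : (2 <= k)%N)
  (l : int)
  (l_cond : (#|` fset_set (center Gamma)|%:Z %| 2 * l)%Z) :
  let i := jC \o jbar in
  (forall D : poincare_data Finf, poincare_admissible k D ->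
     forall z, halfplane i z -> poincare_summable i v Gamma l D z) /\
  modular_forms i v Gamma (2 * k) (k%:Z + l)
    = span_halfplane i (poincare_family i v Gamma k l).
Proof.
have [HvK vE HcK _] := Finf_completion; have [Hv _ Hc _] := Cinf_completion; have [Fbar_closed _] := Fbar_closure.
have Cclosed := completion_closed Fbar_closed Cinf_completion.
pose i : {rmorphism Finf -> Cinf} := GRing.RMorphism.clone _ _ (jC \o jbar) _.
have viE x : v (i x) = vinf x by have [_ vCE _ _] := Cinf_completion; rewrite /= vCE vbar_ext.
(* The fourth root of varpi provides the quarter steps between the absolute values of [Finf]. *)
have [sig sigE] : exists sig : Cinf, sig ^+ 4 = i (varpi jinf).
  have [sig h] := Cclosed 4%N (fun t => if t == 0%N then i (varpi jinf) else 0) isT; exists sig.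
  by rewrite h !big_ord_recl big_ord0 /= !mul0r !addr0 expr0 mulr1.
set s := v sig; have q0 := q_gt0R R Fq; have q1 := q_gt1 R Fq.
have s4 : s ^+ 4 = #|Fq|%:R^-1 by rewrite -(naX Hv) sigE viE (v_varpi Finf_completion).
have s0 : 0 < s.
  by rewrite lt0r (na_ge0 Hv) andbT; apply: contraTneq q0 => s0; rewrite -invr_gt0 -s4 s0 expr0n ltxx.
have s1 : s < 1.
  rewrite ltNge; apply/negP => h; have : 1 <= s ^+ 4 by rewrite exprn_ege1.
  by rewrite s4 leNgt invf_lt1 ?q1.
have q3 : (2 < #|Fq|)%N.
  by have := finNzRing_gt1 Fq; rewrite leq_eqVlt => /orP[/eqP e|//]; move: q_odd; rewrite -e.
have [B_dim _ _] := B_quat; have [O_order _] := O_max.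
have [_ G1 GM GV _] := Gamma_sub.
have tame := group_tame Finf_completion iota_bij B_div Gamma_sub.
apply: (@poincare_spanning R Fq Finf Cinf vinf v i (constK jinf) s sig (varpi jinf)) => //.
- by rewrite (v_varpi Finf_completion) s4.
- move=> x /(v_value Finf_completion)[n ->]; exists (- n).
  by rewrite -exprz_exp -exprnP s4 exprz_inv opprK.
- exact: residue Finf_completion.
- by move=> g /(Gamma_order Finf_completion Gamma_sub)[x []].
- exact (group_discrete Finf_completion iota_bij O_order Gamma_sub).
- exact (group_cobounded Finf_completion iota_bij O_order B_dim q_odd B_div Gamma_sub).
Qed.
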